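(* Let $u$ be a nonnegative locally integrable function on $\mathbb{R}^n$. Let $q>2$ and let $v$ be a weight with $v\in \mathrm{RH}_\infty\cap A_q$. Let $m\in\mathbb{N}$, $b\in\mathrm{BMO}$, $\varepsilon>0$, and let $T$ be a Calderón–Zygmund operator. Then for every $p>\max\{q,\,1+(m+1)/\varepsilon\}$ there exists a constant $C>0$ such that \[ uv\left(\left\{x\in\mathbb{R}^n: \frac{|T_b^m(fv)(x)|}{v(x)}>t\right\}\right)\le C\int_{\mathbb{R}^n}\Phi_m\!\left(\|b\|_{\mathrm{BMO}}^m\frac{|f(x)|}{t}\right)M_{\Phi_m^\varepsilon,\,v^{1-q'}}u(x)\,M(\Psi\circ v)(x)\,dx \] for every $t>0$ and every function $f$ (e.g. bounded with compact support), where $\Psi$ is defined with these $p$ and $q$.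
   Context: Here $uv(E)=\int_E u(x)v(x)\,dx$. A weight is a locally integrable $w$ with $0<w<\infty$ a.e.; cubes have sides parallel to the axes. $w\in A_q$ ($1<q<\infty$) means $\sup_Q\left(\frac1{|Q|}\int_Q w\right)\left(\frac1{|Q|}\int_Q w^{1-q'}\right)^{q-1}<\infty$, where $q'=q/(q-1)$. $w\in\mathrm{RH}_\infty$ means $\sup_Q w\le \frac{C}{|Q|}\int_Q w$ for all cubes $Q$. A Calderón–Zygmund operator (CZO) is a linear operator $T$ bounded on $L^2(\mathbb{R}^n)$ such that for $f\in L^2$ with compact support, $Tf(x)=\int K(x-y)f(y)\,dy$ for $x\notin\mathrm{supp} f$, where $K:\mathbb{R}^n\setminus\{0\}\to\mathbb{C}$ satisfies $|K(x)|\lesssim |x|^{-n}$ and $|K(x-y)-K(x-z)|\lesssim |x-z|/|x-y|^{n+1}$ whenever $|x-y|>2|y-z|$. For $b\in L^1_{\rm loc}$, the commutators are $T_b^0=T$, $T_b^kf=bT_b^{k-1}f-T_b^{k-1}(bf)$. $\mathrm{BMO}$ is the space of locally integrable $b$ with $\|b\|_{\mathrm{BMO}}=\sup_Q\frac1{|Q|}\int_Q|b-b_Q|<\infty$, $b_Q$ the average of $b$ over $Q$. For $m\in\mathbb{N}$ and $\varepsilon\ge0$, $\Phi_m^\varepsilon(\lambda)=\lambda(1+\log^+\lambda)^{m+\varepsilon}$ and $\Phi_m=\Phi_m^0$. For $p>q$, $\Psi(\lambda)=\lambda^{p'+1-q'}\mathcal{X}_{[0,1)}(\lambda)+\lambda^{p'}\mathcal{X}_{[1,\infty)}(\lambda)$.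 For a Young function $\varphi$ (convex, strictly increasing, $\varphi(0)=0$, $\varphi(t)\to\infty$) and a weight $w$, $\|f\|_{\varphi,Q,w}=\inf\{\lambda>0:\frac1{w(Q)}\int_Q\varphi(|f|/\lambda)w\le1\}$ and $M_{\varphi,w}f(x)=\sup_{Q\ni x}\|f\|_{\varphi,Q,w}$; $M_\varphi=M_{\varphi,1}$ and $M$ is the Hardy–Littlewood maximal operator.
   Formalization: The kernel smoothness condition is taken in its standard form |K(x-y)-K(x-z)| ≲ |y-z|/|x-y|^{n+1}; the printed |x-z| in the numerator would follow from the size bound alone and make the claim false. Functions are Borel and b is real valued. *)

(* Defs.v *)
From HB Require Import structures.
From mathcomp Require Import all_boot all_order all_algebra.
From mathcomp Require Import all_classical all_reals all_analysis.
From mathcomp Require Import complex.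

Set Implicit Arguments.
Unset Strict Implicit.
Unset Printing Implicit Defensive.

Import Order.TTheory GRing.Theory Num.Theory.
Local Open Scope classical_set_scope.
Local Open Scope ring_scope.

(* R^n, as a copy of the row vectors 'rV[R]_n (with a point, the origin,
   which is needed to build the generated sigma-algebra) *)
Definition Rvec (R : realType) (n : nat) := 'rV[R]_n.
HB.instance Definition _ (R : realType) (n : nat) := Choice.on (Rvec R n).
HB.instance Definition _ (R : realType) (n : nat) := GRing.Zmodule.on (Rvec R n).
HB.instance Definition _ (R : realType) (n : nat) :=
  isPointed.Build (Rvec R n) (0%R : 'rV[R]_n).

Definition box (R : realType) (n : nat) (a b : 'rV[R]_n) : set (Rvec R n) :=
  [set x : 'rV[R]_n | forall i, a ord0 i <= x ord0 i <= b ord0 i].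

Definition boxes (R : realType) (n : nat) : set (set (Rvec R n)) :=
  [set B | exists a b, B = box a b].

(* R^n with its Borel sigma-algebra (generated by the boxes) *)
Notation Rn R n := (g_sigma_algebraType (@boxes R n)).

Definition is_lebesgue (R : realType) (n : nat)
    (mu : {measure set (Rn R n) -> \bar R}) : Prop :=
  forall a b : 'rV[R]_n, (forall i, a ord0 i <= b ord0 i) ->
    mu (box a b) = (\prod_(i < n) (b ord0 i - a ord0 i))%:E.

Definition enorm (R : realType) (n : nat) (x : 'rV[R]_n) : R :=
  Num.sqrt (\sum_(i < n) x ord0 i ^+ 2).

(* closed cube with lower corner a and side length l (sides parallel to
   the axes); it is a genuine cube when 0 < l *)
Definition cube (R : realType) (n : nat) (a : 'rV[R]_n) (l : R) : set (Rn R n) :=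
  box a (a + const_mx l).

(* average over the cube Q = cube a l, |Q| = l^n *)
Definition avg (R : realType) (n : nat) (mu : {measure set (Rn R n) -> \bar R})
    (a : 'rV[R]_n) (l : R) (g : Rn R n -> R) : \bar R :=
  ((l ^+ n)^-1)%:E * (\int[mu]_(x in cube a l) (g x)%:E)%E.

Definition loc_int (R : realType) (n : nat) (mu : {measure set (Rn R n) -> \bar R})
    (g : Rn R n -> R) : Prop :=
  measurable_fun setT g /\
  forall a l, 0 < l -> mu.-integrable (cube a l) (EFin \o g).

(* weight: locally integrable, 0 < w < oo a.e. (w is real valued) *)
Definition weight (R : realType) (n : nat) (mu : {measure set (Rn R n) -> \bar R})
    (w : Rn R n -> R) : Prop :=
  loc_int mu w /\ {ae mu, forall x, 0 < w x}.

Definition conj_exp (R : realType) (q : R) : R := q / (q - 1).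

Definition A_q (R : realType) (n : nat) (mu : {measure set (Rn R n) -> \bar R})
    (q : R) (w : Rn R n -> R) : Prop :=
  exists C : R, forall a l, 0 < l ->
    (\int[mu]_(x in cube a l) (w x `^ (1 - conj_exp q))%:E < +oo)%E /\
    fine (avg mu a l w) *
      (fine (avg mu a l (fun x => w x `^ (1 - conj_exp q)))) `^ (q - 1) <= C.

Definition RH_infty (R : realType) (n : nat) (mu : {measure set (Rn R n) -> \bar R})
    (w : Rn R n -> R) : Prop :=
  exists C : R, forall a l, 0 < l ->
    {ae mu, forall x, cube a l x -> w x <= C * fine (avg mu a l w)}.

Definition bmo_norm (R : realType) (n : nat) (mu : {measure set (Rn R n) -> \bar R})
    (b : Rn R n -> R) : \bar R :=
  ereal_sup [set y | exists a l, 0 < l /\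
    y = avg mu a l (fun x => `|b x - fine (avg mu a l b)|)].

Definition BMO (R : realType) (n : nat) (mu : {measure set (Rn R n) -> \bar R})
    (b : Rn R n -> R) : Prop :=
  loc_int mu b /\ (bmo_norm mu b < +oo)%E.

Definition HLmax (R : realType) (n : nat) (mu : {measure set (Rn R n) -> \bar R})
    (g : Rn R n -> R) (x : Rn R n) : \bar R :=
  ereal_sup [set y | exists a l, 0 < l /\ cube a l x /\
    y = avg mu a l (fun z => `|g z|)].

Definition lux_norm (R : realType) (n : nat) (mu : {measure set (Rn R n) -> \bar R})
    (phi : R -> R) (w : Rn R n -> R) (a : 'rV[R]_n) (l : R) (f : Rn R n -> R)
    : \bar R :=
  ereal_inf [set lam%:E | lam in [set lam : R | 0 < lam /\
    (((fine (\int[mu]_(x in cube a l) (w x)%:E))^-1)%:E *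
       \int[mu]_(x in cube a l) (phi (`|f x| / lam) * w x)%:E <= 1)%E]].

Definition orlicz_max (R : realType) (n : nat) (mu : {measure set (Rn R n) -> \bar R})
    (phi : R -> R) (w : Rn R n -> R) (f : Rn R n -> R) (x : Rn R n) : \bar R :=
  ereal_sup [set y | exists a l, 0 < l /\ cube a l x /\ y = lux_norm mu phi w a l f].

Definition log_plus (R : realType) (lam : R) : R := Num.max 0 (ln lam).

Definition Phi (R : realType) (m : nat) (eps : R) (lam : R) : R :=
  lam * (1 + log_plus lam) `^ (m%:R + eps).

Definition Phi_m (R : realType) (m : nat) : R -> R := Phi m 0.

Definition Psi (R : realType) (p q : R) (lam : R) : R :=
  if lam < 1 then lam `^ (conj_exp p + 1 - conj_exp q)
  else lam `^ (conj_exp p).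

Definition cmod (R : realType) (z : R[i]) : R :=
  Num.sqrt (complex.Re z ^+ 2 + complex.Im z ^+ 2).

Definition cmeasurable (R : realType) (n : nat) (g : Rn R n -> R[i]) : Prop :=
  measurable_fun setT (fun x => complex.Re (g x)) /\ measurable_fun setT (fun x => complex.Im (g x)).

Definition cintegral (R : realType) (n : nat) (mu : {measure set (Rn R n) -> \bar R})
    (g : Rn R n -> R[i]) : R[i] :=
  Complex (Rintegral mu setT (fun x => complex.Re (g x)))
          (Rintegral mu setT (fun x => complex.Im (g x))).

Definition L2norm2 (R : realType) (n : nat) (mu : {measure set (Rn R n) -> \bar R})
    (g : Rn R n -> R[i]) : \bar R :=
  (\int[mu]_x ((cmod (g x)) ^+ 2)%:E)%E.

Definition L2 (R : realType) (n : nat) (mu : {measure set (Rn R n) -> \bar R})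
    (g : Rn R n -> R[i]) : Prop :=
  cmeasurable g /\ (L2norm2 mu g < +oo)%E.

(* standard kernel K : R^n \ {0} -> C (its value at 0 is irrelevant) *)
Definition CZ_kernel (R : realType) (n : nat) (K : Rvec R n -> R[i]) : Prop :=
  cmeasurable (K : Rn R n -> R[i]) /\
  (exists C : R, forall x : Rvec R n, x != 0 ->
      cmod (K x) <= C / enorm x ^+ n) /\
  (exists C : R, forall x y z : Rvec R n, enorm (x - y) > 2 * enorm (y - z) ->
      cmod (K (x - y) - K (x - z)) <= C * enorm (y - z) / enorm (x - y) ^+ n.+1).

Definition CZO (R : realType) (n : nat) (mu : {measure set (Rn R n) -> \bar R})
    (T : (Rn R n -> R[i]) -> (Rn R n -> R[i])) : Prop :=
  (forall (f g : Rn R n -> R[i]) (c : R[i]), L2 mu f -> L2 mu g ->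
      {ae mu, forall x, T (fun y => f y + c * g y) x = T f x + c * T g x}) /\
  (exists C : R, forall f, L2 mu f ->
      L2 mu (T f) /\ (L2norm2 mu (T f) <= C%:E * L2norm2 mu f)%E) /\
  (exists K : Rvec R n -> R[i], CZ_kernel K /\
    forall (f : Rn R n -> R[i]) (a : 'rV[R]_n) (l : R), 0 < l -> L2 mu f ->
      {ae mu, forall x, ~ cube a l x -> f x = 0} ->
      {ae mu, forall x, ~ cube a l x ->
         T f x = cintegral mu (fun y => K ((x : Rvec R n) - (y : Rvec R n)) * f y)}).

Fixpoint commutator (R : realType) (n : nat)
    (T : (Rn R n -> R[i]) -> (Rn R n -> R[i])) (b : Rn R n -> R) (k : nat)
    (g : Rn R n -> R[i]) {struct k} : Rn R n -> R[i] :=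
  match k with
  | 0 => T g
  | k'.+1 => fun x => real_complex R (b x) * commutator T b k' g x
                      - commutator T b k' (fun y => real_complex R (b y) * g y) x
  end.

(* Main.v *)
(* The estimate is proved with [M v] in place of [M (Psi o v)], which is larger
   because [p > q].

   Splitting [T] and [f] into real and imaginary parts reduces the commutator to
   four commutators [tau_b^m g] of real operators, [g = h v] with [|h| <= |f|]. By
   local weak (1,1) bounds and a stopping-time argument these are dominated almost
   everywhere by sparse sums over triples [R = 3Q] of dyadic cubes of
   [H_R avg_R (H_R |g|)], where [H_R = (1 + |b - b_R|) ^ m]; the one-third trick
   turns the triples into cells of finitely many grids.

   RH_infty gives [v <= C a_R] almost everywhere on [R], where [a_R = avg_R v], so
   that [avg_R (H_R |f| v) <= C a_R avg_R (H_R |f|)], and one has to estimate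
   [u v {sum_R a_R F_R H_R 1_R > v}] with [F_R = avg_R (H_R |f|)]. Group the cells
   by the last [k] with [avg_R (Phi_m (16 ^ k |f|)) <= 1]; by John-Nirenberg,
   [F_R <= C 16 ^ - k]. The union of the cells failing even the first condition is
   directly of the required size. On the others, remove from [R] a bad set where
   the number of smaller cells of the same level exceeds [2 ^ k], or [1 + |b - b_R|]
   exceeds [rho ^ k], or [v < 2 ^ - k a_R]; off the bad sets the sum is at most
   [v / 2]. By sparseness and John-Nirenberg the first two parts of a bad set have a
   doubly exponentially small proportion, and A_q handles the third one: there the
   weight [v ^ (1 - q')] is at least [2 ^ (eta k)] times its average, [eta = q' - 1].
   A Young inequality against [Phi_m^eps] then gives
   [int_bad H_R u <= C c_k |R| ||u||_(Phi_m^eps, R, v ^ (1 - q'))] with [c_k] decaying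
   exponentially, and the sum over the cells of level [k] is controlled by
   [Phi_m (16 ^ (k + 1) |f|)] since a large part of each such cell is covered only
   boundedly often. *)
Require Import Defs.
From HB Require Import structures.
From mathcomp Require Import all_boot all_order all_algebra.
From mathcomp Require Import all_classical all_reals all_analysis.
From mathcomp Require Import complex.
From mathcomp Require Import measurable_realfun.
From mathcomp Require Import ring lra zify.
Import Order.TTheory GRing.Theory Num.Theory.
Import numFieldNormedType.Exports.
Local Open Scope classical_set_scope.
Local Open Scope ring_scope.
Set Implicit Arguments.
Unset Strict Implicit.
Unset Printing Implicit Defensive.

(** The balance of the level [k] rests on the base 16. Off the bad sets the weight, the oscillation
    of [b] and the number of cells cost a factor [2 ^ k] each, and the gain [16 ^- k] leaves the
    summable [2 ^- k]. The cutoffs for the count and the oscillation are themselves exponential in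
    [k]: a set of relative measure [exp (- kap)] is charged [kap ^ - eps] by the bump, and only
    because [kap] grows geometrically in [k] is this charge exponentially small in [k]. It then
    beats [16 ^- k * Phi_m (16 ^ (k + 1))], which grows like [k ^ m]. Two technical obstacles shape
    the text. Measurability of the maximal functions is not established, so integrals of nonnegative
    functions are compared through simple functions, and constants cross the integral sign only in
    the direction valid for arbitrary functions. The operator is additive only almost everywhere and
    on finite sums, so infinite families of cells are truncated, and the remainder is handled in
    [L^2] or by monotone convergence. *)

Lemma eq_ler (R : numDomainType) (x y : R) : x = y -> x <= y.
Proof. by move=> ->. Qed.

(** * Integrals of nonnegative functions *)

Section nonneg_integral.
Context {d : measure_display} {T : measurableType d} {R : realType}.
Variable mu : {measure set T -> \bar R}.
Implicit Types (A B : set T) (f g : T -> R).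

(** The integral of a nonnegative function is a supremum over the simple functions below it, and a
    simple function below [f] is below [g]. Integrands containing maximal functions are thus
    allowed. *)
Lemma le_integral_ge0 (A : set T) (f g : T -> \bar R) :
  (forall x, A x -> 0 <= f x)%E -> (forall x, A x -> f x <= g x)%E ->
  (\int[mu]_(x in A) f x <= \int[mu]_(x in A) g x)%E.
Proof.
move=> f0 fg; rewrite ge0_integralE // ge0_integralE; last first.
  by move=> x Ax; apply: le_trans (fg x Ax); exact: f0.
apply: le_ereal_sup => _ [h hf <-]; exists h => //= x.
apply: le_trans (hf x) _; rewrite /patch; case: ifPn => // /set_mem.
exact: fg.
Qed.

Lemma measurable_EFin_setT A f : measurable_fun setT f ->
  measurable_fun A (fun x => (f x)%:E).
Proof.
move=> mf; apply/measurable_EFinP; exact: measurable_funTS.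
Qed.

Definition Int A f : \bar R := (\int[mu]_(x in A) (f x)%:E)%E.

Lemma Int_ge0 A f : (forall x, 0 <= f x) -> (0 <= Int A f)%E.
Proof. by move=> f0; apply: integral_ge0 => x _; rewrite lee_fin. Qed.

Lemma Int_le A f g : (forall x, 0 <= f x) -> (forall x, A x -> f x <= g x) ->
  (Int A f <= Int A g)%E.
Proof.
by move=> f0 fg; apply: le_integral_ge0 => x Ax; rewrite lee_fin ?fg.
Qed.

Lemma Int_ae_le A f g : measurable A -> measurable_fun setT f ->
  measurable_fun setT g -> (forall x, 0 <= f x) -> (forall x, 0 <= g x) ->
  {ae mu, forall x, A x -> f x <= g x} -> (Int A f <= Int A g)%E.
Proof.
move=> mA mf mg f0 g0 fg; apply: ae_ge0_le_integral => //.
- by move=> x _; rewrite lee_fin.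
- exact: measurable_EFin_setT.
- by move=> x _; rewrite lee_fin.
- exact: measurable_EFin_setT.
Qed.

Lemma Int_eq A f g : (forall x, A x -> f x = g x) -> Int A f = Int A g.
Proof. by move=> fg; apply: eq_integral => x /set_mem /fg ->. Qed.

Lemma Int_subset A B f : (forall x, 0 <= f x) -> A `<=` B ->
  (Int A f <= Int B f)%E.
Proof.
move=> f0 AB; rewrite /Int integral_mkcond [leRHS]integral_mkcond.
apply: le_integral_ge0 => x _; rewrite /patch; case: ifPn => //.
- by rewrite lee_fin.
- by move=> /set_mem /AB Bx; rewrite mem_set.
- by case: ifP => // _ _; rewrite lee_fin.
Qed.

Lemma Int_Z A f (c : R) : measurable A -> measurable_fun setT f ->
  (forall x, 0 <= f x) -> 0 <= c ->
  Int A (fun x => c * f x) = (c%:E * Int A f)%E.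
Proof.
move=> mA mf f0 c0; rewrite /Int -ge0_integralZl_EFin //.
- by move=> x _; rewrite lee_fin.
- exact: measurable_EFin_setT.
Qed.

Lemma Int_D A f g : measurable A -> measurable_fun setT f ->
  measurable_fun setT g -> (forall x, 0 <= f x) -> (forall x, 0 <= g x) ->
  Int A (fun x => f x + g x) = (Int A f + Int A g)%E.
Proof.
move=> mA mf mg f0 g0; rewrite /Int -ge0_integralD //.
- by move=> x _; rewrite lee_fin.
- exact: measurable_EFin_setT.
- by move=> x _; rewrite lee_fin.
- exact: measurable_EFin_setT.
Qed.

Lemma Int_sum A (I : eqType) (s : seq I) (P : pred I) (f : I -> T -> R) :
  measurable A -> (forall i, measurable_fun setT (f i)) ->
  (forall i x, 0 <= f i x) ->
  Int A (fun x => \sum_(i <- s | P i) f i x) = (\sum_(i <- s | P i) Int A (f i))%E.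
Proof.
move=> mA mf f0; elim: s => [|i s IH].
  rewrite big_nil /Int -[RHS](integral0 mu A); apply: eq_integral => x _.
  by rewrite big_nil.
rewrite big_cons -IH; case: ifPn => Pi.
  rewrite -Int_D //.
  - by apply: Int_eq => x _; rewrite big_cons Pi.
  - have -> : (fun x => \sum_(j <- s | P j) f j x) =
        (fun x => \sum_(j <- s) if P j then f j x else 0).
      by apply/funext => x; rewrite big_mkcond.
    by apply: measurable_sum => j; case: (P j) => //; exact: measurable_cst.
  - by move=> x; apply: sumr_ge0.
by apply: Int_eq => x _; rewrite big_cons (negbTE Pi).
Qed.

Lemma Int_cst A (c : R) : measurable A -> Int A (fun=> c) = (c%:E * mu A)%E.
Proof. by move=> mA; rewrite /Int integral_cst. Qed.

Lemma Int_setU_le A B f : measurable A -> measurable B -> measurable_fun setT f ->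
  (forall x, 0 <= f x) -> (Int (A `|` B) f <= Int A f + Int B f)%E.
Proof.
move=> mA mB mf f0; have -> : A `|` B = A `|` (B `\` A).
  apply/seteqP; split => x /=; last by case=> [|[]]; [left|right].
  by case: (pselect (A x)) => Ax [] H; [left|left|left|right].
rewrite /Int ge0_integral_setU //.
- by rewrite leeD2l// (Int_subset f0)//; exact: subDsetl.
- exact: measurableD.
- exact: measurable_EFin_setT.
- by move=> x _; rewrite lee_fin.
- by apply/disj_setPS => x [Ax [_]].
Qed.

Lemma Int_setU A B f : measurable A -> measurable B -> measurable_fun setT f ->
  (forall x, 0 <= f x) -> A `&` B = set0 ->
  Int (A `|` B) f = (Int A f + Int B f)%E.
Proof.
move=> mA mB mf f0 AB; rewrite /Int ge0_integral_setU //.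
- exact: measurable_EFin_setT.
- by move=> x _; rewrite lee_fin.
- by apply/disj_setPS; rewrite AB.
Qed.

Lemma Int_bigcup (F : nat -> set T) f : (forall k, measurable (F k)) ->
  measurable_fun setT f -> (forall x, 0 <= f x) -> trivIset setT F ->
  Int (\bigcup_k F k) f = (\sum_(0 <= k <oo) Int (F k) f)%E.
Proof.
move=> mF mf f0 tF; rewrite /Int ge0_integral_bigcup //.
- exact: measurable_EFin_setT.
- by move=> x _; rewrite lee_fin.
Qed.

(** Monotone convergence; this is how the truncations in [b], in space and in [u] are removed. *)
Lemma Int_bigcup_bound (F : nat -> set T) f (B : \bar R) :
  (forall k, measurable (F k)) -> (forall k, F k `<=` F k.+1) ->
  measurable_fun setT f -> (forall x, 0 <= f x) ->
  (forall k, (Int (F k) f <= B)%E) -> (Int (\bigcup_k F k) f <= B)%E.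
Proof.
move=> mF F1 mf f0 FB.
have ndF : {homo F : a b / (a <= b)%N >-> (a <= b)%O}.
  by apply: homo_leq => [?|x y z|k]; [exact: subsetPset|exact: le_trans|apply/subsetPset/F1].
have := @ge0_nondecreasing_set_cvg_integral _ _ _ F (EFin \o f) mu ndF mF.
move=> /(_ (fun=> measurable_EFin_setT mf)) H.
have {}H : Int (F k) f @[k --> \oo] --> Int (\bigcup_k F k) f.
  by apply: H => i x _; rewrite /= lee_fin.
rewrite -(cvg_lim _ H) //; apply: lime_le; first by apply/cvg_ex; exists (Int (\bigcup_k F k) f).
exact: nearW.
Qed.

Lemma Int_null A f : measurable A -> measurable_fun setT f ->
  mu A = 0%E -> Int A f = 0%E.
Proof.
by move=> mA mf A0; rewrite /Int null_set_integral //; exact: measurable_EFin_setT.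
Qed.

Lemma Int0_ae A f : measurable A -> measurable_fun setT f -> (forall x, 0 <= f x) ->
  Int A f = 0%E -> {ae mu, forall x, A x -> f x = 0}.
Proof.
move=> mA mf f0 If.
have : (\int[mu]_(x in A) `|(f x)%:E|)%E = 0%E.
  by rewrite -If; apply: eq_integral => x _; rewrite gee0_abs// lee_fin.
move=> /ae_eq_integral_abs-/(_ mA (measurable_EFin_setT mf)).
by apply: filterS => x /= H /H [].
Qed.

Lemma ae0_Int A f : measurable A -> measurable_fun setT f -> (forall x, 0 <= f x) ->
  {ae mu, forall x, A x -> f x = 0} -> Int A f = 0%E.
Proof.
move=> mA mf f0 fA; apply/eqP; rewrite eq_le Int_ge0 // andbT.
rewrite -[leRHS](integral0 mu A); apply: Int_ae_le => //.
by apply: filterS fA => x /= H /H ->.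
Qed.

Lemma markov_Int A f (c : R) : measurable A -> measurable_fun setT f ->
  (forall x, 0 <= f x) -> 0 <= c ->
  (c%:E * mu (A `&` [set x | c <= f x]%R) <= Int A f)%E.
Proof.
move=> mA mf f0 c0.
have mB : measurable (A `&` [set x | c <= f x]%R).
  apply: measurableI => //; rewrite -[X in measurable X]setTI.
  exact: (measurable_fun_le measurableT (measurable_cst _) mf).
rewrite -Int_cst //; apply: le_trans (Int_subset f0 (@subIsetl _ A [set x | c <= f x]%R)).
by apply: Int_le => // x [].
Qed.

Lemma measurable_gt_set (c : R) f : measurable_fun setT f -> measurable [set x | c < f x].
Proof.
move=> mf; have -> : [set x | c < f x] = ~` [set x | f x <= c].
  by apply/seteqP; split => x /=; rewrite ltNge => /negP.
apply: measurableC; rewrite -[X in measurable X]setTI.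
exact: (measurable_fun_le measurableT mf (measurable_cst _)).
Qed.

Lemma measurable_le_set (c : R) f : measurable_fun setT f -> measurable [set x | f x <= c].
Proof.
move=> mf; rewrite -[X in measurable X]setTI.
exact: (measurable_fun_le measurableT mf (measurable_cst _)).
Qed.

Lemma ae_null (P : T -> Prop) : {ae mu, forall x, P x} ->
  exists N, [/\ measurable N, mu N = 0%E & forall x, ~ N x -> P x].
Proof.
move=> [N [mN N0 sub]]; exists N; split => // x Nx.
by apply: contrapT => nP; apply: Nx; exact: sub.
Qed.

Lemma null_ae (P : T -> Prop) (N : set T) : measurable N -> mu N = 0%E ->
  (forall x, ~ N x -> P x) -> {ae mu, forall x, P x}.
Proof.
by move=> mN N0 H; exists N; split => // x nP; apply: contrapT => /H.
Qed.

End nonneg_integral.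

Ltac mfun := repeat first [assumption | exact: measurable_cst | exact: measurable_id
  | apply: measurable_funD | apply: measurable_funB | apply: measurable_funM
  | apply: measurable_funX | apply: (measurableT_comp (@normr_measurable _ _))
  | apply: (measurableT_comp (@measurable_expR _)) | solve [apply: measurable_indic => //]
  | apply: (measurableT_comp (@measurable_powR _ _))].

Ltac side := try (by mfun);
  try (by move=> *; rewrite ?mulr_ge0 ?sqr_ge0 ?addr_ge0).

(** * Cubes and dyadic grids *)

Section euclidean_space.
Context {R : realType} {n : nat}.
Local Notation X := (Rn R n).
Implicit Types (a x y z : X) (l r : R).

Definition co (x : X) (i : 'I_n) : R := (x : 'rV[R]_n) ord0 i.
Definition pt (f : 'I_n -> R) : X := (\row_i f i : 'rV[R]_n).

Lemma co_pt f i : co (pt f) i = f i.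
Proof. by rewrite /co mxE. Qed.

Lemma co_inj x y : (forall i, co x i = co y i) -> x = y.
Proof. by move=> H; apply/rowP => i; exact: H. Qed.

(** Half-open, so that the cells of one generation of a dyadic grid partition the space; for [0 < l]
    it differs from the closed cube by a null set. *)
Definition hc a l : set X := [set x | forall i, co a i <= co x i < co a i + l].

Lemma cubeE a l x : cube a l x <-> forall i, co a i <= co x i <= co a i + l.
Proof. by split => H i; move: (H i); rewrite /co !mxE. Qed.

Lemma boxE (a b x : X) : box a b x <-> forall i, co a i <= co x i <= co b i.
Proof. by []. Qed.

Lemma hc_cube a l : hc a l `<=` cube a l.
Proof. by move=> x xa; apply/cubeE => i; have /andP[-> /ltW] := xa i. Qed.

Lemma measurable_box (a b : X) : measurable (box a b : set X).
Proof. by apply: sub_sigma_algebra; exists a, b. Qed.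

Lemma measurable_cube a l : measurable (cube a l).
Proof. exact: measurable_box. Qed.

(** The sigma-algebra is generated by bounded boxes, so a half-space is written as a countable union
    of boxes whose other sides grow. *)
Lemma measurable_co i : measurable_fun setT (co^~ i).
Proof.
apply: (measurability _ (RGenCInfty.measurableE R)).
move=> /= _ [_ [r ->] <-]; rewrite setTI.
have -> : co^~ i @^-1` `[r, +oo[%classic =
    \bigcup_k box (pt (fun j => if j == i then r else - k%:R)) (pt (fun _ => k%:R)).
  apply/seteqP; split => x /=.
    rewrite in_itv /= andbT => rx.
    exists (Num.trunc (\sum_j `|co x j|)).+1 => //; apply/boxE => j; rewrite !co_pt.
    have H : `|co x j| <= (Num.trunc (\sum_j `|co x j|)).+1%:R.
      apply: (@le_trans _ _ (\sum_j `|co x j|)).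
        by rewrite (bigD1 j) //= lerDl sumr_ge0.
      exact: ltW (truncnS_gt _).
    move: H; rewrite ler_norml => /andP[H1 ->]; rewrite andbT.
    by case: eqP => // ->.
  move=> [k _] /boxE /(_ i); rewrite !co_pt eqxx => /andP[H _].
  by rewrite in_itv /= H.
apply: bigcupT_measurable => k; exact: measurable_box.
Qed.

Lemma measurable_coord_set (P : 'I_n -> set R) : (forall i, measurable (P i)) ->
  measurable [set x : X | forall i, P i (co x i)].
Proof.
move=> mP.
have -> : [set x : X | forall i, P i (co x i)] =
    \bigcap_(i in [set: 'I_n]) (co^~ i @^-1` (P i)).
  by apply/seteqP; split => x /= H i *; exact: H.
apply: fin_bigcap_measurable => // i _; rewrite -[X in measurable X]setTI.
exact: measurable_co.
Qed.

Lemma measurable_hc a l : measurable (hc a l).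
Proof.
have -> : hc a l = [set x : X | forall i, `[co a i, co a i + l[%classic (co x i)].
  by apply/seteqP; split => x H i; move: (H i); rewrite /= in_itv.
exact: (@measurable_coord_set (fun i => `[co a i, co a i + l[%classic)).
Qed.

Lemma measurable_reflect x : measurable_fun setT (fun y : X => (x - y)%R : X).
Proof.
have H := @measurability _ _ X X setT (fun y : X => (x - y)%R : X) (@boxes R n) erefl.
apply: H.
move=> _ [_ [a [b ->]] <-]; rewrite setTI.
have -> : (fun y : X => (x - y)%R : X) @^-1` box a b = box (x - b : X) (x - a : X).
  have coB (u w : X) i : co (u - w : X) i = co u i - co w i by rewrite /co !mxE.
  apply/seteqP; split => y /= /boxE H; apply/boxE => i; have := H i; rewrite !coB => /andP[H1 H2];
   apply/andP; split; lra.
exact: measurable_box.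
Qed.

End euclidean_space.

Section cube_measure.
Context {R : realType} {n : nat}.
Local Notation X := (Rn R n).
Variable mu : {measure set X -> \bar R}.
Hypothesis mu_leb : is_lebesgue mu.
Implicit Types (a x y z : X) (l r : R).

Lemma mu_cube a l : 0 <= l -> mu (cube a l) = (l ^+ n)%:E.
Proof.
move=> l0; rewrite /cube mu_leb => [|i]; last by rewrite !mxE lerDl.
congr (_%:E); rewrite -[in RHS](card_ord n) -prodr_const; apply: eq_bigr => i _.
by rewrite !mxE [_ + l]addrC addrK.
Qed.

(** Only closed boxes have a prescribed measure. The lower bound comes from the closed cubes with
    the same corner and side [l - l / (k + 1)], which lie inside the half-open one. *)
Lemma mu_hc a l : 0 < l -> mu (hc a l) = (l ^+ n)%:E.
Proof.
move=> l0; apply/eqP; rewrite eq_le; apply/andP; split.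
  rewrite -(mu_cube a (ltW l0)); apply: le_measure; rewrite ?inE.
  - exact: measurable_hc.
  - exact: measurable_cube.
  - exact: hc_cube.
have H k : (((l - l * k.+1%:R^-1) ^+ n)%:E <= mu (hc a l))%E.
  have h : l * k.+1%:R^-1 <= l by rewrite ler_piMr ?(ltW l0) // invf_le1 ?ltr0n // ler1n.
  rewrite -(@mu_cube a) ?subr_ge0 //; apply: le_measure; rewrite ?inE.
  - exact: measurable_cube.
  - exact: measurable_hc.
  - move=> x /cubeE xc i; have /andP[-> H] := xc i; apply: le_lt_trans H _.
    by rewrite ltrD2l gtrBl mulr_gt0 // invr_gt0.
have cv : (fun k => (l - l * k.+1%:R^-1) ^+ n) @ \oo --> (l - l * 0) ^+ n.
  have cv1 : (fun k => l - l * k.+1%:R^-1) @ \oo --> l - l * 0.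
    apply: cvgB; first exact: cvg_cst.
    by apply: cvgM; [exact: cvg_cst|exact: cvg_harmonic].
  exact: (cvg_comp _ (fun x : R => x ^+ n) cv1 (@exprn_continuous R n _)).
move: cv; rewrite mulr0 subr0 => cv.
have fin : mu (hc a l) \is a fin_num.
  rewrite ge0_fin_numE //; apply: (@le_lt_trans _ _ (l ^+ n)%:E); last exact: ltry.
  rewrite -(mu_cube a (ltW l0)); apply: le_measure; rewrite ?inE.
  - exact: measurable_hc.
  - exact: measurable_cube.
  - exact: hc_cube.
rewrite -(fineK fin) lee_fin.
rewrite -(cvg_lim _ cv) //; apply: limr_le; first by apply/cvg_ex; exists (l ^+ n).
by apply: nearW => k; rewrite -lee_fin fineK.
Qed.

Lemma mu_cubeD_hc a l : 0 < l -> mu (cube a l `\` hc a l) = 0%E.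
Proof.
move=> l0; rewrite measureD; last 3 first.
- exact: measurable_cube.
- exact: measurable_hc.
- by have := mu_cube a (ltW l0) => /= ->; rewrite ltry.
rewrite setIidr; last exact: hc_cube.
have := mu_cube a (ltW l0) => /= ->; have := mu_hc a l0 => /= ->.
by rewrite -EFinB subrr.
Qed.

Lemma Int_cube a l (f : X -> R) : 0 < l -> measurable_fun setT f ->
  (forall x, 0 <= f x) -> Int mu (cube a l) f = Int mu (hc a l) f.
Proof.
move=> l0 mf f0; apply/eqP; rewrite eq_le; apply/andP; split; last first.
  by apply: Int_subset => //; exact: hc_cube.
rewrite -(setDUK (@hc_cube _ _ a l)); apply: le_trans (Int_setU_le _ _ _ _ _) _ => //.
- exact: measurable_hc.
- by apply: measurableD; [exact: measurable_cube|exact: measurable_hc].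
rewrite [X in (_ + X)%E]Int_null ?adde0 //; last exact: mu_cubeD_hc.
by apply: measurableD; [exact: measurable_cube|exact: measurable_hc].
Qed.

End cube_measure.

Section grid.
Context {R : realType} {n : nat}.
Local Notation X := (Rn R n).
Variable mu : {measure set X -> \bar R}.
Hypothesis mu_leb : is_lebesgue mu.
Variables (o : X) (L : R).
Hypothesis L0 : 0 < L.
Implicit Types (x y z : X).

(** Generation and integer position. The type is countable, so unions over arbitrary sets of cells
    are measurable, and it depends neither on the origin nor on the scale, so all translated grids
    share their labels. *)
Definition cell : Type := (nat * {ffun 'I_n -> int})%type.
HB.instance Definition _ := Countable.on cell.
Implicit Types (q : cell) (D : set cell) (f g : X -> R).

Definition glen (q : cell) : R := L / 2 ^+ q.1.
Definition gcorner (q : cell) : X := pt (fun c => co o c + (q.2 c)%:~R * glen q).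
Definition gcell (q : cell) : set X := hc (gcorner q) (glen q).
(** Membership in a cell becomes equality of integer vectors, and nestedness of cells an
    arithmetical property of [Num.floor]. *)
Definition gidx (i : nat) (x : X) : {ffun 'I_n -> int} :=
  [ffun c => Num.floor ((co x c - co o c) * 2 ^+ i / L)].
Definition cellat i x : cell := (i, gidx i x).

Lemma glen_gt0 q : 0 < glen q.
Proof. by rewrite divr_gt0 // exprn_gt0. Qed.

Lemma gcellE q x : gcell q x <-> gidx q.1 x = q.2.
Proof.
have e (c : 'I_n) : (co (gcorner q) c <= co x c < co (gcorner q) c + glen q) =
   (Num.floor ((co x c - co o c) * 2 ^+ q.1 / L) == q.2 c).
  rewrite floor_eq co_pt intrD.
  have P : 0 < 2 ^+ q.1 :> R by rewrite exprn_gt0.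
  rewrite ler_pdivlMr // ltr_pdivrMr // /glen mulrA.
  rewrite -lerBrDl ler_pdivrMr //; congr (_ && _).
  by rewrite -addrA -ltrBlDl -ltr_pdivlMr // mulr1z; congr (_ < _); field; rewrite gt_eqF.
split=> [H|H c]; last by rewrite e -H ffunE.
by apply/ffunP => c; rewrite ffunE; apply/eqP; rewrite -e; exact: H.
Qed.

Lemma gcell_at i x : gcell (cellat i x) x.
Proof. exact/gcellE. Qed.

Lemma gcell_cellat q x : gcell q x -> q = cellat q.1 x.
Proof. by move=> /gcellE; rewrite /cellat => ->; case: q. Qed.

(** The floor of [a] is half the floor of [2 a], rounded down; this is the nestedness of consecutive
    generations. *)
Lemma floor_half (a b : R) : Num.floor (a * 2) = Num.floor (b * 2) ->
  Num.floor a = Num.floor b.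
Proof.
move=> ab; apply/esym/eqP; rewrite floor_eq.
have /andP[a1 a2] := floor_itv a.
have := floor_itv (a * 2); have := floor_itv (b * 2); rewrite ab.
set N := Num.floor (b * 2); set M := Num.floor a => /andP[b3 b4] /andP[a3 a4].
have MN : (M * 2 <= N)%R.
  by rewrite /N -ab floor_ge_int // intrM; lra.
have NM : (N + 1 <= (M + 1) * 2)%R.
  have : N%:~R < ((M + 1) * 2)%:~R :> R by apply: le_lt_trans a3 _; rewrite intrM; lra.
  rewrite ltr_int; lia.
move: MN NM; rewrite -(ler_int R) -(ler_int R (N + 1)) !intrM => MN NM.
by apply/andP; split; lra.
Qed.

Lemma gidx_le i j x y : (i <= j)%N -> gidx j x = gidx j y -> gidx i x = gidx i y.
Proof.
move=> /subnK <-; elim: (j - i)%N => [//|k IH] H; apply: IH.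
apply/ffunP => c; move: H => /ffunP/(_ c); rewrite !ffunE => H.
have e z : (co z c - co o c) * 2 ^+ (k + i) / L * 2 = (co z c - co o c) * 2 ^+ (k.+1 + i) / L.
  by rewrite addSn exprSr; ring.
by apply: floor_half; rewrite !e.
Qed.

Lemma gcell_nested q q' : (q.1 <= q'.1)%N -> gcell q `&` gcell q' !=set0 ->
  gcell q' `<=` gcell q.
Proof.
move=> qq' [x [/gcellE xq /gcellE xq']] y /gcellE yq'; apply/gcellE.
by rewrite -xq; apply: gidx_le qq' _; rewrite xq'.
Qed.

Lemma gcell_eq q q' : q.1 = q'.1 -> gcell q `&` gcell q' !=set0 -> q = q'.
Proof.
by move=> qq' [x [/gcell_cellat -> /gcell_cellat ->]]; rewrite qq'.
Qed.

Lemma measurable_gcell q : measurable (gcell q).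
Proof. exact: measurable_hc. Qed.

Lemma mu_gcell q : mu (gcell q) = (glen q ^+ n)%:E.
Proof. by rewrite mu_hc // glen_gt0. Qed.

Lemma countable_cell (D : set cell) : countable D.
Proof. exact: countableP. Qed.

Lemma measurable_bigcup_cell (D : set cell) (F : cell -> set X) :
  (forall q, measurable (F q)) -> measurable (\bigcup_(q in D) F q).
Proof.
move=> mF; rewrite bigcup_mkcond; apply: countable_bigcupT_measurable => [|q].
  exact: countable_cell.
by case: ifP.
Qed.

(** A smaller level means a larger cell, so these are the maximal cells of [P] for inclusion. Levels
    start at 0, hence every cell of [P] lies in one of them. *)
Definition minimal_cells (P : set cell) : set cell := [set q | P q /\
  forall q', P q' -> (q'.1 < q.1)%N -> gcell q' `&` gcell q = set0].

Lemma minimal_cells_sub P : minimal_cells P `<=` P.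
Proof. by move=> q []. Qed.

Lemma minimal_cellP P q x : P q -> gcell q x ->
  exists2 q', minimal_cells P q' & gcell q `<=` gcell q'.
Proof.
move=> Pq xq.
have ex : exists i, `[< P (cellat i x) /\ (i <= q.1)%N >].
  by exists q.1; apply/asboolP; rewrite -gcell_cellat.
case: (ex_minnP ex) => i /asboolP[Pi iq] mini.
exists (cellat i x); last by apply: gcell_nested => //; exists x; split => //; exact: gcell_at.
split => // q' Pq' q'i; apply/seteqP; split => // y [yq' yi].
have : (i <= q'.1)%N; last by rewrite leqNgt q'i.
apply: mini; apply/asboolP; split; last exact: leq_trans (ltnW q'i) iq.
suff : gcell q' x by move=> /gcell_cellat <-.
have : gcell (cellat i x) `<=` gcell q'.
  by apply: gcell_nested; [exact: ltnW|exists y].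
by apply; exact: gcell_at.
Qed.

Lemma bigcup_minimal P : \bigcup_(q in minimal_cells P) gcell q = \bigcup_(q in P) gcell q.
Proof.
apply/seteqP; split => x [q Pq xq]; first by exists q => //; exact: minimal_cells_sub Pq.
by have [q' ? sub] := minimal_cellP Pq xq; exists q' => //; exact: sub.
Qed.

Lemma trivIset_minimal P : trivIset (minimal_cells P) gcell.
Proof.
move=> q q' [Pq mq] [Pq' mq'] H; case: (ltngtP q.1 q'.1) => lev.
- by move: H; rewrite (mq' _ Pq lev) => -[].
- by move: H; rewrite setIC (mq _ Pq' lev) => -[].
- exact: gcell_eq.
Qed.

(** An enumeration of [D] by codes, padded with empty sets at the numbers that code no cell of [D],
    so that countable additivity along [nat] applies. *)
Definition cell_seq (D : set cell) (k : nat) : set X :=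
  if pickle_inv k is Some q then (if `[< D q >] then gcell q else set0) else set0.

Lemma bigcup_cell_seq D : \bigcup_k cell_seq D k = \bigcup_(q in D) gcell q.
Proof.
apply/seteqP; split => x.
  move=> [k _]; rewrite /cell_seq; case: pickle_inv => // q.
  by case: asboolP => // Dq xq; exists q.
move=> [q Dq xq]; exists (pickle q) => //; rewrite /cell_seq pickleK_inv.
by case: asboolP.
Qed.

Lemma measurable_cell_seq D k : measurable (cell_seq D k).
Proof.
rewrite /cell_seq; case: pickle_inv => // q.
by case: asboolP => // _; exact: measurable_gcell.
Qed.

Lemma trivIset_cell_seq D : trivIset D gcell -> trivIset setT (cell_seq D).
Proof.
move=> tD i j _ _; rewrite /cell_seq.
have := @pickle_invK cell i; have := @pickle_invK cell j.
case: (pickle_inv i) => [q|] /=; last by move=> _ _ [? []].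
case: (pickle_inv j) => [q'|] /=; last by move=> _ _ [? []].
case: asboolP => Dq; last by move=> _ _ [? []].
case: asboolP => Dq'; last by move=> _ _ [? []].
by move=> <- <- /tD -> .
Qed.

Lemma Int_cells_le D f g : trivIset D gcell ->
  measurable_fun setT f -> measurable_fun setT g ->
  (forall x, 0 <= f x) -> (forall x, 0 <= g x) ->
  (forall q, D q -> Int mu (gcell q) f <= Int mu (gcell q) g)%E ->
  (Int mu (\bigcup_(q in D) gcell q) f <= Int mu (\bigcup_(q in D) gcell q) g)%E.
Proof.
move=> tD mf mg f0 g0 fg; rewrite -bigcup_cell_seq.
have mD k := measurable_cell_seq D k; have tD' := trivIset_cell_seq tD.
rewrite !Int_bigcup //; apply: lee_nneseries => k *; first exact: Int_ge0.
rewrite /cell_seq; case: pickle_inv => [q|]; last by rewrite /Int !integral_set0.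
by case: asboolP => [/fg//|_]; rewrite /Int !integral_set0.
Qed.

(* Pass to the maximal cells, which are disjoint and have the same union. *)
Lemma mu_cells_le (P : set cell) f :
  measurable_fun setT f -> (forall x, 0 <= f x) ->
  (forall q, P q -> mu (gcell q) <= Int mu (gcell q) f)%E ->
  (mu (\bigcup_(q in P) gcell q) <= Int mu (\bigcup_(q in P) gcell q) f)%E.
Proof.
move=> mf f0 H; rewrite -bigcup_minimal.
have mE (A : set X) : measurable A -> mu A = Int mu A (fun=> 1).
  by move=> mA; rewrite Int_cst // mul1e.
rewrite mE; last exact: measurable_bigcup_cell measurable_gcell.
apply: Int_cells_le => //; first exact: trivIset_minimal.
move=> q [Pq _]; rewrite -mE; first exact: H.
exact: measurable_gcell.
Qed.

End grid.

(** * Density of measurable sets in dyadic cells *)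

Section density.
Context {R : realType} {n : nat}.
Local Notation X := (Rn R n).
Variable mu : {measure set X -> \bar R}.
Hypothesis mu_leb : is_lebesgue mu.
Variables (o : X) (L : R).
Hypothesis L0 : 0 < L.
Variable W : set X.
Hypothesis mW : measurable W.
Hypothesis finW : (mu W < +oo)%E.

(** Expressed on points: [B] is a union of cells of generation [i]. *)
Definition saturated i (B : set X) := forall x y, gidx o L i x = gidx o L i y -> B x -> B y.

(** Approximation in measure inside the window [W]. These sets form a sigma-algebra containing the
    boxes, which gives the property to every measurable set. *)
Definition grid_approx (A : set X) := measurable A /\ forall e : R, 0 < e ->
  exists i B, [/\ measurable B, saturated i B & (mu ((A `+` B) `&` W) <= e%:E)%E].

Lemma mu_null_seq (F : nat -> set X) (e : R) : 0 < e -> (forall i, measurable (F i)) ->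
  (forall i, F i.+1 `<=` F i) -> (mu (F 0%N) < +oo)%E -> \bigcap_i F i = set0 ->
  exists i, (mu (F i) <= e%:E)%E.
Proof.
move=> e0 mF F1 fin cap0.
have ndF : {homo F : a b / (a <= b)%N >-> (b <= a)%O}.
  by apply: homo_leq => [?|x y z h1 h2|k]; [exact: subsetPset|exact: le_trans h2 h1|apply/subsetPset/F1].
have mcap : measurable (\bigcap_i F i) by rewrite cap0.
have := nonincreasing_cvg_mu fin mF mcap ndF.
rewrite cap0 measure0 => cv; apply: contrapT => nex.
have H k : (e%:E <= mu (F k))%E.
  by rewrite leNgt; apply/negP => /ltW h; apply: nex; exists k.
have : (e%:E <= 0%E)%E; last by rewrite lee_fin leNgt e0.
rewrite -(cvg_lim _ cv) //; apply: lime_ge; first by apply/cvg_ex; exists 0%E.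
exact: nearW.
Qed.

Lemma grid_approx_box (a b : X) : grid_approx (box a b).
Proof.
split=> [|e e0]; first exact: measurable_box.
(* The cells of generation [i] that meet the box; as the box is closed, their union shrinks to
   it. *)
pose B i : set X := \bigcup_(q in [set q : cell | q.1 = i /\ gcell o L q `&` box a b !=set0]) gcell o L q.
have BP i y : B i y <-> exists2 x, box a b x & gidx o L i x = gidx o L i y.
  split.
    move=> [q [qi [x [xq xb]]] yq]; exists x => //.
    by move: xq yq => /(gcellE o L0); rewrite qi => -> /(gcellE o L0); rewrite qi.
  move=> [x xb xy]; exists (cellat o L i y); last exact: gcell_at.
  by split => //; exists x; split => //; apply/(gcellE o L0); rewrite /= xy.
have mB i : measurable (B i).
  by apply: measurable_bigcup_cell => q; exact: measurable_gcell.
have bB i : box a b `<=` B i by move=> x xb; apply/BP; exists x.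
pose F i := (B i `\` box a b) `&` W.
have [i Fi] : exists i, (mu (F i) <= e%:E)%E.
  apply: mu_null_seq => //.
  - move=> i; apply: measurableI => //; apply: measurableD => //; exact: measurable_box.
  - move=> i x [[/BP[y yb yx] xb] Wx]; split => //; split => //.
    by apply/BP; exists y => //; exact: gidx_le yx.
  - apply: le_lt_trans finW; apply: le_measure; rewrite ?inE //; last by move=> x [].
    apply: measurableI => //; apply: measurableD => //; exact: measurable_box.
  - apply/seteqP; split => // x H.
    have [[_ nb] _] := H 0%N I; apply: nb; apply/boxE => c.
    have K i : co a c - L / 2 ^+ i <= co x c <= co b c + L / 2 ^+ i.
      have [[/BP[y yb yx] _] _] := H i I; have /boxE/(_ c)/andP[y1 y2] := yb.
      have /(_ c) := gcell_at o L0 i x.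
      have /(_ c) : gcell o L (cellat o L i x) y by apply/(gcellE o L0).
      by move=> /andP[h1 h2] /andP[h3 h4]; move: h1 h2 h3 h4; rewrite /glen /=; lra.
    have small (r : R) : 0 < r -> exists i, L / 2 ^+ i < r.
      move=> r0; exists (Num.bound (L / r)).
      rewrite ltr_pdivrMr ?exprn_gt0 // mulrC -ltr_pdivrMr //.
      exact: upper_nthrootP.
    apply/andP; split; rewrite leNgt; apply/negP => h.
      have [|i] := small (co a c - co x c); first by lra.
      by have /andP[] := K i; lra.
    have [|i] := small (co x c - co b c); first by lra.
    by have /andP[] := K i; lra.
exists i, (B i); split => //.
  by move=> x y xy /BP[z zb zx]; apply/BP; exists z => //; rewrite zx.
suff -> : box a b `+` B i = B i `\` box a b by [].
by apply/seteqP; split => x /=; [case=> // -[xb /(_ (bB i x xb))]|right].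
Qed.

Lemma grid_approxC A : grid_approx A -> grid_approx (~` A).
Proof.
move=> [mA H]; split; first exact: measurableC.
move=> e /H[i [B [mB sB AB]]]; exists i, (~` B); split.
- exact: measurableC.
- by move=> x y xy nBx By; apply: nBx; apply: sB By.
- suff -> : ~` A `+` ~` B = A `+` B by [].
  apply/seteqP; split => x /= [[h1 h2]|[h1 h2]]; [right|left|right|left]; split => //;
    exact: contrapT.
Qed.

Lemma saturated_le i j B : (i <= j)%N -> saturated i B -> saturated j B.
Proof. by move=> ij sB x y xy; apply: sB; exact: gidx_le ij xy. Qed.

Lemma grid_approxU A A' : grid_approx A -> grid_approx A' -> grid_approx (A `|` A').
Proof.
move=> [mA H] [mA' H']; split; first exact: measurableU.
move=> e e0; have e2 : 0 < e / 2 by lra.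
have [i [B [mB sB AB]]] := H _ e2; have [i' [B' [mB' sB' AB']]] := H' _ e2.
exists (maxn i i'), (B `|` B'); split; first exact: measurableU.
  move=> x y xy [Bx|Bx]; [left|right].
    exact: (saturated_le (leq_maxl i i') sB) Bx.
  exact: (saturated_le (leq_maxr i i') sB') Bx.
have mY C C' : measurable C -> measurable C' -> measurable ((C `+` C') `&` W).
  by move=> mC mC'; apply: measurableI => //; apply: measurableU; exact: measurableD.
apply: (@le_trans _ _ (mu (((A `+` B) `&` W) `|` ((A' `+` B') `&` W)))).
  apply: le_measure; rewrite ?inE.
  - by apply: mY; exact: measurableU.
  - by apply: measurableU; exact: mY.
  - move=> x [[[[Ax|Ax] nB]|[[Bx|Bx] nA]] Wx]; [left|right|left|right]; split => //.
    + by left; split => // ?; apply: nB; left.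
    + by left; split => // ?; apply: nB; right.
    + by right; split => // ?; apply: nA; left.
    + by right; split => // ?; apply: nA; right.
apply: le_trans (measureU2 _ _ _) _; [exact: mY|exact: mY|].
rewrite [e]splitr EFinD; exact: leeD.
Qed.

Lemma grid_approx0 : grid_approx set0.
Proof.
split=> // e e0; exists 0%N, set0; split => //.
by rewrite setYK set0I measure0 lee_fin ltW.
Qed.

(** A finite union carries all but [e / 2] of the countable one inside [W], and finite unions are
    covered by [grid_approxU]. *)
Lemma grid_approx_bigcup (A : nat -> set X) : (forall k, grid_approx (A k)) ->
  grid_approx (\bigcup_k A k).
Proof.
move=> H; have mA k : measurable (A k) by have [] := H k.
split; first exact: bigcupT_measurable.
move=> e e0; have e2 : 0 < e / 2 by lra.
pose U k : set X := \big[setU/set0]_(j < k) A j.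
have gU k : grid_approx (U k).
  rewrite /U; elim: k => [|k IH]; first by rewrite big_ord0; exact: grid_approx0.
  by rewrite big_ord_recr /=; exact: grid_approxU.
have mU k : measurable (U k) by have [] := gU k.
have UE k x : U k x <-> exists2 j, (j < k)%N & A j x.
  rewrite /U -bigcup_mkord; split; first by move=> [j /= jk Aj]; exists j.
  by move=> [j jk Aj]; exists j.
have [k Fk] : exists k, (mu ((\bigcup_k A k `\` U k) `&` W) <= (e / 2)%:E)%E.
  have mF i : measurable ((\bigcup_k A k `\` U i) `&` W).
    by apply: measurableI => //; apply: measurableD => //; exact: bigcupT_measurable.
  apply: mu_null_seq => //.
  - move=> i x [[xA xU] Wx]; split => //; split => // /UE[j ji Aj]; apply: xU.
    by apply/UE; exists j => //; exact: ltnW.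
  - apply: le_lt_trans finW; apply: le_measure; rewrite ?inE //.
  - apply/seteqP; split => // x K; have [[[j _ Aj] _] _] := K 0%N I.
    by have [[_ nU] _] := K j.+1 I; apply: nU; apply/UE; exists j.
have [_ /(_ _ e2)[i [B [mB sB AB]]]] := gU k.
exists i, B; split => //.
have mY C : measurable C -> measurable ((C `+` B) `&` W).
  by move=> mC; apply: measurableI => //; apply: measurableU; exact: measurableD.
have mA' := bigcupT_measurable _ mA.
have mD : measurable ((\bigcup_k A k `\` U k) `&` W).
  by apply: measurableI => //; exact: measurableD.
apply: (@le_trans _ _ (mu (((\bigcup_k A k `\` U k) `&` W) `|` ((U k `+` B) `&` W)))).
  apply: le_measure; rewrite ?inE; [exact: mY|by apply: measurableU => //; exact: mY|].
  move=> x [[[Ax nB]|[Bx nA]] Wx].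
    case: (pselect (U k x)) => Ux; [right|left] => //.
    by split => //; left.
  right; split => //; right; split => // /UE[j _ Aj]; apply: nA; by exists j.
apply: le_trans (measureU2 _ _ _) _ => //; first exact: mY.
rewrite [e]splitr EFinD; exact: leeD.
Qed.

Lemma measurable_grid_approx A : measurable A -> grid_approx A.
Proof.
move=> mA; suff : <<s @boxes R n >> `<=` grid_approx by apply.
apply: smallest_sub; last by move=> _ [a [b ->]]; exact: grid_approx_box.
split.
- exact: grid_approx0.
- by move=> B; rewrite setTD; exact: grid_approxC.
- exact: grid_approx_bigcup.
Qed.

End density.

Section density_theorem.
Context {R : realType} {n : nat}.
Local Notation X := (Rn R n).
Variable mu : {measure set X -> \bar R}.
Hypothesis mu_leb : is_lebesgue mu.
Variables (o : X) (L : R).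
Hypothesis L0 : 0 < L.

(** This replaces the Lebesgue density theorem. Let [N] be the points of [E] in no cell where [E]
    has density above [th], and [B] a union of cells of one generation close to [N]. In a cell of
    [B] that meets [N] the set [E] has density at most [th], so [|N|] is at most about [th |B|],
    hence about [th |N|], and [th < 1] forces [N] to be null. *)
Lemma density_cells (E : set X) (th : R) : measurable E -> E `<=` hc o L ->
  0 < th < 1 ->
  mu (E `\` \bigcup_(q in [set q | th%:E * mu (gcell o L q) < mu (gcell o L q `&` E)]%E)
        gcell o L q) = 0%E.
Proof.
move=> mE EW /andP[th0 th1].
set P := [set q | _]; set N := E `\` _.
have mN : measurable N.
  by apply: measurableD => //; apply: measurable_bigcup_cell => q; exact: measurable_gcell.
have finW : (mu (hc o L) < +oo)%E by have := mu_hc mu_leb o L0 => /= ->; rewrite ltry.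
have mW : measurable (hc o L) by exact: measurable_hc.
have NW : N `<=` hc o L by move=> x [/EW].
have finN : mu N \is a fin_num.
  by rewrite ge0_fin_numE //; apply: le_lt_trans finW; apply: le_measure; rewrite ?inE.
have [_ ap] := measurable_grid_approx o L0 mW finW mN.
(* The inequality obtained below is [|N| <= th (|N| + e) + e], and [th e <= e] gives this
   constant. *)
suff H e : 0 < e -> fine (mu N) <= 2 / (1 - th) * e.
  apply/eqP; rewrite eq_le measure_ge0 andbT -(fineK finN) lee_fin.
  rewrite leNgt; apply/negP => h.
  have /H : 0 < fine (mu N) * (1 - th) / 4 by rewrite !mulr_gt0 // ?subr_gt0 // invr_gt0.
  have -> : 2 / (1 - th) * (fine (mu N) * (1 - th) / 4) = fine (mu N) / 2.
    by field; rewrite subr_eq0 gt_eqF.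
  lra.
move=> e0; have [i [B [mB sB AB]]] := ap _ e0.
pose D := [set q : cell | [/\ q.1 = i, gcell o L q `<=` B `&` hc o L &
   gcell o L q `&` N !=set0]].
have tD : trivIset D (gcell o L).
  by move=> q q' [qi _ _] [qi' _ _]; apply: gcell_eq => //; rewrite qi qi'.
have sW : saturated o L i (hc o L).
  have W0 x : hc o L x <-> gcell o L (0%N, [ffun=> 0]) x.
    rewrite /gcell /glen /= expr0 divr1.
    suff -> : gcorner o L (0%N, [ffun=> 0]) = o by [].
    by apply: co_inj => c; rewrite co_pt ffunE mul0r addr0.
  move=> x y xy; rewrite !W0 => /(gcellE o L0) h; apply/(gcellE o L0).
  by rewrite -h; apply/esym; exact: gidx_le xy.
have DE : N `&` B `<=` \bigcup_(q in D) gcell o L q.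
  move=> x [Nx Bx]; exists (cellat o L i x); last exact: gcell_at.
  split => //; last by exists x; split => //; exact: gcell_at.
  move=> y /(gcellE o L0) /= xy; split; first by apply: sB Bx.
  by apply: (sW x) => //; exact: NW.
have mU : measurable (\bigcup_(q in D) gcell o L q).
  by apply: measurable_bigcup_cell => q; exact: measurable_gcell.
have mi : measurable_fun setT (\1_N : X -> R) by exact: measurable_indic.
have I1 (A : set X) : measurable A -> Int mu A (\1_N : X -> R) = mu (A `&` N).
  by move=> mA; rewrite /Int integral_indic // setIC.
have H1 : (mu (N `&` B) <= th%:E * mu (B `&` hc o L))%E.
  apply: (@le_trans _ _ (Int mu (\bigcup_(q in D) gcell o L q) (fun=> th))).
    apply: (@le_trans _ _ (Int mu (\bigcup_(q in D) gcell o L q) (\1_N : X -> R))).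
      rewrite I1 //; apply: le_measure; rewrite ?inE; try exact: measurableI.
      by move=> x Nx; split; [exact: DE|case: Nx].
    apply: Int_cells_le => //; first by move=> x; exact: ltW.
    move=> q [qi qB [x [xq [Ex nPx]]]].
    rewrite I1 ?Int_cst //; try exact: measurable_gcell.
    apply: (@le_trans _ _ (mu (gcell o L q `&` E))).
      apply: le_measure; rewrite ?inE.
      - by apply: measurableI => //; exact: measurable_gcell.
      - by apply: measurableI => //; exact: measurable_gcell.
      - by move=> y [yq []].
    by rewrite leNgt; apply/negP => h; apply: nPx; exists q.
  rewrite Int_cst //; apply: lee_wpmul2l; first by rewrite lee_fin ltW.
  apply: le_measure; rewrite ?inE //; first exact: measurableI.
  by move=> x [q [_ h _] /h].
have H2 : (mu N <= mu (N `&` B) + e%:E)%E.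
  rewrite (measureDI mu mN mB) addeC leeD2l //; apply: le_trans AB.
  apply: le_measure; rewrite ?inE.
  - exact: measurableD.
  - by apply: measurableI => //; apply: measurableU; exact: measurableD.
  - by move=> x [Nx nB]; split; [left|exact: NW].
have H3 : (mu (B `&` hc o L) <= mu N + e%:E)%E.
  apply: (@le_trans _ _ (mu (N `|` ((N `+` B) `&` hc o L)))).
    apply: le_measure; rewrite ?inE.
    - exact: measurableI.
    - by apply: measurableU => //; apply: measurableI => //; apply: measurableU; exact: measurableD.
    - move=> x [Bx Wx]; case: (pselect (N x)) => Nx; [by left|right].
      by split => //; right.
  apply: le_trans (measureU2 _ _ _) _ => //.
    by apply: measurableI => //; apply: measurableU; exact: measurableD.
  exact: leeD2l.
have : (mu N <= th%:E * (mu N + e%:E) + e%:E)%E.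
  apply: le_trans H2 _; rewrite leeD2r //; apply: le_trans H1 _.
  by apply: lee_wpmul2l => //; rewrite lee_fin ltW.
move=> H4; have {}H4 : fine (mu N) <= th * (fine (mu N) + e) + e.
  by rewrite -lee_fin EFinD EFinM EFinD fineK.
rewrite -[2 / _ * _]mulrAC ler_pdivlMr ?subr_gt0 //.
have : th * e <= e by rewrite ler_piMl // ltW.
by move: H4; rewrite mulrDr; lra.
Qed.

End density_theorem.

(** * Stopping cells and the John-Nirenberg inequality *)

Section calderon_zygmund_cells.
Context {R : realType} {n : nat}.
Local Notation X := (Rn R n).
Variable mu : {measure set X -> \bar R}.
Hypothesis mu_leb : is_lebesgue mu.
Variables (o : X) (L : R).
Hypothesis L0 : 0 < L.

Lemma gcell_root : gcell o L (0%N, [ffun=> 0]) = hc o L.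
Proof.
rewrite /gcell /glen /= expr0 divr1; congr hc.
by apply: co_inj => c; rewrite co_pt ffunE mul0r addr0.
Qed.

Lemma gcell_sub_root q : gcell o L q `&` hc o L !=set0 -> gcell o L q `<=` hc o L.
Proof. by rewrite -gcell_root setIC; apply: gcell_nested. Qed.

Lemma gcell_corner q : gcell o L q (gcorner o L q).
Proof. by move=> c; rewrite lexx ltrDl glen_gt0. Qed.

(** At level 0 the predecessor is again 0 and the cell is its own parent; hence the positive level
    in [glen_parent]. *)
Definition gparent (q : cell) : cell := cellat o L q.1.-1 (gcorner o L q).

Lemma gparent_sub q : gcell o L q `<=` gcell o L (gparent q).
Proof.
apply: gcell_nested => //; first exact: leq_pred.
by exists (gcorner o L q); split; [exact: gcell_at|exact: gcell_corner].
Qed.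

Lemma glen_parent q : (0 < q.1)%N -> glen L (gparent q) = 2 * glen L q.
Proof.
case: q => -[//|i k] _; rewrite /glen /= exprS.
by field; rewrite expf_neq0 // pnatr_eq0.
Qed.

Lemma glen_le (q : @cell n) : (glen L q : R) <= L.
Proof.
by rewrite ler_pdivrMr ?exprn_gt0 // ler_peMr ?(ltW L0) // exprn_ege1 // ler1n.
Qed.

Variables (f : X -> R) (lam : R).
Hypothesis mf : measurable_fun setT f.
Hypothesis f0 : forall x, 0 <= f x.
Hypothesis lam0 : 0 < lam.
Hypothesis root_le : (Int mu (hc o L) f <= (lam * L ^+ n)%:E)%E.

(** All cells of large average, not only the maximal ones; the usual Calderon-Zygmund cells are
    [minimal_cells o L cz_cells]. *)
Definition cz_cells : set cell := [set q | gcell o L q `<=` hc o L /\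
  (lam%:E * mu (gcell o L q) < Int mu (gcell o L q) f)%E].

Lemma cz_sub q : cz_cells q -> gcell o L q `<=` hc o L.
Proof. by case. Qed.

Lemma bigcup_cz_sub : \bigcup_(q in cz_cells) gcell o L q `<=` hc o L.
Proof. by move=> x [q /cz_sub sub /sub]. Qed.

Lemma cz_minimal_level q : cz_cells q -> (0 < q.1)%N.
Proof.
case: q => -[|i] k //= [sub]; rewrite ltNge => /negP[].
have -> : (0%N, k) = (0%N, [ffun=> 0]) :> cell.
  apply: (@gcell_eq _ _ o L L0) => //; rewrite gcell_root.
  by exists (gcorner o L (0%N, k)); split; [exact: gcell_corner|apply: sub; exact: gcell_corner].
by rewrite gcell_root (mu_hc mu_leb) // -EFinM.
Qed.

(** The parent lies in the root cube, since [root_le] excludes level 0, and it is not selected, so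
    its average is at most [lam]. It is [2 ^ n] times as large as the cell. *)
Lemma cz_minimal_le q : minimal_cells o L cz_cells q ->
  (Int mu (gcell o L q) f <= (2 ^+ n * lam)%:E * mu (gcell o L q))%E.
Proof.
move=> [Pq minq]; have lev := cz_minimal_level Pq.
apply: (@le_trans _ _ (Int mu (gcell o L (gparent q)) f)).
  by apply: Int_subset => //; exact: gparent_sub.
have -> : ((2 ^+ n * lam)%:E * mu (gcell o L q) = lam%:E * mu (gcell o L (gparent q)))%E.
  rewrite !(mu_gcell mu_leb) // glen_parent // -!EFinM.
  by rewrite [((2 * _) ^+ n)%R]exprMn mulrCA mulrA.
rewrite leNgt; apply/negP => h.
have sub : gcell o L (gparent q) `<=` hc o L.
  apply: gcell_sub_root; exists (gcorner o L q); split; last by apply: (cz_sub Pq); exact: gcell_corner.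
  by apply: gparent_sub; exact: gcell_corner.
have lev' : (q.1.-1 < q.1)%N by rewrite prednK.
have := minq (gparent q) (conj sub h) lev'.
rewrite -subset0 => /(_ (gcorner o L q)); apply; split; last exact: gcell_corner.
by apply: gparent_sub; exact: gcell_corner.
Qed.

Lemma measurable_bigcup_cz : measurable (\bigcup_(q in cz_cells) gcell o L q).
Proof. by apply: measurable_bigcup_cell => q; exact: measurable_gcell. Qed.

Lemma mu_cz_le : (lam%:E * mu (\bigcup_(q in cz_cells) gcell o L q) <= Int mu (hc o L) f)%E.
Proof.
have H : (mu (\bigcup_(q in cz_cells) gcell o L q) <=
    Int mu (\bigcup_(q in cz_cells) gcell o L q) (fun x => lam^-1 * f x)%R)%E.
  apply: mu_cells_le => //.
  - exact: measurable_funM.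
  - by move=> x; rewrite mulr_ge0 // invr_ge0 ltW.
  - move=> q [_ /ltW h]; rewrite Int_Z ?invr_ge0 ?(ltW lam0) //; last exact: measurable_gcell.
    by rewrite muleC lee_pdivlMr // muleC.
rewrite Int_Z ?invr_ge0 ?(ltW lam0) // in H; last exact: measurable_bigcup_cz.
apply: le_trans _ (Int_subset mu f0 bigcup_cz_sub).
by rewrite muleC -lee_pdivlMr // muleC.
Qed.

(** [density_cells] is applied to the set where [f > 2 lam], with threshold 1/2: a cell filled to
    more than one half by this set has average above [lam]. Hence the factor 2, which Lebesgue
    differentiation would avoid. *)
Lemma cz_ae_le : {ae mu, forall x, hc o L x ->
  ~ (\bigcup_(q in cz_cells) gcell o L q) x -> f x <= 2 * lam}.
Proof.
pose E : set X := hc o L `&` [set x | 2 * lam < f x].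
have mE : measurable E.
  apply: measurableI; first exact: measurable_hc.
  exact: measurable_gt_set.
have := @density_cells _ _ _ mu_leb o L L0 E 2^-1 mE (@subIsetl _ _ _).
have h2 : ((0 : R) < 2^-1) && ((2^-1 : R) < 1) by apply/andP; split; lra.
move=> /(_ h2); set N := E `\` _ => N0; apply: (@null_ae _ _ _ _ _ N) => //.
  by apply: measurableD => //; apply: measurable_bigcup_cell => q; exact: measurable_gcell.
move=> x nN rx nP; rewrite leNgt; apply/negP => h; apply: nN; split => // -[q Pq xq].
apply: nP; exists q => //; split; first by apply: gcell_sub_root; exists x.
apply: (@lt_le_trans _ _ ((2 * lam)%:E * mu (gcell o L q `&` E))%E).
  have -> : (lam%:E * mu (gcell o L q) = (2 * lam)%:E * (2^-1%:E * mu (gcell o L q)))%E.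
    by rewrite muleA -EFinM; congr (_%:E * _)%E; field.
  by rewrite lte_pmul2l // ?fin_numE // lte_fin mulr_gt0.
rewrite -Int_cst; last by apply: measurableI => //; exact: measurable_gcell.
apply: le_trans _ (Int_subset mu f0 (@subIsetl _ _ E)).
by apply: Int_le => [y|y [_ [_ /ltW]]] //; rewrite mulr_ge0 // ltW.
Qed.

End calderon_zygmund_cells.

Section john_nirenberg.
Context {R : realType} {n : nat}.
Local Notation X := (Rn R n).
Variable mu : {measure set X -> \bar R}.
Hypothesis mu_leb : is_lebesgue mu.
Variables (b : X -> R) (m : X -> R -> R) (B : R).
Hypothesis mb : measurable_fun setT b.
Hypothesis B0 : 0 < B.
Hypothesis osc : forall a l, 0 < l ->
  (Int mu (hc a l) (fun x => `|b x - m a l|)%R <= (B * l ^+ n)%:E)%E.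

(** [D] bounds the change of centre from a cube to one of its stopping cells: [B] for the cell, plus
    [2 ^ n] times the height [2 B]. The exponent [c] makes this change cost a factor 3/2, which the
    halving of the measure overcompensates. *)
Let D := (1 + 2 ^+ n.+1) * B.
Let c := ln (3 / 2) / D.

Let D0 : 0 < D.
Proof. by rewrite mulr_gt0 // addr_gt0 // exprn_gt0. Qed.

Let c0 : 0 < c.
Proof. by rewrite divr_gt0 // ln_gt0 //; lra. Qed.

Let cD : expR (c * D) = 3 / 2.
Proof. by rewrite /c divfK ?gt_eqF // lnK // posrE; lra. Qed.

(* The truncation at [t] makes the supremum over all cubes finite, so that the
   recursive inequality for it can be solved. *)
Let F (t : R) a l (x : X) : R := expR (c * Num.min `|b x - m a l| t).

Let mF t a l : measurable_fun setT (F t a l).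
Proof.
apply: (measurableT_comp (@measurable_expR _)); apply: measurable_funM => //.
by apply: measurable_minr => //; mfun.
Qed.

Let F0 t a l x : 0 <= F t a l x.
Proof. exact: expR_ge0. Qed.

(** Stop at height [2 B]. The stopping cells fill at most half of the cube and the centre changes by
    at most [D] on each, so they contribute [1/2 * 3/2 * I]. Off them [|b - m|] is at most [4 B]
    almost everywhere. *)
Lemma jn_step t a l I : 0 < l -> 0 <= I ->
  (forall a' l', 0 < l' -> (Int mu (hc a' l') (F t a' l') <= (I * l' ^+ n)%:E)%E) ->
  (Int mu (hc a l) (F t a l) <= ((expR (4 * c * B) + 3 / 4 * I) * l ^+ n)%:E)%E.
Proof.
move=> l0 I0 HI.
pose h x : R := `|b x - m a l|.
have mh : measurable_fun setT h by rewrite /h; mfun.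
have h0 x : 0 <= h x by rewrite /h.
have lam0 : 0 < 2 * B by rewrite mulr_gt0.
have ln0 : 0 < l ^+ n by exact: exprn_gt0.
have root_le : (Int mu (hc a l) h <= (2 * B * l ^+ n)%:E)%E.
  apply: le_trans (osc a l0) _; rewrite lee_fin ler_pM2r //; lra.
set P := cz_cells mu a l h (2 * B); set U := \bigcup_(q in P) gcell a l q.
have mU : measurable U by exact: measurable_bigcup_cz.
have UR : U `<=` hc a l by exact: bigcup_cz_sub.
have muU : (mu U <= (l ^+ n / 2)%:E)%E.
  have := mu_cz_le mu a l0 mh h0 lam0; rewrite -/P -/U => H.
  have {}H := le_trans H (osc a l0).
  rewrite -(@lee_pmul2l _ (2 * B)%:E) // -EFinM.
  by apply: le_trans H _; rewrite lee_fin; apply: eq_ler; field.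
have IU : (Int mu U (F t a l) <= (3 / 2 * I)%:E * mu U)%E.
  rewrite -Int_cst // /U -bigcup_minimal //.
  apply: Int_cells_le => //; first exact: trivIset_minimal.
    by move=> x; rewrite mulr_ge0.
  move=> q mq; have [Pq _] := mq.
  rewrite Int_cst; last exact: measurable_gcell.
  have q0 := glen_gt0 l0 q.
  have dm : `|m (gcorner a l q) (glen l q) - m a l| <= D.
    have H1 := osc (gcorner a l q) q0.
    have H2 := cz_minimal_le mu_leb l0 h0 root_le mq.
    have H3 : (`|m (gcorner a l q) (glen l q) - m a l|%:E * mu (gcell a l q) <=
       Int mu (gcell a l q) (fun x => `|b x - m (gcorner a l q) (glen l q)| + h x)%R)%E.
      rewrite -Int_cst; last exact: measurable_gcell.
      apply: Int_le => // x _; rewrite /h distrC.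
      rewrite (_ : m a l - _ = (b x - m (gcorner a l q) (glen l q)) - (b x - m a l)); last by ring.
      exact: ler_normB.
    rewrite Int_D // in H3; [|exact: measurable_gcell|by mfun].
    have := le_trans H3 (leeD H1 H2); rewrite (mu_gcell mu_leb) // -!EFinM -EFinD lee_fin.
    rewrite mulrA -mulrDl ler_pM2r ?exprn_gt0 // => H; apply: le_trans H _.
    by rewrite /D exprS; apply: eq_ler; ring.
  apply: (@le_trans _ _ (Int mu (gcell a l q) (fun x => (3 / 2) * F t (gcorner a l q) (glen l q) x))).
    apply: Int_le => // x _; rewrite -cD /F -expRD ler_expR -mulrDr ler_pM2l //.
    have : `|b x - m a l| <= D + `|b x - m (gcorner a l q) (glen l q)|.
      apply: le_trans (lerD dm (lexx _)); apply: le_trans (ler_normD _ _).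
      by apply: eq_ler; congr (`|_|); ring.
    have D1 := D0; rewrite /Num.min; case: ifP; case: ifP; lra.
  rewrite Int_Z //; last exact: measurable_gcell.
  rewrite (EFinM (3 / 2)) -muleA; apply: lee_wpmul2l; first by rewrite lee_fin; lra.
  by rewrite (mu_gcell mu_leb) // -EFinM; exact: HI.
have IR : (Int mu (hc a l `\` U) (F t a l) <= (expR (4 * c * B) * l ^+ n)%:E)%E.
  have mRU : measurable (hc a l `\` U) by apply: measurableD => //; exact: measurable_hc.
  apply: (@le_trans _ _ (Int mu (hc a l `\` U) (fun=> expR (4 * c * B)))).
    apply: Int_ae_le => //.
    have := cz_ae_le mu_leb a l0 mh h0 lam0; apply: filterS => x H [/H{}H /H{}H].
    rewrite /F ler_expR (_ : 4 * c * B = c * (4 * B)); last by ring.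
    rewrite ler_pM2l // ge_min; apply/orP; left.
    by move: H; rewrite /h; lra.
  rewrite Int_cst // EFinM; apply: lee_wpmul2l; first by rewrite lee_fin expR_ge0.
  rewrite -(mu_hc mu_leb a l0); apply: le_measure; rewrite ?inE //; exact: measurable_hc.
rewrite -(setDUK UR) setUC; apply: le_trans (Int_setU_le _ _ _ _ _) _ => //.
  by apply: measurableD => //; exact: measurable_hc.
rewrite mulrDl EFinD; apply: leeD => //; apply: le_trans IU _.
rewrite (_ : 3 / 4 * I * _ = 3 / 2 * I * (l ^+ n / 2)); last by field.
by rewrite [leRHS]EFinM; apply: lee_wpmul2l => //; rewrite lee_fin mulr_ge0.
Qed.

(** Iterate [jn_step] from the trivial bound [expR (c * t)]. The map [I -> E + 3/4 I] has the fixed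
    point [4 E], and the dependence on [t] disappears in the limit. *)
Lemma jn_truncated t a l : 0 <= t -> 0 < l ->
  (Int mu (hc a l) (F t a l) <= (4 * expR (4 * c * B) * l ^+ n)%:E)%E.
Proof.
move=> t0 l0; set E := expR (4 * c * B).
have H k : forall a l, 0 < l ->
    (Int mu (hc a l) (F t a l) <= ((4 * E + (3 / 4) ^+ k * expR (c * t)) * l ^+ n)%:E)%E.
  elim: k => [|k IH] a' l' l'0.
    apply: (@le_trans _ _ (Int mu (hc a' l') (fun=> expR (c * t)))).
      by apply: Int_le => // x _; rewrite ler_expR ler_pM2l // ge_min lexx orbT.
    rewrite Int_cst; last exact: measurable_hc.
    rewrite (mu_hc mu_leb) // -EFinM lee_fin ler_pM2r ?exprn_gt0 // expr0 mul1r.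
    by rewrite lerDr mulr_ge0 // expR_ge0.
  have I0 : 0 <= 4 * E + (3 / 4) ^+ k * expR (c * t).
    by rewrite addr_ge0 // mulr_ge0 ?expR_ge0 // exprn_ge0 //; lra.
  apply: le_trans (jn_step a' l'0 I0 IH) _; rewrite lee_fin -/E exprS.
  by rewrite ler_pM2r ?exprn_gt0 //; lra.
have fin : Int mu (hc a l) (F t a l) \is a fin_num.
  by rewrite ge0_fin_numE ?Int_ge0 //; apply: le_lt_trans (H 0%N a l l0) (ltry _).
rewrite -(fineK fin) lee_fin.
have cv : (fun k => (4 * E + (3 / 4) ^+ k * expR (c * t)) * l ^+ n) @ \oo -->
    (4 * E + 0 * expR (c * t)) * l ^+ n.
  apply: cvgM; last exact: cvg_cst.
  apply: cvgD; first exact: cvg_cst.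
  apply: cvgM; last exact: cvg_cst.
  by apply: cvg_expr; rewrite ger0_norm; lra.
rewrite -[4 * E]addr0 -(mul0r (expR (c * t))) -(cvg_lim _ cv) //; apply: limr_ge.
  by apply/cvg_ex; eexists; exact: cv.
apply: nearW => k /=; rewrite -lee_fin fineK //; exact: H.
Qed.

Lemma john_nirenberg : exists c C : R, [/\ 0 < c, 0 < C & forall a l, 0 < l ->
  (Int mu (hc a l) (fun x => expR (c * `|b x - m a l|))%R <= (C * l ^+ n)%:E)%E].
Proof.
exists c, (4 * expR (4 * c * B)); split => //; first by rewrite mulr_gt0 // expR_gt0.
move=> a l l0.
pose A k : set X := hc a l `&` [set x | `|b x - m a l| <= k%:R].
have mA k : measurable (A k).
  apply: measurableI; first exact: measurable_hc.
  rewrite -[X in measurable X]setTI; apply: (measurable_fun_le measurableT) => //; by mfun.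
have -> : hc a l = \bigcup_k A k.
  apply/seteqP; split => x; last by move=> [k _ []].
  move=> xR; exists (Num.bound `|b x - m a l|) => //; split => //=.
  by apply: ltW; exact: archi_boundP.
apply: Int_bigcup_bound => //.
- by move=> k x [xR /= h]; split => //=; apply: le_trans h _; rewrite ler_nat.
- apply: (measurableT_comp (@measurable_expR _)); apply: measurable_funM => //; by mfun.
- move=> k; apply: le_trans (jn_truncated a (ler0n R k) l0).
  apply: (@le_trans _ _ (Int mu (A k) (F k%:R a l))).
    apply: Int_le => [x|x [_ /= h]]; first exact: expR_ge0.
    by rewrite /F min_l.
  by apply: Int_subset => // x [].
Qed.

End john_nirenberg.

(** * Calderon-Zygmund operators *)

Section L2_functions.
Context {d : measure_display} {T : measurableType d} {R : realType}.
Variable mu : {measure set T -> \bar R}.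
Implicit Types (A B : set T) (f g : T -> R) (c : R).

Definition L2r f := measurable_fun setT f /\ (Int mu setT (fun x => f x ^+ 2)%R < +oo)%E.

Lemma L2r_measurable f : L2r f -> measurable_fun setT f.
Proof. by case. Qed.

Lemma L2r_le f g c : 0 <= c -> measurable_fun setT g -> L2r f ->
  {ae mu, forall x, `|g x| <= c * `|f x|} -> L2r g.
Proof.
move=> c0 mg [mf If] gf; split => //.
apply: (@le_lt_trans _ _ (Int mu setT (fun x => c ^+ 2 * f x ^+ 2)%R)).
  apply: Int_ae_le => //.
  - by mfun.
  - by mfun.
  - by move=> x; exact: sqr_ge0.
  - by move=> x; rewrite mulr_ge0 // sqr_ge0.
  - apply: filterS gf => x H _; rewrite -exprMn -(real_normK (num_real (g x))).
    rewrite -(real_normK (num_real (c * f x))) ler_sqr ?nnegrE //.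
    by rewrite normrM (ger0_norm c0).
rewrite Int_Z ?sqr_ge0 //; last by move=> x; exact: sqr_ge0.
  by rewrite lte_mul_pinfty // ?lee_fin ?sqr_ge0.
by mfun.
Qed.

Lemma L2rD f g c : L2r f -> L2r g -> L2r (fun x => f x + c * g x).
Proof.
move=> [mf If] [mg Ig]; split; first by mfun.
apply: (@le_lt_trans _ _ (Int mu setT (fun x => 2 * f x ^+ 2 + 2 * c ^+ 2 * g x ^+ 2)%R)).
  apply: Int_le => [x|x _]; first exact: sqr_ge0.
  rewrite -subr_ge0 (_ : _ - _ = (f x - c * g x) ^+ 2); last by ring.
  exact: sqr_ge0.
have c2 : 0 <= 2 * c ^+ 2 by rewrite mulr_ge0 // sqr_ge0.
rewrite Int_D //; [|by mfun|by mfun|by move=> x; rewrite mulr_ge0 // sqr_ge0|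
  by move=> x; rewrite mulr_ge0 // sqr_ge0].
rewrite !Int_Z //; [|by mfun|by move=> x; rewrite sqr_ge0|by mfun|by move=> x; rewrite sqr_ge0].
by rewrite lte_add_pinfty // lte_mul_pinfty // lee_fin.
Qed.

Lemma L2r_indic f A : measurable A -> L2r f -> L2r (fun x => f x * \1_A x).
Proof.
move=> mA Lf; have [mf _] := Lf; apply: (L2r_le (ler01) _ Lf).
  by apply: measurable_funM => //; exact: measurable_indic.
apply: aeW => x; rewrite mul1r normrM indicE; case: (x \in A); first by rewrite normr1 mulr1.
by rewrite normr0 mulr0.
Qed.

Lemma L2r1 A : measurable A -> (mu A < +oo)%E -> L2r (\1_A : T -> R).
Proof.
move=> mA fA; split; first exact: measurable_indic.
suff -> : Int mu setT (fun x => (\1_A x : R) ^+ 2)%R = mu A by [].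
rewrite -[RHS]mul1e -Int_cst // /Int [RHS]integral_mkcond; apply: eq_integral => x _.
by rewrite /patch indicE; case: (x \in A); rewrite ?expr1n ?expr0n.
Qed.

Lemma L2r0 : L2r (fun=> 0).
Proof.
split => //; rewrite /Int (_ : integral _ _ _ = 0%E) ?ltry //.
by apply: integral0_eq => x _; rewrite expr0n.
Qed.

Lemma L2r_sum (I : eqType) (s : seq I) (f : I -> T -> R) : (forall i, L2r (f i)) ->
  L2r (fun x => \sum_(i <- s) f i x).
Proof.
move=> Lf; elim: s => [|i s IH].
  by under eq_fun do rewrite big_nil; exact: L2r0.
under eq_fun do rewrite big_cons -[X in _ + X]mul1r; exact: L2rD.
Qed.

Lemma L2r_Int_lty f A : measurable A -> (mu A < +oo)%E -> L2r f ->
  (Int mu A (fun x => `|f x|)%R < +oo)%E.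
Proof.
move=> mA fA [mf If].
apply: (@le_lt_trans _ _ (Int mu A (fun x => 1 + f x ^+ 2)%R)).
  apply: Int_le => // x _; rewrite -(real_normK (num_real (f x))).
  have := sqr_ge0 (`|f x| - 2^-1); rewrite sqrrB; lra.
rewrite Int_D //; [|by mfun|by move=> x; rewrite sqr_ge0].
rewrite Int_cst // mul1e lte_add_pinfty //; apply: le_lt_trans If.
by apply: Int_subset => // x; exact: sqr_ge0.
Qed.

Lemma L2r_chebyshev f A s : measurable A -> measurable_fun setT f -> 0 < s ->
  ((s ^+ 2)%:E * mu (A `&` [set x | s < `|f x|]%R) <= Int mu setT (fun x => f x ^+ 2)%R)%E.
Proof.
move=> mA mf s0.
have mf2 : measurable_fun setT (fun x => f x ^+ 2)%R by mfun.
have f20 x : 0 <= f x ^+ 2 by exact: sqr_ge0.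
apply: le_trans _ (Int_subset mu f20 (@subsetT _ A)).
apply: le_trans _ (markov_Int mu mA mf2 f20 (sqr_ge0 s)).
apply: lee_wpmul2l; first by rewrite lee_fin sqr_ge0.
apply: le_measure; rewrite ?inE.
- by apply: measurableI => //; apply: measurable_gt_set; mfun.
- apply: measurableI => //; rewrite -[X in measurable X]setTI.
  exact: (measurable_fun_le measurableT).
- move=> x [Ax /= /ltW h]; split => //=; rewrite -(real_normK (num_real (f x))).
  by rewrite ler_sqr ?nnegrE // ltW.
Qed.

Lemma Int_tail (F : nat -> set T) f (e : R) : (forall k, measurable (F k)) ->
  (forall k, F k `<=` F k.+1) -> measurable_fun setT f -> (forall x, 0 <= f x) ->
  (Int mu (\bigcup_k F k) f < +oo)%E -> 0 < e ->
  exists k, (Int mu (\bigcup_k F k `\` F k) f <= e%:E)%E.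
Proof.
move=> mF F1 mf f0 fin e0; apply: contrapT => nex.
have mU := bigcupT_measurable _ mF.
have H k : (Int mu (F k) f + e%:E <= Int mu (\bigcup_k F k) f)%E.
  have sub : F k `<=` \bigcup_k F k by move=> x; exists k.
  rewrite -[in leRHS](setDUK sub) Int_setU //.
  - by rewrite leeD2l // leNgt; apply/negP => /ltW h; apply: nex; exists k.
  - exact: measurableD.
  - by rewrite setDE setICA setICr setI0.
have fn : Int mu (\bigcup_k F k) f \is a fin_num by rewrite ge0_fin_numE // Int_ge0.
have : (Int mu (\bigcup_k F k) f <= Int mu (\bigcup_k F k) f - e%:E)%E.
  by apply: Int_bigcup_bound => // k; rewrite leeBrDr.
by rewrite -(fineK fn) -EFinB lee_fin; lra.
Qed.

End L2_functions.

Section real_czo.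
Context {R : realType} {n : nat}.
Local Notation X := (Rn R n).
Variable mu : {measure set X -> \bar R}.
Implicit Types f g : X -> R.

Record real_czo (tau : (X -> R) -> X -> R) (k : X -> R) (CT Ck : R) : Prop := {
  czo_lin : forall f g c, L2r mu f -> L2r mu g ->
    {ae mu, forall x, tau (fun y => f y + c * g y) x = tau f x + c * tau g x};
  czo_meas : forall f, L2r mu f -> measurable_fun setT (tau f);
  czo_bdd : forall f, L2r mu f ->
    (Int mu setT (fun x => tau f x ^+ 2)%R <= CT%:E * Int mu setT (fun x => f x ^+ 2)%R)%E;
  czo_ker : forall f a l, 0 < l -> L2r mu f -> (forall x, ~ cube a l x -> f x = 0) ->
    {ae mu, forall x, ~ cube a l x ->
      tau f x = Rintegral mu setT (fun y => k (x - y) * f y)};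
  czo_kmeas : measurable_fun setT k;
  czo_size : forall x r, 0 < r -> (exists i, r <= `|co x i|) -> `|k x| <= Ck / r ^+ n;
  (* the regularity condition in the sup norm, for [x] and [y] in general position *)
  czo_reg : forall x y r e, 0 < e <= r -> (exists i, r <= `|co x i|) ->
    (exists i, r <= `|co y i|) -> (forall i, `|co x i - co y i| <= e) ->
    `|k x - k y| <= Ck * e / r ^+ n.+1;
  czo_CT : 0 <= CT;
  czo_Ck : 0 <= Ck
}.

Hypothesis mu_leb : is_lebesgue mu.
Variables (tau : (X -> R) -> X -> R) (k : X -> R) (CT Ck : R).
Hypothesis H : real_czo tau k CT Ck.

Lemma coB (x y : X) i : co (x - y : X) i = co x i - co y i.
Proof. by rewrite /co !mxE. Qed.

(** A consequence of the [L^2] bound. It lets [tau] ignore null sets, which matters for functions of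
    average zero and for a symbol that is constant almost everywhere. *)
Lemma tau0 f : measurable_fun setT f -> {ae mu, forall x, f x = 0} ->
  {ae mu, forall x, tau f x = 0}.
Proof.
move=> mf f0.
have I0 : Int mu setT (fun x => f x ^+ 2)%R = 0%E.
  apply: ae0_Int => //; [by mfun|by move=> x; exact: sqr_ge0|].
  by apply: filterS f0 => x -> _; rewrite expr0n.
have Lf : L2r mu f by split => //; rewrite I0.
have mt := czo_meas H Lf.
have T0 : Int mu setT (fun x => tau f x ^+ 2)%R = 0%E.
  apply/eqP; rewrite eq_le Int_ge0 ?andbT; last by move=> x; exact: sqr_ge0.
  by have := czo_bdd H Lf; rewrite I0 mule0.
have mt2 : measurable_fun setT (fun x => tau f x ^+ 2)%R by mfun.
have := Int0_ae measurableT mt2 (fun x => sqr_ge0 _) T0.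
by apply: filterS => x /(_ I) /eqP; rewrite sqrf_eq0 => /eqP.
Qed.

Lemma tau_sum (I : eqType) (s : seq I) (f : I -> X -> R) : (forall i, L2r mu (f i)) ->
  {ae mu, forall x, tau (fun y => \sum_(i <- s) f i y) x = \sum_(i <- s) tau (f i) x}.
Proof.
move=> Lf; elim: s => [|i s IH].
  have := @tau0 (fun y => \sum_(i <- [::]) f i y) _ _.
  have e : (fun y => \sum_(i <- [::]) f i y) = (fun=> 0).
    by apply/funext => y; rewrite big_nil.
  rewrite e => /(_ (measurable_cst _)) h.
  have : {ae mu, forall x, tau (fun=> 0) x = 0} by apply: h; apply: aeW => x; rewrite big_nil.
  by apply: filterS => x ->; rewrite big_nil.
have := czo_lin H 1 (Lf i) (L2r_sum s Lf).
have -> : (fun y => f i y + 1 * \sum_(i <- s) f i y) = (fun y => \sum_(j <- i :: s) f j y).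
  by apply/funext => y; rewrite big_cons mul1r.
move: IH; apply: filterS2 => x IH ->; by rewrite big_cons mul1r IH.
Qed.

End real_czo.

Section integral_tools.
Context {d : measure_display} {T : measurableType d} {R : realType}.
Variable mu : {measure set T -> \bar R}.
Implicit Types (A B : set T) (f g : T -> R) (c : R).

Lemma Int_indic A f : Int mu A f = Int mu setT (fun x => f x * \1_A x)%R.
Proof.
rewrite /Int [LHS]integral_mkcond; apply: eq_integral => x _.
by rewrite /patch indicE; case: (x \in A); rewrite ?mulr1 ?mulr0.
Qed.

Lemma Int_fin f A c : (forall x, 0 <= f x) -> (Int mu A f <= c%:E)%E ->
  Int mu A f \is a fin_num.
Proof. by move=> f0 H; rewrite ge0_fin_numE ?Int_ge0 //; apply: le_lt_trans H (ltry _). Qed.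

Lemma integrable_Int f : measurable_fun setT f ->
  (Int mu setT (fun x => `|f x|)%R < +oo)%E -> mu.-integrable setT (EFin \o f).
Proof.
by move=> mf h; apply/integrableP; split; [exact/measurable_EFinP|exact: h].
Qed.

Lemma normr_Rintegral_le f : measurable_fun setT f ->
  (Int mu setT (fun x => `|f x|)%R < +oo)%E ->
  (`|Rintegral mu setT f|%:E <= Int mu setT (fun x => `|f x|)%R)%E.
Proof.
move=> mf h; have i := integrable_Int mf h.
rewrite EFin_normr_Rintegral //; apply: le_abse_integral => //.
exact/measurable_EFinP.
Qed.

End integral_tools.

Lemma sum_geometric_half (R : realType) (N : nat) : \sum_(t < N) (2^-1 : R) ^+ t <= 2.
Proof.
have -> : \sum_(t < N) (2^-1 : R) ^+ t = 2 - 2 * 2^-1 ^+ N.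
  elim: N => [|N IH]; first by rewrite big_ord0 expr0; ring.
  by rewrite big_ord_recr /= IH exprS; field.
by rewrite gerBl mulr_ge0 // exprn_ge0 // invr_ge0.
Qed.

(** * Decay of the operator away from the support of a function of mean zero *)

Section kernel_estimates.
Context {R : realType} {n : nat}.
Local Notation X := (Rn R n).
Variable mu : {measure set X -> \bar R}.
Hypothesis mu_leb : is_lebesgue mu.
Variables (tau : (X -> R) -> X -> R) (k : X -> R) (CT Ck : R).
Hypothesis H : real_czo mu tau k CT Ck.
Implicit Types f g : X -> R.

Lemma measurable_kernel x : measurable_fun setT (fun y : X => k (x - y)).
Proof. exact: (measurableT_comp (czo_kmeas H) (measurable_reflect x)). Qed.

(** Since [f] has mean zero, [k (x - a)] may be subtracted from the kernel, and regularity gains the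
    factor [l / r]. The null set is fixed before [r], so [r] may later depend on [x]. *)
Lemma mean_zero_kernel_le f a l : 0 < l -> L2r mu f -> (forall x, ~ hc a l x -> f x = 0) ->
  Rintegral mu setT f = 0 ->
  {ae mu, forall x, forall r, l <= r -> (exists i, r + l <= `|co x i - co a i|) ->
    (`|tau f x|%:E <= (Ck * l / r ^+ n.+1)%:E * Int mu setT (fun y => `|f y|)%R)%E}.
Proof.
move=> l0 Lf supp mean; have [mf _] := Lf.
have suppc x : ~ cube a l x -> f x = 0 by move=> nx; apply: supp => /hc_cube.
have fin : (Int mu setT (fun y => `|f y|)%R < +oo)%E.
  have -> : Int mu setT (fun y => `|f y|)%R = Int mu (hc a l) (fun y => `|f y|)%R.
    rewrite [RHS]Int_indic; apply: Int_eq => x _; rewrite indicE.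
    by case: (boolP (x \in _)) => [|/negP]; rewrite ?inE => h; rewrite ?mulr1 // supp // normr0 mul0r.
  apply: L2r_Int_lty => //; first exact: measurable_hc.
  by have := mu_hc mu_leb a l0 => /= ->; rewrite ltry.
have := czo_ker H l0 Lf suppc; apply: filterS => x Hx r lr [i ri].
have r0 : 0 < r by exact: lt_le_trans lr.
have nx : ~ cube a l x.
  by move=> /cubeE/(_ i)/andP[h1 h2]; move: ri; rewrite ger0_norm; lra.
rewrite (Hx nx).
have K1 y : hc a l y -> `|k (x - y) - k (x - a)| <= Ck * l / r ^+ n.+1.
  move=> yR; apply: (czo_reg H); first by rewrite l0.
  - exists i; rewrite coB; have /andP[h1 h2] := yR i.
    have : `|co x i - co a i| <= `|co x i - co y i| + l; last by lra.
    apply: (@le_trans _ _ (`|co x i - co y i| + `|co y i - co a i|)).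
      by apply: le_trans (ler_normD _ _); apply: eq_ler; congr (`|_|); ring.
    by rewrite lerD2l ger0_norm; lra.
  - by exists i; rewrite coB; lra.
  - move=> j; rewrite !coB; have /andP[h1 h2] := yR j.
    by rewrite ler_norml; apply/andP; split; lra.
have mkf c : measurable_fun setT (fun y => c * f y) by mfun.
have mk' := measurable_kernel x.
have C0 : 0 <= Ck * l / r ^+ n.+1.
  by rewrite mulr_ge0 ?invr_ge0 ?exprn_ge0 ?(ltW r0) // mulr_ge0 ?(czo_Ck H) // ltW.
have iD : (Int mu setT (fun y => `|(k (x - y) - k (x - a)) * f y|)%R <=
    (Ck * l / r ^+ n.+1)%:E * Int mu setT (fun y => `|f y|)%R)%E.
  rewrite -Int_Z //; last by mfun.
  apply: Int_le => // y _; rewrite normrM.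
  case: (pselect (hc a l y)) => [yR|/supp ->]; last by rewrite normr0 !mulr0.
  by rewrite ler_wpM2r // K1.
have iD' : (Int mu setT (fun y => `|(k (x - y) - k (x - a)) * f y|)%R < +oo)%E.
  apply: le_lt_trans iD _; rewrite lte_mul_pinfty //.
have mD : measurable_fun setT (fun y : X => (k (x - y) - k (x - a)) * f y) by mfun.
have i2 : mu.-integrable setT (EFin \o (fun y => k (x - a) * f y)).
  apply: integrable_Int; first by mfun.
  under eq_fun do rewrite normrM.
  rewrite Int_Z //; last by mfun.
  by rewrite lte_mul_pinfty.
have -> : Rintegral mu setT (fun y => k (x - y) * f y) =
    Rintegral mu setT (fun y => (k (x - y) - k (x - a)) * f y).
  rewrite -[RHS]addr0 -(mulr0 (k (x - a))) -mean -RintegralZl //; last exact: integrable_Int.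
  rewrite -RintegralD //; last exact: integrable_Int.
  by apply: eq_Rintegral => y _; ring.
exact: le_trans (normr_Rintegral_le mD iD') iD.
Qed.

Definition far (a : X) (l : R) : set X := [set x | exists i, 2 * l <= `|co x i - co a i|].
Definition near (a : X) (l : R) : set X := [set x | forall i, `|co x i - co a i| < 2 * l].

Lemma measurable_nearR (a : X) (r : R) : measurable [set x : X | forall i, `|co x i - co a i| < r].
Proof.
have -> : [set x : X | forall i, `|co x i - co a i| < r] =
    [set x : X | forall i, `]co a i - r, co a i + r[%classic (co x i)].
  apply/seteqP; split => x h i; have := h i; rewrite /= in_itv /= ltr_norml => /andP[h1 h2];
   by apply/andP; split; lra.
exact: (@measurable_coord_set _ _ (fun i => `]co a i - r, co a i + r[%classic)).
Qed.

Lemma farE a l : far a l = ~` near a l.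
Proof.
apply/seteqP; split => x /=.
  by move=> [i h] /(_ i); rewrite ltNge h.
move=> h; apply: contrapT => nf; apply: h => i; rewrite ltNge; apply/negP => h.
by apply: nf; exists i.
Qed.

Lemma measurable_far a l : measurable (far a l).
Proof. by rewrite farE; apply: measurableC; exact: measurable_nearR. Qed.

(** Sum over shells at distance about [2 ^ t l]. Each lies in a cube of side [8 * 2 ^ t l] and so
    contributes [8 ^ n Ck 2 ^- t] times the integral of [|f|]; the geometric series gives 2. *)
Lemma Int_far_le f a l : 0 < l -> L2r mu f -> (forall x, ~ hc a l x -> f x = 0) ->
  Rintegral mu setT f = 0 ->
  (Int mu (far a l) (fun x => `|tau f x|)%R <=
    (2 * 8 ^+ n * Ck)%:E * Int mu setT (fun y => `|f y|)%R)%E.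
Proof.
move=> l0 Lf supp mean; have [mf _] := Lf; have mt := czo_meas H Lf.
have Ck0 := czo_Ck H.
have fin : (Int mu setT (fun y => `|f y|)%R < +oo)%E.
  have -> : Int mu setT (fun y => `|f y|)%R = Int mu (hc a l) (fun y => `|f y|)%R.
    rewrite [RHS]Int_indic; apply: Int_eq => x _; rewrite indicE.
    by case: (boolP (x \in _)) => [|/negP]; rewrite ?inE => h; rewrite ?mulr1 // supp // normr0 mul0r.
  apply: L2r_Int_lty => //; first exact: measurable_hc.
  by have := mu_hc mu_leb a l0 => /= ->; rewrite ltry.
have fn : Int mu setT (fun y => `|f y|)%R \is a fin_num by rewrite ge0_fin_numE ?Int_ge0.
set M := Int mu setT _ in fin fn *.
pose G (t : nat) : set X := [set x | forall i, `|co x i - co a i| < 2 ^+ t * l + l].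
have mG t : measurable (G t) by exact: measurable_nearR.
have -> : far a l = \bigcup_t (far a l `&` G t).
  apply/seteqP; split => x; last by move=> [t _ []].
  move=> xf; pose N := Num.bound ((\sum_i `|co x i - co a i|) / l); exists N => //; split => // i.
  apply: (@le_lt_trans _ _ (\sum_i `|co x i - co a i|)).
    by rewrite (bigD1 i) //= lerDl sumr_ge0.
  apply: (@lt_le_trans _ _ (2 ^+ N * l)); last by rewrite lerDl ltW.
  by rewrite -ltr_pdivrMr //; apply: upper_nthrootP.
apply: Int_bigcup_bound => //.
- by move=> t; apply: measurableI => //; exact: measurable_far.
- move=> t x [xf xG]; split => // i; apply: lt_le_trans (xG i) _.
  by rewrite lerD2r ler_pM2r // ler_eXn2l // ltr1n.
- by mfun.
move=> N.
pose Q (t : nat) : set X := cube (pt (fun i => co a i - 2 ^+ t.+2 * l)) (2 ^+ t.+3 * l).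
pose c (t : nat) : R := Ck * l / (2 ^+ t * l) ^+ n.+1 * fine M.
have p0 (t : nat) : 0 < 2 ^+ t * l by rewrite mulr_gt0 // exprn_gt0.
have c0 t : 0 <= c t.
  rewrite mulr_ge0 ?fine_ge0 ?Int_ge0 // mulr_ge0 ?invr_ge0 ?exprn_ge0 ?(ltW (p0 t)) //.
  by rewrite mulr_ge0 // ltW.
have mQ t : measurable (Q t) by exact: measurable_cube.
have mQ1 t : measurable_fun setT (\1_(Q t) : X -> R) by exact: measurable_indic.
apply: (@le_trans _ _ (Int mu (far a l `&` G N) (fun x => \sum_(t < N) c t * \1_(Q t) x)%R)).
  apply: Int_ae_le => //.
  - by apply: measurableI => //; exact: measurable_far.
  - by mfun.
  - by apply: measurable_sum => t; mfun.
  - by move=> x; apply: sumr_ge0 => t _; rewrite mulr_ge0.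
  have := mean_zero_kernel_le l0 Lf supp mean; apply: filterS => x Hx [xf xG].
  have ex : exists t, `[< G t x >] by exists N; apply/asboolP.
  (* The least index is positive because a far point is at distance at least [2 l]; its predecessor
     gives the lower bound on the distance. *)
  case: (ex_minnP ex) => -[|t] /asboolP xt mint.
    by have [i h] := xf; have := xt i; rewrite expr0 mul1r; lra.
  have tN : (t < N)%N by apply: mint; apply/asboolP.
  have [i hi] : exists i, 2 ^+ t * l + l <= `|co x i - co a i|.
    apply: contrapT => ne; have : (t < t)%N; last by rewrite ltnn.
    apply: mint; apply/asboolP => i; rewrite ltNge; apply/negP => h; by apply: ne; exists i.
  have lt : l <= 2 ^+ t * l by rewrite ler_peMl ?(ltW l0) // exprn_ege1 // ler1n.
  have {}Hx := Hx _ lt (ex_intro _ i hi).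
  rewrite (bigD1 (Ordinal tN)) //=.
  have -> : \1_(Q t) x = 1 :> R.
    rewrite indicE mem_set //; apply/cubeE => j; rewrite co_pt.
    have := xt j; rewrite ltr_norml !exprS => /andP[h1 h2].
    by apply/andP; split; lra.
  rewrite mulr1 -[leLHS]addr0 lerD ?sumr_ge0 // => [|s _]; last by rewrite mulr_ge0.
  by rewrite -lee_fin /c EFinM fineK.
apply: le_trans (Int_subset _ _ (@subsetT _ _)) _.
  by move=> x; apply: sumr_ge0 => t _; rewrite mulr_ge0.
rewrite Int_sum //; [|by move=> t; mfun|by move=> t x; rewrite mulr_ge0].
have E t : Int mu setT (fun x => c t * \1_(Q t) x)%R = (8 ^+ n * Ck * fine M * 2^-1 ^+ t)%:E.
  rewrite Int_Z // -[Int _ _ _](_ : Int mu (Q t) (fun=> 1%R) = _); last first.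
    by rewrite Int_indic; apply: Int_eq => x _; rewrite mul1r.
  have e8 : 2 ^+ t.+3 * l = 8 * (2 ^+ t * l) by rewrite !exprS; ring.
  have p8 : 0 <= 8 * (2 ^+ t * l) by rewrite mulr_ge0 // ltW.
  rewrite Int_cst // mul1e /Q e8 (mu_cube mu_leb _ p8) -EFinM; congr (_%:E); rewrite /c.
  have e2 : (2 ^+ t * l) != 0 by rewrite gt_eqF.
  rewrite [((8 * _) ^+ n)%R]exprMn (exprS _ n) exprVn.
  have e3 : (2 ^+ t * l) ^+ n != 0 by rewrite expf_neq0.
  set w := (2 ^+ t * l) ^+ n in e3 *; set z := 2 ^+ t * l in e2 *.
  have -> : 2 ^- t = l / z :> R by rewrite /z; field; rewrite expf_neq0 // gt_eqF.
  by field; rewrite e2 e3.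
under eq_bigr do rewrite E.
rewrite sumEFin -mulr_sumr -(fineK fn) -EFinM lee_fin.
rewrite -[leRHS](_ : 8 ^+ n * Ck * fine M * 2 = _); last by ring.
have M0 : 0 <= fine M by rewrite fine_ge0 // Int_ge0.
by rewrite /= ler_wpM2l ?sum_geometric_half // !mulr_ge0 ?exprn_ge0.
Qed.

End kernel_estimates.

Section finite_cells.
Context {R : realType} {n : nat}.
Local Notation X := (Rn R n).
Variable mu : {measure set X -> \bar R}.
Hypothesis mu_leb : is_lebesgue mu.
Variables (o : X) (L : R).
Hypothesis L0 : 0 < L.
Variable D : set (@cell n).
Hypothesis tD : trivIset D (gcell o L).
Implicit Types (s : seq (@cell n)) (f g : X -> R).

(** The operators are additive on finite sums only, so infinite families of cells enter through
    these truncations by codes. *)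
Definition cells_upto (N : nat) : seq (@cell n) :=
  undup [seq q <- pmap pickle_inv (iota 0 N) | `[< D q >]].

Lemma mem_cells_upto N q : (q \in cells_upto N) <-> D q /\ (pickle q < N)%N.
Proof.
rewrite mem_undup mem_filter mem_pmap; split.
  move=> /andP[/asboolP Dq /mapP[k]]; rewrite mem_iota add0n => /andP[_ kN] e.
  by split => //; have := @pickle_invK (@cell n) k; rewrite -e /= => ->.
move=> [Dq qN]; apply/andP; split; first exact/asboolP.
by apply/mapP; exists (pickle q); rewrite ?pickleK_inv // mem_iota add0n.
Qed.

Lemma cells_upto_uniq N : uniq (cells_upto N).
Proof. exact: undup_uniq. Qed.

Definition ucells N : set X := \bigcup_(q in [set` cells_upto N]) gcell o L q.

Lemma measurable_ucells N : measurable (ucells N).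
Proof. by apply: measurable_bigcup_cell => q; exact: measurable_gcell. Qed.

Lemma ucellsS N : ucells N `<=` ucells N.+1.
Proof.
move=> x [q /= /mem_cells_upto[Dq qN] xq]; exists q => //=.
by apply/mem_cells_upto; split => //; exact: ltnW.
Qed.

Lemma bigcup_ucells : \bigcup_N ucells N = \bigcup_(q in D) gcell o L q.
Proof.
apply/seteqP; split => x; first by move=> [N _ [q /= /mem_cells_upto[Dq _] xq]]; exists q.
move=> [q Dq xq]; exists (pickle q).+1 => //; exists q => //=.
by apply/mem_cells_upto.
Qed.

Lemma ucells_sub N : ucells N `<=` \bigcup_(q in D) gcell o L q.
Proof. by rewrite -bigcup_ucells => x; exists N. Qed.

Lemma sum_indic_cells N x : \sum_(q <- cells_upto N) \1_(gcell o L q) x = \1_(ucells N) x :> R.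
Proof.
case: (pselect (ucells N x)) => [[q /= qs xq]|nx].
  rewrite [RHS]indicE mem_set; last by exists q.
  rewrite (bigD1_seq q) ?cells_upto_uniq //= indicE mem_set // big_seq_cond big1 ?addr0 //.
  move=> q' /andP[q's q'q]; rewrite indicE memNset // => xq'.
  move: qs q's => /mem_cells_upto[Dq _] /mem_cells_upto[Dq' _].
  by move/eqP: q'q; apply; apply: tD => //; exists x.
rewrite [RHS]indicE memNset // big_seq big1 // => q qs; rewrite indicE memNset // => xq.
by apply: nx; exists q.
Qed.

Lemma sum_Int_cells N f : measurable_fun setT f -> (forall x, 0 <= f x) ->
  (\sum_(q <- cells_upto N) Int mu (gcell o L q) f = Int mu (ucells N) f)%E.
Proof.
move=> mf f0; under eq_bigr do rewrite Int_indic.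
rewrite -(@Int_sum _ _ _ mu setT _ (cells_upto N) xpredT) //.
- by rewrite [RHS]Int_indic; apply: Int_eq => x _; rewrite -mulr_sumr sum_indic_cells.
- by move=> q; apply: measurable_funM => //; apply: measurable_indic; exact: measurable_gcell.
- by move=> q x; rewrite mulr_ge0.
Qed.

Lemma sum_mu_cells N : (\sum_(q <- cells_upto N) mu (gcell o L q) = mu (ucells N))%E.
Proof.
have e A : measurable A -> mu A = Int mu A (fun=> 1%R) by move=> mA; rewrite Int_cst // mul1e.
rewrite e; last exact: measurable_ucells.
rewrite -sum_Int_cells //; apply: eq_bigr => q _; rewrite -e //; exact: measurable_gcell.
Qed.

End finite_cells.

(** * The weak type (1,1) estimate on a cube *)

Section weak_type.
Context {R : realType} {n : nat}.
Local Notation X := (Rn R n).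
Variable mu : {measure set X -> \bar R}.
Hypothesis mu_leb : is_lebesgue mu.
Variables (tau : (X -> R) -> X -> R) (k : X -> R) (CT Ck : R).
Hypothesis H : real_czo mu tau k CT Ck.
Implicit Types f g : X -> R.

Lemma mu_near a l : 0 < l -> (mu (near a l) <= (4 ^+ n * l ^+ n)%:E)%E.
Proof.
move=> l0; rewrite -exprMn.
have l4 : 0 <= 4 * l by rewrite mulr_ge0 // ltW.
have sub : near a l `<=` cube (pt (fun i => co a i - 2 * l)) (4 * l).
  move=> x xn; apply/cubeE => i; rewrite co_pt; have := xn i; rewrite ltr_norml => /andP[h1 h2].
  by apply/andP; split; lra.
rewrite -(mu_cube mu_leb (pt (fun i => co a i - 2 * l)) l4); apply: le_measure; rewrite ?inE //.
  exact: measurable_nearR.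
exact: measurable_cube.
Qed.

Lemma mu_bigcup_seq (I : eqType) (s : seq I) (F : I -> set X) :
  (forall i, measurable (F i)) ->
  (mu (\bigcup_(i in [set` s]) F i) <= \sum_(i <- s) mu (F i))%E.
Proof.
move=> mF; elim: s => [|i s IH].
  rewrite big_nil (_ : \bigcup_(_ in _) _ = set0) ?measure0 //.
  by apply/seteqP; split => // x [].
have -> : \bigcup_(j in [set` i :: s]) F j = F i `|` \bigcup_(j in [set` s]) F j.
  apply/seteqP; split => x.
    move=> [j /=]; rewrite inE => /orP[/eqP -> ?|js xj]; [by left|by right; exists j].
  by case=> [xi|[j /= js xj]]; [exists i => //=; rewrite mem_head|exists j => //=; rewrite inE js orbT].
rewrite big_cons; apply: le_trans (measureU2 _ _ _) _ => //; last exact: leeD2l.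
apply: fin_bigcup_measurable => //; exact: finite_seq.
Qed.

Lemma Int_le_mu A s f : measurable A -> measurable_fun setT f -> (forall x, 0 <= f x) -> 0 < s ->
  (mu (A `&` [set x | s < f x]%R) <= (s^-1)%:E * Int mu A f)%E.
Proof.
move=> mA mf f0 s0; rewrite muleC lee_pdivlMr // muleC.
apply: le_trans _ (markov_Int mu mA mf f0 (ltW s0)); apply: lee_wpmul2l; first by rewrite lee_fin ltW.
apply: le_measure; rewrite ?inE.
- by apply: measurableI => //; exact: measurable_gt_set.
- by apply: measurableI => //; rewrite -[X in measurable X]setTI; exact: (measurable_fun_le measurableT).
- by move=> x [Ax /= /ltW].
Qed.

(** The level is split into three parts [lam / 3]. Chebyshev for the good function, which is bounded
    by [(2 ^ n + 2) lam], gives the second term; the neighbourhoods of the stopping cells give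
    [4 ^ n]; the bad functions away from them give [3 * 2 * 2 * 8 ^ n Ck]. The 1 makes the estimate
    trivial for [A <= 1] in [weak_type]. *)
Definition weak_const : R := 1 + 9 * CT * (2 ^+ n + 2) + 4 ^+ n + 12 * 8 ^+ n * Ck.

Lemma weak_const_ge1 : 1 <= weak_const.
Proof.
have := czo_CT H; have := czo_Ck H => h1 h2.
have p2 : 0 < 2 ^+ n :> R by rewrite exprn_gt0.
have p4 : 0 < 4 ^+ n :> R by rewrite exprn_gt0.
have p8 : 0 < 8 ^+ n :> R by rewrite exprn_gt0.
have : 0 <= 9 * CT * (2 ^+ n + 2) by rewrite !mulr_ge0 // addr_ge0 // ltW.
have : 0 <= 12 * 8 ^+ n * Ck by rewrite !mulr_ge0 // ltW.
rewrite /weak_const; lra.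
Qed.

(** Calderon-Zygmund decomposition at height [lam], with bad functions only for the stopping cells
    of code below [N]. The rest of [f] on the stopping cells is kept as a third function [h],
    estimated through the [L^2] bound; its norm tends to 0 with growing [N]. *)
Lemma weak_type_level f a l lam : 0 < l -> L2r mu f -> (forall x, ~ hc a l x -> f x = 0) ->
  0 < lam -> (Int mu (hc a l) (fun x => `|f x|)%R <= (lam * l ^+ n)%:E)%E ->
  (mu (hc a l `&` [set x | lam < `|tau f x|]%R) <=
     (weak_const / lam)%:E * Int mu (hc a l) (fun x => `|f x|)%R)%E.
Proof.
move=> l0 Lf supp lam0 root_le; have [mf _] := Lf.
have CT0 := czo_CT H; have Ck0 := czo_Ck H.
have ma : measurable_fun setT (fun x => `|f x|) by mfun.
have a0 (x : X) : 0 <= `|f x| by [].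
pose P := cz_cells mu a l (fun x => `|f x|) lam.
pose D := minimal_cells a l P.
have tD : trivIset D (gcell a l) by exact: trivIset_minimal.
pose U := \bigcup_(q in D) gcell a l q.
have UE : U = \bigcup_(q in P) gcell a l q by exact: bigcup_minimal.
have mU : measurable U by rewrite UE; exact: measurable_bigcup_cz.
have mR : measurable (hc a l) by exact: measurable_hc.
have UR : U `<=` hc a l by rewrite UE; exact: bigcup_cz_sub.
set IR := Int mu (hc a l) _ in root_le *.
have IRfin : IR \is a fin_num by exact: Int_fin root_le.
have muU : (lam%:E * mu U <= IR)%E by rewrite UE; exact: mu_cz_le.
have Dle q : D q -> (Int mu (gcell a l q) (fun x => `|f x|)%R <=
    (2 ^+ n * lam)%:E * mu (gcell a l q))%E by exact: cz_minimal_le.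
have mg q : measurable (gcell a l q) by exact: measurable_gcell.
have mg1 q : measurable_fun setT (\1_(gcell a l q) : X -> R) by exact: measurable_indic.
have gl0 (q : @cell n) : 0 < glen l q ^+ n by rewrite exprn_gt0 // glen_gt0.
have gfin q : (mu (gcell a l q) < +oo)%E by rewrite (mu_gcell mu_leb) // ltry.
pose m q := Rintegral mu setT (fun x => f x * \1_(gcell a l q) x) / glen l q ^+ n.
have L1 q : L2r mu (fun x => f x * \1_(gcell a l q) x) by exact: L2r_indic.
have Iq q : (Int mu setT (fun x => `|f x * \1_(gcell a l q) x|)%R =
    Int mu (gcell a l q) (fun x => `|f x|)%R)%E.
  by rewrite [RHS]Int_indic; apply: Int_eq => x _; rewrite normrM [X in _ * X]ger0_norm.
have Iqfin q : (Int mu setT (fun x => `|f x * \1_(gcell a l q) x|)%R < +oo)%E.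
  by rewrite Iq; exact: L2r_Int_lty.
have mq q : (`|m q|%:E * mu (gcell a l q) <= Int mu (gcell a l q) (fun x => `|f x|)%R)%E.
  rewrite (mu_gcell mu_leb) // -EFinM /m normrM normfV (ger0_norm (ltW (gl0 q))).
  rewrite divfK ?gt_eqF // -Iq; apply: normr_Rintegral_le => //.
  exact: L2r_measurable (L1 q).
have mqle q : D q -> `|m q| <= 2 ^+ n * lam.
  move=> Dq; have := le_trans (mq q) (Dle q Dq).
  by rewrite (mu_gcell mu_leb) // -!EFinM lee_fin ler_pM2r.
pose b q x := f x * \1_(gcell a l q) x + (- m q) * \1_(gcell a l q) x.
have L1q q : L2r mu (\1_(gcell a l q) : X -> R) by apply: L2r1.
have Lb q : L2r mu (b q) by exact: L2rD.
have bsupp q x : ~ gcell a l q x -> b q x = 0.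
  by move=> nx; rewrite /b indicE memNset // !mulr0 addr0.
have I1q q : (Int mu setT (fun x => `|\1_(gcell a l q) x|)%R < +oo)%E.
  have -> : Int mu setT (fun x => `|\1_(gcell a l q) x|)%R = Int mu (gcell a l q) (fun=> 1%R).
    by rewrite [RHS]Int_indic; apply: Int_eq => x _; rewrite mul1r ger0_norm.
  by rewrite Int_cst // mul1e.
have bmean q : Rintegral mu setT (b q) = 0.
  have i1 := integrable_Int (L2r_measurable (L1 q)) (Iqfin q).
  have i2 := integrable_Int (mg1 q) (I1q q).
  rewrite RintegralD //; last first.
    by apply: integrable_Int; [mfun|under eq_fun do rewrite normrM; rewrite Int_Z ?lte_mul_pinfty //; mfun].
  rewrite RintegralZl //.
  have -> : Rintegral mu setT (\1_(gcell a l q) : X -> R) = glen l q ^+ n.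
    have -> : Rintegral mu setT (\1_(gcell a l q) : X -> R) = Rintegral mu (gcell a l q) (fun=> 1).
      rewrite [RHS]Rintegral_mkcond; apply: eq_Rintegral => x _.
      by rewrite /patch /=; case: (x \in gcell a l q).
    by rewrite Rintegral_cst // mul1r (mu_gcell mu_leb).
  by rewrite /m mulNr divfK ?gt_eqF // subrr.
have Ib q : (Int mu setT (fun x => `|b q x|)%R <= 2%:E * Int mu (gcell a l q) (fun x => `|f x|)%R)%E.
  apply: (@le_trans _ _ (Int mu setT (fun x => `|f x * \1_(gcell a l q) x| + `|m q| * \1_(gcell a l q) x)%R)).
    apply: Int_le => // x _; apply: le_trans (ler_normD _ _) _; rewrite lerD2l normrM normrN.
    by rewrite ler_wpM2l // ger0_norm.
  rewrite Int_D //; side.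
  rewrite Iq (_ : 2%:E = 1 + 1)%E // ge0_muleDl // mul1e leeD2l //.
  apply: le_trans _ (mq q); rewrite -Int_cst // [leRHS]Int_indic; exact: Int_le.
have near_meas q : measurable (near (gcorner a l q) (glen l q)) by exact: measurable_nearR.
pose c : R := 2 ^+ n + 2.
have c0 : 0 < c by rewrite addr_gt0 // exprn_gt0.
have main N : (mu (hc a l `&` [set x | lam < `|tau f x|]%R) <= (weak_const / lam)%:E * IR +
    (9 * CT / lam ^+ 2)%:E * Int mu (U `\` ucells a l D N) (fun x => f x ^+ 2)%R)%E.
  set s := cells_upto D N; set UN := ucells a l D N.
  have mUN : measurable UN by exact: measurable_ucells.
  have UNU : UN `<=` U by exact: ucells_sub.
  pose h x := f x * \1_(U `\` UN) x.
  pose g1 x := f x * \1_(hc a l `\` U) x.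
  pose g2 x := \sum_(q <- s) m q * \1_(gcell a l q) x.
  pose g x := g1 x + 1 * g2 x.
  pose B x := \sum_(q <- s) b q x.
  have Lh : L2r mu h by apply: L2r_indic => //; exact: measurableD.
  have Lg1 : L2r mu g1 by apply: L2r_indic => //; exact: measurableD.
  have Lg2 : L2r mu g2.
    apply: L2r_sum => q; have := L2rD (m q) (@L2r0 _ _ _ mu) (L1q q).
    by under eq_fun do rewrite add0r.
  have Lg : L2r mu g by exact: L2rD.
  have LB : L2r mu B by exact: L2r_sum.
  have fE : f = (fun x => (g x + 1 * B x) + 1 * h x).
    apply/funext => x; rewrite /g /B /b big_split /= /g2 !mul1r.
    rewrite -mulr_sumr sum_indic_cells // -/UN.
    have -> : \sum_(q <- s) - m q * \1_(gcell a l q) x = - \sum_(q <- s) m q * \1_(gcell a l q) x.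
      by rewrite -sumrN; apply: eq_bigr => q _; rewrite mulNr.
    rewrite /g1 /h !indicE.
    case: (pselect (hc a l x)) => xR; last first.
      by rewrite (supp x xR) !mul0r; ring.
    case: (pselect (U x)) => xU; last first.
      rewrite (@mem_set _ (hc a l `\` U)) // (@memNset _ UN) ?(@memNset _ (U `\` UN)) /=; [ring|by case|by move=> /UNU].
    rewrite (@memNset _ (hc a l `\` U)); last by case.
    case: (pselect (UN x)) => xN.
      by rewrite (@mem_set _ UN) // (@memNset _ (U `\` UN)) /=; [ring|case].
    by rewrite (@memNset _ UN) // (@mem_set _ (U `\` UN)) //=; ring.
  have mtg := czo_meas H Lg; have mtB := czo_meas H LB; have mth := czo_meas H Lh.
  have mtf := czo_meas H Lf.
  have [Z [mZ Z0 HZ]] : exists Z, [/\ measurable Z, mu Z = 0%E & forall x, ~ Z x ->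
      tau f x = tau g x + \sum_(q <- s) tau (b q) x + tau h x].
    apply: ae_null.
    have l1 := czo_lin H 1 Lg LB; have l2 := czo_lin H 1 (L2rD 1 Lg LB) Lh.
    have l3 := tau_sum H s Lb.
    move: l1 l2 l3; rewrite -fE; apply: filterS3 => x e1 e2 e3.
    by rewrite e2 e1 e3 !mul1r.
  pose l3 := lam / 3; have l30 : 0 < l3 by rewrite divr_gt0.
  pose Nr := \bigcup_(q in [set` s]) near (gcorner a l q) (glen l q).
  have mNr : measurable Nr by apply: measurable_bigcup_cell.
  pose S x := \sum_(q <- s) `|tau (b q) x|.
  have mS : measurable_fun setT S.
    by apply: measurable_sum => q; have := czo_meas H (Lb q) => ?; mfun.
  have S0 x : 0 <= S x by apply: sumr_ge0.
  pose A1 := hc a l `&` [set x | l3 < `|tau g x|]%R.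
  pose A3 := (hc a l `\` Nr) `&` [set x | l3 < S x]%R.
  pose A4 := hc a l `&` [set x | l3 < `|tau h x|]%R.
  have mA1 : measurable A1 by apply: measurableI => //; apply: measurable_gt_set; mfun.
  have mA3 : measurable A3.
    by apply: measurableI; [exact: measurableD|exact: measurable_gt_set].
  have mA4 : measurable A4 by apply: measurableI => //; apply: measurable_gt_set; mfun.
  have sub : hc a l `&` [set x | lam < `|tau f x|]%R `<=` (((Z `|` A1) `|` Nr) `|` A3) `|` A4.
    move=> x [xR /= hx]; case: (pselect (Z x)) => xZ; first by do 4 left.
    case: (pselect (Nr x)) => xN; first by left; left; right.
    case: (ltP l3 `|tau g x|) => h1; first by left; left; left; right.
    case: (ltP l3 (S x)) => h2; first by left; right.
    case: (ltP l3 `|tau h x|) => h3; first by right.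
    exfalso; move: hx; rewrite (HZ x xZ); apply/negP; rewrite -leNgt.
    apply: le_trans (ler_normD _ _) _.
    have := ler_normD (tau g x) (\sum_(q <- s) tau (b q) x).
    have : `|\sum_(q <- s) tau (b q) x| <= S x by exact: ler_norm_sum.
    by rewrite /l3 in h1 h2 h3 *; lra.
  have mtot : measurable (hc a l `&` [set x | lam < `|tau f x|]%R).
    by apply: measurableI => //; apply: measurable_gt_set; mfun.
  have b1 : (mu A1 <= (9 * CT * c / lam)%:E * IR)%E.
    have cheb := L2r_chebyshev mu mR mtg l30.
    pose G (x : X) : R := `|f x| * \1_(hc a l `\` U) x + \sum_(q <- s) `|m q| * \1_(gcell a l q) x.
    have mG2 : measurable_fun setT (fun x => \sum_(q <- s) `|m q| * \1_(gcell a l q) x).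
      by apply: measurable_sum => q; mfun.
    have mRU : measurable_fun setT (\1_(hc a l `\` U) : X -> R) by apply: measurable_indic; exact: measurableD.
    have G20 x : 0 <= \sum_(q <- s) `|m q| * \1_(gcell a l q) x.
      by apply: sumr_ge0 => q _; rewrite mulr_ge0.
    have G0 x : 0 <= G x by rewrite addr_ge0 // mulr_ge0.
    have mG : measurable_fun setT G by apply: measurable_funD => //; mfun.
    have gG x : `|g x| <= G x.
      rewrite /g mul1r; apply: le_trans (ler_normD _ _) _; apply: lerD.
        by rewrite normrM [X in _ * X]ger0_norm.
      apply: le_trans (ler_norm_sum _ _ _) _; apply: ler_sum => q _.
      by rewrite normrM [X in _ * X]ger0_norm.
    have IG : (Int mu setT G <= IR)%E.
      rewrite Int_D //; side.
      rewrite -Int_indic (@Int_sum _ _ _ mu setT _ s xpredT); [|by []|by move=> q; mfun|by move=> q x; rewrite mulr_ge0].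
      have -> : IR = (Int mu (hc a l `\` U) (fun x => `|f x|)%R + Int mu U (fun x => `|f x|)%R)%E.
        rewrite /IR -[X in Int mu X _ = _](setDUK UR) setUC Int_setU //.
          exact: measurableD.
        by rewrite setDE -setIA setICl setI0.
      rewrite leeD2l //; apply: (@le_trans _ _ (\sum_(q <- s) Int mu (gcell a l q) (fun x => `|f x|)%R)%E).
        apply: lee_sum => q _; apply: le_trans _ (mq q).
        by rewrite -Int_cst // [leRHS]Int_indic; exact: Int_le.
      by rewrite sum_Int_cells //; exact: Int_subset.
    (* The good function is at most [c * lam] almost everywhere, and its integral is at most that of
       [|f|]. *)
    have Ig2 : (Int mu setT (fun x => g x ^+ 2)%R <= (c * lam)%:E * IR)%E.
      apply: (@le_trans _ _ (Int mu setT (fun x => (c * lam) * G x)%R)).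
        apply: Int_ae_le => //.
        - by have [? _] := Lg; mfun.
        - by mfun.
        - by move=> x; exact: sqr_ge0.
        - by move=> x; rewrite mulr_ge0 // mulr_ge0 // ltW.
        have := cz_ae_le mu_leb a l0 ma a0 lam0; rewrite -UE; apply: filterS => x Hx _.
        rewrite -(real_normK (num_real (g x))) expr2; apply: ler_pM => //.
        rewrite /g mul1r; apply: le_trans (ler_normD _ _) _.
        have g1le : `|g1 x| <= 2 * lam.
          rewrite /g1 indicE; case: (boolP (x \in _)) => hx; last by rewrite mulr0 normr0 mulr_ge0 // ltW.
          by move: hx; rewrite inE mulr1 => -[h1 h2]; exact: Hx.
        have g2le : `|g2 x| <= 2 ^+ n * lam.
          apply: le_trans (ler_norm_sum _ _ _) _.
          apply: (@le_trans _ _ (\sum_(q <- s) (2 ^+ n * lam) * \1_(gcell a l q) x)).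
            rewrite big_seq [leRHS]big_seq; apply: ler_sum => q /mem_cells_upto[Dq _].
            by rewrite normrM [X in _ * X]ger0_norm // ler_wpM2r // mqle.
          rewrite -mulr_sumr sum_indic_cells //; apply: ler_piMr.
            by rewrite mulr_ge0 ?exprn_ge0 // ltW.
          by rewrite indicE; case: (x \in _).
        by rewrite /c; lra.
      rewrite Int_Z //; last by rewrite mulr_ge0 // ltW.
      by apply: lee_wpmul2l => //; rewrite lee_fin mulr_ge0 // ltW.
    have := le_trans cheb (le_trans (czo_bdd H Lg) (lee_wpmul2l _ Ig2)).
    rewrite lee_fin => /(_ CT0) h1.
    rewrite -(@lee_pmul2l _ (l3 ^+ 2)%:E) //; last by rewrite lte_fin exprn_gt0.
    apply: le_trans h1 _; rewrite !muleA -!EFinM; apply: lee_wpmul2r; first exact: Int_ge0.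
    by rewrite lee_fin; apply: eq_ler; rewrite /l3; field; rewrite gt_eqF.
  have b2 : (mu Nr <= (4 ^+ n / lam)%:E * IR)%E.
    apply: le_trans (mu_bigcup_seq _ _) _ => //.
    apply: (@le_trans _ _ (\sum_(q <- s) (4 ^+ n)%:E * mu (gcell a l q))%E).
      apply: lee_sum => q _; apply: le_trans (mu_near _ _) _; first exact: glen_gt0.
      by rewrite (mu_gcell mu_leb) // -EFinM.
    rewrite -ge0_sume_distrr // sum_mu_cells // EFinM -muleA.
    apply: lee_wpmul2l; first by rewrite lee_fin exprn_ge0.
    rewrite muleC lee_pdivlMr // muleC; apply: le_trans _ muU.
    apply: lee_wpmul2l; first by rewrite lee_fin ltW.
    by apply: le_measure; rewrite ?inE.
  have b3 : (mu A3 <= (12 * 8 ^+ n * Ck / lam)%:E * IR)%E.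
    have mRN : measurable (hc a l `\` Nr) by exact: measurableD.
    apply: le_trans (Int_le_mu mRN mS S0 l30) _.
    have mtb q : measurable_fun setT (fun x => `|tau (b q) x|).
      by have := czo_meas H (Lb q) => ?; mfun.
    rewrite (@Int_sum _ _ _ mu _ _ s xpredT) //.
    apply: (@le_trans _ _ (l3^-1%:E * \sum_(q <- s) ((4 * 8 ^+ n * Ck)%:E * Int mu (gcell a l q) (fun x => `|f x|)%R)))%E.
      apply: lee_wpmul2l; first by rewrite lee_fin invr_ge0 ltW.
      rewrite big_seq [leRHS]big_seq; apply: lee_sum => q qs.
      apply: (@le_trans _ _ (Int mu (far (gcorner a l q) (glen l q)) (fun x => `|tau (b q) x|)%R)).
        apply: Int_subset => // x [xR nx]; rewrite farE => xn; apply: nx; by exists q.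
      have q0 := glen_gt0 l0 q.
      apply: le_trans (Int_far_le mu_leb H q0 (Lb q) (@bsupp q) (bmean q)) _.
      apply: le_trans (lee_wpmul2l _ (Ib q)) _; first by rewrite lee_fin !mulr_ge0 // exprn_ge0.
      by rewrite muleA -EFinM; apply: lee_wpmul2r; [exact: Int_ge0|rewrite lee_fin; apply: eq_ler; ring].
    rewrite -ge0_sume_distrr; last by move=> q _; exact: Int_ge0.
    rewrite sum_Int_cells // muleA -EFinM.
    apply: (@le_trans _ _ ((l3^-1 * (4 * 8 ^+ n * Ck))%:E * IR)%E).
      apply: lee_wpmul2l; first by rewrite lee_fin !mulr_ge0 ?invr_ge0 ?exprn_ge0 // ltW.
      by apply: Int_subset => //; exact: subset_trans UR.
    apply: lee_wpmul2r; first exact: Int_ge0.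
    by rewrite lee_fin; apply: eq_ler; rewrite /l3; field; rewrite gt_eqF.
  have b4 : (mu A4 <= (9 * CT / lam ^+ 2)%:E * Int mu (U `\` UN) (fun x => f x ^+ 2)%R)%E.
    have := le_trans (L2r_chebyshev mu mR mth l30) (czo_bdd H Lh).
    have -> : Int mu setT (fun x => h x ^+ 2)%R = Int mu (U `\` UN) (fun x => f x ^+ 2)%R.
      rewrite [RHS]Int_indic; apply: Int_eq => x _; rewrite /h exprMn indicE.
      by case: (x \in _); rewrite ?expr1n ?expr0n.
    move=> h1; rewrite -(@lee_pmul2l _ (l3 ^+ 2)%:E) //; last by rewrite lte_fin exprn_gt0.
    apply: le_trans h1 _; rewrite muleA -EFinM; apply: lee_wpmul2r.
      by apply: Int_ge0 => x; exact: sqr_ge0.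
    by rewrite lee_fin; apply: eq_ler; rewrite /l3; field; rewrite gt_eqF.
  apply: (@le_trans _ _ (mu ((((Z `|` A1) `|` Nr) `|` A3) `|` A4))).
    by apply: le_measure; rewrite ?inE //; do 4 (apply: measurableU => //).
  apply: le_trans (measureU2 _ _ _) _ => //; first by do 3 (apply: measurableU => //).
  apply: leeD => //.
  apply: (@le_trans _ _ (0 + (9 * CT * c / lam)%:E * IR + (4 ^+ n / lam)%:E * IR + (12 * 8 ^+ n * Ck / lam)%:E * IR)%E).
    apply: le_trans (measureU2 _ _ _) _ => //; first by do 2 (apply: measurableU => //).
    apply: leeD => //.
    apply: le_trans (measureU2 _ _ _) _ => //; first by apply: measurableU.
    apply: leeD => //.
    apply: le_trans (measureU2 _ _ _) _ => //.
    by apply: leeD => //; rewrite -Z0.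
  rewrite add0e -!ge0_muleDl ?lee_fin ?addr_ge0 ?divr_ge0 ?mulr_ge0 ?exprn_ge0 ?(ltW lam0) ?(ltW c0) //.
  rewrite -!EFinD; apply: lee_wpmul2r; first exact: Int_ge0.
  rewrite lee_fin -!mulrDl ler_pM2r ?invr_gt0 // /weak_const -/c; lra.
apply/lee_addgt0Pr => e e0.
have mf2 : measurable_fun setT (fun x => f x ^+ 2)%R by mfun.
have K0 : 0 <= 9 * CT / lam ^+ 2 by rewrite !mulr_ge0 ?invr_ge0 ?exprn_ge0 // ltW.
have fU : (Int mu (\bigcup_N ucells a l D N) (fun x => f x ^+ 2)%R < +oo)%E.
  have [_ fin] := Lf; apply: le_lt_trans fin; apply: Int_subset => // x; exact: sqr_ge0.
have e1 : 0 < e / (9 * CT / lam ^+ 2 + 1) by rewrite divr_gt0 //; lra.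
have [N] := Int_tail (measurable_ucells a l D) (@ucellsS _ _ a l D) mf2 (fun x => sqr_ge0 _) fU e1.
rewrite bigcup_ucells => HN; apply: le_trans (main N) _; rewrite leeD2l //.
apply: le_trans (lee_wpmul2l _ HN) _; first by rewrite lee_fin.
rewrite -EFinM lee_fin mulrA ler_pdivrMr; last by lra.
by rewrite mulrC ler_pM2l //; lra.
Qed.

(** For [A <= 1] the right side is at least the measure of the cube, as [weak_const >= 1]; if the
    average is 0 then [f] is null. Otherwise this is [weak_type_level] at [A] times the average. *)
Lemma weak_type f a l A : 0 < l -> L2r mu f -> (forall x, ~ hc a l x -> f x = 0) -> 0 < A ->
  (mu (hc a l `&` [set x | A * (fine (Int mu (hc a l) (fun x => `|f x|)%R) / l ^+ n) < `|tau f x|]%R) <=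
     (weak_const / A * l ^+ n)%:E)%E.
Proof.
move=> l0 Lf supp A0; have [mf _] := Lf.
have mR : measurable (hc a l) by exact: measurable_hc.
have muR : mu (hc a l) = (l ^+ n)%:E by exact: mu_hc.
have ln0 : 0 < l ^+ n by rewrite exprn_gt0.
have W1 := weak_const_ge1.
have ma : measurable_fun setT (fun x => `|f x|) by mfun.
have mtf : measurable_fun setT (fun x => `|tau f x|) by have := czo_meas H Lf => ?; mfun.
have fin : Int mu (hc a l) (fun x => `|f x|)%R \is a fin_num.
  by rewrite ge0_fin_numE ?Int_ge0 //; apply: L2r_Int_lty => //; rewrite muR ltry.
set av := fine _ / _.
have av0 : 0 <= av by rewrite divr_ge0 ?fine_ge0 ?Int_ge0 // ltW.
have avE : Int mu (hc a l) (fun x => `|f x|)%R = (av * l ^+ n)%:E.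
  by rewrite /av divfK ?gt_eqF // fineK.
case: (leP A 1) => A1.
  apply: (@le_trans _ _ (l ^+ n)%:E).
    by rewrite -muR; apply: le_measure; rewrite ?inE //; apply: measurableI => //; exact: measurable_gt_set.
  rewrite lee_fin ler_peMl ?(ltW ln0) // ler_pdivlMr // mul1r; lra.
move: av0; rewrite le_eqVlt => /orP[/eqP av0|av0].
  have f0 : {ae mu, forall x, f x = 0}.
    have I0 : Int mu (hc a l) (fun x => `|f x|)%R = 0%E by rewrite avE -av0 mul0r.
    have := Int0_ae mR ma (fun x => normr_ge0 _) I0.
    apply: filterS => x Hx; case: (pselect (hc a l x)) => [/Hx/eqP|]; last exact: supp.
    by rewrite normr_eq0 => /eqP.
  have := tau0 H mf f0 => /ae_null[Z [mZ Z0 HZ]].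
  apply: (@le_trans _ _ (mu Z)); last by rewrite Z0 lee_fin mulr_ge0 ?divr_ge0 // ?ltW //; lra.
  apply: le_measure; rewrite ?inE //; first by apply: measurableI => //; exact: measurable_gt_set.
  move=> x [_ /=]; rewrite -av0 mulr0 normr_gt0 => h; apply: contrapT => nz.
  by move: h; rewrite (HZ x nz) eqxx.
have lam0 : 0 < A * av by rewrite mulr_gt0.
have root_le : (Int mu (hc a l) (fun x => `|f x|)%R <= (A * av * l ^+ n)%:E)%E.
  by rewrite avE lee_fin ler_pM2r // ler_peMl // ltW.
apply: le_trans (weak_type_level l0 Lf supp lam0 root_le) _.
rewrite avE -EFinM lee_fin; apply: eq_ler; field.
by rewrite !gt_eqF.
Qed.

End weak_type.

(** * Commutators and sparse domination *)

Section commutator_algebra.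
Context {R : realType} {n : nat}.
Local Notation X := (Rn R n).
Variable mu : {measure set X -> \bar R}.
Variables (tau : (X -> R) -> X -> R) (k : X -> R) (CT Ck : R).
Hypothesis H : real_czo mu tau k CT Ck.
Variables (b : X -> R) (m : nat).
Hypothesis mb : measurable_fun setT b.
Implicit Types f g : X -> R.

(** Products of such a function with polynomials in [b] of degree at most [m] lie in [L^2], so the
    operator applies to every term of the expanded commutator. All centres [c] occur because the
    expansion is recentred on each cell. *)
Definition admissible g := measurable_fun setT g /\
  forall c, L2r mu (fun y => (1 + `|b y - c|) ^+ m * g y).

Lemma admissible_indic g A : measurable A -> admissible g ->
  admissible (fun y => g y * \1_A y).
Proof.
move=> mA [mg Lg]; split; first by apply: measurable_funM => //; exact: measurable_indic.
by move=> c; under eq_fun do rewrite mulrA; apply: L2r_indic.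
Qed.

Lemma pow_le_1Dpow (t : R) j : (j <= m)%N -> `|t| ^+ j <= (1 + `|t|) ^+ m.
Proof.
move=> jm; apply: (@le_trans _ _ ((1 + `|t|) ^+ j)).
  by rewrite lerXn2r ?nnegrE ?addr_ge0 // lerDr.
by rewrite ler_weXn2l // lerDl.
Qed.

Lemma L2r_pow g c j : (j <= m)%N -> admissible g -> L2r mu (fun y => (b y - c) ^+ j * g y).
Proof.
move=> jm [mg Lg]; apply: (L2r_le ler01 _ (Lg c)); first by mfun.
apply: aeW => y; rewrite mul1r !normrM ler_wpM2r // !normrX.
have p0 : 0 <= 1 + `|b y - c| by rewrite addr_ge0.
by rewrite (ger0_norm p0); exact: pow_le_1Dpow.
Qed.

(* The commutator of a real operator, as the binomial expansion of [(b x - b) ^ m]. *)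
Definition com0 g x : R := \sum_(i < m.+1) (((b x)%:P - 'X) ^+ m)`_i * tau (fun y => b y ^+ i * g y) x.

Definition comc c g x : R := \sum_(j < m.+1)
  ((-1) ^+ j * (b x - c) ^+ (m - j) * tau (fun y => (b y - c) ^+ j * g y) x) *+ 'C(m, j).

Lemma tau_scale f a : L2r mu f -> {ae mu, forall x, tau (fun y => a * f y) x = a * tau f x}.
Proof.
move=> Lf; have := czo_lin H a (@L2r0 _ _ _ mu) Lf.
have : {ae mu, forall x, tau (fun=> 0) x = 0} by apply: (tau0 H) => //; exact: aeW.
apply: filterS2 => x -> e; rewrite add0r in e; rewrite -e; congr (tau _ x).
by apply/funext => y; rewrite add0r.
Qed.

Lemma tau_lincomb (I : finType) (a : I -> R) (f : I -> X -> R) : (forall i, L2r mu (f i)) ->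
  {ae mu, forall x, tau (fun y => \sum_i a i * f i y) x = \sum_i a i * tau (f i) x}.
Proof.
move=> Lf; have Lf' i : L2r mu (fun y => a i * f i y).
  have := L2rD (a i) (@L2r0 _ _ _ mu) (Lf i).
  by under eq_fun do rewrite add0r.
have h1 := tau_sum H (index_enum I) Lf'.
have h2 : {ae mu, forall x, forall i, tau (fun y => a i * f i y) x = a i * tau (f i) x}.
  have [Z HZ] := @choice _ _ (fun i Z => [/\ measurable Z, mu Z = 0%E &
    forall x, ~ Z x -> tau (fun y => a i * f i y) x = a i * tau (f i) x])
    (fun i => ae_null (tau_scale (a i) (Lf i))).
  pose U := \bigcup_(i in [set` index_enum I]) Z i.
  have mU : measurable U.
    by apply: fin_bigcup_measurable => [|i _]; [exact: finite_seq|have [] := HZ i].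
  apply: (@null_ae _ _ _ _ _ U) => //.
    apply/eqP; rewrite eq_le measure_ge0 andbT; apply: le_trans (mu_bigcup_seq _ _ _) _.
      by move=> i; have [] := HZ i.
    by rewrite big1 // => i _; have [] := HZ i.
  move=> x nU i; have [_ _] := HZ i; apply => zx; apply: nU; exists i => //=.
  exact: mem_index_enum.
by move: h1 h2; apply: filterS2 => x -> e; apply: eq_bigr => i _; rewrite e.
Qed.

Lemma tau_pow_expand g c j : (j <= m)%N -> admissible g ->
  {ae mu, forall x, tau (fun y => (b y - c) ^+ j * g y) x =
    \sum_(i < m.+1) (('X - c%:P) ^+ j)`_i * tau (fun y => b y ^+ i * g y) x}.
Proof.
move=> jm Ag.
have L i : L2r mu (fun y => b y ^+ (i : 'I_m.+1) * g y).
  by have := L2r_pow 0 (ltn_ord i : (i <= m)%N) Ag; under eq_fun do rewrite subr0.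
have := tau_lincomb (fun i : 'I_m.+1 => (('X - c%:P) ^+ j)`_i) L.
apply: filterS => x <-; congr (tau _ x); apply/funext => y.
have -> : (b y - c) ^+ j = (('X - c%:P) ^+ j).[b y] by rewrite !hornerE.
rewrite (@horner_coef_wide _ m.+1); last by rewrite size_exp_XsubC ltnS.
by rewrite mulr_suml; apply: eq_bigr => i _; rewrite mulrA.
Qed.

(** The polynomial identity [(b x - X) ^ m = ((b x - c) - (X - c)) ^ m], carried through [tau] by
    linearity. The commutator does not depend on the centre, which can thus be adapted to each
    cell. *)
Lemma com0E g c : admissible g -> {ae mu, forall x, com0 g x = comc c g x}.
Proof.
move=> Ag.
have : {ae mu, forall x, forall j : nat, (j <= m)%N -> tau (fun y => (b y - c) ^+ j * g y) x =
    \sum_(i < m.+1) (('X - c%:P) ^+ j)`_i * tau (fun y => b y ^+ i * g y) x}.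
  apply: ae_foralln => j; case: (leqP j m) => jm; last by apply: aeW.
  by have := tau_pow_expand c jm Ag; apply: filterS => x e _.
apply: filterS => x e; rewrite /com0 /comc.
have -> : (b x)%:P - 'X = (b x - c)%:P - ('X - c%:P) :> {poly R} by rewrite polyCB; ring.
rewrite exprBn.
have -> : \sum_(j < m.+1) ((-1) ^+ j * (b x - c) ^+ (m - j) *
      tau (fun y => (b y - c) ^+ j * g y) x) *+ 'C(m, j) =
    \sum_(j < m.+1) \sum_(i < m.+1) ((-1) ^+ j * (b x - c) ^+ (m - j) * (('X - c%:P) ^+ j)`_i *+ 'C(m, j)) *
      tau (fun y => b y ^+ i * g y) x.
  apply: eq_bigr => j _; rewrite e; last by rewrite -ltnS.
  rewrite mulr_sumr -sumrMnl; apply: eq_bigr => i _.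
  by rewrite mulrA mulrnAl.
rewrite exchange_big /=; apply: eq_bigr => i _.
rewrite coef_sum mulr_suml; apply: eq_bigr => j _.
rewrite coefMn -polyC_exp -(@polyCN _ 1) -polyC_exp -polyCM coefCM.
by [].
Qed.

(** The binomial coefficients resum to [(1 + |b x - c|) ^ m]; this is the origin of the factor
    [H_R]. *)
Lemma comc_le g c x B : 0 <= B ->
  (forall j, (j <= m)%N -> `|tau (fun y => (b y - c) ^+ j * g y) x| <= B) ->
  `|comc c g x| <= B * (1 + `|b x - c|) ^+ m.
Proof.
move=> B0 h; rewrite /comc (addrC 1) exprDn mulr_sumr.
apply: le_trans (ler_norm_sum _ _ _) _; apply: ler_sum => j _.
rewrite normrMn expr1n mulr1 mulrnAr ler_wMn2r //.
rewrite !normrM normrX normrN1 expr1n mul1r normrX mulrC.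
by rewrite ler_wpM2r ?exprn_ge0 // h // -ltnS.
Qed.

Lemma comcD c f g : admissible f -> admissible g ->
  {ae mu, forall x, comc c (fun y => f y + g y) x = comc c f x + comc c g x}.
Proof.
move=> Af Ag.
have : {ae mu, forall x, forall j : nat, (j <= m)%N -> tau (fun y => (b y - c) ^+ j * (f y + g y)) x =
    tau (fun y => (b y - c) ^+ j * f y) x + tau (fun y => (b y - c) ^+ j * g y) x}.
  apply: ae_foralln => j; case: (leqP j m) => jm; last by apply: aeW.
  have := czo_lin H 1 (L2r_pow c jm Af) (L2r_pow c jm Ag); apply: filterS => x e _.
  rewrite mul1r in e; rewrite -e; congr (tau _ x); apply/funext => y; ring.
apply: filterS => x e; rewrite /comc -big_split /=; apply: eq_bigr => j _.
by rewrite e ?mulrDr ?mulrnDl // -ltnS.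
Qed.

End commutator_algebra.

(** * Oscillation of the operator on a cube when the function vanishes on its triple *)

Section oscillation.
Context {R : realType} {n : nat}.
Local Notation X := (Rn R n).
Variable mu : {measure set X -> \bar R}.
Hypothesis mu_leb : is_lebesgue mu.
Variables (tau : (X -> R) -> X -> R) (k : X -> R) (CT Ck : R).
Hypothesis H : real_czo mu tau k CT Ck.
Implicit Types f g psi : X -> R.

Definition triple (p : X) (l : R) : set X := hc (pt (fun i => co p i - l)) (3 * l).

Lemma tripleE p l x : triple p l x <-> forall i, co p i - l <= co x i < co p i + 2 * l.
Proof.
have e i : co p i - l + 3 * l = co p i + 2 * l by ring.
by split => h i; have := h i; rewrite /= co_pt e.
Qed.

Lemma measurable_triple p l : measurable (triple p l).
Proof. exact: measurable_hc. Qed.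

Lemma far_triple p l x y : hc p l x -> ~ triple p l y -> exists i, l <= `|co (x - y : X) i|.
Proof.
move=> xp ny; apply: contrapT => ne; apply: ny; apply/tripleE => i.
have /andP[h1 h2] := xp i.
have : `|co (x - y : X) i| < l by rewrite ltNge; apply/negP => h; apply: ne; exists i.
by rewrite coB ltr_norml => /andP[h3 h4]; apply/andP; split; lra.
Qed.

(** The kernel formula holds only outside a cube containing the support, so the function is first
    restricted to a set [A] inside a cube disjoint from the given one. Integrability follows from
    the size bound, since a point of the cube and a point off its triple are at distance at least
    [l]. *)
Lemma kernel_diff_le psi a0 l0 p l (A : set X) : 0 < l -> 0 < l0 -> measurable A ->
  L2r mu psi -> (forall x, triple p l x -> psi x = 0) ->
  (forall x, hc p l x -> ~ cube a0 l0 x) -> (forall y, A y -> cube a0 l0 y) ->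
  {ae mu, forall x, hc p l x ->
    tau (fun y => psi y * \1_A y) x = Rintegral mu setT (fun y => k (x - y) * (psi y * \1_A y)) /\
    mu.-integrable setT (EFin \o (fun y => k (x - y) * (psi y * \1_A y)))}.
Proof.
move=> lp l0p mA Lpsi z3 disj sub; have [mpsi _] := Lpsi.
have Lp := L2r_indic mA Lpsi.
have mpA : measurable_fun setT (fun y => psi y * \1_A y) by exact: L2r_measurable Lp.
have supp x : ~ cube a0 l0 x -> psi x * \1_A x = 0.
  by move=> nx; rewrite indicE memNset ?mulr0 // => /sub.
have mc : measurable (cube a0 l0) by exact: measurable_cube.
have fin : (Int mu setT (fun y => `|psi y * \1_A y|)%R < +oo)%E.
  have -> : Int mu setT (fun y => `|psi y * \1_A y|)%R = Int mu (cube a0 l0) (fun y => `|psi y * \1_A y|)%R.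
    rewrite [RHS]Int_indic; apply: Int_eq => x _; rewrite [X in _ = _ * X]indicE.
    by case: (boolP (x \in cube _ _)) => [|/negP]; rewrite ?inE => h; rewrite ?mulr1 // supp // normr0 mul0r.
  apply: L2r_Int_lty => //.
  by have := mu_cube mu_leb a0 (ltW l0p) => /= ->; rewrite ltry.
have := czo_ker H l0p Lp supp; apply: filterS => x Hx xp; split; first by apply: Hx; exact: disj.
have mk' := measurable_kernel H x.
apply: integrable_Int; first by mfun.
apply: (@le_lt_trans _ _ (Int mu setT (fun y => (Ck / l ^+ n) * `|psi y * \1_A y|)%R)).
  apply: Int_le => // y _; rewrite normrM.
  case: (pselect (triple p l y)) => [/z3 ->|yt]; first by rewrite mul0r normr0 !mulr0.
  rewrite ler_wpM2r //; apply: (czo_size H) => //; exact: (far_triple xp).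
have Ckl : 0 <= Ck / l ^+ n by rewrite divr_ge0 ?(czo_Ck H) // exprn_ge0 // ltW.
by rewrite Int_Z // ?lte_mul_pinfty //; mfun.
Qed.

(* The complement of a tripled cube is cut into pieces, each of them contained
   in a cube that does not meet the original cube. *)
Definition side_cond (p : X) (l : R) (s : 'I_n * bool) (y : X) : Prop :=
  if s.2 then co p s.1 + 2 * l <= co y s.1 else co y s.1 <= co p s.1 - l.

Lemma measurable_side p l s : measurable [set y | side_cond p l s y].
Proof.
rewrite /side_cond; case: s => i [] /=.
  rewrite -[X in measurable X]setTI; apply: (measurable_fun_le measurableT) => //; exact: measurable_co.
exact: (measurable_le_set _ (measurable_co i)).
Qed.

(** The sides are taken in the order of [enum_rank] and a point belongs to its first one, so the
    pieces are disjoint and cover the complement of the triple. *)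
Definition piece (p : X) (l : R) (r : nat) : set X :=
  [set y | exists2 s : 'I_n * bool, enum_rank s = r :> nat & side_cond p l s y] `\`
  [set y | exists2 s : 'I_n * bool, (enum_rank s < r)%N & side_cond p l s y].

Hypothesis n_gt0 : (0 < n)%N.

Let N := #|{: 'I_n * bool}|.

Lemma measurable_exists_side p l (P : pred ('I_n * bool)) :
  measurable [set y | exists2 s, P s & side_cond p l s y].
Proof.
have -> : [set y | exists2 s, P s & side_cond p l s y] =
    \bigcup_(s in [set s | P s]) [set y | side_cond p l s y].
  by apply/seteqP; split => y; [move=> [s Ps ys]; exists s|move=> [s /= Ps ys]; exists s].
apply: fin_bigcup_measurable => // s _; exact: measurable_side.
Qed.

Lemma measurable_piece p l r : measurable (piece p l r).
Proof.
apply: measurableD; last exact: measurable_exists_side.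
by have := measurable_exists_side p l (fun s => enum_rank s == r :> nat);
   congr (measurable _); apply/seteqP; split => y [s /eqP ? ?]; exists s => //; apply/eqP.
Qed.

Lemma sum_piece p l y : ~ triple p l y -> \sum_(r <- iota 0 N) \1_(piece p l r) y = 1 :> R.
Proof.
move=> ny.
have [s0 ys0] : exists s, side_cond p l s y.
  apply: contrapT => ne; apply: ny; apply/tripleE => i; apply/andP; split.
    rewrite leNgt; apply/negP => h; apply: ne; exists (i, false); exact: ltW.
  by rewrite ltNge; apply/negP => h; apply: ne; exists (i, true).
have ex : exists r, `[< exists2 s : 'I_n * bool, enum_rank s = r :> nat & side_cond p l s y >].
  by exists (enum_rank s0); apply/asboolP; exists s0.
case: (ex_minnP ex) => r /asboolP[s sr ys] minr.
have yr : piece p l r y.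
  split; first by exists s.
  move=> [s' s'r ys']; suff : (r <= enum_rank s')%N by rewrite leqNgt s'r.
  by apply: minr; apply/asboolP; exists s'.
rewrite (bigD1_seq r) ?iota_uniq //=; last by rewrite mem_iota add0n /= -sr ltn_ord.
rewrite indicE mem_set // big1 ?addr0 // => r' r'r; rewrite indicE memNset // => -[[s' s'r' ys'] nl].
have : (r <= r')%N by apply: minr; apply/asboolP; exists s'.
rewrite leq_eqVlt eq_sym (negbTE r'r) /= => rr'.
by apply: nl; exists s => //; rewrite sr.
Qed.

(** The new cube is the old one moved in direction [i] beyond the given side and enlarged by [D], so
    that it still contains the part of the old cube on that side. If no side has rank [r], the piece
    is empty and any disjoint cube does. *)
Lemma piece_cube p l a0 l0 r : 0 < l -> 0 < l0 -> exists a1 l1, [/\ 0 < l1,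
  forall x, hc p l x -> ~ cube a1 l1 x &
  forall y, piece p l r y -> cube a0 l0 y -> cube a1 l1 y].
Proof.
move=> lp l0p.
case: (pselect (exists s : 'I_n * bool, enum_rank s = r :> nat)); last first.
  move=> ne; exists (pt (fun i => co p i - 2 * l)), l; split => //; last first.
    by move=> y [[s sr _] _]; exfalso; apply: ne; exists s.
  move=> x xp.
  move=> /cubeE/(_ (Ordinal n_gt0)); rewrite co_pt => /andP[_].
  by have /andP[h1 h2] := xp (Ordinal n_gt0); lra.
move=> [[i sg] sr].
pose D := `|co p i - l - co a0 i| + `|co p i + 2 * l - co a0 i|.
have D1 : `|co p i - l - co a0 i| <= D by rewrite lerDl.
have D2 : `|co p i + 2 * l - co a0 i| <= D by rewrite lerDr.
have D0 : 0 <= D by exact: le_trans D1.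
pose f j := if j == i then (if sg then co p i + 2 * l else co p i - l - (l0 + D)) else co a0 j.
exists (pt f), (l0 + D); split; first lra.
  move=> x xp /cubeE/(_ i); rewrite co_pt /f eqxx.
  by have /andP[h1 h2] := xp i; case: sg {f sr} => /andP[]; lra.
move=> y [[s sr' ys] _] /cubeE yc; apply/cubeE => j; rewrite co_pt /f.
have es : s = (i, sg) by apply: enum_rank_inj; apply: val_inj; rewrite /= sr' sr.
have := yc j; case: eqP => [->|_] /andP[h1 h2]; last by apply/andP; split; lra.
move: D1 D2; rewrite !ler_norml => /andP[d1 d2] /andP[d3 d4].
by move: ys; rewrite es /side_cond /=; case: sg {f sr es} => ys; apply/andP; split; lra.
Qed.

(** Both values are kernel integrals after summing over the finitely many pieces. One null set
    serves all pairs, so a single good point can be compared with almost every other one. *)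
Lemma czo_oscillation_le psi a0 l0 p l : 0 < l -> 0 < l0 -> L2r mu psi ->
  (forall x, triple p l x -> psi x = 0) -> (forall x, ~ cube a0 l0 x -> psi x = 0) ->
  exists Z, [/\ measurable Z, mu Z = 0%E & forall x x', hc p l x -> hc p l x' -> ~ Z x -> ~ Z x' ->
    (`|tau psi x - tau psi x'|%:E <=
      Int mu setT (fun y => `|k (x - y) - k (x' - y)| * `|psi y|)%R)%E].
Proof.
move=> lp l0p Lpsi z3 supp; have [mpsi _] := Lpsi.
pose A r := piece p l r `&` cube a0 l0.
have mA r : measurable (A r).
  by apply: measurableI; [exact: measurable_piece|exact: measurable_cube].
have LA r : L2r mu (fun y => psi y * \1_(A r) y) by exact: L2r_indic.
have psiE : psi = (fun y => \sum_(r <- iota 0 N) psi y * \1_(A r) y).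
  apply/funext => y; rewrite -mulr_sumr.
  case: (pselect (triple p l y)) => [/z3 ->|yt]; first by rewrite mul0r.
  case: (pselect (cube a0 l0 y)) => [yc|/supp ->]; last by rewrite mul0r.
  rewrite -[LHS]mulr1 -(sum_piece yt); congr (_ * _); apply: eq_bigr => r _.
  by rewrite /A indicI /= [X in _ = _ * X]indicE mem_set ?mulr1.
have hA : {ae mu, forall x, forall r, hc p l x ->
    tau (fun y => psi y * \1_(A r) y) x = Rintegral mu setT (fun y => k (x - y) * (psi y * \1_(A r) y)) /\
    mu.-integrable setT (EFin \o (fun y => k (x - y) * (psi y * \1_(A r) y)))}.
  apply: ae_foralln => r.
  have [a1 [l1 [l1p disj sub]]] := piece_cube p a0 r lp l0p.
  apply: (kernel_diff_le lp l1p (mA r) Lpsi z3 disj).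
  by move=> y [yp yc]; exact: sub.
have [Z [mZ Z0 HZ]] : exists Z, [/\ measurable Z, mu Z = 0%E & forall x, ~ Z x -> hc p l x ->
    tau psi x = \sum_(r <- iota 0 N) Rintegral mu setT (fun y => k (x - y) * (psi y * \1_(A r) y)) /\
    forall r, mu.-integrable setT (EFin \o (fun y => k (x - y) * (psi y * \1_(A r) y)))].
  apply: ae_null; have := tau_sum H (iota 0 N) LA; rewrite -psiE.
  move: hA; apply: filterS2 => x h -> xp; split; last by move=> r; have [] := h r xp.
  by apply: eq_bigr => r _; have [] := h r xp.
exists Z; split => // x x' xp xp' /HZ/(_ xp)[-> ix] /HZ/(_ xp')[-> ix'].
have mk1 := measurable_kernel H x; have mk2 := measurable_kernel H x'.
have mA1 r : measurable_fun setT (\1_(A r) : X -> R) by exact: measurable_indic.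
rewrite -sumrB.
apply: (@le_trans _ _ (\sum_(r <- iota 0 N) Int mu setT (fun y => `|(k (x - y) - k (x' - y)) * (psi y * \1_(A r) y)|)%R)%E).
  apply: (@le_trans _ _ (\sum_(r <- iota 0 N) `|Rintegral mu setT (fun y => k (x - y) * (psi y * \1_(A r) y)) -
      Rintegral mu setT (fun y => k (x' - y) * (psi y * \1_(A r) y))|%:E)%E).
    by rewrite sumEFin lee_fin; exact: ler_norm_sum.
  apply: lee_sum => r _; rewrite -RintegralB //.
  have -> : (fun y => k (x - y) * (psi y * \1_(A r) y) - k (x' - y) * (psi y * \1_(A r) y)) =
      (fun y : X => (k (x - y) - k (x' - y)) * (psi y * \1_(A r) y)).
    by apply/funext => y; ring.
  have mkk : measurable_fun setT (fun y : X => (k (x - y) - k (x' - y)) * (psi y * \1_(A r) y)).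
    by apply: measurable_funM; [exact: measurable_funB|exact: measurable_funM].
  apply: normr_Rintegral_le => //.
  have /integrableP[_] := integrableB measurableT (ix r) (ix' r).
  congr (_ < _)%E; apply: eq_integral => y _ /=; congr (_%:E); congr (`|_|); ring.
rewrite -(@Int_sum _ _ _ mu setT _ (iota 0 N) xpredT) //; last first.
  move=> r; apply: (measurableT_comp (@normr_measurable _ _)).
  by apply: measurable_funM; [exact: measurable_funB|exact: measurable_funM].
apply: Int_le => [y|y _]; first by apply: sumr_ge0.
rewrite [leLHS](_ : _ = `|k (x - y) - k (x' - y)| * `|psi y| * \sum_(r <- iota 0 N) \1_(A r) y); last first.
  rewrite mulr_sumr; apply: eq_bigr => r _; rewrite !normrM mulrA.
  by rewrite [X in _ * X = _]ger0_norm.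
case: (pselect (triple p l y)) => [/z3 ->|yt]; first by rewrite normr0 !mulr0 mul0r.
rewrite ler_piMr ?mulr_ge0 // -(sum_piece yt); apply: ler_sum => r _.
by rewrite /A indicI /= ler_piMr // indicE; case: (_ \in _).
Qed.

End oscillation.

(** * Tripled cells and translated grids *)

Section shifted_grids.
Context {R : realType} {n : nat}.
Local Notation X := (Rn R n).
Variable mu : {measure set X -> \bar R}.
Hypothesis mu_leb : is_lebesgue mu.
Variables (o : X) (L : R).
Hypothesis L0 : 0 < L.
Hypothesis n_gt0 : (0 < n)%N.

Definition tri (q : @cell n) : set X := triple (gcorner o L q) (glen L q).
Definition shift_origin (s : {ffun 'I_n -> 'I_3}) : X := pt (fun i => co o i + (s i)%:R * L).

Lemma pow2_mod3 (i : nat) : exists t : int, (2 ^+ i = 3 * t + 1 \/ 2 ^+ i = 3 * t + 2 :> int)%R.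
Proof.
elim: i => [|i [t [e|e]]]; first by exists 0; left; rewrite expr0; lia.
  by exists (2 * t); right; rewrite exprS e; lia.
by exists (2 * t + 1); left; rewrite exprS e; lia.
Qed.

(** As [2 ^ i] is 1 or 2 modulo 3, its multiples by 0, 1, 2 represent all residues. The shift of the
    coarse grid by [s L] equals [2 ^ i s] side lengths of the original cells of generation [i]. *)
Lemma residue_shift (i : nat) (j : int) : exists (s : 'I_3) (j' : int),
  (j = 3 * j' + 2 ^+ i * (s : nat)%:Z)%R.
Proof.
have [t et] := pow2_mod3 i.
have [a [r [er [r0 | [r1 | r2]]]]] : exists a r : int, (j = 3 * a + r /\ (r = 0 \/ r = 1 \/ r = 2))%R.
  exists (divz j 3), (modz j 3); split; first by rewrite {1}(divz_eq j 3); lia.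
  have := modz_ge0 j (isT : 3 != 0 :> int); have := ltz_pmod j (isT : 0 < 3 :> int)%R; lia.
- exists (inord 0), a; rewrite inordK // er r0; lia.
- case: et => et.
    by exists (inord 1), (a - t); rewrite inordK // er r1 et; lia.
  by exists (inord 2), (a - 2 * t - 1); rewrite inordK // er r1 et; lia.
- case: et => et.
    by exists (inord 2), (a - 2 * t); rewrite inordK // er r2 et; lia.
  by exists (inord 1), (a - t); rewrite inordK // er r2 et; lia.
Qed.

(* One-third trick: the tripled cells of a dyadic grid are cells of one of
   [3 ^ n] translated dyadic grids. *)
Lemma tri_gcell q : exists s k', tri q = gcell (shift_origin s) (3 * L) (q.1, k').
Proof.
have [s Hs] := @choice _ _ (fun (c : 'I_n) (s : 'I_3) => exists j', q.2 c - 1 = 3 * j' + 2 ^+ q.1 * (s : nat)%:Z)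
  (fun c => residue_shift q.1 (q.2 c - 1)).
have [k' Hk] := @choice _ _ (fun (c : 'I_n) j' => q.2 c - 1 = 3 * j' + 2 ^+ q.1 * (s c : nat)%:Z) Hs.
exists [ffun c => s c], [ffun c => k' c].
rewrite /tri /triple /gcell; congr hc; last by rewrite /glen /=; ring.
apply: co_inj => c; rewrite !co_pt !ffunE /glen /=.
have : (q.2 c)%:~R - 1 = 3 * (k' c)%:~R + 2 ^+ q.1 * (s c)%:R :> R.
  have := Hk c => /(congr1 (fun z : int => z%:~R : R)).
  by rewrite intrB intrD !intrM rmorphXn /= => ->.
move=> e; have -> : (q.2 c)%:~R = 3 * (k' c)%:~R + 2 ^+ q.1 * (s c)%:R + 1 :> R by rewrite -e; ring.
by field; rewrite expf_neq0 // pnatr_eq0.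
Qed.

Lemma gcell_sub_tri q : gcell o L q `<=` tri q.
Proof.
move=> x xq; apply/tripleE => i; have /andP[h1 h2] := xq i; have := glen_gt0 L0 q.
by move=> h; apply/andP; split; lra.
Qed.

Lemma measurable_tri q : measurable (tri q).
Proof. exact: measurable_triple. Qed.

Lemma mu_tri q : mu (tri q) = (3 ^+ n * glen L q ^+ n)%:E.
Proof. by rewrite /tri /triple mu_hc ?exprMn // mulr_gt0 // glen_gt0. Qed.

Lemma gcell_corners q p : gcell o L p `<=` gcell o L q ->
  glen L p <= glen L q /\ forall i, co (gcorner o L q) i <= co (gcorner o L p) i /\
   co (gcorner o L p) i + glen L p <= co (gcorner o L q) i + glen L q.
Proof.
move=> sub; have p0 := glen_gt0 L0 p.
have lo i : co (gcorner o L q) i <= co (gcorner o L p) i.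
  have /(_ i)/andP[] // := sub _ (gcell_corner o L0 p).
have hi i : co (gcorner o L p) i + glen L p <= co (gcorner o L q) i + glen L q.
  rewrite leNgt; apply/negP => h.
  (* The upper corner is not in the half-open cell; this coordinate lies in the small cell but at or
     beyond the upper end of the large one. *)
  pose t := Num.max (co (gcorner o L p) i) (co (gcorner o L q) i + glen L q).
  have : gcell o L p (pt (fun j => if j == i then t else co (gcorner o L p) j)).
    move=> j; rewrite co_pt; case: eqP => [->|_]; last by rewrite lexx ltrDl.
    by rewrite /t le_max lexx /= gt_max ltrDl p0 h.
  move=> /sub/(_ i); rewrite co_pt eqxx => /andP[_].
  by rewrite /t gt_max ltxx andbF.
split; last by move=> i; split.
by have := lo (Ordinal n_gt0); have := hi (Ordinal n_gt0); lra.
Qed.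

Lemma tri_sub q p : gcell o L p `<=` gcell o L q -> tri p `<=` tri q.
Proof.
move=> /gcell_corners[h1 h2] x /tripleE xp; apply/tripleE => i.
have [h3 h4] := h2 i; have /andP[h5 h6] := xp i; apply/andP; split; lra.
Qed.

(** In each translated grid the maximal cells are disjoint, which gives [1 / lam]; the factor
    [3 ^ n] is the number of grids. *)
Lemma tri_weak (h : X -> R) (lam c : R) (P : set cell) : measurable_fun setT h -> (forall x, 0 <= h x) ->
  0 < lam -> (Int mu setT h <= c%:E)%E ->
  (forall p, P p -> lam%:E * mu (tri p) <= Int mu (tri p) h)%E ->
  (mu (\bigcup_(p in P) gcell o L p) <= (3 ^+ n / lam * c)%:E)%E.
Proof.
move=> mh h0 lam0 hc HP.
have L30 : 0 < 3 * L by rewrite mulr_gt0.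
pose Q s := [set q : cell | (lam%:E * mu (gcell (shift_origin s) (3 * L) q) <=
   Int mu (gcell (shift_origin s) (3 * L) q) h)%E].
pose U s := \bigcup_(q in Q s) gcell (shift_origin s) (3 * L) q.
have mU s : measurable (U s) by apply: measurable_bigcup_cell => q; exact: measurable_gcell.
apply: (@le_trans _ _ (mu (\bigcup_(s in [set` enum {: {ffun 'I_n -> 'I_3}}]) U s))).
  apply: le_measure; rewrite ?inE.
  - by apply: measurable_bigcup_cell => q; exact: measurable_gcell.
  - by apply: fin_bigcup_measurable => //; exact: finite_seq.
  - move=> x [p Pp xp]; have [s [k' e]] := tri_gcell p.
    exists s; first by rewrite /= mem_enum.
    exists (p.1, k'); last by rewrite -e; exact: gcell_sub_tri.
    by rewrite /Q /= -e; exact: HP.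
apply: le_trans (mu_bigcup_seq _ _ _) _ => //.
apply: (@le_trans _ _ (\sum_(s <- enum {: {ffun 'I_n -> 'I_3}}) (lam^-1 * c)%:E)%E).
  apply: lee_sum => s _.
  apply: (@le_trans _ _ (Int mu (U s) (fun x => lam^-1 * h x)%R)).
    apply: mu_cells_le => //.
    - by mfun.
    - by move=> x; rewrite mulr_ge0 // invr_ge0 ltW.
    - move=> q hq; rewrite Int_Z ?invr_ge0 ?(ltW lam0) //; last exact: measurable_gcell.
      by rewrite muleC lee_pdivlMr // muleC.
  rewrite Int_Z ?invr_ge0 ?(ltW lam0) // EFinM; apply: lee_wpmul2l.
    by rewrite lee_fin invr_ge0 ltW.
  apply: le_trans _ hc; exact: Int_subset.
rewrite sumEFin lee_fin big_enum /= sumr_const card_ffun !card_ord.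
by rewrite -(mulr_natl (lam^-1 * c)) natrX mulrA.
Qed.

End shifted_grids.

Section kernel_on_cells.
Context {R : realType} {n : nat}.
Local Notation X := (Rn R n).
Variable mu : {measure set X -> \bar R}.
Hypothesis mu_leb : is_lebesgue mu.
Variables (tau : (X -> R) -> X -> R) (k : X -> R) (CT Ck : R).
Hypothesis H : real_czo mu tau k CT Ck.
Variables (o : X) (L : R).
Hypothesis L0 : 0 < L.
Hypothesis n_gt0 : (0 < n)%N.

Let lev (p : @cell n) (z : X) (t : nat) : cell := cellat o L (p.1 - t) z.

(** Split the triple of [q] minus that of [p] into shells between the triples of consecutive
    ancestors of [p]. On shell [t] regularity gives [Ck l / (2 ^ t l) ^ (n + 1)], the hypothesis on
    averages gives [B (6 * 2 ^ t l) ^ n], and the remaining powers [2 ^- t] sum to at most 2. *)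
Lemma kernel_sum_le (h : X -> R) (B : R) (q p : @cell n) (z x x' : X) :
  measurable_fun setT h -> 0 <= B ->
  (q.1 <= p.1)%N -> gcell o L q z -> gcell o L p z -> gcell o L p x -> gcell o L p x' ->
  (forall y, tri o L p y -> h y = 0) -> (forall y, ~ tri o L q y -> h y = 0) ->
  (forall t, (t <= p.1 - q.1)%N ->
    Int mu (tri o L (lev p z t)) (fun y => `|h y|)%R <= (B * (3 * glen L (lev p z t)) ^+ n)%:E)%E ->
  (Int mu setT (fun y => `|k (x - y) - k (x' - y)| * `|h y|)%R <= (2 * 6 ^+ n * Ck * B)%:E)%E.
Proof.
move=> mh B0 qp zq zp xp xp' hp hq HB.
have Ck0 := czo_Ck H.
set N := (p.1 - q.1)%N.
pose l := glen L p; have l0 : 0 < l by exact: glen_gt0.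
have len t : (t <= N)%N -> glen L (lev p z t) = 2 ^+ t * l.
  move=> tN; rewrite /glen /l /glen /lev /=.
  have tp : (t <= p.1)%N by apply: leq_trans tN _; exact: leq_subr.
  have -> : (2 : R) ^+ p.1 = 2 ^+ (p.1 - t) * 2 ^+ t by rewrite -exprD subnK.
  by field; rewrite !expf_neq0 // pnatr_eq0.
have sub t y : gcell o L p y -> gcell o L (lev p z t) y.
  apply: gcell_nested => //; first by rewrite /lev /=; exact: leq_subr.
  by exists z; split => //; exact: gcell_at.
have p0 (t : nat) : 0 < 2 ^+ t * l by rewrite mulr_gt0 // exprn_gt0.
pose c (t : nat) : R := Ck * l / (2 ^+ t * l) ^+ n.+1.
have c0 t : 0 <= c t.
  by rewrite divr_ge0 ?exprn_ge0 // ?mulr_ge0 ?(ltW l0) // ltW.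
have mT t : measurable_fun setT (\1_(tri o L (lev p z t)) : X -> R).
  by apply: measurable_indic; exact: measurable_tri.
apply: (@le_trans _ _ (Int mu setT (fun y => \sum_(t < N) c t * (`|h y| * \1_(tri o L (lev p z t.+1)) y))%R)).
  apply: Int_le => [y|y _]; first by rewrite mulr_ge0.
  have S0 : 0 <= \sum_(t < N) c t * (`|h y| * \1_(tri o L (lev p z t.+1)) y).
    by apply: sumr_ge0 => t _; rewrite mulr_ge0 // mulr_ge0.
  have z0 : h y = 0 -> `|k (x - y) - k (x' - y)| * `|h y| = 0 by move=> ->; rewrite normr0 mulr0.
  case: (pselect (tri o L p y)) => yp; first by rewrite (z0 (hp y yp)).
  case: (pselect (tri o L q y)) => yq; last by rewrite (z0 (hq y yq)).
  have ex : exists t, `[< tri o L (lev p z t) y >].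
    exists N; apply/asboolP; suff -> : lev p z N = q by [].
    by rewrite /lev /N subKn //; apply/esym/gcell_cellat.
  case: (ex_minnP ex) => -[|t] /asboolP yt mint.
    by exfalso; apply: yp; move: yt; rewrite /lev subn0 -(gcell_cellat L0 zp).
  have tN : (t < N)%N.
    apply: mint; apply/asboolP; suff -> : lev p z N = q by [].
    by rewrite /lev /N subKn //; apply/esym/gcell_cellat.
  have nyt : ~ tri o L (lev p z t) y.
    by move=> yt'; have : (t < t)%N by [apply: mint; apply/asboolP]; rewrite ltnn.
  rewrite (bigD1 (Ordinal tN)) //= -[leLHS]addr0 lerD //; last first.
    by apply: sumr_ge0 => s _; rewrite mulr_ge0 // mulr_ge0.
  rewrite indicE mem_set // mulr1 ler_wpM2r //.
  have f1 := far_triple (sub t x xp) nyt; have f2 := far_triple (sub t x' xp') nyt.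
  rewrite len ?(ltnW tN) // in f1 f2.
  apply: (czo_reg H) => //.
    by rewrite l0 /= ler_peMl ?(ltW l0) // exprn_ege1 // ler1n.
  move=> i; rewrite !coB; have /andP[h1 h2] := xp i; have /andP[h3 h4] := xp' i.
  by rewrite ler_norml /l; apply/andP; split; lra.
rewrite (@Int_sum _ _ _ mu setT _ (index_enum _) xpredT) //; last 2 first.
  by move=> t; mfun.
  by move=> t x0; rewrite mulr_ge0 // mulr_ge0.
apply: (@le_trans _ _ (\sum_(t < N) (6 ^+ n * Ck * B * 2^-1 ^+ t)%:E)%E).
  apply: lee_sum => t _; rewrite Int_Z //; side.
  rewrite -Int_indic; apply: le_trans (lee_wpmul2l _ (HB _ (ltn_ord t))) _; first by rewrite lee_fin.
  rewrite -EFinM lee_fin len // /c exprS exprVn.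
  apply: eq_ler.
  rewrite (_ : 3 * (2 ^+ t.+1 * l) = 6 * (2 ^+ t * l)); last by rewrite exprS; ring.
  rewrite [((6 * _) ^+ n)%R]exprMn.
  have e2 : 2 ^+ t * l != 0 by rewrite gt_eqF.
  have e3 : (2 ^+ t * l) ^+ n != 0 by rewrite expf_neq0.
  set w := (2 ^+ t * l) ^+ n in e3 *; set v := 2 ^+ t * l in e2 *.
  have -> : 2 ^- t = l / v :> R by rewrite /v; field; rewrite expf_neq0 ?pnatr_eq0 // gt_eqF.
  by field; rewrite e2 e3.
rewrite sumEFin -mulr_sumr lee_fin -[leRHS](_ : 6 ^+ n * Ck * B * 2 = _); last by ring.
by rewrite ler_wpM2l ?sum_geometric_half // !mulr_ge0 // exprn_ge0.
Qed.

End kernel_on_cells.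

Definition upto (m : nat) : seq nat := iota 0 m.+1.
Lemma mem_upto m j : (j \in upto m) = (j <= m)%N.
Proof. by rewrite mem_iota add0n ltnS. Qed.
Lemma size_upto m : size (upto m) = m.+1. Proof. exact: size_iota. Qed.

(** * One stopping step of the sparse domination *)

Section sparse_step.
Context {R : realType} {n : nat}.
Local Notation X := (Rn R n).
Variable mu : {measure set X -> \bar R}.
Hypothesis mu_leb : is_lebesgue mu.
Hypothesis n_gt0 : (0 < n)%N.
Variables (tau : (X -> R) -> X -> R) (k : X -> R) (CT Ck : R).
Hypothesis H : real_czo mu tau k CT Ck.
Variables (b : X -> R) (m : nat).
Hypothesis mb : measurable_fun setT b.
Variable ctr : X -> R -> R.
Variables (o : X) (L : R).
Hypothesis L0 : 0 < L.
Variable g : X -> R.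
Hypothesis Ag : admissible mu b m g.
Implicit Types (p q : @cell n).

(** The arguments of [ctr] are the corner and the side of the tripled cell, since all averages in
    the domination are over tripled cells. *)
Definition ccell q : R := ctr (pt (fun i => co (gcorner o L q) i - glen L q)) (3 * glen L q).
Definition Hcell q (x : X) : R := (1 + `|b x - ccell q|) ^+ m.
Definition Fcell q : R :=
  fine (Int mu (tri o L q) (fun y => Hcell q y * `|g y|)%R) / (3 * glen L q) ^+ n.

Let mg : measurable_fun setT g. Proof. by case: Ag. Qed.

Let mH q : measurable_fun setT (Hcell q).
Proof. by rewrite /Hcell; mfun. Qed.

Lemma Hcell_ge1 q x : 1 <= Hcell q x.
Proof. by rewrite exprn_ege1 // lerDl. Qed.

Let H0 q x : 0 <= Hcell q x.
Proof. exact: le_trans (Hcell_ge1 q x). Qed.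

Let mtri q : measurable (tri o L q). Proof. exact: measurable_tri. Qed.
Let mcell q : measurable (gcell o L q). Proof. exact: measurable_gcell. Qed.

Let hq q (y : X) : R := Hcell q y * `|g y| * \1_(tri o L q) y.

Let mhq q : measurable_fun setT (hq q).
Proof. by rewrite /hq; have := mH q => ?; mfun; exact: measurable_indic. Qed.

Let hq0 q y : 0 <= hq q y.
Proof. by rewrite /hq mulr_ge0 // mulr_ge0. Qed.

Let l0 q : 0 < glen L q. Proof. exact: glen_gt0. Qed.

Let l3 q : 0 < (3 * glen L q) ^+ n.
Proof. by rewrite exprn_gt0 // mulr_gt0. Qed.

Let tri_lty q : (mu (tri o L q) < +oo)%E.
Proof. by rewrite mu_tri // ltry. Qed.

Lemma Int_hq q : Int mu setT (hq q) = (Fcell q * (3 * glen L q) ^+ n)%:E.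
Proof.
rewrite /Fcell divfK ?gt_eqF // fineK; last first.
  rewrite ge0_fin_numE; last by apply: Int_ge0 => x; rewrite mulr_ge0.
  have [_ LA] := Ag; have := L2r_Int_lty (mtri q) (tri_lty q) (LA (ccell q)).
  by congr (_ < _)%E; apply: Int_eq => x _; rewrite normrM ger0_norm // H0.
by rewrite [RHS]Int_indic.
Qed.

Lemma Fcell_ge0 q : 0 <= Fcell q.
Proof.
by rewrite divr_ge0 ?(ltW (l3 q)) // fine_ge0 // Int_ge0 // => x; rewrite mulr_ge0.
Qed.

Let W := @weak_const R n CT Ck.
Let W1 : 1 <= W. Proof. exact: weak_const_ge1 H. Qed.
(** [2 ^ n th = 1/4], so the exceptional set will fill at most a quarter of a stopping cell. [A1]
    and [A2] make the two exceptional sets of a cell at most [th / 4] of it: [m + 1] counts the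
    powers of [b - c], and [9 ^ n] is the number of grids times the relative volume of a triple.
    [A4] leaves a quarter of a stopping cell for the points where the inner function has a large
    image. *)
Let th : R := 2^-1 ^+ n.+2.
Let th0 : 0 < th. Proof. by rewrite exprn_gt0 // invr_gt0. Qed.
Let A1 : R := m.+1%:R * W * 3 ^+ n * 4 / th.
Let A2 : R := 9 ^+ n * 4 / th.
Let A4 : R := 4 * W * 3 ^+ n.
Definition sparse_const : R := A1 + A4 * A2 + 2 * 6 ^+ n * Ck * A2.

Let A1p : 0 < A1.
Proof. by rewrite divr_gt0 // !mulr_gt0 // ?ltr0n ?exprn_gt0 //; exact: lt_le_trans W1. Qed.
Let A2p : 0 < A2.
Proof. by rewrite divr_gt0 // !mulr_gt0 // ?exprn_gt0. Qed.
Let A4p : 0 < A4.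
Proof. by rewrite !mulr_gt0 // ?exprn_gt0 //; exact: lt_le_trans W1. Qed.

Lemma sparse_const_ge0 : 0 <= sparse_const.
Proof.
have Ck0 := czo_Ck H.
have A10 := ltW A1p; have A20 := ltW A2p; have A40 := ltW A4p.
by rewrite /sparse_const !addr_ge0 // (mulr_ge0 _ A20) // !mulr_ge0 ?exprn_ge0.
Qed.

Definition gloc q (y : X) : R := g y * \1_(tri o L q) y.

Lemma admissible_gloc q : admissible mu b m (gloc q).
Proof. exact: admissible_indic. Qed.

Let gj q j (y : X) : R := (b y - ccell q) ^+ j * gloc q y.

Let Lgj q j : (j <= m)%N -> L2r mu (gj q j).
Proof. by move=> jm; exact: (L2r_pow mb _ jm (admissible_gloc q)). Qed.

Let gj_le q j y : (j <= m)%N -> `|gj q j y| <= hq q y.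
Proof.
move=> jm; rewrite /gj /hq /gloc !normrM normrX mulrA.
rewrite [X in _ * X <= _]ger0_norm // ler_wpM2r // ler_wpM2r //; exact: pow_le_1Dpow.
Qed.

(* The commutator is expanded in powers of [b - c], so the stopping conditions
   involve every function [(b - c) ^ j g]. *)
Let E1 q : set X := \bigcup_(j in [set` upto m])
  (gcell o L q `&` [set x | A1 * Fcell q < `|tau (gj q j) x|]).
Let big q : set (@cell n) := [set p | gcell o L p `<=` gcell o L q /\
  ((A2 * Fcell q)%:E * mu (tri o L p) < Int mu (tri o L p) (hq q))%E].
Let E2 q : set X := \bigcup_(p in big q) gcell o L p.

Let meas_gt q j c : (j <= m)%N -> measurable [set x | c < `|tau (gj q j) x|].
Proof.
by move=> jm; apply: measurable_gt_set; have := czo_meas H (Lgj q jm) => ?; mfun.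
Qed.

Let mE1 q : measurable (E1 q).
Proof.
apply: fin_bigcup_measurable => [|j /=]; first exact: finite_seq.
by rewrite mem_upto => jm; apply: measurableI => //; exact: meas_gt.
Qed.

Let mE2 q : measurable (E2 q).
Proof. exact: measurable_bigcup_cell. Qed.

Let tri_hc q : tri o L q = hc (pt (fun i => co (gcorner o L q) i - glen L q)) (3 * glen L q).
Proof. by []. Qed.

Let l3p q : 0 < 3 * glen L q. Proof. by rewrite mulr_gt0. Qed.

Let weak_tri q f A : L2r mu f -> (forall x, ~ tri o L q x -> f x = 0) -> 0 < A ->
  (mu (tri o L q `&` [set x | A * (fine (Int mu (tri o L q) (fun x => `|f x|)%R) / (3 * glen L q) ^+ n) < `|tau f x|]%R) <=
     (W / A * (3 ^+ n * glen L q ^+ n))%:E)%E.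
Proof.
move=> Lf supp Ap; rewrite tri_hc; apply: le_trans (weak_type mu_leb H (l3p q) Lf supp Ap) _.
by rewrite exprMn.
Qed.

Let mu_E1 q : (mu (E1 q) <= (th / 4)%:E * mu (gcell o L q))%E.
Proof.
pose G j : set X := tri o L q `&` [set x | A1 * Fcell q < `|tau (gj q j) x|].
rewrite (mu_gcell mu_leb o L0) -EFinM.
apply: (@le_trans _ _ (\sum_(j <- upto m) (W / A1 * (3 ^+ n * glen L q ^+ n))%:E)%E); last first.
  rewrite sumEFin lee_fin big_const_seq count_predT size_upto iter_addr_0 -[leLHS]mulr_natl.
  by apply: eq_ler; rewrite /A1; field; rewrite !gt_eqF // ?exprn_gt0 // ?(lt_le_trans _ W1) // addr_gt0 // ltr0n.
have sub : E1 q `<=` \bigcup_(j in [set` upto m]) (G j `&` [set x : X | (j <= m)%N]).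
  move=> x [j /= jm [xq hx]]; exists j => //; split; last by move: jm; rewrite mem_upto.
  by split => //; exact: gcell_sub_tri.
have mG j : measurable (G j `&` [set x : X | (j <= m)%N]).
  case: (leqP j m) => jm; last by rewrite (_ : [set x | _] = set0) ?setI0 //; apply/seteqP; split.
  by apply: measurableI; [apply: measurableI => //; exact: meas_gt|rewrite (_ : [set x | _] = setT) //; apply/seteqP; split].
apply: (@le_trans _ _ (mu (\bigcup_(j in [set` upto m]) (G j `&` [set x : X | (j <= m)%N])))).
  by apply: le_measure; rewrite ?inE //; apply: fin_bigcup_measurable => //; exact: finite_seq.
apply: le_trans (mu_bigcup_seq _ _ _) _ => //.
rewrite big_seq [leRHS]big_seq; apply: lee_sum => j; rewrite mem_upto => jm.
have supp x : ~ tri o L q x -> gj q j x = 0.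
  by move=> nx; rewrite /gj /gloc indicE memNset // !mulr0.
apply: le_trans _ (weak_tri (Lgj q jm) supp A1p).
have mL : measurable_fun setT (gj q j) by exact: L2r_measurable (Lgj q jm).
apply: le_measure; rewrite ?inE //.
  by apply: measurableI => //; exact: meas_gt.
move=> x [[xq /= hx] _]; split => //=; apply: le_lt_trans hx; rewrite ler_pM2l //.
rewrite ler_pdivrMr // -lee_fin -Int_hq fineK.
  by apply: le_trans (Int_subset _ _ (@subsetT _ _)) _ => //; apply: Int_le => // y _; exact: gj_le.
rewrite ge0_fin_numE ?Int_ge0 //.
exact: L2r_Int_lty (mtri q) (tri_lty q) (Lgj q jm).
Qed.

Let mu_E2 q : (mu (E2 q) <= (th / 4)%:E * mu (gcell o L q))%E.
Proof.
have := Fcell_ge0 q; rewrite le_eqVlt => /orP[/eqP F0|F0].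
  have -> : E2 q = set0.
    apply/seteqP; split => // x [p [_ h] _]; move: h; rewrite -F0 mulr0 mul0e.
    have : (Int mu (tri o L p) (hq q) <= Int mu setT (hq q))%E by exact: Int_subset.
    by rewrite Int_hq -F0 mul0r leNgt => /negP.
  by rewrite measure0 mule_ge0 // lee_fin divr_ge0 // ltW.
have lam0 : 0 < A2 * Fcell q by rewrite mulr_gt0.
have hc : (Int mu setT (hq q) <= (Fcell q * (3 * glen L q) ^+ n)%:E)%E by rewrite Int_hq.
have := @tri_weak _ _ mu o L L0 n_gt0 (hq q) _ _ (big q) (mhq q) (hq0 q) lam0 hc.
move=> /(_ (fun p bp => ltW (proj2 bp))) h; apply: le_trans h _.
rewrite (mu_gcell mu_leb o L0) -EFinM lee_fin [((3 * _) ^+ n)%R]exprMn.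
rewrite /A2 (_ : 9 = 3 * 3 :> R); last by ring.
rewrite [((3 * 3) ^+ n)%R]exprMn; apply: eq_ler; field.
by rewrite !gt_eqF // exprn_gt0.
Qed.

Let EE q := E1 q `|` E2 q.

Let mEE q : measurable (EE q). Proof. exact: measurableU. Qed.

Let EEq q : EE q `<=` gcell o L q.
Proof. by move=> x [[j _ []]//|[p [sub _] /sub]]. Qed.

Let mu_EE q : (mu (EE q) <= (th / 2)%:E * mu (gcell o L q))%E.
Proof.
apply: le_trans (measureU2 _ _ _) _ => //.
apply: le_trans (leeD (mu_E1 q) (mu_E2 q)) _.
rewrite -ge0_muleDl ?lee_fin ?divr_ge0 ?(ltW th0) // -EFinD.
by apply: lee_wpmul2r => //; rewrite lee_fin; apply: eq_ler; field.
Qed.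

Let fE q : X -> R := \1_(EE q).
Let mfE q : measurable_fun setT (fE q). Proof. exact: measurable_indic. Qed.
Let fE0 q x : 0 <= fE q x. Proof. by []. Qed.
Let IfE q (A : set X) : measurable A -> Int mu A (fE q) = mu (A `&` EE q).
Proof. by move=> mA; rewrite /Int integral_indic // setIC. Qed.

(** One stops where the exceptional set has density above [th], not at the exceptional set itself:
    by maximality each stopping cell then keeps many points outside that set. *)
Definition stops q : set (@cell n) := minimal_cells o L (cz_cells mu o L (fE q) th).

Section fixed_cell.
Variable q : @cell n.
Hypothesis qroot : gcell o L q `<=` hc o L.

Let root_le : (Int mu (hc o L) (fE q) <= (th * L ^+ n)%:E)%E.
Proof.
rewrite IfE; last exact: measurable_hc.
apply: (@le_trans _ _ (mu (EE q))).
  by apply: le_measure; rewrite ?inE //; apply: measurableI => //; exact: measurable_hc.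
apply: le_trans (mu_EE q) _; rewrite (mu_gcell mu_leb o L0) -EFinM lee_fin.
apply: ler_pM; rewrite ?divr_ge0 ?exprn_ge0 ?(ltW th0) ?(ltW (l0 q)) //.
  by rewrite ler_pdivrMr // ler_peMr ?(ltW th0) //; lra.
by rewrite lerXn2r ?nnegrE ?(ltW (l0 q)) ?(ltW L0) // glen_le.
Qed.

Lemma trivIset_stops : trivIset (stops q) (gcell o L).
Proof. exact: trivIset_minimal. Qed.

(** A stopping cell meets [EE q], and it is strictly smaller than [q] because in any cell containing
    [q] the density of [EE q] is at most [th / 2]. *)
Lemma stops_sub P : stops q P -> gcell o L P `<=` gcell o L q /\ (q.1 < P.1)%N.
Proof.
move=> [[Psub hP] _]; rewrite IfE // in hP.
have ne : gcell o L q `&` gcell o L P !=set0.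
  apply: contrapT => nex; move: hP; rewrite (_ : gcell o L P `&` EE q = set0); last first.
    by apply/seteqP; split => // x [xP xE]; apply: nex; exists x; split => //; exact: EEq.
  by rewrite measure0 ltNge mule_ge0 // lee_fin ltW.
have lt : (q.1 < P.1)%N.
  rewrite ltnNge; apply/negP => Pq.
  have sub : gcell o L q `<=` gcell o L P by apply: gcell_nested => //; rewrite setIC.
  move: hP; rewrite ltNge => /negP; apply.
  apply: (@le_trans _ _ (mu (EE q))).
    by apply: le_measure; rewrite ?inE //; apply: measurableI.
  apply: le_trans (mu_EE q) _; apply: lee_pmul.
  - by rewrite lee_fin divr_ge0 // ltW.
  - exact: measure_ge0.
  - by rewrite lee_fin ler_pdivrMr // ler_peMr ?(ltW th0) //; lra.
  - by apply: le_measure; rewrite ?inE.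
split => //; apply: gcell_nested => //; exact: ltnW.
Qed.

Lemma mu_stops : (mu (\bigcup_(P in stops q) gcell o L P) <= 2^-1%:E * mu (gcell o L q))%E.
Proof.
rewrite /stops bigcup_minimal //.
have := mu_cz_le mu o L0 (mfE q) (fE0 q) th0.
rewrite IfE; last exact: measurable_hc.
move=> h; have {}h : (th%:E * mu (\bigcup_(P in cz_cells mu o L (fE q) th) gcell o L P) <= th%:E * (2^-1%:E * mu (gcell o L q)))%E.
  apply: le_trans h _; rewrite muleA -EFinM.
  apply: le_trans _ (mu_EE q).
  by apply: le_measure; rewrite ?inE //; apply: measurableI => //; exact: measurable_hc.
by rewrite lee_pmul2l // in h.
Qed.

(** The parent of a stopping cell has density at most [th], and [2 ^ n th = 1/4]. *)
Lemma mu_EE_stop P : stops q P -> (mu (gcell o L P `&` EE q) <= 4^-1%:E * mu (gcell o L P))%E.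
Proof.
move=> sP; have := cz_minimal_le mu_leb L0 (fE0 q) root_le sP.
rewrite IfE // => h; apply: le_trans h _; apply: lee_wpmul2r => //.
rewrite lee_fin /th !exprS exprVn; apply: eq_ler; field.
by rewrite expf_neq0 // pnatr_eq0.
Qed.

(** Almost everywhere off the stopping cells the indicator of [EE q] is at most [2 th < 1], hence 0,
    and outside [EE q] every [tau ((b - c) ^ j g)] is at most [A1 * Fcell q]. *)
Lemma com_off_stops : {ae mu, forall x, gcell o L q x ->
  ~ (\bigcup_(P in stops q) gcell o L P) x ->
  `|com0 tau b m (gloc q) x| <= sparse_const * Fcell q * Hcell q x}.
Proof.
have h1 := cz_ae_le mu_leb o L0 (mfE q) (fE0 q) th0.
have h2 := com0E H mb (ccell q) (admissible_gloc q).
move: h1 h2; rewrite /stops bigcup_minimal //; apply: filterS2 => x h1 e xq nx; rewrite e.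
have nE : ~ EE q x.
  move=> xE; have := h1 (qroot xq) nx; rewrite /fE indicE mem_set //= => h.
  have : 2 * th <= 2^-1.
    rewrite /th !exprS (_ : 2 * _ = 2^-1 * 2^-1 ^+ n); last by field.
    by rewrite ler_piMr // exprn_ile1 // invf_le1 // ler1n.
  lra.
apply: comc_le; first by rewrite mulr_ge0 ?Fcell_ge0 ?sparse_const_ge0.
move=> j jm; apply: (@le_trans _ _ (A1 * Fcell q)).
  rewrite leNgt; apply/negP => h; apply: nE; left; exists j => //=.
  by rewrite mem_upto.
rewrite ler_wpM2r ?Fcell_ge0 // /sparse_const -addrA lerDl addr_ge0 //.
  by rewrite mulr_ge0 // ltW.
by apply: mulr_ge0; [rewrite !mulr_ge0 ?exprn_ge0 // (czo_Ck H)|exact: ltW].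
Qed.

(** The difference is the commutator of the part of [g] between the two triples. It is bounded at
    one good point [z] of [P], where the outer and the inner functions have small images. Other
    points differ from [z] by the oscillation, controlled by averages over the ancestors of [P] up
    to [q]; these are not large because [z] is not in [E2 q]. *)
Lemma com_on_stop P : stops q P -> {ae mu, forall x, gcell o L P x ->
  `|com0 tau b m (gloc q) x - com0 tau b m (gloc P) x| <= sparse_const * Fcell q * Hcell q x}.
Proof.
move=> sP; have [Pq lev] := stops_sub sP.
have F0 := Fcell_ge0 q.
have tsub : tri o L P `<=` tri o L q by exact: tri_sub.
pose psi y := g y * \1_(tri o L q `\` tri o L P) y.
have mD : measurable (tri o L q `\` tri o L P) by exact: measurableD.
have Apsi : admissible mu b m psi by exact: admissible_indic.
have glE : gloc q = (fun y => gloc P y + psi y).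
  apply/funext => y; rewrite /gloc /psi -mulrDr; congr (_ * _); rewrite !indicE.
  case: (pselect (tri o L P y)) => yP.
    by rewrite (@mem_set _ (tri o L P)) // (@mem_set _ (tri o L q)) ?(@memNset _ (_ `\` _)) ?addr0 //; [case|exact: tsub].
  rewrite (@memNset _ (tri o L P)) // add0r.
  case: (pselect (tri o L q y)) => yq; first by rewrite !mem_set.
  by rewrite !memNset // => -[].
pose c := ccell q.
pose ps j y := (b y - c) ^+ j * psi y.
have Lps j : (j <= m)%N -> L2r mu (ps j) by move=> jm; exact: (L2r_pow mb _ jm Apsi).
have ps_le j y : (j <= m)%N -> `|ps j y| <= hq q y.
  move=> jm; rewrite /ps /hq /psi !normrM normrX mulrA.
  apply: ler_pM => //.
    by rewrite ler_wpM2r //; exact: pow_le_1Dpow.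
  rewrite ger0_norm // !indicE; case: (boolP (y \in _ `\` _)) => //; rewrite inE => -[h _].
  by rewrite mem_set.
have psP j y : tri o L P y -> ps j y = 0.
  by move=> yP; rewrite /ps /psi indicE memNset ?mulr0 //; case.
have psq j y : ~ tri o L q y -> ps j y = 0.
  by move=> yq; rewrite /ps /psi indicE memNset ?mulr0 // => -[].
have key j : (j <= m)%N -> {ae mu, forall x, gcell o L P x -> `|tau (ps j) x| <= sparse_const * Fcell q}.
  move=> jm.
  pose phi y := (b y - c) ^+ j * gloc P y.
  have Lphi : L2r mu phi by exact: (L2r_pow mb _ jm (admissible_gloc P)).
  have phis y : ~ tri o L P y -> phi y = 0 by move=> ny; rewrite /phi /gloc indicE memNset // !mulr0.
  have split : {ae mu, forall x, tau (gj q j) x = tau phi x + tau (ps j) x}.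
    have := czo_lin H 1 Lphi (Lps j jm).
    have -> : (fun y => phi y + 1 * ps j y) = gj q j.
      by apply/funext => y; rewrite /gj glE /phi /ps -/c; ring.
    by apply: filterS => x ->; rewrite mul1r.
  have qroot3 : forall x, ~ cube (pt (fun i => co (gcorner o L q) i - glen L q)) (3 * glen L q) x -> ps j x = 0.
    by move=> x nx; apply: psq => /hc_cube.
  have [Z [mZ Z0 HZ]] := czo_oscillation_le mu_leb H n_gt0 (l0 P) (l3p q) (Lps j jm) (psP j) qroot3.
  have [Z' [mZ' Z0' HZ']] := ae_null split.
  pose av := fine (Int mu (tri o L P) (fun x => `|phi x|)%R) / (3 * glen L P) ^+ n.
  pose V := tri o L P `&` [set x | A4 * av < `|tau phi x|]%R.
  have mV : measurable V.
    by apply: measurableI => //; apply: measurable_gt_set; have := czo_meas H Lphi => ?; mfun.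
  have mu_V : (mu V <= 4^-1%:E * mu (gcell o L P))%E.
    apply: le_trans (weak_tri Lphi phis A4p) _; rewrite (mu_gcell mu_leb o L0) -EFinM lee_fin.
    by apply: eq_ler; rewrite /A4; field; rewrite !gt_eqF // ?exprn_gt0 //; exact: lt_le_trans W1.
  (* Two sets of relative measure at most 1/4 and two null sets cannot cover the cell. *)
  have [z [zP zE zV zZ zZ']] : exists z, [/\ gcell o L P z, ~ EE q z, ~ V z, ~ Z z & ~ Z' z].
    apply: contrapT => nex.
    have sub : gcell o L P `<=` ((gcell o L P `&` EE q) `|` V) `|` (Z `|` Z').
      move=> z zP; apply: contrapT => nz; apply: nex; exists z; split => // h; apply: nz.
      - by left; left.
      - by left; right.
      - by right; left.
      - by right; right.
    have : (mu (gcell o L P) <= (4^-1%:E * mu (gcell o L P) + 4^-1%:E * mu (gcell o L P)) + (0 + 0))%E.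
      apply: (@le_trans _ _ (mu (((gcell o L P `&` EE q) `|` V) `|` (Z `|` Z')))).
        apply: le_measure; rewrite ?inE //.
        by apply: measurableU; apply: measurableU => //; exact: measurableI.
      have mEV : measurable (gcell o L P `&` EE q `|` V) by apply: measurableU => //; exact: measurableI.
      have mZZ : measurable (Z `|` Z') by exact: measurableU.
      apply: le_trans (measureU2 _ mEV mZZ) _.
      apply: leeD.
        apply: le_trans (measureU2 _ _ _) _ => //; first exact: measurableI.
        by apply: leeD => //; exact: mu_EE_stop.
      apply: le_trans (measureU2 _ _ _) _ => //.
      by apply: leeD; [rewrite -[X in (_ <= X)%E]Z0|rewrite -[X in (_ <= X)%E]Z0'].
    rewrite !adde0 (mu_gcell mu_leb o L0) -!EFinM -EFinD lee_fin.
    have : 0 < glen L P ^+ n by rewrite exprn_gt0.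
    set w := glen L P ^+ n; lra.
  have small p : gcell o L p z -> gcell o L p `<=` gcell o L q ->
      (Int mu (tri o L p) (hq q) <= (A2 * Fcell q)%:E * mu (tri o L p))%E.
    by move=> zp psub; rewrite leNgt; apply/negP => h; apply: zE; right; exists p.
  have smallP := small P zP Pq.
  have avle : av <= A2 * Fcell q.
    rewrite /av ler_pdivrMr // -lee_fin fineK; last first.
      by rewrite ge0_fin_numE ?Int_ge0 //; exact: L2r_Int_lty.
    apply: le_trans _ (le_trans smallP _).
      apply: Int_le => // y yP; rewrite /phi /hq /gloc !normrM normrX mulrA.
      rewrite !indicE (mem_set yP) (mem_set (tsub y yP)) normr1 !mulr1 ler_wpM2r //.
      exact: pow_le_1Dpow.
    by rewrite (mu_tri mu_leb o L0) -EFinM lee_fin [((3 * _) ^+ n)%R]exprMn.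
  have tz : `|tau (ps j) z| <= A1 * Fcell q + A4 * (A2 * Fcell q).
    have e := HZ' z zZ'.
    have -> : tau (ps j) z = tau (gj q j) z - tau phi z by rewrite e; ring.
    apply: le_trans (ler_normB _ _) _; apply: lerD.
      rewrite leNgt; apply/negP => h; apply: zE; left; exists j => /=.
        by rewrite mem_upto.
      by split => //; exact: Pq.
    rewrite leNgt; apply/negP => h; apply: zV; split; first exact: gcell_sub_tri.
    by apply: le_lt_trans h; rewrite /= ler_pM2l.
  apply: (@null_ae _ _ _ _ _ Z) => // x xZ xP.
  have osc := HZ x z xP zP xZ zZ.
  have zq := Pq z zP.
  have B0 : 0 <= A2 * Fcell q by rewrite mulr_ge0 // ltW.
  have HB t : (t <= P.1 - q.1)%N ->
      (Int mu (tri o L (cellat o L (P.1 - t) z)) (fun y => `|ps j y|)%R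
        <= (A2 * Fcell q * (3 * glen L (cellat o L (P.1 - t) z)) ^+ n)%:E)%E.
    move=> tN; set p := cellat o L (P.1 - t) z.
    have zp : gcell o L p z by exact: gcell_at.
    have psub : gcell o L p `<=` gcell o L q.
      apply: (gcell_nested L0); last by exists z.
      by rewrite /p /= leq_subRL ?(leq_trans tN) ?leq_subr // addnC -leq_subRL // ltnW.
    apply: le_trans _ (le_trans (small p zp psub) _).
      by apply: Int_le => // y _; exact: ps_le.
    by rewrite (mu_tri mu_leb o L0) -EFinM lee_fin [((3 * _) ^+ n)%R]exprMn.
  have ks := @kernel_sum_le _ _ mu tau k CT Ck H o L L0 (ps j) (A2 * Fcell q) q P z x z
    (L2r_measurable (Lps j jm)) B0 (ltnW lev) zq zP xP zP (psP j) (psq j) HB.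
  have {}ks := le_trans osc ks; rewrite lee_fin in ks.
  have -> : tau (ps j) x = tau (ps j) z + (tau (ps j) x - tau (ps j) z) by ring.
  apply: le_trans (ler_normD _ _) _; apply: le_trans (lerD tz ks) _.
  by apply: eq_ler; rewrite /sparse_const; ring.
have keyall : {ae mu, forall x, forall j : nat, (j <= m)%N -> gcell o L P x ->
    `|tau (ps j) x| <= sparse_const * Fcell q}.
  apply: ae_foralln => j; case: (leqP j m) => jm; last by apply: aeW.
  by have := key j jm; apply: filterS => x h _.
have e1 := com0E H mb c (admissible_gloc q).
have e2 := com0E H mb c (admissible_gloc P).
have e3 := comcD H mb c (admissible_gloc P) Apsi.
have e4 : {ae mu, forall x, com0 tau b m (gloc q) x - com0 tau b m (gloc P) x = comc tau b m c psi x}.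
  rewrite -glE in e3; move: e1 e2 e3; apply: filterS3 => x -> -> ->; ring.
move: keyall e4; apply: filterS2 => x h -> xP.
apply: comc_le; last by move=> j jm; exact: h.
by rewrite mulr_ge0 ?Fcell_ge0 ?sparse_const_ge0.
Qed.

End fixed_cell.
End sparse_step.

(** * The sparse family generated by the stopping cells *)

Section sparse_family.
Context {R : realType} {n : nat}.
Local Notation X := (Rn R n).
Variable mu : {measure set X -> \bar R}.
Hypothesis mu_leb : is_lebesgue mu.
Variables (o : X) (L : R).
Hypothesis L0 : 0 < L.
Variable st : @cell n -> set (@cell n).
Implicit Types (p q : @cell n).
Hypothesis st_triv : forall q, trivIset (st q) (gcell o L).
Hypothesis st_sub : forall q P, st q P -> gcell o L P `<=` gcell o L q /\ (q.1 < P.1)%N.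
Hypothesis st_mu : forall q,
  (mu (\bigcup_(P in st q) gcell o L P) <= 2^-1%:E * mu (gcell o L q))%E.

Definition root : @cell n := (0%N, [ffun=> 0]).

Fixpoint gen r : set (@cell n) :=
  if r is r'.+1 then \bigcup_(q in gen r') st q else [set root].

Definition sparse_cells : set (@cell n) := \bigcup_r gen r.
(** The disjoint subsets that witness sparseness. *)
Definition spart q : set X := gcell o L q `\` \bigcup_(P in st q) gcell o L P.

Let mcell q : measurable (gcell o L q). Proof. exact: measurable_gcell. Qed.

Lemma gen_sub r q : gen r q -> gcell o L q `<=` hc o L.
Proof.
elim: r q => [|r IH] q /=; first by move=> ->; rewrite /root gcell_root.
by move=> [p gp /st_sub[sub _]]; exact: subset_trans sub (IH p gp).
Qed.

Lemma trivIset_gen r : trivIset (gen r) (gcell o L).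
Proof.
elim: r => [|r IH]; first by move=> p q /= -> ->.
move=> p q [p' gp' sp] [q' gq' sq] [x [xp xq]].
have e : p' = q'.
  by apply: IH => //; exists x; split; [exact: (st_sub sp).1|exact: (st_sub sq).1].
by apply: (st_triv (q := p')) => //; [rewrite e|exists x].
Qed.

Lemma gen_chain r i q x : gen (r + i) q -> gcell o L q x -> exists2 p, gen r p & gcell o L p x.
Proof.
elim: i q => [|i IH] q; first by rewrite addn0; exists q.
by rewrite addnS => -[p gp /st_sub[sub _]] xq; apply: (IH p) => //; exact: sub.
Qed.

Lemma measurable_spart q : measurable (spart q).
Proof. by apply: measurableD => //; exact: measurable_bigcup_cell. Qed.

Lemma spart_sub q : spart q `<=` gcell o L q. Proof. by move=> x []. Qed.

Lemma trivIset_spart : trivIset sparse_cells spart.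
Proof.
have lt r r' q q' x : (r < r')%N -> gen r q -> gen r' q' -> spart q x -> spart q' x -> False.
  move=> rr gq gq' [xq nx] [xq' _]; apply: nx.
  have gq2 : gen (r.+1 + (r' - r.+1)) q' by rewrite subnKC.
  have [p [q2 gq2' sp] xp] := gen_chain gq2 xq'.
  exists p => //; suff -> : q = q2 by [].
  by apply: (@trivIset_gen r) => //; exists x; split => //; exact: (st_sub sp).1.
move=> q q' [r _ gq] [r' _ gq'] [x [xq xq']]; case: (ltngtP r r') => rr.
- by case: (lt _ _ _ _ _ rr gq gq' xq xq').
- by case: (lt _ _ _ _ _ rr gq' gq xq' xq).
- by subst r'; apply: (@trivIset_gen r) => //; exists x; split; exact: spart_sub.
Qed.

Let cell_lty q : (mu (gcell o L q) < +oo)%E. Proof. by rewrite (mu_gcell mu_leb) // ltry. Qed.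

Lemma mu_spart q : (mu (gcell o L q) <= 2%:E * mu (spart q))%E.
Proof.
set U := \bigcup_(P in st q) gcell o L P.
have mU : measurable U by exact: measurable_bigcup_cell.
have e : mu (gcell o L q) = (mu (spart q) + mu U)%E.
  rewrite -measureU //; last 2 first.
  - exact: measurable_spart.
  - by apply/seteqP; split => // x [[_ nx] xU].
  congr (mu _); apply/seteqP; split => x; last by case=> [[]//|[P sP]]; exact: (st_sub sP).1.
  by move=> xq; case: (pselect (U x)) => xU; [right|left].
have h := st_mu q; rewrite -/U in h.
have Ul : (mu U < +oo)%E by apply: le_lt_trans h _; rewrite lte_mul_pinfty // lee_fin.
have sl : (mu (spart q) < +oo)%E.
  apply: le_lt_trans (cell_lty q); apply: le_measure; rewrite ?inE //; first exact: measurable_spart.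
  exact: spart_sub.
move: h; rewrite e -(@fineK _ (mu U)) ?ge0_fin_numE // -(@fineK _ (mu (spart q))) ?ge0_fin_numE //.
rewrite -!EFinD -!EFinM !lee_fin; lra.
Qed.

Let ugen r : set X := \bigcup_(q in gen r) gcell o L q.
Let mugen r : measurable (ugen r). Proof. exact: measurable_bigcup_cell. Qed.

(** Each generation covers at most half of the previous one, so almost every point lies in finitely
    many generations. *)
Lemma mu_ugen r : (mu (ugen r) <= (2^-1 ^+ r * L ^+ n)%:E)%E.
Proof.
elim: r => [|r IH].
  by rewrite /ugen /= bigcup_set1 /root gcell_root // mu_hc // expr0 mul1r.
have If (A : set X) : measurable A -> Int mu A (\1_(ugen r.+1)) = mu (A `&` ugen r.+1).
  by move=> mA; rewrite /Int integral_indic // setIC.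
have sub : ugen r.+1 `<=` ugen r.
  by move=> x [q [p gp /st_sub[pq _]] xq]; exists p => //; exact: pq.
have : (Int mu (ugen r) (\1_(ugen r.+1)) <= Int mu (ugen r) (fun=> 2^-1)%R)%E.
  apply: Int_cells_le => //; first exact: trivIset_gen.
  move=> q gq; rewrite If // Int_cst //; apply: le_trans _ (st_mu q).
  apply: le_measure; rewrite ?inE //; first exact: measurableI.
    exact: measurable_bigcup_cell.
  move=> x [xq [P [q' gq' sP] xP]]; exists P => //; suff -> : q = q' by [].
  by apply: (@trivIset_gen r) => //; exists x; split => //; exact: (st_sub sP).1.
rewrite If // (setIidr sub) Int_cst // => h; apply: le_trans h _.
rewrite exprS -mulrA EFinM; apply: lee_wpmul2l => //.
Qed.

Lemma ae_forall_cell (P : @cell n -> X -> Prop) :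
  (forall q, {ae mu, forall x, P q x}) -> {ae mu, forall x, forall q, P q x}.
Proof.
move=> h; have : {ae mu, forall x, forall i : nat, if pickle_inv i is Some q then P q x else True}.
  apply: ae_foralln => i; case: (pickle_inv i) => [q|]; first exact: h.
  exact: aeW.
by apply: filterS => x hx q; have := hx (pickle q); rewrite pickleK_inv.
Qed.

Variables (com w : @cell n -> X -> R).
Hypothesis off : forall q, gcell o L q `<=` hc o L ->
  {ae mu, forall x, gcell o L q x -> ~ (\bigcup_(P in st q) gcell o L P) x -> `|com q x| <= w q x}.
Hypothesis on : forall q P, gcell o L q `<=` hc o L -> st q P ->
  {ae mu, forall x, gcell o L P x -> `|com q x - com P x| <= w q x}.

(** Telescope along the chain of stopping cells containing [x]: each passage to the next cell costs
    the term of [on], and the last cell that of [off]. The chain is finite for almost every [x] by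
    [mu_ugen]. *)
Lemma sparse_domination : {ae mu, forall x, hc o L x -> exists s : seq (@cell n),
  [/\ uniq s, (forall q, q \in s -> sparse_cells q /\ gcell o L q x) &
      `|com root x| <= \sum_(q <- s) w q x]}.
Proof.
have h1 : {ae mu, forall x, forall q, gcell o L q `<=` hc o L -> gcell o L q x ->
    ~ (\bigcup_(P in st q) gcell o L P) x -> `|com q x| <= w q x}.
  apply: ae_forall_cell => q; case: (pselect (gcell o L q `<=` hc o L)) => qr; last exact: aeW.
  by have := off qr; apply: filterS => x hx _.
have h2 : {ae mu, forall x, forall q P, gcell o L q `<=` hc o L -> st q P -> gcell o L P x ->
    `|com q x - com P x| <= w q x}.
  apply: ae_forall_cell => q; apply: ae_forall_cell => P.
  case: (pselect (gcell o L q `<=` hc o L /\ st q P)) => [[qr sP]|nq].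
    by have := on qr sP; apply: filterS => x hx _ _.
  by apply: aeW => x qr sP; case: nq.
have h3 : {ae mu, forall x, ~ (\bigcap_r ugen r) x}.
  exists (\bigcap_r ugen r); split.
  - exact: bigcapT_measurable.
  - apply/eqP; rewrite eq_le measure_ge0 andbT; apply/lee_addgt0Pr => e e0; rewrite add0e.
    have [r hr] : exists r, 2^-1 ^+ r * L ^+ n <= e.
      exists (Num.bound (L ^+ n / e)).
      have := @upper_nthrootP _ (L ^+ n / e) _ (leqnn _); set r := Num.bound _ => h.
      rewrite exprVn mulrC ler_pdivrMr ?exprn_gt0 // mulrC -ler_pdivrMr //; exact: ltW.
    apply: (@le_trans _ _ (mu (ugen r))).
      by apply: le_measure; rewrite ?inE //; [exact: bigcapT_measurable|exact: bigcap_inf].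
    by apply: le_trans (mu_ugen r) _; rewrite lee_fin.
  - by move=> x /= nx; apply: contrapT => h; apply: nx.
move: h1 h2 h3; apply: filterS3 => x h1 h2 h3 xr.
(* Levels increase strictly along the chain, which keeps the list free of repetitions. *)
have tel r : forall q, gen r q -> gcell o L q x -> exists s : seq (@cell n),
    [/\ uniq s, (forall p, p \in s -> [/\ sparse_cells p, gcell o L p x & (p.1 < q.1)%N]) &
     `|com root x - com q x| <= \sum_(p <- s) w p x].
  elim: r => [|r IH] q /=.
    by move=> -> _; exists [::]; split => //; rewrite subrr normr0 big_nil.
  move=> [p gp sq] xq; have [pq lev] := st_sub sq.
  have xp := pq _ xq; have [s [us sP hs]] := IH p gp xp.
  exists (p :: s); split.
  - by rewrite /= us andbT; apply/negP => /sP[_ _]; rewrite ltnn.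
  - move=> p'; rewrite inE => /orP[/eqP ->|/sP[? ? lt]]; first by split => //; exists r.
    by split => //; exact: ltn_trans lev.
  - rewrite big_cons; have -> : com root x - com q x = (com p x - com q x) + (com root x - com p x) by ring.
    apply: le_trans (ler_normD _ _) _; apply: lerD => //.
    by apply: h2 => //; exact: gen_sub gp.
have [r [xr1 nx]] : exists r, ugen r x /\ ~ ugen r.+1 x.
  apply: contrapT => nex; apply: h3 => r _; elim: r => [|r IH].
    by exists root => //; rewrite /root gcell_root.
  by apply: contrapT => nx; apply: nex; exists r.
have [q gq xq] := xr1; have [s [us sP hs]] := tel r q gq xq.
exists (q :: s); split.
- by rewrite /= us andbT; apply/negP => /sP[_ _]; rewrite ltnn.
- by move=> p; rewrite inE => /orP[/eqP ->|/sP[]] //; split => //; exists r.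
- rewrite big_cons; have -> : com root x = com q x + (com root x - com q x) by ring.
  apply: le_trans (ler_normD _ _) _; apply: lerD => //.
  apply: h1 => //; first exact: gen_sub gq.
  by move=> [P sP' xP]; apply: nx; exists P => //; exists q.
Qed.

End sparse_family.

(** * Logarithmic bumps *)

Section log_bumps.
Context {R : realType}.
Implicit Types (x y t s h e : R) (m : nat).

Lemma log_plus_ge0 x : 0 <= log_plus x.
Proof. by rewrite /log_plus le_max lexx. Qed.

Lemma log_plus_le x y : 0 <= x -> x <= y -> log_plus x <= log_plus y.
Proof.
move=> x0 xy; rewrite /log_plus ge_max le_max lexx /=.
have [->|xn] := eqVneq x 0; first by rewrite ln0 // le_max lexx.
have xp : 0 < x by rewrite lt_def xn.
by rewrite le_max; apply/orP; right; rewrite ler_ln // posrE (lt_le_trans xp).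
Qed.

Lemma log_plusM x y : 0 <= x -> 0 <= y -> log_plus (x * y) <= log_plus x + log_plus y.
Proof.
move=> x0 y0; rewrite {1}/log_plus ge_max addr_ge0 ?log_plus_ge0 //=.
have [->|xn] := eqVneq x 0; first by rewrite mul0r ln0 // addr_ge0 ?log_plus_ge0.
have [->|yn] := eqVneq y 0; first by rewrite mulr0 ln0 // addr_ge0 ?log_plus_ge0.
have xp : 0 < x by rewrite lt_def xn.
have yp : 0 < y by rewrite lt_def yn.
by rewrite lnM ?posrE // lerD // /log_plus le_max lexx orbT.
Qed.

Lemma le_expR_log_plus x : 0 <= x -> x <= expR (log_plus x).
Proof.
move=> x0; have [->|xn] := eqVneq x 0; first exact: expR_ge0.
have xp : 0 < x by rewrite lt_def xn.
by rewrite -{1}(lnK (x := x)) // ler_expR /log_plus le_max lexx orbT.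
Qed.

Let base0 x : 1 <= 1 + log_plus x. Proof. by rewrite lerDl log_plus_ge0. Qed.
Let base_gt0 x : 0 < 1 + log_plus x. Proof. exact: lt_le_trans ltr01 (base0 x). Qed.

Lemma PhiE m e x : Phi m e x = x * ((1 + log_plus x) ^+ m * (1 + log_plus x) `^ e).
Proof.
rewrite /Phi powRD ?powR_mulrn ?(ltW (base_gt0 _)) //.
by rewrite (gt_eqF (base_gt0 x)) implybT.
Qed.

Lemma Phi_mE m x : Phi_m m x = x * (1 + log_plus x) ^+ m.
Proof. by rewrite /Phi_m PhiE powRr0 mulr1. Qed.

Lemma Phi_ge m e x : 0 <= e -> 0 <= x -> x <= Phi m e x.
Proof.
move=> e0 x0; rewrite /Phi ler_peMr //.
by rewrite -[leLHS](powRr0 (1 + log_plus x)) ler_powR // addr_ge0.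
Qed.

Lemma Phi_ge0 m e x : 0 <= x -> 0 <= Phi m e x.
Proof. by move=> x0; rewrite mulr_ge0 // powR_ge0. Qed.

Lemma Phi_le m e x y : 0 <= e -> 0 <= x -> x <= y -> Phi m e x <= Phi m e y.
Proof.
move=> e0 x0 xy; apply: ler_pM => //; first exact: powR_ge0.
have h : 1 + log_plus x <= 1 + log_plus y by rewrite lerD2l log_plus_le.
by apply: ge0_ler_powR; rewrite ?nnegrE ?addr_ge0 ?log_plus_ge0.
Qed.

(** From the subadditivity [log_plusM] and [1 + a + b <= (1 + a) (1 + b)]. Submultiplicativity lets
    constants be moved out of [Phi]. *)
Lemma PhiM m e x y : 0 <= e -> 0 <= x -> 0 <= y -> Phi m e (x * y) <= Phi m e x * Phi m e y.
Proof.
move=> e0 x0 y0; rewrite /Phi [leRHS]mulrACA -powRM ?(ltW (base_gt0 _)) //.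
apply: ler_wpM2l; first exact: mulr_ge0.
have lx := log_plus_ge0 x; have ly := log_plus_ge0 y; have lxy := log_plus_ge0 (x * y).
apply: ge0_ler_powR; rewrite ?nnegrE ?addr_ge0 ?mulr_ge0 ?addr_ge0 //.
apply: le_trans (_ : 1 + (log_plus x + log_plus y) <= _); first by rewrite lerD2l log_plusM.
by rewrite mulrDl mul1r mulrDr mulr1 -!addrA lerD2l addrCA lerD2l lerDl mulr_ge0.
Qed.

Lemma measurable_Phi m e : measurable_fun setT (Phi m e : R -> R).
Proof.
rewrite /Phi; apply: measurable_funM; first exact: measurable_id.
apply: (measurableT_comp (@measurable_powR _ _)); apply: measurable_funD; first exact: measurable_cst.
by apply: measurable_maxr; [exact: measurable_cst|exact: measurable_ln].
Qed.

(** Raise [1 + h <= exp (d' h) / d'], valid for [d' <= 1], to the power [m], with [m d' <= d]. *)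
Lemma one_plus_pow_le m d : 0 < d -> exists2 C : R, 0 < C &
  forall h, 0 <= h -> (1 + h) ^+ m <= C * expR (d * h).
Proof.
move=> d0; pose d' := Num.min 1 (d / m.+1%:R).
have d'0 : 0 < d' by rewrite lt_min ltr01 /= divr_gt0.
exists (d'^-1 ^+ m) => [|h h0]; first by rewrite exprn_gt0 // invr_gt0.
have h1 : 1 + h <= d'^-1 * expR (d' * h).
  rewrite mulrC ler_pdivlMr // mulrDl mul1r; apply: le_trans (expR_ge1Dx _).
  by rewrite [h * _]mulrC lerD2r /d' ge_min lexx.
apply: (@le_trans _ _ ((d'^-1 * expR (d' * h)) ^+ m)).
  by rewrite lerXn2r ?nnegrE ?addr_ge0 // mulr_ge0 ?expR_ge0 // invr_ge0 ltW.
rewrite exprMn -expRM_natl ler_wpM2l ?exprn_ge0 ?invr_ge0 ?(ltW d'0) //.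
rewrite ler_expR mulrA ler_wpM2r //.
apply: (@le_trans _ _ (m%:R * (d / m.+1%:R))); first by rewrite ler_wpM2l // /d' ge_min lexx orbT.
rewrite mulrCA ler_piMr ?(ltW d0) // ler_pdivrMr // mul1r ler_nat; exact: leqnSn.
Qed.

(* Either [y] is at most [exp (kap / 2)], or the bump beats the factor
   [(1 + h) ^ m], or [y] is exponentially small compared with [exp h]. *)
Lemma young_bump m e c : 0 <= e -> 0 < c -> exists2 C : R, 0 < C & forall kap h y,
  0 < kap -> 0 <= h -> 0 <= y -> (1 + h) ^+ m * y <=
  C * ((kap / 2) `^ (- e) * Phi m e y + expR (3 / 4 * kap) + expR (- kap / 4) * expR (c * h)).
Proof.
move=> e0 c0; have c4 : 0 < c / 4 by lra.
have [C0 C0p HC0] := one_plus_pow_le m c4.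
(* [A] separates the last two cases: if [1 + h] exceeds [A * (1 + log_plus y)], then [y] is at most
   [expR (c / 4 * (1 + h))]. *)
pose A := 4 / c; have A0 : 0 < A by rewrite /A divr_gt0.
pose C := C0 + A ^+ m + C0 * expR (3 / 4 * c).
have Am : 0 < A ^+ m by rewrite exprn_gt0.
have E0 x : 0 < expR x by exact: expR_gt0.
have C1 : C0 <= C by rewrite /C -addrA lerDl addr_ge0 ?mulr_ge0 ?ltW.
have C2 : A ^+ m <= C by rewrite /C addrAC lerDr addr_ge0 ?mulr_ge0 ?ltW.
have C3 : C0 * expR (3 / 4 * c) <= C by rewrite /C lerDr addr_ge0 ?ltW.
exists C => [|kap h y k0 h0 y0]; first exact: lt_le_trans C0p C1.
have k2 : 0 < kap / 2 by lra.
have T1 : 0 <= (kap / 2) `^ (- e) * Phi m e y by rewrite mulr_ge0 ?powR_ge0 ?Phi_ge0.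
have Cp : 0 < C by exact: lt_le_trans C0p C1.
have H1 : (1 + h) ^+ m * y <= C0 * expR (c / 4 * h) * y by rewrite ler_wpM2r // HC0.
have [ysm|ybig] := leP y (expR (kap / 2)).
  apply: (le_trans H1); apply: (@le_trans _ _ (C0 * (expR (c / 4 * h) * expR (kap / 2)))).
    by rewrite -mulrA ler_wpM2l ?(ltW C0p) // ler_wpM2l // ltW.
  apply: ler_pM; [exact: ltW|by rewrite mulr_ge0 // ltW|exact: C1|].
  rewrite -!expRD; have [hk|hk] := leP (c * h) kap.
    apply: (@le_trans _ _ (expR (3 / 4 * kap))); first by rewrite ler_expR; lra.
    by rewrite addrAC lerDr addr_ge0 // ltW.
  apply: (@le_trans _ _ (expR (- kap / 4 + c * h))); first by rewrite ler_expR; lra.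
  by rewrite lerDr addr_ge0 // ltW.
have yp : 0 < y by exact: lt_trans ybig.
have ly : kap / 2 <= log_plus y.
  by rewrite /log_plus le_max; apply/orP; right; rewrite -(expRK (kap / 2)) ler_ln ?posrE // ltW.
have [hA|hA] := leP (1 + h) (A * (1 + log_plus y)).
  apply: (@le_trans _ _ (A ^+ m * (y * (1 + log_plus y) ^+ m))).
    rewrite mulrA [A ^+ m * y]mulrC -mulrA -exprMn mulrC ler_wpM2l //.
    by rewrite lerXn2r ?nnegrE ?addr_ge0 // mulr_ge0 ?(ltW A0) // addr_ge0 // log_plus_ge0.
  apply: ler_pM; [exact: ltW|by rewrite mulr_ge0 ?exprn_ge0 // addr_ge0 // log_plus_ge0|exact: C2|].
  apply: (@le_trans _ _ ((kap / 2) `^ (- e) * Phi m e y)).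
    rewrite PhiE mulrA [_ `^ _ * _]mulrC -!mulrA ler_wpM2l // mulrCA ler_peMr //.
      by rewrite exprn_ge0 // addr_ge0 // log_plus_ge0.
    rewrite powRN mulrC ler_pdivlMr ?powR_gt0 // mul1r.
    apply: ge0_ler_powR; rewrite ?nnegrE ?addr_ge0 ?log_plus_ge0 ?(ltW k2) //.
    by apply: (le_trans ly); rewrite lerDr.
  by rewrite -addrA lerDl addr_ge0 // ?mulr_ge0 // ltW.
have l1 : 1 + log_plus y < c / 4 * (1 + h).
  rewrite -(ltr_pM2l A0) mulrA (_ : A * (c / 4) = 1) ?mul1r // /A; field; lra.
have yle : y <= expR (c / 4 * (1 + h)).
  apply: le_trans (le_expR_log_plus y0) _; rewrite ler_expR; lra.
apply: (le_trans H1); apply: (@le_trans _ _ (C0 * (expR (c / 4 * h) * expR (c / 4 * (1 + h))))).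
  by rewrite -mulrA ler_wpM2l ?(ltW C0p) // ler_wpM2l // ltW.
apply: (@le_trans _ _ (C0 * expR (3 / 4 * c) * (expR (- kap / 4) * expR (c * h)))).
  rewrite -[leRHS]mulrA ler_wpM2l ?(ltW C0p) // -!expRD ler_expR; nra.
apply: ler_pM => //; try by rewrite ?mulr_ge0 ?ltW.
by rewrite lerDr addr_ge0 // ltW.
Qed.

End log_bumps.

(** * The weak-type estimate for sparse families *)

Lemma measurable_sum_if d (T : measurableType d) (R : realType) (I : Type) (s : seq I)
    (P : pred I) (f : I -> T -> R) : (forall i, measurable_fun setT (f i)) ->
  measurable_fun setT (fun x => \sum_(i <- s | P i) f i x).
Proof.
move=> mf; under eq_fun do rewrite big_mkcond.
by apply: measurable_sum => i; case: (P i).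
Qed.

Lemma seq_minimum (I : eqType) (r : rel I) (s : seq I) : total r -> transitive r -> s != [::] ->
  exists2 i, i \in s & forall j, j \in s -> r i j.
Proof.
move=> tot tr; have rr i : r i i by have := tot i i; rewrite orbb.
elim: s => // i [|i' s] IH _; first by exists i; rewrite ?inE // => j; rewrite inE => /eqP ->.
have [//|i0 i0s hi0] := IH; case/orP: (tot i i0) => h.
  exists i; first by rewrite inE eqxx.
  by move=> j; rewrite inE => /orP[/eqP ->//|/hi0]; exact: tr.
exists i0; first by rewrite inE i0s orbT.
by move=> j; rewrite inE => /orP[/eqP ->|/hi0].
Qed.

Lemma seq_min_level (I : eqType) (lev : I -> nat) (s : seq I) : s != [::] ->
  exists2 i, i \in s & forall j, j \in s -> (lev i <= lev j)%N.
Proof.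
apply: (@seq_minimum _ (fun i j => (lev i <= lev j)%N)) => [i j|j i k]; first exact: leq_total.
exact: leq_trans.
Qed.

Lemma seq_max_level (I : eqType) (lev : I -> nat) (s : seq I) : s != [::] ->
  exists2 i, i \in s & forall j, j \in s -> (lev j <= lev i)%N.
Proof.
apply: (@seq_minimum _ (fun i j => (lev j <= lev i)%N)) => [i j|j i k]; first exact: leq_total.
by move=> h1 h2; exact: leq_trans h2 h1.
Qed.

(** Ordered by level, this is [(1 + t) ^ N = 1 + t * sum_(j < N) (1 + t) ^ j]; ties in level only
    enlarge the exponents on the right. Each step of the induction removes an element of lowest
    level. *)
Lemma pow_size_le (R : realType) (I : eqType) (lev : I -> nat) (t : R) (s : seq I) : 0 <= t ->
  (1 + t) ^+ size s <= 1 + t * \sum_(i <- s) (1 + t) ^+ (count (fun j => lev i <= lev j)%N s).-1.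
Proof.
move=> t0; move: {2}(size s) (leqnn (size s)) => k; elim: k s => [|k IH] s.
  by rewrite leqn0 => /nilP ->; rewrite big_nil mulr0 addr0.
have [->|sn] := eqVneq s [::]; first by rewrite big_nil mulr0 addr0.
move=> sk; have [i is_ hi] := seq_min_level lev sn.
have ps := perm_to_rem is_; set s' := rem i s in ps.
have es : size s = (size s').+1 by rewrite (perm_size ps).
rewrite (perm_big _ ps) big_cons /=.
have -> : count (fun j => lev i <= lev j)%N s = size s.
  by apply/eqP; rewrite -all_count; apply/allP => j /hi.
rewrite es /=; have sk' : (size s' <= k)%N by rewrite -ltnS -es.
have h := IH s' sk'.

have h2 : \sum_(j <- s') (1 + t) ^+ (count (fun j' => lev j <= lev j')%N s').-1 <=
   \sum_(j <- s') (1 + t) ^+ (count (fun j' => lev j <= lev j')%N s).-1.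
  apply: ler_sum => j _; rewrite ler_weXn2l ?lerDl //.
  have -> : count (fun j' => lev j <= lev j')%N s = ((lev j <= lev i) + count (fun j' => lev j <= lev j') s')%N.
    by rewrite (permP ps).
  by rewrite -!subn1 leq_sub2r // leq_addl.
rewrite exprS mulrDr mulrDl mul1r; have := ler_wpM2l t0 h2; lra.
Qed.

(** * Overlap of families with the Carleson property *)

Section counting.
Context {R : realType} {n : nat}.
Local Notation X := (Rn R n).
Variable mu : {measure set X -> \bar R}.
Hypothesis mu_leb : is_lebesgue mu.
Variables (o : X) (L : R).
Hypothesis L0 : 0 < L.
Variable T : seq (@cell n).
Implicit Types (p q : @cell n) (x : X).

Definition above q x p := `[< gcell o L p x >] && (q.1 <= p.1)%N.
(** The cell [q] itself is counted if it belongs to [T] and contains [x]. For [x] in [q] only cells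
    inside [q] count. *)
Definition cnt q x : nat := count (above q x) T.

Let mcell q : measurable (gcell o L q). Proof. exact: measurable_gcell. Qed.

Lemma above_sub q x p : gcell o L q x -> above q x p -> gcell o L p `<=` gcell o L q.
Proof.
by move=> xq /andP[/asboolP xp lev]; apply: (gcell_nested L0) => //; exists x.
Qed.

(** Take one of these cells of lowest level: all the others are counted in its [cnt], which is at
    most [M]. *)
Lemma card_cnt_le x M :
  (count (fun q => `[< gcell o L q x >] && (cnt q x <= M))%N T <= M)%N.
Proof.
set P := fun q => _.
have [e|sn] := eqVneq (seq.filter P T) [::]; first by rewrite -size_filter e.
have [q] := seq_min_level (fun q : @cell n => q.1) sn.
rewrite mem_filter => /andP[/andP[/asboolP xq cM] qT] hq.
apply: leq_trans cM; rewrite /cnt -!size_filter.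
have -> : seq.filter P T = seq.filter P (seq.filter (above q x) T).
  rewrite -filter_predI; apply: eq_in_filter => p pT /=; rewrite andbC.
  case Pp : (P p); rewrite ?andbF //= andbT; apply/esym.
  by move: (Pp) => /andP[xp _]; rewrite /above xp /=; apply: hq; rewrite mem_filter Pp.
by rewrite size_filter; exact: count_size.
Qed.

Lemma pow_cnt_le (t : R) q x : 0 <= t -> (1 + t) ^+ cnt q x <=
  1 + t * \sum_(p <- T | above q x p) (1 + t) ^+ (cnt p x).-1.
Proof.
move=> t0; have := @pow_size_le R _ (fun p : @cell n => p.1) t (seq.filter (above q x) T) t0.
rewrite size_filter -/(cnt q x) big_filter => h; apply: le_trans h _.
rewrite lerD2l ler_wpM2l //; apply: ler_sum => p ap.
rewrite ler_weXn2l ?lerDl // -!subn1 leq_sub2r // /cnt -!size_filter -filter_predI !size_filter.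
apply/eq_leq/eq_in_count => p' _ /=; rewrite /above; case: asboolP => /= _; last by rewrite andbF.
case: (leqP p.1 p'.1) => //= h1; case/andP: ap => _ qp.
exact: leq_trans qp h1.
Qed.

(** A finite product of simple functions, from which measurability of the count follows. *)
Lemma pow_cntE (t : R) q x :
  (1 + t) ^+ cnt q x = \prod_(p <- T | (q.1 <= p.1)%N) (1 + t * \1_(gcell o L p) x).
Proof.
rewrite /cnt; elim: T => [|p s IH]; first by rewrite big_nil.
rewrite big_cons /= exprD IH /above; case: (leqP q.1 p.1) => lev; last by rewrite andbF expr0 mul1r.
rewrite andbT indicE; case: asboolP => xp; first by rewrite mem_set // mulr1 expr1.
by rewrite memNset // mulr0 addr0 expr0.
Qed.

Lemma measurable_pow_cnt (t : R) q : measurable_fun setT (fun x => (1 + t) ^+ cnt q x).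
Proof.
under eq_fun do rewrite pow_cntE.
under eq_fun do rewrite big_mkcond.
apply: measurable_prod => p _; case: (q.1 <= p.1)%N; mfun; exact: measurable_indic.
Qed.

Lemma measurable_cnt_gt q M : measurable [set x | (M < cnt q x)%N].
Proof.
have := @measurable_gt_set _ _ _ (2 ^+ M) _ (measurable_pow_cnt 1 q).
by congr measurable; apply/seteqP; split => x /=; rewrite (_ : 1 + 1 = 2%:R :> R) // -!natrX ltr_nat ltn_exp2l.
Qed.

Variables (Lam t : R).
Hypothesis carleson : forall q,
  \sum_(p <- T | `[< gcell o L p `<=` gcell o L q >]) glen L p ^+ n <= Lam * glen L q ^+ n.
Hypothesis t0 : 0 < t.
Hypothesis tLam : t * Lam <= 2^-1.

Let K0 : R := (1 + t) ^+ size T.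
Let t1 : 0 <= 1 + t. Proof. by rewrite addr_ge0 // ltW. Qed.
Let lp q : 0 < glen L q ^+ n. Proof. by rewrite exprn_gt0 // glen_gt0. Qed.
Let pc0 q x : 0 <= (1 + t) ^+ cnt q x. Proof. by rewrite exprn_ge0. Qed.

(** By [pow_cnt_le] and the Carleson condition, a bound [K] valid for all cells improves to
    [1 + t Lam K <= 1 + K / 2], whose fixed point is 2. The iteration can start because [T] is a
    finite list. *)
Lemma Int_pow_cnt_iter j q :
  (Int mu (gcell o L q) (fun x => (1 + t) ^+ cnt q x)%R <= ((2 + K0 / 2 ^+ j) * glen L q ^+ n)%:E)%E.
Proof.
elim: j q => [|j IH] q.
  apply: (@le_trans _ _ (Int mu (gcell o L q) (fun=> K0)%R)).
    by apply: Int_le => // x _; rewrite ler_weXn2l ?lerDl ?(ltW t0) // count_size.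
  rewrite Int_cst // (mu_gcell mu_leb o L0) -EFinM lee_fin ler_wpM2r ?(ltW (lp q)) //.
  by rewrite expr0 divr1 lerDr.
set K := 2 + K0 / 2 ^+ j in IH.
have K00 : 0 <= K by rewrite addr_ge0 // divr_ge0 ?exprn_ge0.
pose F p x : R := (1 + t) ^+ cnt p x * \1_(gcell o L p) x.
have mF p : measurable_fun setT (F p).
  by apply: measurable_funM; [exact: measurable_pow_cnt|exact: measurable_indic].
have F0 p x : 0 <= F p x by rewrite mulr_ge0.
pose sub p := `[< gcell o L p `<=` gcell o L q >].
apply: (@le_trans _ _ (Int mu (gcell o L q) (fun x => 1 + t * \sum_(p <- T | sub p) F p x)%R)).
  apply: Int_le => // x xq; apply: le_trans (pow_cnt_le q x (ltW t0)) _.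
  rewrite lerD2l ler_wpM2l ?(ltW t0) // big_mkcond [leRHS]big_mkcond.
  apply: ler_sum => p _; case: ifP => ap; last by case: ifP.
  rewrite (_ : sub p = true); last by apply/asboolP; exact: above_sub ap.
  rewrite /F indicE mem_set ?mulr1; last by case/andP: ap => /asboolP.
  by rewrite ler_weXn2l ?lerDl ?(ltW t0) // leq_pred.
have mS : measurable_fun setT (fun x => \sum_(p <- T | sub p) F p x).
  by exact: measurable_sum_if.
have S0 x : 0 <= \sum_(p <- T | sub p) F p x by exact: sumr_ge0.
rewrite Int_D //; last 2 first.
- by mfun.
- by move=> x; rewrite mulr_ge0 // ltW.
rewrite Int_cst // mul1e (mu_gcell mu_leb o L0) Int_Z ?(ltW t0) //.
rewrite (@Int_sum _ _ _ mu (gcell o L q) _ T sub) //.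
have h : (\sum_(p <- T | sub p) Int mu (gcell o L q) (F p) <= (K * (Lam * glen L q ^+ n))%:E)%E.
  apply: (@le_trans _ _ (\sum_(p <- T | sub p) (K * glen L p ^+ n)%:E)%E); last first.
    by rewrite sumEFin lee_fin -mulr_sumr ler_wpM2l //; exact: carleson.
  apply: lee_sum => p _; apply: le_trans (IH p).
  by rewrite [leRHS]Int_indic; apply: Int_subset.
apply: le_trans (leeD (lexx _) (lee_wpmul2l _ h)) _; first by rewrite lee_fin ltW.
rewrite -EFinM -EFinD lee_fin exprS.
have : t * (K * (Lam * glen L q ^+ n)) <= 2^-1 * K * glen L q ^+ n.
  rewrite (_ : t * _ = t * Lam * (K * glen L q ^+ n)); last by ring.
  by rewrite -[leRHS]mulrA ler_wpM2r // mulr_ge0 // ltW.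
move=> h1; apply: le_trans (lerD (lexx _) h1) _; apply: eq_ler; rewrite /K; field.
by rewrite expf_neq0 // pnatr_eq0.
Qed.

Lemma Int_pow_cnt q :
  (Int mu (gcell o L q) (fun x => (1 + t) ^+ cnt q x)%R <= (3 * glen L q ^+ n)%:E)%E.
Proof.
apply: le_trans (Int_pow_cnt_iter (Num.bound K0) q) _; rewrite lee_fin ler_wpM2r ?(ltW (lp q)) //.
have := @upper_nthrootP _ K0 _ (leqnn _) => h.
rewrite (_ : 3 = 2 + 1); last by ring.
by rewrite lerD2l ler_pdivrMr ?exprn_gt0 // mul1r ltW.
Qed.

(** Chebyshev for the exponential moment; with [M = 2 ^ k] the bound is doubly exponential in
    [k]. *)
Lemma mu_cnt_gt q M :
  (mu (gcell o L q `&` [set x | (M < cnt q x)%N]) <= (3 / (1 + t) ^+ M * glen L q ^+ n)%:E)%E.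
Proof.
have P0 : 0 < (1 + t) ^+ M by rewrite exprn_gt0 // addr_gt0.
have mA : measurable (gcell o L q `&` [set x | (1 + t) ^+ M <= (1 + t) ^+ cnt q x]).
  apply: measurableI => //; rewrite -[X in measurable X]setTI.
  exact: (measurable_fun_le measurableT (measurable_cst _) (measurable_pow_cnt _ _)).
have h : (((1 + t) ^+ M)%:E * mu (gcell o L q `&` [set x | (1 + t) ^+ M <= (1 + t) ^+ cnt q x]%R) <=
    (3 * glen L q ^+ n)%:E)%E.
  apply: le_trans (Int_pow_cnt q); apply: markov_Int => //; first exact: measurable_pow_cnt.
  exact: ltW.
apply: (@le_trans _ _ (mu (gcell o L q `&` [set x | (1 + t) ^+ M <= (1 + t) ^+ cnt q x]%R))).
  apply: le_measure; rewrite ?inE //; first by apply: measurableI => //; exact: measurable_cnt_gt.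
  by move=> x [xq /= hx]; split => //=; rewrite ler_weXn2l ?lerDl ?(ltW t0) // ltnW.
rewrite -(lee_pmul2l _ (_ : 0 < ((1 + t) ^+ M)%:E)%E) ?lte_fin // -?EFinM.
apply: le_trans h _; rewrite lee_fin; apply: eq_ler; field; exact: lt0r_neq0.
Qed.

Variables (phi : X -> R) (C1 : R).
Hypothesis mphi : measurable_fun setT phi.
Hypothesis phi0 : forall x, 0 <= phi x.
Hypothesis C10 : 0 <= C1.
Hypothesis phi_le : forall p, p \in T -> (Int mu (gcell o L p) phi <= (C1 * glen L p ^+ n)%:E)%E.

(** The set is a union of cells of [T]: if [p0] is the smallest counted cell at [x], every point of
    [p0] lies in the same larger cells and has at least the same count. On the maximal such cells
    [phi_le] applies. *)
Lemma Int_cnt_gt_le q M : (Int mu (gcell o L q `&` [set x | (M < cnt q x)%N]) phi <=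
  C1%:E * mu (gcell o L q `&` [set x | (M < cnt q x)%N]))%E.
Proof.
set D := _ `&` _.
have mD : measurable D by apply: measurableI => //; exact: measurable_cnt_gt.
pose P : set (@cell n) := [set p | p \in T /\ gcell o L p `<=` D].
have DE : D = \bigcup_(p in P) gcell o L p.
  apply/seteqP; split => x; last by move=> [p [_ sub]]; exact: sub.
  move=> [xq /= hx]; pose s := seq.filter (above q x) T.
  have sn : s != [::] by rewrite -size_eq0 size_filter -lt0n (leq_ltn_trans _ hx).
  have [p0 p0s hp0] := @seq_max_level _ (fun p : @cell n => p.1) s sn.
  move: (p0s); rewrite mem_filter => /andP[ap0 p0T].
  have xp0 : gcell o L p0 x by case/andP: ap0 => /asboolP.
  exists p0 => //; split => // y yp0; split; first exact: above_sub ap0 _ yp0.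
  apply: (leq_trans hx); rewrite /cnt.
  have -> : count (above q x) T = count (fun p => above q x p && above q y p) T.
    apply: eq_in_count => p pT; case ap : (above q x p) => //=; apply/esym.
    case/andP: (ap) => /asboolP xp lev; rewrite /above lev andbT; apply/asboolP.
    have ps : p \in s by rewrite mem_filter ap.
    apply: (gcell_nested L0) yp0; last by exists x.
    exact: hp0.
  by apply: sub_count => p /andP[].
rewrite DE -Int_cst; last by apply: measurable_bigcup_cell.
rewrite -(@bigcup_minimal _ _ o L L0 P); apply: Int_cells_le => //; first exact: trivIset_minimal.
by move=> p [[pT _] _]; rewrite Int_cst // (mu_gcell mu_leb o L0) -EFinM; exact: phi_le.
Qed.

(** The points of multiplicity above [M] are so rare that, by [Int_cnt_gt_le], they carry at most
    [|q| / 2]; the rest of the mass lies where the overlap is bounded. *)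
Lemma half_mass q M : 3 * C1 / (1 + t) ^+ M <= 2^-1 -> (mu (gcell o L q) <= Int mu (gcell o L q) phi)%E ->
  (mu (gcell o L q) <= 2%:E * Int mu (gcell o L q `&` [set x | (cnt q x <= M)%N]) phi)%E.
Proof.
move=> hM hq; set D := gcell o L q `&` [set x | (M < cnt q x)%N].
set E := gcell o L q `&` [set x | (cnt q x <= M)%N].
have mD : measurable D by apply: measurableI => //; exact: measurable_cnt_gt.
have ED : E = gcell o L q `&` ~` [set x | (M < cnt q x)%N].
  by rewrite /E; congr (_ `&` _); apply/seteqP; split => x /= h; [by rewrite ltnNge h|rewrite leqNgt; apply/negP].
have mE : measurable E.
  by rewrite ED; apply: measurableI => //; apply: measurableC; exact: measurable_cnt_gt.
have U : gcell o L q = D `|` E.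
  apply/seteqP; split => x; last by case=> -[].
  by move=> xq; case: (leqP (cnt q x) M) => h; [right|left].
have h1 : (Int mu D phi <= (2^-1 * glen L q ^+ n)%:E)%E.
  apply: le_trans (Int_cnt_gt_le q M) _.
  apply: le_trans (lee_wpmul2l _ (mu_cnt_gt q M)) _; first by rewrite lee_fin.
  rewrite -EFinM lee_fin mulrA ler_wpM2r ?(ltW (lp q)) //.
  by rewrite mulrA [C1 * 3]mulrC.
have h2 : (Int mu (gcell o L q) phi = Int mu D phi + Int mu E phi)%E.
  rewrite {1}U Int_setU // /D /E; apply/seteqP; split => // x [[_ /= h] [_ /=]].
  by rewrite leqNgt h.
rewrite (mu_gcell mu_leb o L0) in hq *; rewrite h2 in hq.
have := le_trans hq (leeD h1 (lexx _)).
have : (0 <= Int mu E phi)%E by exact: Int_ge0.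
case: (Int mu E phi) => [r| |] //; last by rewrite mulry gtr0_sg // mul1e leey.
by rewrite -!EFinD -EFinM !lee_fin; lra.
Qed.

End counting.

Section multiplicity.
Context {d : measure_display} {X : measurableType d} {R : realType}.
Variable mu : {measure set X -> \bar R}.

Lemma Int_bigcup_seq_le (I : eqType) (s : seq I) (A : I -> set X) (g : X -> R) :
  (forall i, measurable (A i)) -> measurable_fun setT g -> (forall x, 0 <= g x) ->
  (Int mu (\bigcup_(i in [set` s]) A i) g <= \sum_(i <- s) Int mu (A i) g)%E.
Proof.
move=> mA mg g0; elim: s => [|i s IH].
  rewrite big_nil (_ : \bigcup_(_ in _) _ = set0); first by rewrite Int_null.
  by apply/seteqP; split => x //; case.
rewrite big_cons (_ : \bigcup_(_ in _) _ = A i `|` \bigcup_(i in [set` s]) A i); last first.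
  apply/seteqP; split => x.
    by move=> [j /=]; rewrite inE => /orP[/eqP ->|js] xj; [left|right; exists j].
  by case=> [xi|[j js xj]]; [exists i => //=; rewrite inE eqxx|exists j => //=; rewrite inE js orbT].
apply: le_trans (Int_setU_le _ _ _ _ _) _ => //.
  by apply: fin_bigcup_measurable => //; exact: finite_seq.
exact: leeD.
Qed.

(** At each point at most [M] terms are present, and the largest of their coefficients is at most
    [w x]. *)
Lemma sum_Int_mult (I : eqType) (s : seq I) (A : I -> set X) (r : I -> R) (M : nat)
    (phi : X -> R) (w : X -> \bar R) :
  (0 < M)%N -> (forall i, measurable (A i)) -> (forall i, 0 <= r i) ->
  (forall x, (count (fun i => `[< A i x >]) s <= M)%N) ->
  measurable_fun setT phi -> (forall x, 0 <= phi x) ->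
  (forall i x, i \in s -> A i x -> ((r i)%:E <= w x)%E) -> (forall x, 0 <= w x)%E ->
  (\sum_(i <- s) (r i)%:E * Int mu (A i) phi <= M%:R%:E * \int[mu]_x ((phi x)%:E * w x))%E.
Proof.
move=> M0 mA r0 hM mphi phi0 hw w0.
have MR : 0 < M%:R :> R by rewrite ltr0n.
pose F i x : R := r i * (phi x * \1_(A i) x).
have mF i : measurable_fun setT (F i).
  by rewrite /F; mfun; exact: measurable_indic.
have F0 i x : 0 <= F i x by rewrite !mulr_ge0.
have -> : (\sum_(i <- s) (r i)%:E * Int mu (A i) phi = Int mu setT (fun x => \sum_(i <- s) F i x)%R)%E.
  rewrite (@Int_sum _ _ _ mu setT _ s xpredT) //; apply: eq_bigr => i _.
  rewrite /F Int_Z //; first by rewrite -Int_indic.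
  - by mfun; exact: measurable_indic.
  - by move=> x; rewrite mulr_ge0.
have mS : measurable_fun setT (fun x => \sum_(i <- s) F i x) by exact: measurable_sum.
have S0 x : 0 <= \sum_(i <- s) F i x by exact: sumr_ge0.
(* The factor [M] is taken out on the measurable side, because [w] is an arbitrary function. *)
have -> : Int mu setT (fun x => \sum_(i <- s) F i x)%R =
    (M%:R%:E * Int mu setT (fun x => M%:R^-1 * \sum_(i <- s) F i x)%R)%E.
  rewrite Int_Z ?invr_ge0 ?(ltW MR) // muleA -EFinM divff ?gt_eqF // mul1e //.
apply: lee_wpmul2l; first by rewrite lee_fin ltW.
apply: le_integral_ge0 => x _; first by rewrite lee_fin mulr_ge0 // invr_ge0 ltW.
pose s' := seq.filter (fun i => `[< A i x >]) s.
have -> : \sum_(i <- s) F i x = phi x * \sum_(i <- s') r i.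
  rewrite big_filter mulr_sumr [RHS]big_mkcond; apply: eq_bigr => i _.
  rewrite /F indicE; case: asboolP => xi; last by rewrite memNset // !mulr0.
  by rewrite mem_set // mulr1 mulrC.
have [->|sn] := eqVneq s' [::]; first by rewrite big_nil !mulr0 mule_ge0 // lee_fin.
have [i0 i0s hi0] : exists2 i, i \in s' & forall j, j \in s' -> r j <= r i.
  apply: (@seq_minimum _ (fun i j => r j <= r i)) => // [i j|j i k h1 h2]; first exact: ge_total.
  exact: le_trans h2 h1.
move: (i0s); rewrite mem_filter => /andP[/asboolP xi0 is0].
apply: (@le_trans _ _ ((phi x)%:E * (r i0)%:E)%E); last first.
  by apply: lee_wpmul2l; [rewrite lee_fin|exact: hw].
rewrite -EFinM lee_fin mulrCA ler_wpM2l // mulrC ler_pdivrMr //.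
apply: (@le_trans _ _ (\sum_(j <- s') r i0)).
  by rewrite big_seq [leRHS]big_seq; apply: ler_sum => j js; exact: hi0.
rewrite big_const_seq count_predT iter_addr_0 -[leLHS]mulr_natr ler_wpM2l // ler_nat.
by rewrite size_filter.
Qed.

End multiplicity.

Section carleson.
Context {R : realType} {n : nat}.
Local Notation X := (Rn R n).
Variable mu : {measure set X -> \bar R}.
Hypothesis mu_leb : is_lebesgue mu.
Variables (o : X) (L : R).
Hypothesis L0 : 0 < L.
Variables (s : seq (@cell n)) (G : @cell n -> set X) (Lam : R).
Hypothesis us : uniq s.
Hypothesis mG : forall p, measurable (G p).
Hypothesis Gsub : forall p, p \in s -> G p `<=` gcell o L p.
Hypothesis Gtriv : trivIset [set` s] G.
Hypothesis Glarge : forall p, p \in s -> (mu (gcell o L p) <= Lam%:E * mu (G p))%E.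
Hypothesis Lam0 : 0 <= Lam.

(** The large parts [G p] of the subcells of [q] are disjoint subsets of [q]. *)
Lemma carleson_sum (P : pred (@cell n)) (q : @cell n) :
  \sum_(p <- seq.filter P s | `[< gcell o L p `<=` gcell o L q >]) glen L p ^+ n <= Lam * glen L q ^+ n.
Proof.
rewrite -big_filter -filter_predI; set s' := seq.filter _ s.
have s's p : p \in s' -> p \in s /\ gcell o L p `<=` gcell o L q.
  by rewrite mem_filter => /andP[/andP[/asboolP]].
have mcell p : measurable (gcell o L p) by exact: measurable_gcell.
rewrite -lee_fin -sumEFin EFinM -(mu_gcell mu_leb o L0).
apply: (@le_trans _ _ (\sum_(p <- s') Lam%:E * mu (G p))%E).
  rewrite big_seq [leRHS]big_seq; apply: lee_sum => p /s's[ps _].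
  by rewrite -(mu_gcell mu_leb o L0); exact: Glarge.
rewrite -ge0_sume_distrr //; apply: lee_wpmul2l; first by rewrite lee_fin.
have e (A : set X) : measurable A -> mu A = Int mu setT (\1_A) by move=> mA; rewrite /Int integral_indic // setIT.
under eq_bigr do rewrite e //.
rewrite e // -(@Int_sum _ _ _ mu setT _ s' xpredT) //; apply: Int_le => [x|x _]; first exact: sumr_ge0.
case: (pselect (exists2 p, p \in s' & G p x)) => [[p ps xp]|nex]; last first.
  by rewrite big_seq big1 // => p ps; rewrite indicE memNset // => xp; apply: nex; exists p.
have [pis psub] := s's p ps.
rewrite [leRHS]indicE mem_set; last by apply: psub; exact: Gsub.
rewrite (bigD1_seq p) ?filter_uniq //= indicE mem_set // big_seq_cond big1 ?addr0 //.
move=> p' /andP[p's pp']; rewrite indicE memNset // => xp'; have [p'is _] := s's p' p's.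
by move/eqP: pp'; apply; apply: Gtriv => //; exists x.
Qed.

End carleson.

Section bumps.
Context {R : realType} {n : nat}.
Local Notation X := (Rn R n).
Variable mu : {measure set X -> \bar R}.
Variables (Q : set X) (V : R).
Variables (h y : X -> R) (m : nat) (eps c0 CY Cphi CJ : R).
Hypothesis mh : measurable_fun setT h.
Hypothesis my : measurable_fun setT y.
Hypothesis h0 : forall x, 0 <= h x.
Hypothesis y0 : forall x, 0 <= y x.
Hypothesis CY0 : 0 <= CY.
Hypothesis young : forall kap z t, 0 < kap -> 0 <= z -> 0 <= t -> (1 + z) ^+ m * t <=
  CY * ((kap / 2) `^ (- eps) * Phi m eps t + expR (3 / 4 * kap) + expR (- kap / 4) * expR (c0 * z)).
Hypothesis phi_le : (Int mu Q (fun x => Phi m eps (y x)) <= (Cphi * V)%:E)%E.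
Hypothesis jn_le : (Int mu Q (fun x => expR (c0 * h x))%R <= (CJ * V)%:E)%E.

Lemma Int_bump (A : set X) (D kap : R) : measurable A -> A `<=` Q -> 0 < kap ->
  (mu A <= (D * expR (- kap) * V)%:E)%E ->
  (Int mu A (fun x => (1 + h x) ^+ m * y x)%R <=
    (CY * ((kap / 2) `^ (- eps) * Cphi + (D + CJ) * expR (- kap / 4)) * V)%:E)%E.
Proof.
move=> mA AQ kap0 muA.
have mP : measurable_fun setT (fun x => Phi m eps (y x)).
  by apply: measurableT_comp my; exact: measurable_Phi.
have P0 x : 0 <= Phi m eps (y x) by exact: Phi_ge0.
have mE : measurable_fun setT (fun x => expR (c0 * h x)) by mfun.
pose F x := CY * ((kap / 2) `^ (- eps) * Phi m eps (y x) + expR (3 / 4 * kap) + expR (- kap / 4) * expR (c0 * h x)).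
have mF1 : measurable_fun setT (fun x => (kap / 2) `^ (- eps) * Phi m eps (y x)) by mfun.
have k0 : 0 <= (kap / 2) `^ (- eps) by exact: powR_ge0.
have F10 x : 0 <= (kap / 2) `^ (- eps) * Phi m eps (y x) by rewrite mulr_ge0.
have mF3 : measurable_fun setT (fun x => expR (- kap / 4) * expR (c0 * h x)) by mfun.
have F30 x : 0 <= expR (- kap / 4) * expR (c0 * h x) by rewrite mulr_ge0 ?expR_ge0.
apply: (@le_trans _ _ (Int mu A F)).
  apply: Int_le => x; first by rewrite mulr_ge0 // exprn_ge0 // addr_ge0.
  by move=> _; exact: young.
rewrite /F Int_Z //; last 2 first.
- by mfun.
- by move=> x; rewrite !addr_ge0 ?expR_ge0.
rewrite -[X in (_ <= X%:E)%E]mulrA EFinM; apply: lee_wpmul2l; first by rewrite lee_fin.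
rewrite Int_D //; last 2 first.
- by mfun.
- by move=> x; rewrite addr_ge0 ?expR_ge0.
rewrite Int_D //.
rewrite Int_Z // Int_cst // Int_Z ?expR_ge0 //.
have h1 : (((kap / 2) `^ (- eps))%:E * Int mu A (fun x => Phi m eps (y x)) <= ((kap / 2) `^ (- eps) * (Cphi * V))%:E)%E.
  rewrite EFinM; apply: lee_wpmul2l; first by rewrite lee_fin.
  by apply: le_trans phi_le; exact: Int_subset.
have h2 : ((expR (3 / 4 * kap))%:E * mu A <= (D * expR (- kap / 4) * V)%:E)%E.
  apply: le_trans (lee_wpmul2l _ muA) _; first by rewrite lee_fin expR_ge0.
  rewrite -EFinM lee_fin mulrA mulrCA -expRD; apply: eq_ler; congr (_ * expR _ * _); lra.
have h3 : ((expR (- kap / 4))%:E * Int mu A (fun x => expR (c0 * h x))%R <= (expR (- kap / 4) * (CJ * V))%:E)%E.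
  rewrite EFinM; apply: lee_wpmul2l; first by rewrite lee_fin expR_ge0.
  by apply: le_trans jn_le; apply: Int_subset => // x; exact: expR_ge0.
apply: le_trans (leeD (leeD h1 h2) h3) _; rewrite -!EFinD lee_fin.
by apply: eq_ler; ring.
Qed.

End bumps.

Section homogeneity.
Context {d : measure_display} {X : measurableType d} {R : realType}.
Variable mu : {measure set X -> \bar R}.

(** The Luxemburg norm is an infimum, so its defining inequality is at hand for [r > lam] only; the
    bound follows by homogeneity as [r] decreases to [lam], including [lam = 0]. *)
Lemma Int_homog_le (A : set X) (H u : X -> R) (lam K : R) : measurable A ->
  measurable_fun setT H -> measurable_fun setT u -> (forall x, 0 <= H x) -> (forall x, 0 <= u x) ->
  0 <= lam -> 0 <= K ->
  (forall r, lam < r -> (Int mu A (fun x => H x * (u x / r))%R <= K%:E)%E) ->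
  (Int mu A (fun x => H x * u x)%R <= (lam * K)%:E)%E.
Proof.
move=> mA mH mu_ H0 u0 lam0 K0 hr.
have h r : lam < r -> (Int mu A (fun x => H x * u x)%R <= (r * K)%:E)%E.
  move=> lr; have r0 : 0 < r by exact: le_lt_trans lr.
  have -> : (fun x => H x * u x) = (fun x => r * (H x * (u x / r))).
    by apply/funext => x; field; rewrite gt_eqF.
  have my : measurable_fun setT (fun x => u x / r) by mfun.
  rewrite Int_Z ?(ltW r0) //; last 2 first.
  - by mfun.
  - by move=> x; rewrite mulr_ge0 // divr_ge0 // ltW.
  by rewrite EFinM; apply: lee_wpmul2l; [rewrite lee_fin ltW|exact: hr].
apply/lee_addgt0Pr => e e0; rewrite -EFinD.
apply: le_trans (h (lam + e / (K + 1)) _) _.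
  by rewrite ltrDl divr_gt0 // ltr_wpDl.
rewrite lee_fin mulrDl lerD2l -mulrA ler_piMr ?(ltW e0) // ler_pdivrMl ?ltr_wpDl //; lra.
Qed.

End homogeneity.

(** * Integrals over the bad sets *)

Section bad_set.
Context {R : realType} {n : nat}.
Local Notation X := (Rn R n).
Variable mu : {measure set X -> \bar R}.
Hypothesis mu_leb : is_lebesgue mu.
Variables (m : nat) (eps eta Cv Cs CJ c0 CY t rho : R).
Hypothesis eps0 : 0 < eps.
Hypothesis eta0 : 0 < eta.
Hypothesis Cv0 : 0 < Cv.
Hypothesis Cs0 : 0 < Cs.
Hypothesis CJ0 : 0 <= CJ.
Hypothesis c00 : 0 < c0.
Hypothesis CY0 : 0 <= CY.
Hypothesis young : forall kap z t, 0 < kap -> 0 <= z -> 0 <= t -> (1 + z) ^+ m * t <=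
  CY * ((kap / 2) `^ (- eps) * Phi m eps t + expR (3 / 4 * kap) + expR (- kap / 4) * expR (c0 * z)).
Hypothesis t0 : 0 < t.
Hypothesis rho1 : 1 < rho.

Definition bump_const (D kap : R) : R :=
  CY * ((kap / 2) `^ (- eps) * (Cv `^ eta * Cs) + (D + CJ) * expR (- kap / 4)).
(** One term for each part of the bad set: the count exceeds [2 ^ k], of relative measure at most
    [3 exp (- ln (1 + t) 2 ^ k)]; the oscillation exceeds [rho ^ k]; the weight is small, where [H]
    is at most [(rho ^ k) ^ m] and the gain is [(2 ^- k) ^ eta]. *)
Definition bad_const (k : nat) : R :=
  bump_const 3 (ln (1 + t) * 2 ^+ k) + bump_const (expR c0 * CJ) (c0 * rho ^+ k) +
  (rho ^+ k) ^+ m * (2^-1 ^+ k) `^ eta * Cs.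

Lemma bump_const_ge0 D kap : 0 <= D -> 0 <= bump_const D kap.
Proof.
move=> D0; rewrite mulr_ge0 // addr_ge0 // ?mulr_ge0 ?powR_ge0 ?expR_ge0 ?(ltW Cs0) //.
exact: addr_ge0.
Qed.

Lemma bad_const_ge0 k : 0 <= bad_const k.
Proof.
rewrite !addr_ge0 ?bump_const_ge0 ?mulr_ge0 ?expR_ge0 ?powR_ge0 ?exprn_ge0 ?(ltW Cs0) //.
by rewrite ltW // (lt_trans ltr01).
Qed.

Variables (o : X) (L : R).
Hypothesis L0 : 0 < L.
Variables (T : seq (@cell n)) (Lam : R).
Hypothesis car : forall q,
  \sum_(p <- T | `[< gcell o L p `<=` gcell o L q >]) glen L p ^+ n <= Lam * glen L q ^+ n.
Hypothesis tLam : t * Lam <= 2^-1.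
Variables (u v b : X -> R) (p : @cell n) (a c lam : R).
Hypothesis mu_ : measurable_fun setT u.
Hypothesis mv : measurable_fun setT v.
Hypothesis mb : measurable_fun setT b.
Hypothesis u0 : forall x, 0 <= u x.
Hypothesis v0 : forall x, 0 < v x.
Hypothesis a0 : 0 < a.
Hypothesis lam0 : 0 <= lam.
Let V : R := glen L p ^+ n.
Let Q := gcell o L p.
Hypothesis Hv : {ae mu, forall x, Q x -> v x <= Cv * a}.
Hypothesis Hs : (Int mu Q (fun x => v x `^ (- eta))%R <= (Cs * a `^ (- eta) * V)%:E)%E.
Hypothesis HJ : (Int mu Q (fun x => expR (c0 * `|b x - c|))%R <= (CJ * V)%:E)%E.
Hypothesis Hlam : forall r, lam < r ->
  (Int mu Q (fun x => Phi m eps (u x / r) * v x `^ (- eta))%R <= Int mu Q (fun x => v x `^ (- eta))%R)%E.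

Let h x : R := `|b x - c|.
Let mh : measurable_fun setT h. Proof. by rewrite /h; mfun. Qed.
Let h0 x : 0 <= h x. Proof. exact: normr_ge0. Qed.
Let mQ : measurable Q. Proof. exact: measurable_gcell. Qed.
Let V0 : 0 < V. Proof. by rewrite exprn_gt0 // glen_gt0. Qed.
Let muQ : mu Q = V%:E. Proof. exact: mu_gcell. Qed.
Let rho0 : 0 < rho. Proof. exact: lt_trans rho1. Qed.

Definition bad_set (k : nat) : set X := gcell o L p `&` [set x |
  ((2 ^ k < cnt o L T p x)%N \/ rho ^+ k < 1 + `|b x - c|) \/ 2 ^+ k * v x < a].

Lemma measurable_bad_set k : measurable (bad_set k).
Proof.
apply: measurableI => //; apply: measurableU; first apply: measurableU.
- exact: measurable_cnt_gt.
- by apply: measurable_gt_set; mfun.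
- rewrite (_ : (fun x => _) = [set x | - a < - (2 ^+ k * v x)]).
    by apply: measurable_gt_set; apply: measurableT_comp => //; mfun.
  by apply/seteqP; split => x /=; rewrite ltrN2.
Qed.

Section fixed_r.
Variable r : R.
Hypothesis lr : lam < r.
Let r0 : 0 < r. Proof. exact: le_lt_trans lr. Qed.
Let y x : R := u x / r.
Let my : measurable_fun setT y. Proof. by rewrite /y; mfun. Qed.
Let y0 x : 0 <= y x. Proof. by rewrite divr_ge0 // ltW. Qed.
Let sg x : R := v x `^ (- eta).
Let msg : measurable_fun setT sg. Proof. by rewrite /sg; mfun. Qed.
Let sg0 x : 0 <= sg x. Proof. exact: powR_ge0. Qed.
Let F x : R := Phi m eps (y x).
Let mF : measurable_fun setT F.
Proof. by apply: measurableT_comp my; exact: measurable_Phi. Qed.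
Let F0 x : 0 <= F x. Proof. exact: Phi_ge0. Qed.

Let Fs : (Int mu Q (fun x => F x * sg x)%R <= (Cs * a `^ (- eta) * V)%:E)%E.
Proof. exact: le_trans (Hlam lr) Hs. Qed.

Let apow (C : R) : 0 <= C -> (C * a) `^ eta * (Cs * a `^ (- eta) * V) = C `^ eta * Cs * V.
Proof.
move=> C0; rewrite powRM ?(ltW a0) // powRN.
by field; rewrite gt_eqF // powR_gt0.
Qed.

(** Where [v <= A], the weight [v ^ (- eta)] is at least [A ^ (- eta)]. With [A = Cv a] this turns
    the weighted Orlicz condition into an unweighted one; with [A = a / 2 ^ k] it yields the gain
    where the weight is small. *)
Let wpow (A : R) x : 0 < A -> v x <= A -> F x <= A `^ eta * (F x * sg x).
Proof.
move=> A0 vA; rewrite mulrCA ler_peMr // /sg powRN ler_pdivlMr ?powR_gt0 // mul1r.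
by apply: ge0_ler_powR; rewrite ?nnegrE ?(ltW A0) ?(ltW (v0 _)) ?(ltW eta0).
Qed.

Lemma Int_Phi_cell : (Int mu Q F <= (Cv `^ eta * Cs * V)%:E)%E.
Proof.
have mFs : measurable_fun setT (fun x => F x * sg x) by mfun.
apply: (@le_trans _ _ (Int mu Q (fun x => (Cv * a) `^ eta * (F x * sg x))%R)).
  apply: Int_ae_le => //.
  - by mfun.
  - by move=> x; apply: mulr_ge0; [exact: powR_ge0|exact: mulr_ge0].
  by move: Hv; apply: filterS => x /= hv xQ; apply: wpow (hv xQ); exact: mulr_gt0.
rewrite Int_Z ?powR_ge0 //; last by move=> x; rewrite mulr_ge0.
apply: le_trans (lee_wpmul2l _ Fs) _; first by rewrite lee_fin powR_ge0.
by rewrite -EFinM apow // ltW.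
Qed.

Lemma Int_cell_le : (Int mu Q y <= (Cv `^ eta * Cs * V)%:E)%E.
Proof.
apply: le_trans Int_Phi_cell; apply: Int_le => // x _; apply: Phi_ge => //; exact: ltW.
Qed.

Lemma Int_bad_set_r k :
  (Int mu (bad_set k) (fun x => (1 + h x) ^+ m * y x)%R <= (bad_const k * V)%:E)%E.
Proof.
pose g x := (1 + h x) ^+ m * y x.
have mg : measurable_fun setT g by rewrite /g; mfun.
have g0 x : 0 <= g x by rewrite mulr_ge0 // exprn_ge0 // addr_ge0.
pose A1 := Q `&` [set x | (2 ^ k < cnt o L T p x)%N].
pose A2 := Q `&` [set x | rho ^+ k < 1 + h x].
(* The points of large oscillation are removed, so that [H] is bounded on [A3]. *)
pose A3 := (Q `&` [set x | 2 ^+ k * v x < a]) `\` A2.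
have mA1 : measurable A1 by apply: measurableI => //; exact: measurable_cnt_gt.
have mA2 : measurable A2 by apply: measurableI => //; apply: measurable_gt_set; mfun.
have mA3 : measurable A3.
  apply: measurableD => //; apply: measurableI => //.
  rewrite (_ : [set x | 2 ^+ k * v x < a] = [set x | - a < - (2 ^+ k * v x)]).
    by apply: measurable_gt_set; apply: measurableT_comp => //; mfun.
  by apply/seteqP; split => x /=; rewrite ltrN2.
have IB (A : set X) (D kap : R) : measurable A -> A `<=` Q -> 0 < kap ->
    (mu A <= (D * expR (- kap) * V)%:E)%E -> (Int mu A g <= (bump_const D kap * V)%:E)%E.
  move=> mA AQ kap0 hA.
  exact: (@Int_bump _ _ mu Q V h y m eps c0 CY (Cv `^ eta * Cs) CJ mh my h0 y0 CY0 young Int_Phi_cell HJ A D kap mA AQ kap0 hA).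
apply: (@le_trans _ _ (Int mu ((A1 `|` A2) `|` A3) g)).
  apply: Int_subset => // x [xQ] [[h1|h2]|h3].
  - by left; left.
  - by left; right.
  - by case: (pselect (A2 x)) => x2; [left; right|right].
apply: le_trans (Int_setU_le mu _ mA3 mg g0) _; first exact: measurableU.
rewrite /bad_const !mulrDl !EFinD; apply: leeD.
  apply: le_trans (Int_setU_le mu mA1 mA2 mg g0) _; apply: leeD.
    apply: IB => //.
    - by move=> x [].
    - by rewrite mulr_gt0 ?exprn_gt0 // ln_gt0 // ltrDl.
    - apply: le_trans (mu_cnt_gt mu_leb L0 car t0 tLam p (2 ^ k)) _.
      rewrite lee_fin; apply: eq_ler; congr (_ * _ * _).
      rewrite expRN -natrX expRM_natr lnK //; by rewrite posrE addr_gt0.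
  apply: IB => //.
  - by move=> x [].
  - by rewrite mulr_gt0 ?exprn_gt0.
  - have mE : measurable_fun setT (fun x => expR (c0 * h x)) by mfun.
    (* The cutoff is on [1 + h], so the exponent loses [c0]; hence the factor [expR c0] in front of
       [CJ]. *)
    have P0 : 0 < expR (c0 * (rho ^+ k - 1)) by exact: expR_gt0.
    have hm := markov_Int mu mQ mE (fun x => expR_ge0 _) (ltW P0).
    have {}hm := le_trans hm HJ.
    apply: (@le_trans _ _ (mu (Q `&` [set x | expR (c0 * (rho ^+ k - 1)) <= expR (c0 * h x)]%R))).
      apply: le_measure; rewrite ?inE //.
        apply: measurableI => //; rewrite -[X in measurable X]setTI.
        exact: (measurable_fun_le measurableT (measurable_cst _) mE).
      move=> x [xQ /= hx]; split => //=; rewrite ler_expR ler_wpM2l ?(ltW c00) //; lra.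
    rewrite -(lee_pmul2l _ (_ : 0 < (expR (c0 * (rho ^+ k - 1)))%:E)%E) ?lte_fin //.
    apply: le_trans hm _; rewrite -EFinM lee_fin !mulrA -expRD.
    rewrite [expR _ * CJ]mulrC -[CJ * _ * _]mulrA -expRD (_ : _ + _ = 0) ?expR0 ?mulr1 //; ring.
rewrite -[X in (_ <= X%:E)%E]mulrA.
have mFs : measurable_fun setT (fun x => F x * sg x) by mfun.
have Fs0 x : 0 <= F x * sg x by rewrite mulr_ge0.
pose B := (a / 2 ^+ k) `^ eta.
apply: (@le_trans _ _ (Int mu A3 (fun x => (rho ^+ k) ^+ m * (B * (F x * sg x)))%R)).
  apply: Int_le => // x [[xQ /= hv] nx2]; apply: ler_pM => //; first by rewrite exprn_ge0 // addr_ge0.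
    rewrite lerXn2r ?nnegrE ?addr_ge0 ?exprn_ge0 ?(ltW rho0) //.
    by rewrite leNgt; apply/negP => hx; apply: nx2.
  apply: (@le_trans _ _ (F x)); first by apply: Phi_ge => //; exact: ltW.
  by apply: wpow; rewrite ?divr_gt0 ?exprn_gt0 // ler_pdivlMr ?exprn_gt0 // mulrC ltW.
have B0 : 0 <= B by exact: powR_ge0.
have rk0 : 0 <= (rho ^+ k) ^+ m by rewrite !exprn_ge0 // ltW.
rewrite Int_Z //; last 2 first.
- by mfun.
- by move=> x; rewrite mulr_ge0.
rewrite Int_Z // -mulrA EFinM; apply: lee_wpmul2l; first by rewrite lee_fin.
apply: (@le_trans _ _ (B%:E * (Cs * a `^ (- eta) * V)%:E)%E).
  apply: lee_wpmul2l; first by rewrite lee_fin.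
  by apply: le_trans Fs; apply: Int_subset => // x [[]].
by rewrite -EFinM lee_fin /B mulrC [a / _]mulrC -exprVn mulrC apow ?mulrA.
Qed.

End fixed_r.

Lemma Int_bad_set k : (Int mu (bad_set k) (fun x => (1 + `|b x - c|) ^+ m * u x)%R <=
  (lam * (bad_const k * V))%:E)%E.
Proof.
apply: Int_homog_le => //.
- exact: measurable_bad_set.
- by mfun.
- by rewrite mulr_ge0 ?bad_const_ge0 // ltW.
- by move=> r lr; exact: Int_bad_set_r.
Qed.

Lemma Int_cell_u : (Int mu Q u <= (lam * (Cv `^ eta * Cs * V))%:E)%E.
Proof.
have h1 : Int mu Q u = Int mu Q (fun x => 1 * u x)%R by apply: Int_eq => x _; rewrite mul1r.
rewrite h1; apply: (Int_homog_le (H := fun=> 1)) => //.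
  by rewrite !mulr_ge0 ?powR_ge0 // ltW.
move=> r lr; rewrite (@Int_eq _ _ _ mu Q _ (fun x => u x / r)); last by move=> x _; rewrite mul1r.
exact: Int_cell_le.
Qed.

End bad_set.

Lemma sum_half_le (R : realFieldType) (i j : nat) :
  \sum_(k <- index_iota i j) (2 ^+ k)^-1 <= 2 / 2 ^+ i :> R.
Proof.
rewrite /index_iota; move: (j - i)%N => d; elim: d i => [|d IH] i.
  by rewrite big_nil divr_ge0 // exprn_ge0.
rewrite /= big_cons; apply: le_trans (lerD (lexx _) (IH _)) _; rewrite exprS.
by apply: eq_ler; field; rewrite expf_neq0 // pnatr_eq0.
Qed.

Lemma last_level (P : nat -> bool) k0 : P k0 -> (forall k, P (k0 + k)%N) \/
  exists k, [/\ (k0 <= k)%N, P k & ~~ P k.+1].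
Proof.
move=> P0; case: (pselect (forall k, P (k0 + k)%N)) => allP; [by left|right].
have ex : exists k, ~~ P (k0 + k)%N.
  by apply: contrapT => nex; apply: allP => k; apply/negPn/negP => nk; apply: nex; exists k.
case: (ex_minnP ex) => k1 nk1 mink1.
have k1p : (0 < k1)%N by rewrite lt0n; apply/negP => /eqP e; move: nk1; rewrite e addn0 P0.
exists (k0 + k1.-1)%N; split; first exact: leq_addr.
  by apply/negPn/negP => /mink1; rewrite leqNgt prednK // leqnn.
by rewrite -addnS prednK.
Qed.

Lemma le0_of_geometric (R : realType) (x C : R) (k0 : nat) :
  (forall k, x <= C / 16 ^+ (k0 + k)) -> x <= 0.
Proof.
move=> hx; rewrite leNgt; apply/negP => x0.
have := @upper_nthrootP _ (C / x) _ (leqnn _); set N := Num.bound _ => h2.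
have p16 : 0 < 16 ^+ (k0 + N) :> R by rewrite exprn_gt0.
have := hx N; rewrite ler_pdivlMr // mulrC -ler_pdivlMr // leNgt => /negP; apply.
apply: (lt_le_trans h2); apply: (@le_trans _ _ (16 ^+ N)).
  by rewrite lerXn2r ?nnegrE //; lra.
by rewrite ler_weXn2l ?leq_addl //; lra.
Qed.

Lemma le_sum_pick (R : realDomainType) (I : eqType) (ks : seq I) (Pr : pred I) (c : R) k : uniq ks -> k \in ks ->
  Pr k -> 0 <= c -> c <= \sum_(i <- ks) (if Pr i then c else 0).
Proof.
move=> uk kk Pk c0; rewrite (bigD1_seq k) //= Pk lerDl; apply: sumr_ge0 => i _.
by case: ifP.
Qed.

(** * Summation over the levels *)

Section endgame.
Context {R : realType} {n : nat}.
Local Notation X := (Rn R n).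
Variable mu : {measure set X -> \bar R}.
Hypothesis mu_leb : is_lebesgue mu.
Variables (m M k0 : nat) (eps eta Lam Cv Cs CJ c0 CY CZ CS t rho : R).
Hypothesis eps0 : 0 < eps.
Hypothesis eta0 : 0 < eta.
Hypothesis Lam0 : 0 <= Lam.
Hypothesis Cv0 : 0 < Cv.
Hypothesis Cs0 : 0 < Cs.
Hypothesis CJ0 : 0 <= CJ.
Hypothesis c00 : 0 < c0.
Hypothesis CY0 : 0 <= CY.
Hypothesis CZ0 : 0 <= CZ.
Hypothesis young : forall kap z t, 0 < kap -> 0 <= z -> 0 <= t -> (1 + z) ^+ m * t <=
  CY * ((kap / 2) `^ (- eps) * Phi m eps t + expR (3 / 4 * kap) + expR (- kap / 4) * expR (c0 * z)).
Hypothesis young0 : forall z t, 0 <= z -> 0 <= t ->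
  (1 + z) ^+ m * t <= CZ * (Phi_m m t + expR (c0 * z)).
Hypothesis t0 : 0 < t.
Hypothesis tLam : t * Lam <= 2^-1.
Hypothesis rho1 : 1 < rho.
Hypothesis rho_m : rho ^+ m <= 2.
Hypothesis M0 : (0 < M)%N.
Hypothesis hM : 3 * Phi_m m 16 / (1 + t) ^+ M <= 2^-1.
Let C2 : R := CZ * (1 + CJ).
Hypothesis hk0 : C2 * (2 / 2 ^+ k0) <= 2^-1.
Let bc := bad_const m eps eta Cv Cs CJ c0 CY t rho.
Hypothesis hCS : forall K,
  \sum_(k <- index_iota k0 K) bc k * ((16 ^+ k)^-1 * Phi_m m (16 ^+ k.+1)) <= CS.

(** The first term comes from the cells failing the first condition, the second from the bad sets of
    all levels. Its 4 is a 2 from absorbing half of [v] and a 2 from [half_mass]. *)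
Definition end_const : R := Cv * (Cv `^ eta * Cs) * Phi_m m (16 ^+ k0) + 4 * (CZ * (1 + CJ)) * M%:R * CS.

Variables (o : X) (L : R).
Hypothesis L0 : 0 < L.
Variables (s : seq (@cell n)) (G : @cell n -> set X).
Hypothesis us : uniq s.
Hypothesis mG : forall p, measurable (G p).
Hypothesis Gsub : forall p, p \in s -> G p `<=` gcell o L p.
Hypothesis Gtriv : trivIset [set` s] G.
Hypothesis Glarge : forall p, p \in s -> (mu (gcell o L p) <= Lam%:E * mu (G p))%E.
Variables (u v f b : X -> R).
Hypothesis mu_ : measurable_fun setT u.
Hypothesis mv : measurable_fun setT v.
Hypothesis mf : measurable_fun setT f.
Hypothesis mb : measurable_fun setT b.
Hypothesis u0 : forall x, 0 <= u x.
Hypothesis v0 : forall x, 0 < v x.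
Hypothesis f0 : forall x, 0 <= f x.
Variables (a c lam F : @cell n -> R) (w : X -> \bar R).
Hypothesis a0 : forall p, 0 < a p.
Hypothesis lam0 : forall p, 0 <= lam p.
Hypothesis F0 : forall p, 0 <= F p.
Hypothesis w0 : forall x, (0 <= w x)%E.
Let V (p : @cell n) : R := glen L p ^+ n.
Let Q (p : @cell n) := gcell o L p.
Let h (p : @cell n) x : R := `|b x - c p|.
Let H (p : @cell n) x : R := (1 + h p x) ^+ m.
Hypothesis Hv : forall p, p \in s -> {ae mu, forall x, Q p x -> v x <= Cv * a p}.
Hypothesis Hs : forall p, p \in s ->
  (Int mu (Q p) (fun x => v x `^ (- eta))%R <= (Cs * a p `^ (- eta) * V p)%:E)%E.
Hypothesis HJ : forall p, p \in s ->
  (Int mu (Q p) (fun x => expR (c0 * `|b x - c p|))%R <= (CJ * V p)%:E)%E.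
Hypothesis Hlam : forall p, p \in s -> forall r, lam p < r ->
  (Int mu (Q p) (fun x => Phi m eps (u x / r) * v x `^ (- eta))%R <=
   Int mu (Q p) (fun x => v x `^ (- eta))%R)%E.
Hypothesis HF : forall p, p \in s ->
  ((F p * V p)%:E <= Int mu (Q p) (fun x => (1 + `|b x - c p|) ^+ m * f x)%R)%E.
Hypothesis Hw : forall p x, p \in s -> Q p x -> ((a p * lam p)%:E <= w x)%E.

Let I : \bar R := (\int[mu]_x ((Phi_m m (f x))%:E * w x))%E.
Let I0 : (0 <= I)%E.
Proof. by apply: integral_ge0 => x _; rewrite mule_ge0 // lee_fin Phi_ge0. Qed.
Let V0 p : 0 < V p. Proof. by rewrite exprn_gt0 // glen_gt0. Qed.
Let muQ p : mu (Q p) = (V p)%:E. Proof. exact: mu_gcell. Qed.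
Let mQ p : measurable (Q p). Proof. exact: measurable_gcell. Qed.
Let mh p : measurable_fun setT (h p). Proof. by rewrite /h; mfun. Qed.
Let mH p : measurable_fun setT (H p). Proof. by rewrite /H; have := mh p => ?; mfun. Qed.
Let H0 p x : 0 <= H p x. Proof. by rewrite exprn_ge0 // addr_ge0 // normr_ge0. Qed.
Let C20 : 0 <= C2. Proof. by rewrite mulr_ge0 // addr_ge0. Qed.
Let p16 k : 0 < 16 ^+ k :> R. Proof. by rewrite exprn_gt0. Qed.
Let p2 k : 0 < 2 ^+ k :> R. Proof. by rewrite exprn_gt0. Qed.

Let PhS k x : R := Phi_m m (16 ^+ k * f x).
Let mPh k : measurable_fun setT (PhS k).
Proof.
apply: (measurableT_comp (f := Phi_m m)); first exact: measurable_Phi.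
by mfun.
Qed.
Let Ph0 k x : 0 <= PhS k x. Proof. by rewrite Phi_ge0 // mulr_ge0. Qed.
Let mPhi : measurable_fun setT (fun x => Phi_m m (f x)).
Proof. by apply: (measurableT_comp (f := Phi_m m)); first exact: measurable_Phi. Qed.
Let Phi0 x : 0 <= Phi_m m (f x). Proof. by rewrite Phi_ge0. Qed.

Let P k p := (Int mu (Q p) (PhS k) <= (V p)%:E)%E.
Let T k : seq (@cell n) := seq.filter (fun p => P k p && ~~ P k.+1 p) s.
Let big_cells : seq (@cell n) := seq.filter (fun p => ~~ P k0 p) s.

Let Tin k p : p \in T k -> [/\ p \in s, P k p & ~~ P k.+1 p].
Proof. by rewrite mem_filter => /andP[/andP[]]. Qed.

Let car k q : \sum_(p <- T k | `[< gcell o L p `<=` gcell o L q >]) glen L p ^+ n <= Lam * glen L q ^+ n.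
Proof. exact: (carleson_sum mu_leb L0 us mG Gsub Gtriv Glarge Lam0). Qed.

(** Young's inequality for [H] and [16 ^ k f]: the average of [Phi_m (16 ^ k f)] is at most 1, that
    of the exponential at most [CJ]. *)
Lemma F_le k p : p \in s -> P k p -> F p <= C2 / 16 ^+ k.
Proof.
move=> ps Pk; rewrite ler_pdivlMr // -(ler_pM2r (V0 p)) -lee_fin mulrAC mulrC EFinM.
apply: le_trans (lee_wpmul2l _ (HF ps)) _; first by rewrite lee_fin ltW.
have mE : measurable_fun setT (fun x => expR (c0 * h p x)) by have := mh p => ?; mfun.
have E0 x : 0 <= expR (c0 * h p x) by exact: expR_ge0.
rewrite -Int_Z ?(ltW (p16 _)) //; last 2 first.
- by have := mH p => ?; mfun.
- by move=> x; rewrite mulr_ge0 // H0.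
apply: (@le_trans _ _ (Int mu (Q p) (fun x => CZ * (PhS k x + expR (c0 * h p x)))%R)).
  apply: Int_le => [x|x _]; first by rewrite !mulr_ge0 // ?H0 // ltW.
  by rewrite mulrCA; apply: young0; rewrite ?normr_ge0 // mulr_ge0 // ltW.
have mS : measurable_fun setT (fun x => PhS k x + expR (c0 * h p x)) by apply: measurable_funD => //; exact: mPh.
rewrite Int_Z //; last by move=> x; rewrite addr_ge0.
rewrite Int_D // /C2 -mulrA EFinM; apply: lee_wpmul2l; first by rewrite lee_fin.
by rewrite mulrDl mul1r EFinD; apply: leeD => //; exact: HJ.
Qed.

Lemma level_exists p : p \in s -> P k0 p -> exists K, F p = 0 \/
  exists k, (k0 <= k < K)%N /\ p \in T k.
Proof.
move=> ps P0; have [allP|[k [k0k Pk nPk]]] := @last_level (fun k => P k p) k0 P0.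
  exists 0%N; left; apply/eqP; rewrite eq_le F0 andbT.
  exact: (@le0_of_geometric _ (F p) C2 k0 (fun k => F_le ps (allP k))).
exists k.+1; right; exists k; split; first by rewrite k0k /=.
by rewrite mem_filter ps andbT; apply/andP; split.
Qed.

Lemma levels_exist : exists K, forall p, p \in s -> P k0 p -> F p = 0 \/
  exists k, (k0 <= k < K)%N /\ p \in T k.
Proof.
suff [K hK] : exists K, forall p, p \in s -> p \in s -> P k0 p -> F p = 0 \/
  exists k, (k0 <= k < K)%N /\ p \in T k by exists K => p ps; exact: hK.
have : forall s' : seq (@cell n), exists K, forall p, p \in s' -> p \in s -> P k0 p -> F p = 0 \/
  exists k, (k0 <= k < K)%N /\ p \in T k.
  elim=> [|p s' [K IH]]; first by exists 0%N.
  case: (pselect (p \in s /\ P k0 p)) => [[ps Pp]|np].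
    have [K' hK'] := level_exists ps Pp; exists (maxn K K') => q; rewrite inE => /orP[/eqP -> _ _|qs' qs Pq].
      case: hK' => [|[k [/andP[kk0 kK] kT]]]; [by left|right; exists k].
      by rewrite kk0 /= leq_max kK orbT.
    case: (IH q qs' qs Pq) => [|[k [/andP[kk0 kK] kT]]]; [by left|right; exists k].
    by rewrite kk0 /= leq_max kK.
  exists K => q; rewrite inE => /orP[/eqP -> ps Pp|]; [by case: np|exact: IH].
by apply.
Qed.

Let Phi16_ge0 k : 0 <= Phi_m m (16 ^+ k) :> R.
Proof. by rewrite Phi_ge0 // ltW. Qed.

(** [half_mass] with [phi = Phi_m (16 ^ (k + 1) f)]: on cells of level [k] its average is at most
    [Phi_m 16], as the condition holds at [k], and above 1, as it fails at [k + 1]. Where the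
    overlap is at most [M], the sum over the cells is done pointwise. *)
Lemma level_sum k : (\sum_(p <- T k) (a p * lam p * V p)%:E <=
  (2 * M%:R * Phi_m m (16 ^+ k.+1))%:E * I)%E.
Proof.
pose E p := gcell o L p `&` [set x | (cnt o L (T k) p x <= M)%N].
have mE p : measurable (E p).
  apply: measurableI => //; rewrite (_ : [set x | _] = ~` [set x | (M < cnt o L (T k) p x)%N]).
    by apply: measurableC; exact: measurable_cnt_gt.
  by apply/seteqP; split => x /= hx; [by rewrite ltnNge hx|rewrite leqNgt; apply/negP].
have r0 p : 0 <= a p * lam p by rewrite mulr_ge0 // ltW.
have hmass p : p \in T k -> ((V p)%:E <= (2 * Phi_m m (16 ^+ k.+1))%:E * Int mu (E p) (fun x => Phi_m m (f x)))%E.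
  move=> pT; have [ps Pk nPk] := Tin pT.
  have le1 q : q \in T k -> (Int mu (gcell o L q) (PhS k.+1) <= (Phi_m m 16 * glen L q ^+ n)%:E)%E.
    move=> qT; have [_ Pq _] := Tin qT.
    have c16 : 0 <= Phi_m m 16 :> R by rewrite Phi_ge0.
    rewrite EFinM; apply: le_trans _ (lee_wpmul2l _ Pq); last by rewrite lee_fin.
    rewrite -Int_Z //; apply: Int_le => // x _.
    by rewrite /PhS exprS -mulrA; apply: PhiM => //; rewrite mulr_ge0 // ltW.
  have ge1 : (mu (gcell o L p) <= Int mu (gcell o L p) (PhS k.+1))%E.
    by rewrite muQ ltW // ltNge.
  have := half_mass mu_leb L0 (car k) t0 tLam (mPh k.+1) (Ph0 k.+1) _ le1 hM ge1.
  rewrite muQ => h1; apply: le_trans (h1 _) _; first by rewrite Phi_ge0.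
  rewrite EFinM -muleA; apply: lee_wpmul2l => //.
  rewrite -Int_Z //; apply: Int_le => // x _; apply: PhiM => //; exact: ltW.
apply: (@le_trans _ _ (\sum_(p <- T k) (2 * Phi_m m (16 ^+ k.+1))%:E * ((a p * lam p)%:E * Int mu (E p) (fun x => Phi_m m (f x))))%E).
  rewrite big_seq [leRHS]big_seq; apply: lee_sum => p pT.
  by rewrite EFinM muleCA; apply: lee_wpmul2l; [rewrite lee_fin|exact: hmass].
rewrite -ge0_sume_distrr; last by move=> p _; rewrite mule_ge0 ?lee_fin // Int_ge0.
rewrite -[2 * M%:R * _]mulrAC [X in (_ <= X * _)%E]EFinM -muleA; apply: lee_wpmul2l; first by rewrite lee_fin mulr_ge0.
apply: sum_Int_mult => // [x|p x pT [xp _]].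
  apply: leq_trans (card_cnt_le o L (T k) x M); apply: sub_count => p /asboolP[xp hp].
  by apply/andP; split => //; apply/asboolP.
by have [ps _ _] := Tin pT; exact: Hw.
Qed.

Let Om : set X := \bigcup_(p in [set` big_cells]) gcell o L p.

(** The maximal cells are disjoint. On each, [v <= Cv a], the integral of [u] is at most a multiple
    of [lam V], and failure of the condition at [k0] bounds [V] by the integral of
    [Phi_m (16 ^ k0 f)]. *)
Lemma omega_le : (Int mu Om (fun x => u x * v x)%R <=
  (Cv * (Cv `^ eta * Cs) * Phi_m m (16 ^+ k0))%:E * I)%E.
Proof.
pose D : set (@cell n) := [set` big_cells].
pose mn := seq.filter (fun p => `[< minimal_cells o L D p >]) s.
have mnE p : minimal_cells o L D p <-> p \in mn.
  split; last by rewrite mem_filter => /andP[/asboolP].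
  move=> hp; rewrite mem_filter; apply/andP; split; first exact/asboolP.
  by have [] := hp; rewrite /D /= mem_filter => /andP[].
have OmE : Om = \bigcup_(p in [set` mn]) gcell o L p.
  rewrite /Om -(@bigcup_minimal _ _ o L L0 D); apply/seteqP; split => x [p hp xp]; exists p => //; exact/mnE.
have muv : measurable_fun setT (fun x => u x * v x) by mfun.
have uv0 x : 0 <= u x * v x by rewrite mulr_ge0 // ltW.
rewrite OmE; apply: le_trans (Int_bigcup_seq_le _ _ _ _ _) _ => //.
set Cf := Cv `^ eta * Cs; have Cf0 : 0 <= Cf by rewrite mulr_ge0 ?powR_ge0 // ltW.
set K := Cv * Cf * _; have K0 : 0 <= K by apply: mulr_ge0 => //; apply: mulr_ge0 => //; exact: ltW.
apply: (@le_trans _ _ (\sum_(p <- mn) K%:E * ((a p * lam p)%:E * Int mu (gcell o L p) (fun x => Phi_m m (f x))))%E).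
  rewrite big_seq [leRHS]big_seq; apply: lee_sum => p /mnE[Dp _].
  move: Dp; rewrite /D /= mem_filter => /andP[nP ps].
  have Va : 0 <= Cv * a p by rewrite mulr_ge0 // ltW.
  apply: (@le_trans _ _ (Int mu (gcell o L p) (fun x => Cv * a p * u x)%R)).
    apply: Int_ae_le => //; first by mfun.
      by move=> x; rewrite mulr_ge0.
    by have := Hv ps; apply: filterS => x hx xp; rewrite mulrC ler_wpM2r // hx.
  rewrite Int_Z //.
  have h1 := Int_cell_u eps0 eta0 Cv0 Cs0 L0 mu_ mv u0 v0 (a0 p) (lam0 p) (Hv ps) (Hs ps) (Hlam ps).
  apply: le_trans (lee_wpmul2l _ h1) _; first by rewrite lee_fin.
  have h2 : ((V p)%:E <= (Phi_m m (16 ^+ k0))%:E * Int mu (gcell o L p) (fun x => Phi_m m (f x)))%E.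
    apply: (@le_trans _ _ (Int mu (Q p) (PhS k0))); first by rewrite ltW // ltNge.
    rewrite -Int_Z //; apply: Int_le => // x _; apply: PhiM => //; exact: ltW.
  rewrite -EFinM -/(V p) -/Cf (_ : Cv * a p * (lam p * (Cf * V p)) = (Cv * Cf * (a p * lam p)) * V p); last by ring.
  rewrite EFinM; apply: le_trans (lee_wpmul2l _ h2) _; first by rewrite lee_fin; apply: mulr_ge0; [exact: mulr_ge0 (ltW Cv0) Cf0|exact: mulr_ge0 (ltW (a0 p)) (lam0 p)].
  by rewrite !muleA -!EFinM; apply: lee_wpmul2r; [exact: Int_ge0|rewrite lee_fin; apply: eq_ler; rewrite /K; ring].
rewrite -ge0_sume_distrr; last first.
  by move=> p _; rewrite mule_ge0 ?Int_ge0 // lee_fin mulr_ge0 // ltW.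
apply: lee_wpmul2l; first by rewrite lee_fin.
rewrite -[leRHS]mul1e; apply: (@sum_Int_mult _ _ _ mu _ mn (gcell o L) (fun p => a p * lam p) 1) => //.
- by move=> p; rewrite mulr_ge0 // ltW.
- move=> x; rewrite -size_filter; set l := seq.filter _ _.
  have ul : uniq l by rewrite !filter_uniq.
  have hl p q : p \in l -> q \in l -> p = q.
    rewrite !mem_filter => /andP[/asboolP xp /andP[/asboolP hp _]] /andP[/asboolP xq /andP[/asboolP hq _]].
    by apply: (trivIset_minimal L0 hp hq); exists x.
  case: l ul hl => // p [//|q l] /= /andP[npl _] hl.
  by move: npl; rewrite (hl p q) ?inE ?eqxx ?orbT.
- by move=> p x /mnE[]; rewrite /D /= mem_filter => /andP[_ ps] _; exact: Hw.
Qed.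

Let bad k p := bad_set rho o L (T k) v b p (a p) (c p) k.
Let mbad k p : measurable (bad k p). Proof. exact: measurable_bad_set. Qed.
Let bterm k p x : R := C2 / 16 ^+ k * a p * (H p x * \1_(bad k p) x).
Let bterm0 k p x : 0 <= bterm k p x.
Proof.
apply: mulr_ge0; last by apply: mulr_ge0 => //; exact: H0.
apply: mulr_ge0; last exact: ltW (a0 p).
by apply: divr_ge0; [exact: C20|exact: ltW (p16 k)].
Qed.
Let term p x : R := a p * F p * H p x * \1_(gcell o L p) x.
Let term0 p x : 0 <= term p x.
Proof. by rewrite !mulr_ge0 // ltW. Qed.

(* Off the bad sets the multiplicity of the cells, the oscillation of [b] and
   [a p / v x] are at most powers of [2 ^ k], which the gain [16 ^- k] absorbs. *)
Lemma level_term_le k x : \sum_(p <- T k) term p x <=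
  C2 * v x * (2 ^+ k)^-1 + \sum_(p <- T k) bterm k p x.
Proof.
pose gd p := `[< gcell o L p x >] && (cnt o L (T k) p x <= 2 ^ k)%N.
pose cst := C2 * v x / 4 ^+ k.
have p4 : 0 < 4 ^+ k :> R by rewrite exprn_gt0.
have cst0 : 0 <= cst by apply: divr_ge0; [apply: mulr_ge0; [exact: C20|exact: ltW]|exact: ltW].
apply: (@le_trans _ _ (\sum_(p <- T k) ((if gd p then cst else 0) + bterm k p x))).
  rewrite big_seq [leRHS]big_seq; apply: ler_sum => p pT; have [ps Pk _] := Tin pT.
  have Fk := F_le ps Pk.
  have ifge : 0 <= if gd p then cst else 0 by case: ifP.
  case: (pselect (gcell o L p x)) => xp; last first.
    by rewrite /term indicE memNset // mulr0; apply: addr_ge0 => //; exact: bterm0.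
  case: (pselect (bad k p x)) => xb.
    apply: (@le_trans _ _ (bterm k p x)); last by rewrite lerDr.
    rewrite /term /bterm !indicE !mem_set // !mulr1 ler_wpM2r //.
    by rewrite mulrC ler_wpM2r // ltW.
  have [gp [hp ap]] : gd p /\ (1 + h p x <= rho ^+ k /\ a p <= 2 ^+ k * v x).
    split; last split.
    - apply/andP; split; first exact/asboolP.
      by rewrite leqNgt; apply/negP => hh; apply: xb; split => //; left; left.
    - by rewrite leNgt; apply/negP => hh; apply: xb; split => //; left; right.
    - by rewrite leNgt; apply/negP => hh; apply: xb; split => //; right.
  rewrite gp; apply: (@le_trans _ _ cst); last by rewrite lerDl; exact: bterm0.
  rewrite /term indicE mem_set // mulr1.
  have Hp : H p x <= 2 ^+ k.
    apply: (@le_trans _ _ ((rho ^+ k) ^+ m)).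
      by rewrite lerXn2r ?nnegrE ?addr_ge0 ?normr_ge0 ?exprn_ge0 // ltW // (lt_trans ltr01).
    rewrite -exprM mulnC exprM lerXn2r ?nnegrE ?exprn_ge0 //; by rewrite ltW // (lt_trans ltr01).
  have st : a p * F p * H p x <= (2 ^+ k * v x) * (C2 / 16 ^+ k) * 2 ^+ k.
    apply: ler_pM => //; first by rewrite mulr_ge0 // ltW.
    by apply: ler_pM => //; exact: ltW.
  apply: le_trans st _; rewrite /cst; apply: eq_ler.
  rewrite (_ : 16 = 4 * 4 :> R) ?exprMn; last by ring.
  rewrite (_ : 4 = 2 * 2 :> R) ?exprMn; last by ring.
  by field; rewrite gt_eqF.
rewrite big_split /= lerD2r -big_mkcond /= big_const_seq iter_addr_0.
apply: (@le_trans _ _ (cst *+ 2 ^ k)).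
  by rewrite ler_wpMn2l //; exact: card_cnt_le.
rewrite -[leLHS]mulr_natr natrX /cst (_ : 4 = 2 * 2 :> R) ?exprMn; last by ring.
by apply: eq_ler; field; rewrite gt_eqF.
Qed.

(** By the choice of [k0], the sum outside [Om] is at most [v / 2] plus the sum [B] over the bad
    sets. Where it exceeds [v] this forces [v <= 2 B], and the integral of [u B] is bounded by
    [Int_bad_set] and [level_sum]. *)
Lemma endgame : (Int mu [set x | v x < \sum_(p <- s) term p x]%R (fun x => u x * v x)%R <=
  end_const%:E * I)%E.
Proof.
have [K hK] := levels_exist.
pose ks := index_iota k0 K.
pose B x : R := \sum_(k <- ks) \sum_(p <- T k) bterm k p x.
have mbt k p : measurable_fun setT (bterm k p).
  by rewrite /bterm; have := mH p => ?; mfun; exact: measurable_indic.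
have mB : measurable_fun setT B.
  by apply: measurable_sum => k; apply: measurable_sum.
have B0 x : 0 <= B x by apply: sumr_ge0 => k _; apply: sumr_ge0 => p _; exact: bterm0.
have key x : v x < \sum_(p <- s) term p x -> ~ Om x -> v x <= 2 * B x.
  move=> hx nx.
  have h1 : \sum_(p <- s) term p x <= \sum_(k <- ks) \sum_(p <- T k) term p x.
    have -> : \sum_(k <- ks) \sum_(p <- T k) term p x =
        \sum_(p <- s) \sum_(k <- ks) (if P k p && ~~ P k.+1 p then term p x else 0).
      rewrite exchange_big /=; apply: eq_bigr => k _; rewrite big_filter [LHS]big_mkcond.
      by apply: eq_bigr => p _; case: ifP.
    rewrite big_seq [leRHS]big_seq; apply: ler_sum => p ps.
    case: (pselect (gcell o L p x)) => xp; last first.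
      by rewrite {1}/term indicE memNset // mulr0; apply: sumr_ge0 => k _; case: ifP.
    have Pp : P k0 p.
      apply: contrapT => /negP nP; apply: nx; exists p => //=.
      by rewrite mem_filter nP.
    case: (hK p ps Pp) => [Fp|[k [kK kT]]].
      by rewrite {1}/term Fp mulr0 !mul0r; apply: sumr_ge0 => k _; case: ifP.
    have kin : k \in ks by rewrite mem_index_iota.
    have [_ Pk nPk] := Tin kT; have PT : P k p && ~~ P k.+1 p by apply/andP.
    exact: (@le_sum_pick _ _ ks (fun k => P k p && ~~ P k.+1 p) (term p x) k (iota_uniq _ _) kin PT (term0 p x)).
  have h2 : \sum_(k <- ks) \sum_(p <- T k) term p x <= 2^-1 * v x + B x.
    apply: (@le_trans _ _ (\sum_(k <- ks) (C2 * v x * (2 ^+ k)^-1 + \sum_(p <- T k) bterm k p x))).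
      by apply: ler_sum => k _; exact: level_term_le.
    rewrite big_split /= lerD2r -mulr_sumr.
    apply: (@le_trans _ _ (C2 * v x * (2 / 2 ^+ k0))).
      by rewrite ler_wpM2l ?sum_half_le // mulr_ge0 // ltW.
    by rewrite mulrAC ler_wpM2r // ltW.
  by have := lt_le_trans hx (le_trans h1 h2); lra.
have mOm : measurable Om by apply: fin_bigcup_measurable => //; exact: finite_seq.
have muv : measurable_fun setT (fun x => u x * v x) by mfun.
have uv0 x : 0 <= u x * v x by rewrite mulr_ge0 // ltW.
pose A := [set x | v x <= 2 * B x].
have mA : measurable A.
  rewrite -[A]setTI; apply: (measurable_fun_le measurableT mv); mfun.
apply: (@le_trans _ _ (Int mu (Om `|` A) (fun x => u x * v x)%R)).
  apply: Int_subset => // x hx; case: (pselect (Om x)) => xO; [by left|right].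
  exact: key.
apply: le_trans (Int_setU_le mu mOm mA muv uv0) _.
rewrite /end_const EFinD ge0_muleDl ?lee_fin; last 2 first.
- by rewrite !mulr_ge0 ?powR_ge0 // ltW.
- have CS0 : 0 <= CS by have := hCS k0; rewrite /index_iota subnn big_nil.
  by rewrite mulr_ge0 // mulr_ge0 // mulr_ge0.
apply: leeD; first exact: omega_le.
apply: (@le_trans _ _ (Int mu setT (fun x => 2 * (\sum_(k <- ks) \sum_(p <- T k) u x * bterm k p x))%R)).
  apply: (@le_trans _ _ (Int mu A (fun x => 2 * (\sum_(k <- ks) \sum_(p <- T k) u x * bterm k p x))%R)).
    apply: Int_le => // x Ax.
    have -> : 2 * (\sum_(k <- ks) \sum_(p <- T k) u x * bterm k p x) = u x * (2 * B x).
      rewrite mulrCA; congr (2 * _); rewrite /B mulr_sumr; apply: eq_bigr => k _; by rewrite mulr_sumr.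
    by rewrite ler_wpM2l.
  by apply: Int_subset => // x; rewrite mulr_ge0 // sumr_ge0 // => k _; rewrite sumr_ge0 // => p _; rewrite mulr_ge0.
have mub k p : measurable_fun setT (fun x => u x * bterm k p x) by have := mbt k p => ?; mfun.
have ub0 k p x : 0 <= u x * bterm k p x by rewrite mulr_ge0.
rewrite Int_Z //; last 2 first.
- by apply: measurable_sum => k; exact: measurable_sum.
- by move=> x; apply: sumr_ge0 => k _; exact: sumr_ge0.
rewrite (@Int_sum _ _ _ mu setT _ ks xpredT) //; last 2 first.
- by move=> k; exact: measurable_sum.
- by move=> k x; exact: sumr_ge0.
have step k : (Int mu setT (fun x => \sum_(p <- T k) u x * bterm k p x)%R <=
    (C2 * 2 * M%:R * (bc k * ((16 ^+ k)^-1 * Phi_m m (16 ^+ k.+1))))%:E * I)%E.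
  rewrite (@Int_sum _ _ _ mu setT _ (T k) xpredT) //.
  have bc0 : 0 <= bc k by exact: bad_const_ge0.
  pose e := C2 / 16 ^+ k * bc k.
  have e0 : 0 <= e by rewrite mulr_ge0 // divr_ge0 // ltW.
  apply: (@le_trans _ _ (\sum_(p <- T k) e%:E * (a p * lam p * V p)%:E)%E).
    rewrite big_seq [leRHS]big_seq; apply: lee_sum => p pT; have [ps _ _] := Tin pT.
    have -> : Int mu setT (fun x => u x * bterm k p x)%R =
        Int mu setT (fun x => C2 / 16 ^+ k * a p * (H p x * u x * \1_(bad k p) x))%R.
      by apply: Int_eq => x _; rewrite /bterm; ring.
    have mHu : measurable_fun setT (fun x => H p x * u x) by have := mH p => ?; mfun.
    rewrite Int_Z //; last 3 first.
    - by mfun; exact: measurable_indic.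
    - by move=> x; rewrite !mulr_ge0.
    - by rewrite mulr_ge0 ?divr_ge0 // ltW.
    rewrite -Int_indic.
    have := Int_bad_set mu_leb eps0 eta0 Cv0 Cs0 CJ0 c00 CY0 young t0 rho1 L0 (car k) tLam
      mu_ mv mb u0 v0 (a0 p) (lam0 p) (Hv ps) (Hs ps) (HJ ps) (Hlam ps) k.
    move=> hb; apply: le_trans (lee_wpmul2l _ hb) _.
      by rewrite lee_fin mulr_ge0 ?divr_ge0 // ltW.
    by rewrite -!EFinM lee_fin; apply: eq_ler; rewrite /e /bc /V; ring.
  rewrite -ge0_sume_distrr; last by move=> p _; rewrite lee_fin !mulr_ge0 // ltW.
  apply: le_trans (lee_wpmul2l _ (level_sum k)) _; first by rewrite lee_fin.
  rewrite muleA -EFinM; apply: lee_wpmul2r => //; rewrite lee_fin; apply: eq_ler.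
  by rewrite /e; ring.
apply: (@le_trans _ _ (2%:E * (\sum_(k <- ks) (C2 * 2 * M%:R * (bc k * ((16 ^+ k)^-1 * Phi_m m (16 ^+ k.+1))))%:E * I))%E).
  by apply: lee_wpmul2l => //; apply: lee_sum => k _; exact: step.
rewrite -ge0_sume_distrl; last first.
  move=> k _; rewrite lee_fin; apply: mulr_ge0.
    by apply: mulr_ge0 => //; apply: mulr_ge0 => //; exact: C20.
  apply: mulr_ge0; first exact: bad_const_ge0.
  by apply: mulr_ge0 => //; rewrite invr_ge0 ltW.
rewrite sumEFin muleA -EFinM; apply: lee_wpmul2r => //; rewrite lee_fin -mulr_sumr.
apply: le_trans (_ : 2 * (C2 * 2 * M%:R * CS) <= _).
  apply: ler_wpM2l => //; apply: ler_wpM2l; last exact: hCS.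
  by apply: mulr_ge0 => //; apply: mulr_ge0 => //; exact: C20.
by apply: eq_ler; rewrite /C2; ring.
Qed.

End endgame.

(** * Constants uniform in the level *)

Section constants.
Context {R : realType}.

Lemma bernoulli_le (x : R) k : 0 <= x -> 1 + k%:R * x <= (1 + x) ^+ k.
Proof.
move=> x0; elim: k => [|k IH]; first by rewrite mul0r addr0 expr0.
have := ler_wpM2l (_ : 0 <= 1 + x) IH; rewrite addr_ge0 // => /(_ isT) h.
rewrite exprS; apply: le_trans h; rewrite -natr1.
have : 0 <= k%:R * x * x by rewrite !mulr_ge0.
nra.
Qed.

Lemma exists_pow_ge (t A : R) : 0 < t -> 0 <= A ->
  exists2 M : nat, (0 < M)%N & 3 * A / (1 + t) ^+ M <= 2^-1.
Proof.
move=> t0 A0; have q0 : 0 <= 6 * A / t by rewrite divr_ge0 ?mulr_ge0 // ltW.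
have := archi_boundP q0; move: (Num.bound _) => N; rewrite ltr_pdivrMr // => h.
exists N.+1 => //; have P0 : 0 < (1 + t) ^+ N.+1 by rewrite exprn_gt0 // addr_gt0.
rewrite ler_pdivrMr //; have := bernoulli_le N.+1 (ltW t0); rewrite -natr1 mulrDl mul1r.
lra.
Qed.

Lemma exists_pow2_ge (A : R) : exists k, A * (2 / 2 ^+ k) <= 2^-1.
Proof.
exists (Num.bound (4 * A)); have := @upper_nthrootP _ (4 * A) _ (leqnn _); move: (Num.bound _) => k h.
rewrite mulrA ler_pdivrMr ?exprn_gt0 //; lra.
Qed.

(* Only exponential decay of the constants of the levels [k] matters; it absorbs
   the polynomial factors coming from [Phi_m m (16 ^ k)]. *)
Definition decays (a : nat -> R) := exists K g : R, [/\ 0 <= K, 0 < g &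
  forall k, a k <= K * expR (- (g * k%:R))].

Lemma decaysD a1 a2 : decays a1 -> decays a2 -> decays (fun k => a1 k + a2 k).
Proof.
move=> [K1 [g1 [K10 g10 h1]]] [K2 [g2 [K20 g20 h2]]].
exists (K1 + K2), (Num.min g1 g2); split; [exact: addr_ge0|by rewrite lt_min g10 g20|move=> k].
have e g : Num.min g1 g2 <= g -> expR (- (g * k%:R)) <= expR (- (Num.min g1 g2 * k%:R)).
  by move=> hg; rewrite ler_expR lerN2 ler_wpM2r.
rewrite mulrDl; apply: lerD.
  by apply: le_trans (h1 k) _; rewrite ler_wpM2l // e // ge_min lexx.
by apply: le_trans (h2 k) _; rewrite ler_wpM2l // e // ge_min lexx orbT.
Qed.

Lemma decaysZ C a : 0 <= C -> decays a -> decays (fun k => C * a k).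
Proof.
move=> C0 [K [g [K0 g0 h]]]; exists (C * K), g; split => // [|k]; first exact: mulr_ge0.
by rewrite -mulrA ler_wpM2l.
Qed.

Lemma decays_expR C (g : R) : 0 <= C -> 0 < g -> decays (fun k => C * expR (- (g * k%:R))).
Proof. by move=> C0 g0; exists C, g. Qed.

Lemma decays_powR C (A r e : R) : 0 <= C -> 0 < A -> 1 < r -> 0 < e ->
  decays (fun k => C * (A * r ^+ k) `^ (- e)).
Proof.
move=> C0 A0 r1 e0; have r0 : 0 < r by exact: lt_trans r1.
exists (C * A `^ (- e)), (e * ln r); split => [||k].
- by rewrite mulr_ge0 ?powR_ge0.
- by rewrite mulr_gt0 // ln_gt0.
- rewrite -[leRHS]mulrA; apply: ler_wpM2l => //; rewrite powRM ?exprn_ge0 ?(ltW A0) ?(ltW r0) //.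
  apply: ler_wpM2l; first exact: powR_ge0.
  rewrite -(powR_mulrn _ (ltW r0)) -powRrM {1}/powR gt_eqF // ler_expR.
  by apply: eq_ler; ring.
Qed.

(** Bernoulli's inequality [r ^ k >= k (r - 1)] reduces the double exponential to a simple one. *)
Lemma decays_expR_pow C (A r : R) : 0 <= C -> 0 < A -> 1 < r ->
  decays (fun k => C * expR (- (A * r ^+ k))).
Proof.
move=> C0 A0 r1; exists C, (A * (r - 1)); split => // [|k].
  by rewrite mulr_gt0 // subr_gt0.
rewrite ler_wpM2l // ler_expR lerN2 -mulrA ler_wpM2l ?(ltW A0) //.
have r10 : 0 <= r - 1 by rewrite subr_ge0 ltW.
have := bernoulli_le k r10; rewrite (_ : 1 + (r - 1) = r) 1?mulrC; last by ring.
move=> h; apply: le_trans h.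
by rewrite lerDr.
Qed.

Lemma decays_le a1 a2 : (forall k, a1 k <= a2 k) -> decays a2 -> decays a1.
Proof.
by move=> h [K [g [K0 g0 h2]]]; exists K, g; split => // k; exact: le_trans (h k) (h2 k).
Qed.

Lemma Phi_m_pow16 m k : (16 ^+ k)^-1 * Phi_m m (16 ^+ k.+1) = 16 * (1 + k.+1%:R * ln 16) ^+ m :> R.
Proof.
have p16 : 0 < 16 ^+ k :> R by rewrite exprn_gt0.
rewrite Phi_mE exprS; have -> : log_plus (16 * 16 ^+ k) = k.+1%:R * ln 16 :> R.
  rewrite -exprS /log_plus lnXn; last lra.
  rewrite mulr_natl; apply/max_idPr.
  by rewrite mulrn_wge0 // ln_ge0 //; lra.
by field; rewrite gt_eqF.
Qed.

(** By [Phi_m_pow16] the extra factor is polynomial in [k]; it is absorbed by half of the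
    exponential rate, and a geometric series remains. *)
Lemma decays_sum m a : (forall k, 0 <= a k) -> decays a -> exists C : R, forall (ks : seq nat), uniq ks ->
  \sum_(k <- ks) a k * ((16 ^+ k)^-1 * Phi_m m (16 ^+ k.+1)) <= C.
Proof.
move=> a0 [K [g [K0 g0 h]]].
have l0 : 0 < ln 16 :> R by rewrite ln_gt0 //; lra.
have d0 : 0 < g / (2 * ln 16) by rewrite divr_gt0 // mulr_gt0.
have [C C0 HC] := one_plus_pow_le m d0.
pose th : R := expR (- g / 2).
have th0 : 0 < th by exact: expR_gt0.
have th1 : th < 1 by rewrite /th -[ltRHS]expR0 ltr_expR; lra.
have t1 : 0 < 1 - th by rewrite subr_gt0.
pose D := K * (16 * (C * expR (g / 2))).
have D0 : 0 <= D by rewrite !mulr_ge0 ?expR_ge0 // ltW.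
have term k : a k * ((16 ^+ k)^-1 * Phi_m m (16 ^+ k.+1)) <= D * th ^+ k.
  rewrite Phi_m_pow16; have k0 : 0 <= k.+1%:R * ln 16 :> R by rewrite mulr_ge0 // ltW.
  apply: (@le_trans _ _ (K * expR (- (g * k%:R)) * (16 * (C * expR (g / (2 * ln 16) * (k.+1%:R * ln 16)))))).
    apply: ler_pM => //; first by rewrite mulr_ge0 // exprn_ge0 // addr_ge0.
    by rewrite ler_wpM2l // HC.
  have -> : g / (2 * ln 16) * (k.+1%:R * ln 16) = g / 2 * k%:R + g / 2.
    by rewrite -natr1; field; rewrite gt_eqF.
  have -> : th ^+ k = expR (- (g * k%:R)) * expR (g / 2 * k%:R).
    by rewrite /th -expRM_natl -expRD; congr expR; field.
  by rewrite expRD /D; apply: eq_ler; ring.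
have geo N : \sum_(0 <= k < N) th ^+ k <= (1 - th)^-1.
  rewrite -[leRHS]mul1r ler_pdivlMr // mulr_suml; apply: (@le_trans _ _ (1 - th ^+ N)); last first.
    by rewrite gerBl exprn_ge0 // ltW.
  elim: N => [|N IH]; first by rewrite big_geq // expr0 subrr.
  by rewrite big_nat_recr //=; apply: le_trans (lerD IH (lexx _)) _; rewrite exprS; apply: eq_ler; ring.
exists (D * (1 - th)^-1) => ks uks.
apply: (@le_trans _ _ (\sum_(k <- ks) D * th ^+ k)); first by apply: ler_sum => k _.
rewrite -mulr_sumr ler_wpM2l //; pose N := (\max_(k <- ks) k).+1.
apply: le_trans (geo N); rewrite [leRHS](bigID (mem ks)) /=.
apply: (@le_trans _ _ (\sum_(0 <= k < N | k \in ks) th ^+ k)); last first.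
  by rewrite lerDl; apply: sumr_ge0 => k _; rewrite exprn_ge0 // ltW.
have pe : perm_eq ks [seq k <- index_iota 0 N | k \in ks].
  apply: uniq_perm => //; first by rewrite filter_uniq // iota_uniq.
  move=> k; rewrite mem_filter mem_index_iota /=; case ki : (k \in ks) => //=.
  by rewrite /N ltnS leq_bigmax_seq.
by rewrite [leLHS](perm_big _ pe) big_filter.
Qed.

End constants.

Section uniform_endgame.
Context {R : realType} {n : nat}.
Local Notation X := (Rn R n).
Variable mu : {measure set X -> \bar R}.
Hypothesis mu_leb : is_lebesgue mu.
Variables (m : nat) (eps eta Lam Cv Cs CJ c0 : R).
Hypothesis eps0 : 0 < eps.
Hypothesis eta0 : 0 < eta.
Hypothesis eta1 : eta <= 1.
Hypothesis Lam0 : 0 <= Lam.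
Hypothesis Cv0 : 0 < Cv.
Hypothesis Cs0 : 0 < Cs.
Hypothesis CJ0 : 0 <= CJ.
Hypothesis c00 : 0 < c0.

(** All auxiliary parameters are chosen from the constants of the weight and of [b] before the grid,
    the cells and the functions are given, so one constant serves them all. *)
Lemma endgame_uniform : exists2 C : R, 0 < C &
  forall (o : X) (L : R), 0 < L ->
  forall (s : seq (@cell n)) (G : @cell n -> set X), uniq s ->
  (forall p, measurable (G p)) -> (forall p, p \in s -> G p `<=` gcell o L p) ->
  trivIset [set` s] G ->
  (forall p, p \in s -> (mu (gcell o L p) <= Lam%:E * mu (G p))%E) ->
  forall (u v f b : X -> R), measurable_fun setT u -> measurable_fun setT v ->
  measurable_fun setT f -> measurable_fun setT b ->
  (forall x, 0 <= u x) -> (forall x, 0 < v x) -> (forall x, 0 <= f x) ->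
  forall (a c lam F : @cell n -> R) (w : X -> \bar R),
  (forall p, 0 < a p) -> (forall p, 0 <= lam p) -> (forall p, 0 <= F p) ->
  (forall x, (0 <= w x)%E) ->
  (forall p, p \in s -> {ae mu, forall x, gcell o L p x -> v x <= Cv * a p}) ->
  (forall p, p \in s ->
    (Int mu (gcell o L p) (fun x => v x `^ (- eta))%R <= (Cs * a p `^ (- eta) * glen L p ^+ n)%:E)%E) ->
  (forall p, p \in s ->
    (Int mu (gcell o L p) (fun x => expR (c0 * `|b x - c p|))%R <= (CJ * glen L p ^+ n)%:E)%E) ->
  (forall p, p \in s -> forall r, lam p < r ->
    (Int mu (gcell o L p) (fun x => Phi m eps (u x / r) * v x `^ (- eta))%R <=
     Int mu (gcell o L p) (fun x => v x `^ (- eta))%R)%E) ->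
  (forall p, p \in s ->
    ((F p * glen L p ^+ n)%:E <= Int mu (gcell o L p) (fun x => (1 + `|b x - c p|) ^+ m * f x)%R)%E) ->
  (forall p x, p \in s -> gcell o L p x -> ((a p * lam p)%:E <= w x)%E) ->
  (Int mu [set x | v x < \sum_(p <- s) a p * F p * (1 + `|b x - c p|) ^+ m * \1_(gcell o L p) x]%R
     (fun x => u x * v x)%R <= C%:E * \int[mu]_x ((Phi_m m (f x))%:E * w x))%E.
Proof.
have [CY CY0 young] := young_bump m (ltW eps0) c00.
have [CZ' CZ0' young'] := young_bump m (lexx 0) c00.
pose CZ := CZ' * (expR (3 / 4) + 1).
have CZ0 : 0 < CZ by rewrite mulr_gt0 // addr_gt0 // expR_gt0.
(* The case [eps = 0], [kap = 1] of the Young inequality; its constant term is absorbed since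
   [expR (c0 * z) >= 1]. *)
have young0 z t : 0 <= z -> 0 <= t -> (1 + z) ^+ m * t <= CZ * (Phi_m m t + expR (c0 * z)).
  move=> z0 t0; apply: le_trans (young' 1 z t ltr01 z0 t0) _.
  rewrite /CZ -[leRHS]mulrA ler_wpM2l ?(ltW CZ0') // oppr0 powRr0 mul1r mulr1.
  have P0 : 0 <= Phi m 0 t by exact: Phi_ge0.
  have E1 : 1 <= expR (c0 * z) by rewrite -[leLHS]expR0 ler_expR mulr_ge0 // ltW.
  have E3 : 0 <= expR (3 / 4) :> R by exact: expR_ge0.
  have E4 : expR (- 1 / 4) <= 1 :> R by rewrite -[leRHS]expR0 ler_expR; lra.
  have : expR (3 / 4) <= expR (3 / 4) * expR (c0 * z) by rewrite ler_peMr.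
  have : expR (- 1 / 4) * expR (c0 * z) <= expR (c0 * z) by rewrite ler_piMl ?expR_ge0.
  have : 0 <= expR (3 / 4) * Phi m 0 t by rewrite mulr_ge0.
  by rewrite mulrDl mul1r mulrDr -/(Phi_m m t) /Phi_m; lra.
(* Any [t] with [t Lam <= 1/2] does; the 1 added to [Lam] allows [Lam = 0]. *)
pose t : R := (2 * (Lam + 1))^-1.
have t0 : 0 < t by rewrite invr_gt0 mulr_gt0 // ltr_wpDl.
have tLam : t * Lam <= 2^-1.
  rewrite /t invfM -mulrA ler_piMr ?invr_ge0 // mulrC ler_pdivrMr ?ltr_wpDl // mul1r; lra.
have ln2 : 0 < ln 2 :> R by rewrite ln_gt0 //; lra.
(* With [rho = exp r0], the loss [rho ^ (k m)] is at most [2 ^ (eta k / 2)], the square root of the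
   gain from the weight. Since [eta <= 1], this also yields [rho ^ m <= 2]. The [m + 1] covers
   [m = 0]. *)
pose r0 : R := eta * ln 2 / (2 * m.+1%:R).
have r00 : 0 < r0 by rewrite divr_gt0 // !mulr_gt0.
have r0m : m%:R * r0 <= eta * ln 2 / 2.
  have e0 : 0 <= eta * ln 2 by rewrite mulr_ge0 // ltW.
  rewrite /r0 mulrA ler_pdivrMr ?mulr_gt0 //.
  rewrite (_ : eta * ln 2 / 2 * _ = eta * ln 2 * m.+1%:R); last by field.
  by rewrite mulrC ler_wpM2l // ler_nat.
pose rho : R := expR r0.
have rho1 : 1 < rho by rewrite /rho -[ltLHS]expR0 ltr_expR.
have rho_m : rho ^+ m <= 2.
  rewrite /rho -expRM_natl -[leRHS]lnK ?posrE // ler_expR; apply: le_trans r0m _.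
  have : eta * ln 2 <= ln 2 by rewrite ler_piMl // ltW.
  lra.
have [M M0 hM] := exists_pow_ge t0 (Phi_ge0 m 0 (ler0n R 16)).
pose C2 := CZ * (1 + CJ).
have C20 : 0 <= C2 by rewrite mulr_ge0 ?addr_ge0 // ltW.
have [k0 hk0] := exists_pow2_ge C2.
pose bc := bad_const m eps eta Cv Cs CJ c0 CY t rho.
have bc0 k : 0 <= bc k by apply: bad_const_ge0 => //; exact: ltW.
have lt0 : 0 < ln (1 + t) by rewrite ln_gt0 // ltrDl.
have bump_decay D A r : 0 <= D -> 0 < A -> 1 < r ->
    decays (fun k => bump_const eps eta Cv Cs CJ CY D (A * r ^+ k)).
  move=> D0 A0 r1; rewrite /bump_const.
  apply: (decaysZ (ltW CY0)); apply: decaysD.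
    apply: (@decays_le _ _ (fun k => (Cv `^ eta * Cs) * (A / 2 * r ^+ k) `^ (- eps))) => [k|].
      by rewrite mulrC [A * _ / 2]mulrAC.
    by apply: decays_powR => //; [rewrite mulr_ge0 ?powR_ge0 // ltW|rewrite divr_gt0].
  apply: (@decays_le _ _ (fun k => (D + CJ) * expR (- (A / 4 * r ^+ k)))) => [k|].
    by rewrite mulNr [A * _ / 4]mulrAC.
  by apply: decays_expR_pow => //; [rewrite addr_ge0|rewrite divr_gt0].
have bcd : decays bc.
  apply: decaysD; first apply: decaysD.
  - by apply: bump_decay => //; lra.
  - by apply: bump_decay => //; rewrite mulr_ge0 ?expR_ge0.
  apply: (@decays_le _ _ (fun k => Cs * expR (- ((eta * ln 2 / 2) * k%:R)))) => [k|].
    rewrite mulrC ler_wpM2l ?(ltW Cs0) // /rho -!expRM_natl.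
    rewrite /powR gt_eqF ?exprn_gt0 ?invr_gt0 // -expRD ler_expR lnXn ?invr_gt0 // lnV ?posrE //.
    rewrite -[- ln 2 *+ k]mulr_natl.
    have := ler_wpM2l (ler0n R k) r0m; lra.
  by apply: decays_expR; [exact: ltW|rewrite divr_gt0 // mulr_gt0].
have [CS hCS] := decays_sum m bc0 bcd.
have CS0 : 0 <= CS by have := hCS [::] isT; rewrite big_nil.
have EC : 0 <= end_const m M k0 eta Cv Cs CJ CZ CS.
  rewrite /end_const -/C2 addr_ge0 //.
    by rewrite !mulr_ge0 ?powR_ge0 ?Phi_ge0 // ltW.
  by rewrite mulr_ge0 // mulr_ge0 // mulr_ge0.
exists (1 + end_const m M k0 eta Cv Cs CJ CZ CS); first by rewrite ltr_pwDl.
move=> o L L0 s G us mG Gsub Gtriv Glarge u v f b mu_ mv mf mb u0 v0 f0 a c lam F w a0 lam0 F0 w0 Hv Hs HJ Hlam HF Hw.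
have := endgame mu_leb eps0 eta0 Lam0 Cv0 Cs0 CJ0 c00 (ltW CY0) (ltW CZ0) young young0 t0 tLam rho1 rho_m M0 hM hk0
  (fun K => hCS _ (iota_uniq _ _)) L0 us mG Gsub Gtriv Glarge mu_ mv mf mb u0 v0 f0 a0 lam0 F0 w0 Hv Hs HJ Hlam HF Hw.
move=> h; apply: le_trans h _; apply: lee_wpmul2r; last by rewrite lee_fin lerDr.
by apply: integral_ge0 => x _; rewrite mule_ge0 // lee_fin Phi_ge0.
Qed.

End uniform_endgame.

(** * Weights and maximal functions *)

Section weights.
Context {R : realType} {n : nat}.
Local Notation X := (Rn R n).
Variable mu : {measure set X -> \bar R}.
Hypothesis mu_leb : is_lebesgue mu.

Lemma integral_cube_ae a l (g h : X -> R) : 0 < l -> measurable_fun setT g -> measurable_fun setT h ->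
  (forall x, 0 <= h x) -> {ae mu, forall x, g x = h x} ->
  (\int[mu]_(x in cube a l) (g x)%:E = Int mu (hc a l) h)%E.
Proof.
move=> l0 mg mh h0 gh; rewrite -Int_cube // /Int; apply: ae_eq_integral.
- exact: measurable_cube.
- exact: measurable_EFin_setT.
- exact: measurable_EFin_setT.
- by move: gh; apply: filterS => x -> _.
Qed.

Lemma Int_hc_gt0 a l (h : X -> R) : 0 < l -> measurable_fun setT h -> (forall x, 0 < h x) ->
  (0 < Int mu (hc a l) h)%E.
Proof.
move=> l0 mh h0; rewrite lt_def Int_ge0 ?andbT; last by move=> x; exact: ltW.
apply/eqP => I0; have := Int0_ae (measurable_hc a l) mh (fun x => ltW (h0 x)) I0.
move=> /ae_null[N [mN N0 hN]]; have : (mu (hc a l) <= mu N)%E.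
  apply: le_measure; rewrite ?inE //; first exact: measurable_hc.
  move=> x xa; apply: contrapT => nx; have := hN x nx xa => e; have := h0 x; by rewrite e ltxx.
by rewrite N0 mu_hc // lee_fin leNgt exprn_gt0.
Qed.

Variables (q : R) (v : X -> R).
Hypothesis q_gt2 : 2 < q.
Hypothesis v_w : weight mu v.
Hypothesis v_RH : RH_infty mu v.
Hypothesis v_Aq : A_q mu q v.

(* A modification of [v] on a null set that is positive everywhere. *)
Definition pos_part (x : X) : R := if 0 < v x then v x else 1.
Definition dual_exp : R := conj_exp q - 1.
Let eta := dual_exp.
Local Notation v' := pos_part.

Let mv : measurable_fun setT v. Proof. by case: v_w => -[]. Qed.

Lemma pos_part_gt0 x : 0 < v' x.
Proof. by rewrite /pos_part; case: ifP. Qed.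

Lemma measurable_pos_part : measurable_fun setT v'.
Proof.
have -> : v' = (fun x => \1_[set x | 0 < v x] x * v x + \1_(~` [set x | 0 < v x]) x).
  apply/funext => x; rewrite /pos_part !indicE; case: ifP => h.
    by rewrite mem_set // memNset ?mul1r ?addr0.
  by rewrite memNset ?mul0r ?add0r ?mem_set //= h.
have m1 : measurable [set x | 0 < v x] by exact: measurable_gt_set.
apply: measurable_funD; first apply: measurable_funM => //; apply: measurable_indic => //.
exact: measurableC.
Qed.

Lemma pos_part_ae : {ae mu, forall x, v x = v' x}.
Proof. by case: v_w => _; apply: filterS => x h; rewrite /pos_part h. Qed.

(** Also applied to [b], where it is the mean entering the BMO norm. *)
Definition wavg (a : X) (l : R) : R := fine (avg mu a l v).

Lemma Int_wavg a l : 0 < l -> Int mu (hc a l) v' = (wavg a l * l ^+ n)%:E.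
Proof.
move=> l0; have ln : 0 < l ^+ n by rewrite exprn_gt0.
have e := integral_cube_ae a l0 mv measurable_pos_part (fun x => ltW (pos_part_gt0 x)) pos_part_ae.
have fin : Int mu (hc a l) v' \is a fin_num.
  by rewrite -e; case: v_w => -[_ /(_ a l l0) vi] _; apply: integrable_fin_num vi; exact: measurable_cube.
rewrite /wavg /avg e -(fineK fin) -EFinM /= mulrAC mulVf ?mul1r //; exact: lt0r_neq0.
Qed.

Lemma wavg_gt0 a l : 0 < l -> 0 < wavg a l.
Proof.
move=> l0; have := Int_hc_gt0 a l0 measurable_pos_part pos_part_gt0.
by rewrite Int_wavg // lte_fin pmulr_lgt0 // exprn_gt0.
Qed.

Lemma RH_cell : exists2 Cv : R, 0 < Cv & forall a l, 0 < l ->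
  {ae mu, forall x, hc a l x -> v' x <= Cv * wavg a l}.
Proof.
have [C HC] := v_RH; exists (Num.max 1 C) => [|a l l0]; first by rewrite lt_max ltr01.
have := HC a l l0; have := pos_part_ae; apply: filterS2 => x <- h xa.
apply: le_trans (h (hc_cube xa)) _; rewrite ler_wpM2r ?(ltW (wavg_gt0 _ _)) //.
by rewrite le_max lexx orbT.
Qed.

Let q10 : 0 < q - 1. Proof. by have := q_gt2; lra. Qed.
Lemma dual_expE : eta = (q - 1)^-1.
Proof. rewrite /eta /dual_exp /conj_exp; have := q10 => ?; field; exact: lt0r_neq0. Qed.
Lemma dual_exp_gt0 : 0 < eta. Proof. by rewrite dual_expE invr_gt0. Qed.
Lemma dual_exp_le1 : eta <= 1.
Proof. by rewrite dual_expE invf_le1 //; have := q_gt2; lra. Qed.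
Lemma conj_expE : 1 - conj_exp q = - eta. Proof. rewrite /eta /dual_exp; ring. Qed.

Let msg : measurable_fun setT (fun x => v' x `^ (- eta)).
Proof. by have := measurable_pos_part => ?; mfun. Qed.
Let msg1 : measurable_fun setT (fun x => v x `^ (1 - conj_exp q)).
Proof. by have := mv => ?; mfun. Qed.
Let sg0 x : 0 <= v' x `^ (- eta). Proof. exact: powR_ge0. Qed.
Let sg_ae : {ae mu, forall x, v x `^ (1 - conj_exp q) = v' x `^ (- eta)}.
Proof. by have := pos_part_ae; apply: filterS => x ->; rewrite conj_expE. Qed.

(** The [A_q] inequality raised to the power [eta = 1 / (q - 1)]. *)
Lemma dual_powR_le (c w s : R) : 0 < c -> 0 < w -> 0 <= s -> w * s `^ (q - 1) <= c ->
  s <= c `^ eta * w `^ (- eta).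
Proof.
move=> c0 w0 s0 h; have -> : s = (s `^ (q - 1)) `^ eta.
  by rewrite -powRrM dual_expE mulfV ?powRr1 // gt_eqF.
apply: (@le_trans _ _ ((c / w) `^ eta)).
  apply: ge0_ler_powR; rewrite ?nnegrE ?powR_ge0 ?(ltW dual_exp_gt0) //.
    by rewrite divr_ge0 // ltW.
  by rewrite ler_pdivlMr // mulrC.
rewrite powRM ?invr_ge0; [|exact: ltW|exact: ltW].
by rewrite -(powR_inv1 (ltW w0)) -powRrM mulN1r.
Qed.

Lemma Aq_cell : exists2 Cs : R, 0 < Cs & forall a l, 0 < l ->
  (Int mu (hc a l) (fun x => v' x `^ (- eta))%R <= (Cs * wavg a l `^ (- eta) * l ^+ n)%:E)%E.
Proof.
have [C HC] := v_Aq; pose C1 := Num.max 1 C.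
have C10 : 0 < C1 by rewrite lt_max ltr01.
exists (C1 `^ eta) => [|a l l0]; first exact: powR_gt0.
have [fin h] := HC a l l0; have a0 := wavg_gt0 a l0.
have ln : 0 < l ^+ n by rewrite exprn_gt0.
have e := integral_cube_ae a l0 msg1 msg sg0 sg_ae.
rewrite e in fin.
have If : Int mu (hc a l) (fun x => v' x `^ (- eta))%R \is a fin_num by rewrite ge0_fin_numE ?Int_ge0.
have S0 := fine_ge0 (Int_ge0 mu (hc a l) sg0).
move: h S0; rewrite -/(wavg a l) /avg e -(fineK If) -EFinM /= lee_fin.
move: (fine _) (wavg a l) a0 => S w w0 h S0; rewrite -ler_pdivrMr //.
apply: (dual_powR_le C10 w0); first by rewrite divr_ge0 // ltW.
by rewrite (mulrC S); apply: le_trans h _; rewrite le_max lexx orbT.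
Qed.

(* [Psi x >= x] because [p > q]. *)
Lemma HLmax_ge (p : R) a l x : q < p -> 0 < l -> hc a l x ->
  ((wavg a l)%:E <= HLmax mu (fun y => Psi p q (v y)) x)%E.
Proof.
move=> qp l0 xa; have ln : 0 < l ^+ n by rewrite exprn_gt0.
apply: (@le_trans _ _ (avg mu a l (fun z => `|Psi p q (v z)|))); last first.
  by apply: ereal_sup_ubound; exists a, l; split => //; split => //; exact: hc_cube.
have q1 : 0 < q - 1 by [].
have p1 : 0 < p - 1 by lra.
have cp1 : 1 <= conj_exp p by rewrite /conj_exp ler_pdivlMr //; lra.
have cpq : conj_exp p <= conj_exp q.
  rewrite /conj_exp ler_pdivrMr // mulrAC ler_pdivlMr //; nra.
have PsiP z : 0 < v z -> v z <= `|Psi p q (v z)|.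
  move=> vz; rewrite /Psi; case: ifP => v1; rewrite ger0_norm ?powR_ge0 //.
    rewrite -{1}(powRr1 (ltW vz)); apply: ger_powR; last by lra.
    by rewrite vz ltW.
  have v1' : 1 <= v z by rewrite leNgt v1.
  by rewrite -{1}(powRr1 (ltW vz)); apply: ler_powR.
(* [v] may fail to be positive on a null set. Cut to the set where it is positive, it lies below
   [|Psi o v|] everywhere, and the comparison of integrals is pointwise. *)
pose g z := v z * \1_[set x | 0 < v x] z.
have mg : measurable_fun setT g.
  by have := mv => ?; mfun; apply: measurable_indic; exact: measurable_gt_set.
have g0 z : 0 <= g z.
  rewrite /g indicE; case: (pselect (0 < v z)) => h; first by rewrite mem_set // mulr1 ltW.
  by rewrite memNset // mulr0.
have -> : (wavg a l)%:E = (((l ^+ n)^-1)%:E * \int[mu]_(z in cube a l) (g z)%:E)%E.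
  rewrite (integral_cube_ae a l0 mg measurable_pos_part (fun x => ltW (pos_part_gt0 x))).
    by rewrite Int_wavg // -EFinM mulrCA mulVf ?mulr1 //; exact: lt0r_neq0.
  case: v_w => _; apply: filterS => z vz.
  by rewrite /g /pos_part vz indicE mem_set ?mulr1.
apply: lee_wpmul2l; first by rewrite lee_fin invr_ge0 ltW.
apply: le_integral_ge0 => z _; rewrite lee_fin //.
rewrite /g indicE; case: (pselect (0 < v z)) => h; first by rewrite mem_set // mulr1 PsiP.
by rewrite memNset // mulr0.
Qed.

Section luxemburg.
Variables (m : nat) (eps : R) (u : X -> R) (N : R).
Hypothesis eps0 : 0 <= eps.
Hypothesis u0 : forall x, 0 <= u x.
Hypothesis uN : forall x, u x <= N.
Hypothesis mu_ : measurable_fun setT u.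

Let sg (x : X) : R := v x `^ (1 - conj_exp q).
Let lux (a : X) l (f : X -> R) := lux_norm mu (Phi m eps) sg a l f.

Let N0 : 0 <= N. Proof. exact: le_trans (u0 point) (uN point). Qed.

Let Phi1 : Phi m eps 1 = 1 :> R.
Proof. by rewrite /Phi /log_plus ln1 maxxx addr0 powR1 mulr1. Qed.

Lemma lux_norm_ge0 a l (f : X -> R) : (0 <= lux a l f)%E.
Proof. by apply: le_ereal_inf_tmp => _ [r [r0 _] <-]; rewrite lee_fin ltW. Qed.

Let Pm r : measurable_fun setT (fun x => Phi m eps (u x / r)).
Proof. by apply: (measurableT_comp (f := Phi m eps)); [exact: measurable_Phi|mfun]. Qed.

Let Iphi a l (r : R) : 0 < l -> 0 < r ->
  (\int[mu]_(x in cube a l) (Phi m eps (`|u x| / r) * sg x)%:E =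
   Int mu (hc a l) (fun x => Phi m eps (u x / r) * v' x `^ (- eta))%R)%E.
Proof.
move=> l0 r0; apply: integral_cube_ae => //.
- apply: measurable_funM; last exact: msg1.
  by under eq_fun do rewrite (ger0_norm (u0 _)); exact: Pm.
- by apply: measurable_funM; [exact: Pm|exact: msg].
- by move=> x; rewrite mulr_ge0 // Phi_ge0 // divr_ge0 // ltW.
- by have := sg_ae; apply: filterS => x; rewrite /sg => ->; rewrite ger0_norm.
Qed.

Let Isg a l : 0 < l -> exists2 S : R, 0 < S & Int mu (hc a l) (fun x => v' x `^ (- eta))%R = S%:E.
Proof.
move=> l0; have h0 : (0 < Int mu (hc a l) (fun x => v' x `^ (- eta))%R)%E.
  by apply: Int_hc_gt0 => // x; rewrite powR_gt0 // pos_part_gt0.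
have [Cs _ hC] := Aq_cell; have fin := le_lt_trans (hC a l l0) (ltry _).
move: h0 fin; case: (Int _ _ _) => [r| |] //; rewrite lte_fin => r0 _; by exists r.
Qed.

Let mem_lux a l (r : R) : 0 < l -> 0 < r ->
  ((((fine (\int[mu]_(x in cube a l) (sg x)%:E))^-1)%:E *
     \int[mu]_(x in cube a l) (Phi m eps (`|u x| / r) * sg x)%:E <= 1)%E <->
   (Int mu (hc a l) (fun x => Phi m eps (u x / r) * v' x `^ (- eta))%R <=
    Int mu (hc a l) (fun x => v' x `^ (- eta))%R)%E).
Proof.
move=> l0 r0; rewrite Iphi // (integral_cube_ae a l0 msg1 msg sg0 sg_ae).
have [S S0 ->] := Isg a l0; rewrite /=; split => h.
  by have := lee_wpmul2l (_ : (0 <= S%:E)%E) h; rewrite lee_fin ltW // => /(_ isT);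
    rewrite muleA -EFinM mulfV ?gt_eqF // mul1e mule1.
have Si : (0 <= (S^-1)%:E)%E by rewrite lee_fin invr_ge0 ltW.
by have := lee_wpmul2l Si h; rewrite -EFinM mulVf ?gt_eqF.
Qed.

Let lux_le a l : 0 < l -> (lux a l u <= (N + 1)%:E)%E.
Proof.
move=> l0; have N1 : 0 < N + 1 by rewrite ltr_wpDl.
apply: ereal_inf_lbound; exists (N + 1) => //; split => //.
apply/(mem_lux a l0 N1); apply: Int_le => x.
  by rewrite mulr_ge0 // Phi_ge0 // divr_ge0 // ltW.
move=> _; rewrite -[leRHS]mul1r ler_wpM2r // -[leRHS]Phi1; apply: Phi_le => //.
  by rewrite divr_ge0 // ltW.
by rewrite ler_pdivrMr // mul1r; apply: le_trans (uN x) _; rewrite lerDl.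
Qed.

(** The norm is finite because [u] is bounded by [N]: the value [N + 1] satisfies the Luxemburg
    condition, as [Phi m eps 1 = 1]. *)
Definition lux_real (a : X) (l : R) : R := fine (lux a l u).

Lemma lux_real_ge0 a l : 0 <= lux_real a l.
Proof. by rewrite fine_ge0 // lux_norm_ge0. Qed.

Let lux_realE a l : 0 < l -> lux a l u = (lux_real a l)%:E.
Proof.
move=> l0; rewrite fineK // ge0_fin_numE ?lux_norm_ge0 //.
exact: le_lt_trans (lux_le a l0) (ltry _).
Qed.

Lemma lux_real_spec a l : 0 < l -> forall r, lux_real a l < r ->
  (Int mu (hc a l) (fun x => Phi m eps (u x / r) * v' x `^ (- eta))%R <=
   Int mu (hc a l) (fun x => v' x `^ (- eta))%R)%E.
Proof.
move=> l0 r hr; have : (lux a l u < r%:E)%E by rewrite lux_realE // lte_fin.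
move=> /ereal_inf_lt[_ [r1 [r10 h] <-]]; rewrite lte_fin => r1r.
have {}h := proj1 (mem_lux a l0 r10) h; apply: le_trans h.
have r0 : 0 < r by exact: lt_trans r1r.
apply: Int_le => x; first by rewrite mulr_ge0 // Phi_ge0 // divr_ge0 // ltW.
move=> _; rewrite ler_wpM2r //; apply: Phi_le => //; first by rewrite divr_ge0 // ltW.
by rewrite ler_wpM2l // lef_pV2 // ltW.
Qed.

(** The bounded [u] stands for a truncation of [U], whose maximal function occurs in the final
    estimate; the two norms are compared pointwise, for an arbitrary [U]. *)
Lemma orlicz_max_ge (U : X -> R) a l x : (forall y, u y <= U y) -> 0 < l -> hc a l x ->
  ((lux_real a l)%:E <= orlicz_max mu (Phi m eps) (fun y => (v y `^ (1 - conj_exp q))%R) U x)%E.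
Proof.
move=> uU l0 xa; rewrite -lux_realE //; apply: (@le_trans _ _ (lux a l U)); last first.
  by apply: ereal_sup_ubound; exists a, l; split => //; split => //; exact: hc_cube.
rewrite /lux /lux_norm; apply: ereal_inf_le_tmp; move=> _ [r [r0 h] <-].
exists r; last by [].
split; first exact: r0.
apply: le_trans h; apply: lee_wpmul2l.
  rewrite lee_fin invr_ge0 (integral_cube_ae a l0 msg1 msg sg0 sg_ae).
  by rewrite fine_ge0 // Int_ge0.
apply: le_integral_ge0 => y _; rewrite lee_fin.
  by rewrite mulr_ge0 ?powR_ge0 // Phi_ge0 // divr_ge0 // ltW.
rewrite ler_wpM2r ?powR_ge0 //; apply: Phi_le => //; first by rewrite divr_ge0 // ltW.
by rewrite ler_wpM2r ?invr_ge0 ?(ltW r0) // !ger0_norm // (le_trans (u0 y)).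
Qed.

End luxemburg.
End weights.

Section bmo.
Context {R : realType} {n : nat}.
Local Notation X := (Rn R n).
Variable mu : {measure set X -> \bar R}.
Hypothesis mu_leb : is_lebesgue mu.
Variable b : X -> R.
Hypothesis b_BMO : BMO mu b.

Let mb : measurable_fun setT b. Proof. by case: b_BMO => -[]. Qed.

Lemma bmo_osc a l : 0 < l -> (Int mu (hc a l) (fun x => `|b x - wavg mu b a l|)%R <=
  (fine (bmo_norm mu b) * l ^+ n)%:E)%E.
Proof.
move=> l0; have ln : 0 < l ^+ n by rewrite exprn_gt0.
have mo : measurable_fun setT (fun x => `|b x - wavg mu b a l|) by mfun.
have le : (avg mu a l (fun x => `|b x - wavg mu b a l|)%R <= bmo_norm mu b)%E.
  by apply: ereal_sup_ubound; exists a, l.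
have b0 : (0 <= bmo_norm mu b)%E.
  apply: le_trans le; rewrite mule_ge0 ?lee_fin ?invr_ge0 ?(ltW ln) //.
  exact: (Int_ge0 mu (cube a l) (fun x => normr_ge0 (b x - wavg mu b a l))).
have bf : bmo_norm mu b \is a fin_num by rewrite ge0_fin_numE //; case: b_BMO.
move: le; rewrite -(fineK bf) /avg -/(Int mu (cube a l) _) Int_cube // => h.
rewrite mulrC EFinM -lee_pdivrMl //.
Qed.

Lemma bmo_exp : exists c C : R, [/\ 0 < c, 0 < C & forall a l, 0 < l ->
  (Int mu (hc a l) (fun x => expR (c * `|b x - wavg mu b a l|))%R <= (C * l ^+ n)%:E)%E].
Proof.
have B0 : 0 <= fine (bmo_norm mu b).
  have h := bmo_osc (0 : X) (ltr01 : 0 < 1 :> R).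
  rewrite expr1n mulr1 in h; rewrite -lee_fin; apply: le_trans h.
  exact: Int_ge0.
(* John-Nirenberg asks for a positive bound, hence the 1 added to the norm. *)
apply: (@john_nirenberg _ _ mu mu_leb b (wavg mu b) (fine (bmo_norm mu b) + 1) mb).
  by rewrite ltr_wpDl.
move=> a l l0; apply: le_trans (bmo_osc a l0) _.
by rewrite lee_fin ler_wpM2r ?exprn_ge0 ?(ltW l0) // lerDl.
Qed.

Lemma bmo0_cst : fine (bmo_norm mu b) = 0 -> forall a l, 0 < l ->
  {ae mu, forall x, hc a l x -> b x = wavg mu b a l}.
Proof.
move=> B0 a l l0; have h := bmo_osc a l0; rewrite B0 mul0r in h.
have mo : measurable_fun setT (fun x => `|b x - wavg mu b a l|) by mfun.
have I0 : Int mu (hc a l) (fun x => `|b x - wavg mu b a l|)%R = 0%E.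
  by apply/eqP; rewrite eq_le h Int_ge0.
have := Int0_ae (measurable_hc a l) mo (fun x => normr_ge0 _) I0.
by apply: filterS => x hx /hx /eqP; rewrite normr_eq0 subr_eq0 => /eqP.
Qed.

End bmo.

Import HBNNSimple.

(** Here [g] is arbitrary: a simple function below [c g] is [c] times a simple function below
    [g]. *)
Lemma integral_scale_le d (T : measurableType d) (R : realType) (mu : {measure set T -> \bar R})
    (g : T -> \bar R) (c : R) : 0 < c -> (forall x, 0 <= g x)%E ->
  (\int[mu]_x (c%:E * g x) <= c%:E * \int[mu]_x g x)%E.
Proof.
move=> c0 g0; rewrite {1}ge0_integralE => [|x _]; last by rewrite mule_ge0 // lee_fin ltW.
apply: ge_ereal_sup => _ [h hg <-].
rewrite -integralT_nnsfun.
have -> : (\int[mu]_x (h x)%:E = c%:E * Int mu setT (fun x => c^-1 * h x)%R)%E.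
  by rewrite Int_Z ?invr_ge0 ?(ltW c0) // muleA -EFinM mulfV ?gt_eqF // mul1e.
apply: lee_wpmul2l; first by rewrite lee_fin ltW.
apply: le_integral_ge0 => x _; first by rewrite lee_fin mulr_ge0 // invr_ge0 ltW.
have := hg x; rewrite patchT ?inE // => hx.
have ci : (0 <= (c^-1)%:E)%E by rewrite lee_fin invr_ge0 ltW.
by have := lee_wpmul2l ci hx; rewrite muleA -!EFinM mulVf ?gt_eqF // mul1e.
Qed.

(** * Sparse families over tripled cells *)

Section shifted_families.
Context {R : realType} {n : nat}.
Local Notation X := (Rn R n).
Variable mu : {measure set X -> \bar R}.
Hypothesis mu_leb : is_lebesgue mu.
Hypothesis n_gt0 : (0 < n)%N.
Implicit Types (p q : @cell n).

Lemma hc_inj (a a' : X) (l : R) : 0 < l -> hc a l = hc a' l -> a = a'.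
Proof.
move=> l0 e; have h (c : X) : hc c l c by move=> i; rewrite lexx ltrDl.
have h1 := h a; rewrite e in h1; have h2 := h a'; rewrite -e in h2.
by apply: co_inj => i; apply/eqP; rewrite eq_le; case/andP: (h1 i) => -> _; case/andP: (h2 i) => ->.
Qed.

Definition tcorner (o : X) (L : R) q : X := pt (fun i => co (gcorner o L q) i - glen L q).

Lemma triE o L q : tri o L q = hc (tcorner o L q) (3 * glen L q).
Proof. by []. Qed.

Lemma tri_inj (o : X) (L : R) q q' : 0 < L -> q.1 = q'.1 -> tri o L q = tri o L q' -> q = q'.
Proof.
move=> L0 lev; have gl : glen L q = glen L q' by rewrite /glen lev.
have l0 : 0 < glen L q by exact: glen_gt0.
rewrite !triE -gl => /(hc_inj (_ : 0 < 3 * glen L q)); rewrite mulr_gt0 // => /(_ isT) e.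
case: q q' lev gl l0 e => [i k] [i' k'] /= lev gl l0 e; congr (_, _) => //.
apply/ffunP => c; have := congr1 (fun x => co x c) e; rewrite !co_pt /= -gl => h.
have {}h : (k c)%:~R * glen L (i, k) = (k' c)%:~R * glen L (i, k) :> R by lra.
by apply/eqP; rewrite -(eqr_int R); apply/eqP; apply: mulIf h; exact: lt0r_neq0.
Qed.

(** The one-third trick with the choices made: [cl q] names the translated grid, [sh q] the label of
    the triple of [q] in it. Corner and side are recorded because the averages refer to them. *)
Lemma shift_classes o L : 0 < L -> exists (cl : @cell n -> {ffun 'I_n -> 'I_3}) (sh : @cell n -> @cell n),
  forall q, [/\ (sh q).1 = q.1, tri o L q = gcell (shift_origin o L (cl q)) (3 * L) (sh q),
    gcorner (shift_origin o L (cl q)) (3 * L) (sh q) = tcorner o L q &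
    glen (3 * L) (sh q) = 3 * glen L q].
Proof.
move=> L0; have [cl Hcl] := @choice _ _ (fun q (s : {ffun 'I_n -> 'I_3}) => exists k',
  tri o L q = gcell (shift_origin o L s) (3 * L) (q.1, k')) (tri_gcell o L0 n_gt0).
have [k' Hk] := @choice _ _ (fun q k' => tri o L q = gcell (shift_origin o L (cl q)) (3 * L) (q.1, k')) Hcl.
exists cl, (fun q => (q.1, k' q)) => q.
have gl : glen (3 * L) (q.1, k' q) = 3 * glen L q by rewrite /glen /= mulrA.
split => //; have := Hk q; rewrite triE /gcell gl => /hc_inj -> //.
by rewrite mulr_gt0 // glen_gt0.
Qed.

Lemma orlicz_max_ge0 (phi : R -> R) (w f : X -> R) x : (0 <= orlicz_max mu phi w f x)%E.
Proof.
apply: (@le_trans _ _ (lux_norm mu phi w x 1 f)).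
  by apply: le_ereal_inf_tmp => _ [r [r0 _] <-]; rewrite lee_fin ltW.
apply: ereal_sup_ubound; exists x, 1; split => //; split => //.
by apply: hc_cube => i; rewrite lexx ltrDl ltr01.
Qed.

Lemma HLmax_ge0 (g : X -> R) x : (0 <= HLmax mu g x)%E.
Proof.
apply: (@le_trans _ _ (avg mu x 1 (fun z => `|g z|))).
  by rewrite /avg expr1n invr1 mul1e; exact: (Int_ge0 mu (cube x 1) (fun z => normr_ge0 (g z))).
apply: ereal_sup_ubound; exists x, 1; split => //; split => //.
by apply: hc_cube => i; rewrite lexx ltrDl ltr01.
Qed.

Variables (q0 : R) (v : X -> R).
Hypothesis q_gt2 : 2 < q0.
Hypothesis v_w : weight mu v.
Hypothesis v_RH : RH_infty mu v.
Hypothesis v_Aq : A_q mu q0 v.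
Variables (m : nat) (b : X -> R).
Hypothesis b_BMO : BMO mu b.
Variables (eps p0 : R).
Hypothesis eps0 : 0 < eps.
Hypothesis p0q : q0 < p0.
Let v' := pos_part v.
Let mb : measurable_fun setT b. Proof. by case: b_BMO => -[]. Qed.

Definition havg (f : X -> R) (a : X) (l : R) : R :=
  fine (Int mu (hc a l) (fun x => (1 + `|b x - wavg mu b a l|) ^+ m * f x)%R) / l ^+ n.

Definition weight_max (U : X -> R) (x : X) : \bar R :=
  (orlicz_max mu (Phi m eps) (fun y => (v y `^ (1 - conj_exp q0))%R) U x *
   HLmax mu (fun y => Psi p0 q0 (v y)) x)%E.

Definition sparse_term (o : X) (L : R) (f : X -> R) q (x : X) : R :=
  wavg mu v (tcorner o L q) (3 * glen L q) * havg f (tcorner o L q) (3 * glen L q) *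
  (1 + `|b x - wavg mu b (tcorner o L q) (3 * glen L q)|) ^+ m * \1_(tri o L q) x.

Let H a l (x : X) : R := (1 + `|b x - wavg mu b a l|) ^+ m.
Let mH a l : measurable_fun setT (H a l). Proof. by rewrite /H; mfun. Qed.
Let H0 a l x : 0 <= H a l x. Proof. by rewrite exprn_ge0 // addr_ge0. Qed.

Lemma havg_ge0 (f : X -> R) a l : 0 < l -> (forall x, 0 <= f x) -> 0 <= havg f a l.
Proof.
move=> l0 f0; rewrite divr_ge0 ?exprn_ge0 ?(ltW l0) // fine_ge0 // Int_ge0 // => x.
by rewrite mulr_ge0 // exprn_ge0 // addr_ge0.
Qed.

Lemma havgZ (f : X -> R) a l c : 0 < c -> measurable_fun setT f -> (forall x, 0 <= f x) ->
  havg (fun x => c * f x) a l = c * havg f a l.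
Proof.
move=> c0 mf f0; rewrite /havg mulrA; congr (_ / _).
have -> : Int mu (hc a l) (fun x => H a l x * (c * f x))%R = (c%:E * Int mu (hc a l) (fun x => H a l x * f x)%R)%E.
  rewrite -Int_Z ?(ltW c0) //.
  - by apply: Int_eq => x _; rewrite mulrCA.
  - exact: measurable_hc.
  - by have := mH a l => ?; mfun.
  - by move=> x; rewrite mulr_ge0 // H0.
have : (0 <= Int mu (hc a l) (fun x => H a l x * f x)%R)%E.
  by apply: Int_ge0 => x; rewrite mulr_ge0 // H0.
case: (Int _ _ _) => [r| |] //= _.
by rewrite mulry gtr0_sg // mul1e /= mulr0.
Qed.

Lemma sparse_termZ o L (f : X -> R) q c x : 0 < c -> measurable_fun setT f -> (forall x, 0 <= f x) ->
  sparse_term o L (fun x => c * f x) q x = c * sparse_term o L f q x.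
Proof. by move=> c0 mf f0; rewrite /sparse_term havgZ //; ring. Qed.

Lemma measurable_sparse_term o L f q : measurable_fun setT (sparse_term o L f q).
Proof.
rewrite /sparse_term; mfun; apply: measurable_indic; exact: measurable_tri.
Qed.

Let Ns : R := #|{ffun 'I_n -> 'I_3}|%:R.

(** Sort the cells by translated grid. If the whole sum exceeds [v'], then one of the [Ns] classes
    exceeds [v' / Ns], which homogeneity absorbs into [Ns * f]. Within one grid the triples are
    cells and the sets [G] stay disjoint, with proportion reduced by [3 ^ n], so [endgame_uniform]
    applies. *)
Lemma sparse_weak : exists2 C : R, 0 < C &
  forall (o : X) (L : R), 0 < L ->
  forall (D : set (@cell n)) (G : @cell n -> set X), (forall q, measurable (G q)) ->
  (forall q, G q `<=` gcell o L q) -> trivIset D G ->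
  (forall q, (mu (gcell o L q) <= 2%:E * mu (G q))%E) ->
  forall (u U f : X -> R) (N : R) (K : nat), measurable_fun setT u -> measurable_fun setT f ->
  (forall x, 0 <= u x) -> (forall x, u x <= N) -> (forall x, u x <= U x) -> (forall x, 0 <= f x) ->
  (Int mu [set x | v' x < \sum_(q <- cells_upto D K) sparse_term o L f q x]%R
     (fun x => u x * v' x)%R <=
   C%:E * \int[mu]_x ((Phi_m m (Ns * f x))%:E * weight_max U x))%E.
Proof.
have [Cv Cv0 HCv] := RH_cell mu_leb v_w v_RH.
have [Cs Cs0 HCs] := Aq_cell mu_leb q_gt2 v_w v_Aq.
have [c0 [CJ [c00 CJ0 HJ]]] := bmo_exp mu_leb b_BMO.
pose eta := dual_exp q0.
have Lam0 : 0 <= 2 * 3 ^+ n :> R by rewrite mulr_ge0 // exprn_ge0.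
have [C C0 HC] := endgame_uniform mu_leb m eps0 (dual_exp_gt0 q_gt2) (dual_exp_le1 q_gt2) Lam0 Cv0 Cs0 (ltW CJ0) c00.
have Ns0 : 0 < Ns by rewrite ltr0n; apply/card_gt0P; exists [ffun=> ord0].
exists (Ns * C); first by rewrite mulr_gt0.
move=> o L L0 D G mG Gsub Gtriv Glarge u U f N K mu_ mf u0 uN uU f0.
have [cl [sh Hsh]] := shift_classes o L0.
pose l := cells_upto D K.
pose f1 x := Ns * f x.
have f10 x : 0 <= f1 x by rewrite mulr_ge0 // ltW.
have mf1 : measurable_fun setT f1 by rewrite /f1; mfun.
have mv' := measurable_pos_part v_w.
have v'0 x : 0 < v' x by exact: pos_part_gt0.
pose E (s : {ffun 'I_n -> 'I_3}) : set X :=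
  [set x | v' x < \sum_(q <- l | cl q == s) sparse_term o L f1 q x].
have muv : measurable_fun setT (fun x => u x * v' x) by mfun.
have uv0 x : 0 <= u x * v' x by rewrite mulr_ge0 // ltW.
have mE s : measurable (E s).
  have mS : measurable_fun setT (fun x => \sum_(q <- l | cl q == s) sparse_term o L f1 q x).
    by apply: measurable_sum_if => q; exact: measurable_sparse_term.
  rewrite (_ : E s = [set x | 0 < (\sum_(q <- l | cl q == s) sparse_term o L f1 q x) - v' x]).
    by apply: measurable_gt_set; exact: measurable_funB.
  by apply/seteqP; split => x; rewrite /E /= subr_gt0.
have sub : [set x | v' x < \sum_(q <- l) sparse_term o L f q x] `<=`
    \bigcup_(s in [set` enum {ffun 'I_n -> 'I_3}]) E s.
  move=> x /= hx; apply: contrapT => nE.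
  have hs s : \sum_(q <- l | cl q == s) sparse_term o L f q x <= v' x / Ns.
    rewrite ler_pdivlMr // mulrC mulr_sumr leNgt; apply/negP => h; apply: nE.
    exists s; first by rewrite /= mem_enum.
    by rewrite /E /=; apply: lt_le_trans h _; apply: ler_sum => q _; rewrite sparse_termZ.
  move: hx; rewrite ltNge => /negP; apply.
  rewrite (partition_big cl xpredT) //=.
  apply: (@le_trans _ _ (\sum_(s : {ffun 'I_n -> 'I_3}) v' x / Ns)).
    by apply: ler_sum => s _; exact: hs.
  by rewrite sumr_const -[leLHS]mulr_natr divfK // gt_eqF.
apply: (@le_trans _ _ (Int mu (\bigcup_(s in [set` enum {ffun 'I_n -> 'I_3}]) E s) (fun x => u x * v' x)%R)).
  exact: Int_subset.
apply: le_trans (Int_bigcup_seq_le mu _ mE muv uv0) _.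
set I := (\int[mu]_x _)%E.
apply: (@le_trans _ _ (\sum_(s <- enum {ffun 'I_n -> 'I_3}) C%:E * I)%E); last first.
  have -> : (\sum_(s <- enum {ffun 'I_n -> 'I_3}) C%:E * I =
      (\sum_(s <- enum {ffun 'I_n -> 'I_3}) 1%:E) * (C%:E * I))%E.
    by rewrite ge0_sume_distrl //; apply: eq_bigr => s _; rewrite mul1e.
  by rewrite sumEFin big_const_seq count_predT -cardE iter_addr_0 /Ns EFinM muleA.
apply: lee_sum => s _.
pose o' := shift_origin o L s.
have L30 : 0 < 3 * L by rewrite mulr_gt0.
pose ls := [seq q <- l | cl q == s].
pose P p q := [/\ D q, cl q = s & sh q = p].
(* At most one [q] qualifies, since a triple determines its cell once the level is known; the union
   avoids choosing it. *)
pose G' p := \bigcup_(q in P p) G q.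
have shtri q : cl q = s -> tri o L q = gcell o' (3 * L) (sh q) by move=> e; have [_ h _ _] := Hsh q; rewrite h e.
have shc q : cl q = s -> gcorner o' (3 * L) (sh q) = tcorner o L q by move=> e; have [_ _ h _] := Hsh q; rewrite -h e.
have shl q : glen (3 * L) (sh q) = 3 * glen L q by have [_ _ _ h] := Hsh q.
have us : uniq (map sh ls).
  rewrite map_inj_in_uniq ?filter_uniq ?cells_upto_uniq // => q q'.
  rewrite !mem_filter => /andP[/eqP cq _] /andP[/eqP cq' _] e.
  apply: (tri_inj (o := o) L0); last by rewrite !shtri // e.
  by have [<- _ _ _] := Hsh q; have [<- _ _ _] := Hsh q'; rewrite e.
have mG' p : measurable (G' p) by exact: measurable_bigcup_cell.
have lsP p : p \in map sh ls -> exists q, [/\ D q, cl q = s & sh q = p].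
  move=> /mapP[q]; rewrite mem_filter => /andP[/eqP cq /mem_cells_upto[Dq _]] ->.
  by exists q.
have Gsub' p : p \in map sh ls -> G' p `<=` gcell o' (3 * L) p.
  move=> _ x [q [Dq cq <-] xq]; rewrite -shtri //; apply: gcell_sub_tri => //; exact: Gsub.
have Gtriv' : trivIset [set` map sh ls] G'.
  move=> p p' _ _ [x [[q [Dq _ <-] xq] [q' [Dq' _ <-] xq']]]; congr sh.
  by apply: Gtriv => //; exists x.
have Glarge' p : p \in map sh ls ->
    (mu (gcell o' (3 * L) p) <= (2 * 3 ^+ n)%:E * mu (G' p))%E.
  move=> /lsP[q [Dq cq e]]; rewrite -e -shtri // (mu_tri mu_leb o L0) [X in (X <= _)%E]EFinM -(mu_gcell mu_leb o L0).
  apply: (@le_trans _ _ ((3 ^+ n)%:E * (2%:E * mu (G q)))%E).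
    by apply: lee_wpmul2l; [rewrite lee_fin exprn_ge0|exact: Glarge].
  rewrite muleA -EFinM mulrC; apply: lee_wpmul2l; first by rewrite lee_fin.
  by apply: le_measure; rewrite ?inE // => x xq; exists q.
pose a p := wavg mu v (gcorner o' (3 * L) p) (glen (3 * L) p).
pose c p := wavg mu b (gcorner o' (3 * L) p) (glen (3 * L) p).
pose lam p := lux_real mu q0 v m eps u (gcorner o' (3 * L) p) (glen (3 * L) p).
pose F p := havg f1 (gcorner o' (3 * L) p) (glen (3 * L) p).
have gl0 p : 0 < glen (3 * L) p by exact: glen_gt0.
have w0 x : (0 <= weight_max U x)%E by rewrite mule_ge0 ?orlicz_max_ge0 ?HLmax_ge0.
have := HC o' (3 * L) L30 (map sh ls) G' us mG' Gsub' Gtriv' Glarge' u v' f1 b mu_ mv' mf1 mb u0 v'0 f10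
  a c lam F (weight_max U).
move=> h; apply: le_trans _ (h _ _ _ _ _ _ _ _ _ _).
- apply: Int_subset => // x; rewrite /E /= => hx; apply: lt_le_trans hx _.
  rewrite big_map big_filter; apply: ler_sum => q /eqP cq.
  by rewrite /sparse_term /a /c /F shc // shl -shtri.
- by move=> p; exact: wavg_gt0.
- by move=> p; exact: lux_real_ge0.
- by move=> p; apply: havg_ge0.
- exact: w0.
- by move=> p _; exact: HCv.
- by move=> p _; exact: HCs.
- by move=> p _; exact: HJ.
- by move=> p _; apply: lux_real_spec => //; exact: ltW.
- move=> p _; rewrite /F /havg divfK ?gt_eqF ?exprn_gt0 //.
  have : (0 <= Int mu (gcell o' (3 * L) p) (fun x => (1 + `|b x - c p|) ^+ m * f1 x)%R)%E.
    by apply: Int_ge0 => x; rewrite mulr_ge0 // exprn_ge0 // addr_ge0.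
  rewrite -/(c p) -/(gcell o' (3 * L) p).
  by case: (Int _ _ _) => [r| |] //= _; rewrite leey.
- move=> p x _ xp; rewrite EFinM muleC; apply: lee_pmul.
  + by rewrite lee_fin; exact: lux_real_ge0.
  + by rewrite lee_fin; apply: ltW; exact: wavg_gt0.
  + apply: orlicz_max_ge; rewrite ?(ltW eps0) //; exact: uN.
  + by apply: HLmax_ge.
Qed.

End shifted_families.

(** * Reduction to real operators *)

Section complex_parts.
Context {R : realType}.
Implicit Types (z w : R[i]) (c : R).

Definition part (r : bool) z : R := if r then complex.Re z else complex.Im z.

Lemma part_lin r z w c : part r (z + real_complex R c * w) = part r z + c * part r w.
Proof. by case: z w => [a a'] [b b']; case: r => /=; ring. Qed.

Lemma partB r z w : part r (z - w) = part r z - part r w.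
Proof. by case: z w => [a a'] [b b']; case: r. Qed.

Lemma part_le_cmod r z : `|part r z| <= cmod z.
Proof.
rewrite /cmod -sqrtr_sqr ler_sqrt; last by rewrite addr_ge0 // sqr_ge0.
by case: r => /=; rewrite ?lerDl ?lerDr sqr_ge0.
Qed.

Lemma cmod_sqr z : cmod z ^+ 2 = complex.Re z ^+ 2 + complex.Im z ^+ 2.
Proof. by rewrite sqr_sqrtr // addr_ge0 // sqr_ge0. Qed.

Lemma cmod_ge0 z : 0 <= cmod z. Proof. exact: sqrtr_ge0. Qed.

Lemma cmod_le z : cmod z <= `|complex.Re z| + `|complex.Im z|.
Proof.
rewrite -(ler_pXn2r (ltn0Sn 1)) ?nnegrE ?cmod_ge0 ?addr_ge0 // cmod_sqr.
rewrite sqrrD !real_normK ?num_real // lerD2r lerDl mulrn_wge0 // mulr_ge0 //.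
Qed.

End complex_parts.

Section complex_to_real.
Context {R : realType} {n : nat}.
Local Notation X := (Rn R n).
Variable mu : {measure set X -> \bar R}.
Variable T : (X -> R[i]) -> X -> R[i].
Hypothesis T_CZO : CZO mu T.
Implicit Types (f g h : X -> R).

Definition toC h (y : X) : R[i] := real_complex R (h y).

Lemma L2_toC h : L2r mu h -> L2 mu (toC h).
Proof.
move=> [mh hi]; split; first by split => //=; exact: measurable_cst.
rewrite /L2norm2; apply: le_lt_trans hi; apply: le_integral_ge0 => x _; rewrite lee_fin ?sqr_ge0 //.
by rewrite cmod_sqr /= expr0n addr0.
Qed.

Lemma L2norm2_toC h : L2norm2 mu (toC h) = Int mu setT (fun x => h x ^+ 2)%R.
Proof. by apply: eq_integral => x _; rewrite cmod_sqr /= expr0n addr0. Qed.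

Definition realpart (r : bool) h (x : X) : R := part r (T (toC h) x).

Lemma enorm_ge (x : Rvec R n) i : `|co (x : X) i| <= enorm x.
Proof.
rewrite -sqrtr_sqr /enorm ler_sqrt ?sumr_ge0 //; last by move=> j _; exact: sqr_ge0.
by rewrite (bigD1 i) //= lerDl sumr_ge0 // => j _; exact: sqr_ge0.
Qed.

Lemma enorm_le (x : Rvec R n) e : 0 <= e -> (forall i, `|co (x : X) i| <= e) -> enorm x <= n%:R * e.
Proof.
move=> e0 h; rewrite -[leRHS]ger0_norm ?mulr_ge0 // -sqrtr_sqr /enorm ler_sqrt ?sqr_ge0 //.
apply: (@le_trans _ _ (\sum_(i < n) e ^+ 2)).
  apply: ler_sum => i _; rewrite -[_ ^+ 2]real_normK ?num_real // lerXn2r ?nnegrE //.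
  exact: h.
rewrite sumr_const card_ord -[leLHS]mulr_natl exprMn ler_wpM2r ?sqr_ge0 //.
by rewrite -natrX ler_nat; case: n => // k; rewrite -{1}(expn1 k.+1) leq_pexp2l.
Qed.

(** The Euclidean conditions on [K] pass to the sup norm at the price of factors [n]; [Ck] collects
    the size bound and the two cases of regularity. *)
Lemma realpart_czo r : exists (k : X -> R) (CT Ck : R), real_czo mu (realpart r) k CT Ck.
Proof.
have [lin [[CT bdd] [K [[Kmeas [[C1 Ksize] [C2 Kreg]]] ker]]]] := T_CZO.
pose D1 := Num.max 0 C1; pose D2 := Num.max 0 C2.
have D10 : 0 <= D1 by rewrite le_max lexx.
have D20 : 0 <= D2 by rewrite le_max lexx.
pose Ck := D1 + (D2 * n%:R + 2 * D1 * (2 * n%:R)).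
have Ck1 : D1 <= Ck by rewrite lerDl addr_ge0 // !mulr_ge0.
have Ck2 : D2 * n%:R <= Ck by rewrite /Ck addrCA lerDl addr_ge0 // !mulr_ge0.
have Ck3 : 2 * D1 * (2 * n%:R) <= Ck by rewrite /Ck addrA lerDr addr_ge0 // !mulr_ge0.
have size x s : 0 < s -> (exists i, s <= `|co x i|) -> cmod (K x) <= D1 / s ^+ n.
  move=> s0 [i si]; have sx : s <= enorm x by exact: le_trans si (enorm_ge x i).
  have xn0 : x != 0.
    apply/eqP => x0; move: si; rewrite x0 /co mxE normr0 leNgt s0 //.
  apply: le_trans (Ksize x xn0) _; apply: (@le_trans _ _ (D1 / enorm x ^+ n)).
    by rewrite ler_wpM2r ?invr_ge0 ?exprn_ge0 ?(le_trans (ltW s0)) // le_max lexx orbT.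
  rewrite ler_wpM2l // lef_pV2 ?posrE ?exprn_gt0 ?(lt_le_trans s0) //.
  by rewrite lerXn2r ?nnegrE ?(ltW s0) ?(le_trans (ltW s0)).
exists (fun x => part r (K x)), (Num.max 0 CT), Ck; split.
- move=> f g c Lf Lg; have := lin (toC f) (toC g) (real_complex R c) (L2_toC Lf) (L2_toC Lg).
  have -> : (fun y => toC f y + real_complex R c * toC g y) = toC (fun y => f y + c * g y).
    by apply/funext => y; rewrite /toC rmorphD rmorphM.
  by apply: filterS => x hx; rewrite /realpart hx part_lin.
- by move=> f /L2_toC /bdd[[[mR mI] _] _]; case: r.
- move=> f Lf; have [[_ _] h] := bdd _ (L2_toC Lf).
  apply: (@le_trans _ _ (L2norm2 mu (T (toC f)))).
    apply: le_integral_ge0 => x _; rewrite lee_fin ?sqr_ge0 //.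
    rewrite -[leLHS]real_normK ?num_real // lerXn2r ?nnegrE ?cmod_ge0 //; exact: part_le_cmod.
  apply: le_trans h _; rewrite L2norm2_toC; apply: lee_wpmul2r.
    by apply: Int_ge0 => x; exact: sqr_ge0.
  by rewrite lee_fin le_max lexx orbT.
- move=> f a l l0 Lf supp; have suppC : {ae mu, forall x, ~ cube a l x -> toC f x = 0}.
    by apply: aeW => x nx; rewrite /toC supp.
  have := ker (toC f) a l l0 (L2_toC Lf) suppC; apply: filterS => x hx nx.
  rewrite /realpart (hx nx) /cintegral /part; case: r => /=; apply: eq_Rintegral => y _;
    by case: (K _) => [p q] /=; ring.
- by case: r; case: Kmeas.
- move=> x s s0 hx; apply: le_trans (part_le_cmod _ _) _.
  by apply: le_trans (size x s s0 hx) _; rewrite ler_wpM2r // invr_ge0 exprn_ge0 // ltW.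
- move=> x y s e /andP[e0 es] hx hy hxy; have s0 : 0 < s by exact: lt_le_trans es.
  have [i si] := hx; have sx : s <= enorm (x : Rvec R n) by exact: le_trans si (enorm_ge x i).
  have exy : enorm ((x : Rvec R n) - (y : Rvec R n)) <= n%:R * e.
    by apply: enorm_le => [|j]; [exact: ltW|rewrite coB; exact: hxy].
  have sn : 0 < s ^+ n.+1 by rewrite exprn_gt0.
  (* Regularity of [K] is used at [x], [0], [x - y] and requires [|x| > 2 |x - y|]. Otherwise
     [s <= 2 n e], and the size bound at both points is already of the required order. *)
  have [big|small] := ltP (2 * enorm ((x : Rvec R n) - (y : Rvec R n))) (enorm (x : Rvec R n)).
    have e1 : (x : Rvec R n) - 0 = x by rewrite subr0.
    have e2 : (x : Rvec R n) - ((x : Rvec R n) - y) = y by rewrite opprB addrC subrK.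
    have e3 : enorm (0 - ((x : Rvec R n) - (y : Rvec R n))) = enorm ((x : Rvec R n) - (y : Rvec R n)).
      by rewrite sub0r /enorm; congr Num.sqrt; apply: eq_bigr => j _; rewrite mxE sqrrN.
    have := Kreg (x : Rvec R n) 0 ((x : Rvec R n) - (y : Rvec R n)).
    rewrite e1 e2 e3 => /(_ big) h; rewrite -partB; apply: le_trans (part_le_cmod _ _) _; apply: (le_trans h).
    apply: (@le_trans _ _ (D2 * (n%:R * e) / s ^+ n.+1)); last first.
      by rewrite mulrA ler_wpM2r ?invr_ge0 ?(ltW sn) // ler_wpM2r // ltW.
    have xs0 : 0 <= enorm (x : Rvec R n) by exact: le_trans (ltW s0) sx.
    apply: (@le_trans _ _ (D2 * enorm ((x : Rvec R n) - (y : Rvec R n)) / enorm (x : Rvec R n) ^+ n.+1)).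
      by rewrite ler_wpM2r ?invr_ge0 ?exprn_ge0 // ler_wpM2r ?sqrtr_ge0 // le_max lexx orbT.
    apply: ler_pM.
    + by rewrite mulr_ge0 // sqrtr_ge0.
    + by rewrite invr_ge0 exprn_ge0.
    + by rewrite ler_wpM2l.
    + rewrite lef_pV2 ?posrE ?exprn_gt0 ?(lt_le_trans s0) //.
      by rewrite lerXn2r ?nnegrE ?(ltW s0).
  have sne : s <= 2 * n%:R * e by apply: le_trans sx (le_trans small _); rewrite -mulrA ler_wpM2l.
  have tri : `|part r (K x) - part r (K y)| <= 2 * D1 / s ^+ n.
    apply: le_trans (ler_normB _ _) _; rewrite -mulrA mulr_natl mulr2n; apply: lerD.
      by apply: le_trans (part_le_cmod _ _) _; exact: size.
    by apply: le_trans (part_le_cmod _ _) _; exact: size.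
  apply: le_trans tri _; apply: (@le_trans _ _ (2 * D1 * (2 * n%:R * e) / s ^+ n.+1)).
    rewrite exprS invfM mulrA -!mulrA ler_wpM2l // ler_wpM2l //.
    rewrite [leRHS]mulrA [leRHS]mulrA [leRHS]mulrA ler_peMl ?invr_ge0 ?exprn_ge0 ?(ltW s0) //.
    by rewrite ler_pdivlMr // mul1r.
  by rewrite ler_wpM2r ?invr_ge0 ?(ltW sn) // mulrA ler_wpM2r // ltW.
- by rewrite le_max lexx.
- exact: le_trans D10 Ck1.
Qed.

Variable b : X -> R.

(** Induction on [m]: one commutation multiplies the polynomial by [b x - 'X], where ['X] stands for
    multiplication by [b] before applying [T]. *)
Lemma commutatorE m (g : X -> R[i]) x : commutator T b m g x =
  \sum_(i < m.+1) real_complex R ((((b x)%:P - 'X) ^+ m)`_i) *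
    T (fun y => real_complex R (b y ^+ i) * g y) x.
Proof.
elim: m g => [|m IH] g /=.
  rewrite big_ord_recl big_ord0 addr0 expr0 coef1 /= mul1r; congr (T _ x).
  by apply/funext => y; rewrite expr0 mul1r.
rewrite !IH; set p := (_ - _) ^+ m.
have pm : p`_m.+1 = 0.
  apply: nth_default; apply: leq_trans (size_poly_exp_leq _ _) _.
  have -> : size ((b x)%:P - 'X) = 2 by rewrite -opprB size_polyN size_XsubC.
  by rewrite /= mul1n.
rewrite exprS -/p.
have cE i : (((b x)%:P - 'X) * p)`_i = b x * p`_i - (if (i == 0)%N then 0 else p`_i.-1).
  by rewrite mulrBl coefB coefCM coefXM.
have -> : \sum_(i < m.+2) real_complex R ((((b x)%:P - 'X) * p)`_i) * T (fun y => real_complex R (b y ^+ i) * g y) x =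
  \sum_(i < m.+2) real_complex R (b x * p`_i) * T (fun y => real_complex R (b y ^+ i) * g y) x -
  \sum_(i < m.+2) real_complex R (if (i == 0 :> nat)%N then 0 else p`_i.-1) * T (fun y => real_complex R (b y ^+ i) * g y) x.
  by rewrite -sumrB; apply: eq_bigr => i _; rewrite cE rmorphB mulrBl.
congr (_ - _).
  rewrite [RHS]big_ord_recr -[LHS]addr0; congr (_ + _).
    by rewrite mulr_sumr; apply: eq_bigr => i _; rewrite rmorphM mulrA.
  by rewrite [p`_ord_max]pm mulr0 rmorph0 mul0r.
rewrite [RHS]big_ord_recl eqxx rmorph0 mul0r add0r; apply: eq_bigr => i _.
rewrite lift0 /=; congr (_ * T _ x); apply/funext => y; rewrite /bump /= ?add1n exprSr rmorphM.
by rewrite mulrA.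
Qed.

End complex_to_real.

Lemma sum_seq_le (R : realDomainType) (I : eqType) (s1 s2 : seq I) (t : I -> R) :
  uniq s1 -> {subset s1 <= s2} -> (forall i, 0 <= t i) ->
  \sum_(i <- s1) t i <= \sum_(i <- s2) t i.
Proof.
move=> u1 sub t0.
have ps : perm_eq s1 [seq i <- undup s2 | i \in s1].
  apply: uniq_perm => //; first by rewrite filter_uniq // undup_uniq.
  by move=> i; rewrite mem_filter mem_undup; case: (boolP (i \in s1)) => //= /sub ->.
rewrite (perm_big _ ps) big_filter; apply: (@le_trans _ _ (\sum_(i <- undup s2) t i)).
  by rewrite big_mkcond; apply: ler_sum => i _; case: ifP.
elim: s2 {sub ps} => [|i s IH] /=; first by rewrite big_nil.
rewrite big_cons; case: ifP => _; last by rewrite big_cons lerD2l.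
by apply: le_trans IH _; rewrite lerDr.
Qed.

(** * Sparse domination of the commutators of real operators *)

Section real_sparse.
Context {R : realType} {n : nat}.
Local Notation X := (Rn R n).
Variable mu : {measure set X -> \bar R}.
Hypothesis mu_leb : is_lebesgue mu.
Hypothesis n_gt0 : (0 < n)%N.
Variable v : X -> R.
Hypothesis v_w : weight mu v.
Hypothesis v_RH : RH_infty mu v.
Variables (m : nat) (b : X -> R).
Hypothesis b_BMO : BMO mu b.
Let v' := pos_part v.
Let mb : measurable_fun setT b. Proof. by case: b_BMO => -[]. Qed.
Let mv : measurable_fun setT v. Proof. by case: v_w => -[]. Qed.

Lemma Int_pow_osc_lty k c a l : 0 < l -> (Int mu (hc a l) (fun x => (1 + `|b x - c|) ^+ k)%R < +oo)%E.
Proof.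
move=> l0; have [c0 [CJ [c00 CJ0 HJ]]] := bmo_exp mu_leb b_BMO.
have [C C0 HC] := one_plus_pow_le k c00.
pose w := wavg mu b a l.
have mE : measurable_fun setT (fun x => expR (c0 * `|b x - w|)) by mfun.
pose K := C * expR (c0 * `|w - c|).
have K0 : 0 <= K by rewrite mulr_ge0 ?expR_ge0 // ltW.
apply: (@le_lt_trans _ _ (Int mu (hc a l) (fun x => K * expR (c0 * `|b x - w|))%R)).
  apply: Int_le => [x|x _]; first by rewrite exprn_ge0 // addr_ge0.
  apply: le_trans (HC _ (normr_ge0 _)) _; rewrite /K -mulrA ler_wpM2l ?(ltW C0) //.
  rewrite -expRD ler_expR -mulrDr ler_wpM2l ?(ltW c00) // [leRHS]addrC.
  rewrite (_ : b x - c = (b x - w) + (w - c)); last by ring.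
  exact: ler_normD.
rewrite Int_Z //; last exact: measurable_hc.
apply: le_lt_trans (lee_wpmul2l _ (HJ a l l0)) _; first by rewrite lee_fin.
by rewrite -EFinM ltry.
Qed.

(** On a cube [v] is bounded by [RH_infty], and the powers of [1 + |b - c|] are integrable by
    John-Nirenberg. *)
Lemma admissible_mul (h : X -> R) (M : R) a l : measurable_fun setT h -> (forall x, `|h x| <= M) ->
  0 < l -> (forall x, ~ hc a l x -> h x = 0) -> admissible mu b m (fun x => h x * v x).
Proof.
move=> mh hM l0 supp; split; first by mfun.
move=> c; split; first by mfun.
have [Cv Cv0 HCv] := RH_cell mu_leb v_w v_RH.
have M0 : 0 <= M by exact: le_trans (normr_ge0 _) (hM point).
pose K := (M * (Cv * wavg mu v a l)) ^+ 2.
pose F x := (1 + `|b x - c|) ^+ (m * 2).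
have mF : measurable_fun setT F by rewrite /F; mfun.
have F0 x : 0 <= F x by rewrite exprn_ge0 // addr_ge0.
apply: (@le_lt_trans _ _ (Int mu setT (fun x => K * (F x * \1_(hc a l) x))%R)).
  apply: Int_ae_le => //.
  - by mfun.
  - by mfun; apply: measurable_indic; exact: measurable_hc.
  - by move=> x; exact: sqr_ge0.
  - by move=> x; apply: mulr_ge0; [exact: sqr_ge0|exact: mulr_ge0].
  have := HCv a l l0; have := pos_part_ae v_w; apply: filterS2 => x e hx _.
  case: (pselect (hc a l x)) => xa; last first.
    by rewrite supp // mul0r mulr0 expr0n /= mulr_ge0 ?sqr_ge0 // mulr_ge0.
  rewrite indicE mem_set // mulr1 exprMn [leRHS]mulrC /F exprM ler_wpM2l ?sqr_ge0 //.
  rewrite -real_normK ?num_real // /K lerXn2r ?nnegrE //.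
    by rewrite mulr_ge0 // mulr_ge0 ?(ltW Cv0) // ltW // wavg_gt0.
  by rewrite normrM; apply: ler_pM => //; rewrite e ger0_norm ?hx // ltW // pos_part_gt0.
rewrite Int_Z ?sqr_ge0 //; last 2 first.
- by mfun; apply: measurable_indic; exact: measurable_hc.
- by move=> x; rewrite mulr_ge0.
rewrite -Int_indic lte_mul_pinfty ?lee_fin ?sqr_ge0 //.
exact: Int_pow_osc_lty.
Qed.

Variables (tau : (X -> R) -> X -> R) (k : X -> R) (CT Ck : R).
Hypothesis H : real_czo mu tau k CT Ck.

(** The finite chain of cells through [x] depends on [x], so the bound is stated for all truncations
    [K] beyond a [K0] depending on [x]. *)
Lemma real_sparse : exists2 A : R, 0 < A &
  forall (f h : X -> R) (M : R) (o : X) (L : R), measurable_fun setT f -> measurable_fun setT h ->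
  (forall x, `|h x| <= f x) -> (forall x, f x <= M) -> 0 < L -> (forall x, ~ hc o L x -> h x = 0) ->
  exists (D : set (@cell n)) (G : @cell n -> set X),
  [/\ forall q, measurable (G q), forall q, G q `<=` gcell o L q, trivIset D G,
      forall q, (mu (gcell o L q) <= 2%:E * mu (G q))%E &
      {ae mu, forall x, hc o L x -> exists K0, forall K, (K0 <= K)%N ->
        `|com0 tau b m (fun y => h y * v y) x| <=
        A * \sum_(q <- cells_upto D K) sparse_term mu v m b o L f q x}].
Proof.
have [Cv Cv0 HCv] := RH_cell mu_leb v_w v_RH.
pose SC := @sparse_const R n CT Ck m.
have SC0 : 0 <= SC by exact: (sparse_const_ge0 H m).
exists (SC * Cv + 1); first by rewrite ltr_wpDl // mulr_ge0 // ltW.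
move=> f h M o L mf mh hf fM L0 supp.
have f0 x : 0 <= f x by exact: le_trans (normr_ge0 _) (hf x).
pose g y := h y * v y.
have Ag : admissible mu b m g.
  by apply: (@admissible_mul h M o L) => // x; exact: le_trans (hf x) (fM x).
pose ctr := wavg mu b.
pose st q := stops mu tau CT Ck b m ctr o L g q.
pose com q := com0 tau b m (gloc o L g q).
pose w q x := SC * Fcell mu b m ctr o L g q * Hcell b m ctr o L q x.
have st_triv q : trivIset (st q) (gcell o L) by exact: trivIset_stops.
have st_sub q P : st q P -> gcell o L P `<=` gcell o L q /\ (q.1 < P.1)%N.
  exact: (stops_sub mu_leb n_gt0 H mb L0 Ag).
have st_mu q := mu_stops mu_leb n_gt0 H mb ctr o L0 Ag q.
have off q : gcell o L q `<=` hc o L -> {ae mu, forall x, gcell o L q x ->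
    ~ (\bigcup_(P in st q) gcell o L P) x -> `|com q x| <= w q x}.
  exact: (com_off_stops mu_leb H mb ctr L0 Ag).
have on q P : gcell o L q `<=` hc o L -> st q P ->
    {ae mu, forall x, gcell o L P x -> `|com q x - com P x| <= w q x}.
  by move=> _; exact: (com_on_stop mu_leb n_gt0 H mb L0 Ag).
have dom := sparse_domination mu_leb L0 st_triv st_sub st_mu off on.
have mcell q : measurable (gcell o L q) by exact: measurable_gcell.
exists (sparse_cells st), (spart o L st); split.
- by move=> q; exact: measurable_spart.
- by move=> q; exact: spart_sub.
- exact: trivIset_spart.
- by move=> q; exact: (mu_spart mu_leb L0 st_sub st_mu).
have gE : gloc o L g root = g.
  apply/funext => y; rewrite /gloc indicE; case: (pselect (hc o L y)) => yo.
    rewrite mem_set ?mulr1 //; apply: gcell_sub_tri => //.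
    by rewrite /root gcell_root.
  by rewrite /g supp // mul0r mul0r.
have Fle q : Fcell mu b m ctr o L g q <=
    Cv * (wavg mu v (tcorner o L q) (3 * glen L q) * havg mu m b f (tcorner o L q) (3 * glen L q)).
  have l0 : 0 < 3 * glen L q by rewrite mulr_gt0 // glen_gt0.
  have w0 : 0 < wavg mu v (tcorner o L q) (3 * glen L q) by exact: wavg_gt0.
  rewrite /Fcell /havg triE; set l := 3 * glen L q in l0 w0 *; set a := tcorner o L q in w0 *.
  rewrite [Cv * _]mulrA [leRHS]mulrA ler_wpM2r ?invr_ge0 ?exprn_ge0 ?(ltW l0) //.
  set B := Cv * _; have B0 : 0 <= B by rewrite mulr_ge0 // ltW.
  set J1 := Int _ _ _; set J2 := Int _ _ _.
  have mH : measurable_fun setT (Hcell b m ctr o L q) by rewrite /Hcell; mfun.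
  have H0 x : 0 <= Hcell b m ctr o L q x by exact: le_trans ler01 (Hcell_ge1 _ _ _ _ _ _ _).
  have J20 : (0 <= J2)%E by apply: Int_ge0 => x; rewrite mulr_ge0 // H0.
  have J10 : (0 <= J1)%E by apply: Int_ge0 => x; rewrite mulr_ge0 // H0.
  have J2f : (J2 < +oo)%E.
    have M0 : 0 <= M by exact: le_trans (f0 point) (fM point).
    apply: (@le_lt_trans _ _ (M%:E * Int mu (hc a l) (Hcell b m ctr o L q))%E).
      rewrite -Int_Z //; last exact: measurable_hc.
      apply: Int_le => [x|x _]; first by rewrite mulr_ge0 // H0.
      by rewrite mulrC ler_wpM2r // H0.
    rewrite lte_mul_pinfty ?lee_fin //; exact: Int_pow_osc_lty.
  have J12 : (J1 <= B%:E * J2)%E.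
    rewrite /J2 -Int_Z //; last 3 first.
    - exact: measurable_hc.
    - by mfun.
    - by move=> x; rewrite mulr_ge0 // H0.
    apply: Int_ae_le; first exact: measurable_hc.
    - by have mg : measurable_fun setT g by [case: Ag]; mfun.
    - by mfun.
    - by move=> x; rewrite mulr_ge0 // H0.
    - by move=> x; apply: mulr_ge0 => //; apply: mulr_ge0; [exact: H0|exact: f0].
    have := HCv a l l0; have := pos_part_ae v_w.
    apply: filterS2 => x e hx xq; rewrite mulrCA ler_wpM2l // /g normrM mulrC.
    by apply: ler_pM => //; rewrite e ger0_norm ?hx // ltW // pos_part_gt0.
  have J1f : (J1 < +oo)%E by apply: le_lt_trans J12 _; rewrite lte_mul_pinfty ?lee_fin.
  by rewrite -lee_fin EFinM !fineK ?ge0_fin_numE.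
move: dom; apply: filterS => x hx xo; have [s [us sP hs]] := hx xo.
have tm0 q : 0 <= sparse_term mu v m b o L f q x.
  have l0 : 0 < 3 * glen L q by rewrite mulr_gt0 // glen_gt0.
  rewrite mulr_ge0 // mulr_ge0 // ?exprn_ge0 ?addr_ge0 // mulr_ge0 ?havg_ge0 // ltW //.
  exact: wavg_gt0.
exists (\max_(q <- s) pickle q).+1 => K hK.
apply: (@le_trans _ _ ((SC * Cv) * \sum_(q <- cells_upto (sparse_cells st) K) sparse_term mu v m b o L f q x)); last first.
  by rewrite ler_wpM2r ?sumr_ge0 // lerDl.
apply: (@le_trans _ _ ((SC * Cv) * \sum_(q <- s) sparse_term mu v m b o L f q x)).
  move: hs; rewrite /com gE => hs; apply: (le_trans hs); rewrite mulr_sumr.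
  rewrite big_seq [leRHS]big_seq; apply: ler_sum => q /sP[_ xq].
  rewrite /w /sparse_term indicE mem_set ?mulr1; last exact: gcell_sub_tri.
  rewrite [leRHS]mulrA; apply: ler_pM => //.
  - by rewrite mulr_ge0 // Fcell_ge0.
  - exact: le_trans ler01 (Hcell_ge1 _ _ _ _ _ _ _).
  - by rewrite -[leRHS]mulrA ler_wpM2l //; exact: Fle.
rewrite ler_wpM2l ?mulr_ge0 ?(ltW Cv0) //; apply: sum_seq_le => // q qs.
apply/mem_cells_upto; split; first by case: (sP q qs).
by apply: leq_trans hK; rewrite ltnS; exact: leq_bigmax_seq.
Qed.

End real_sparse.

(** Here [f] may be negative: its integral is at most that of its positive part. This handles the
    points where [v] is not positive. *)
Lemma integral_le_ge0 d (T : measurableType d) (R : realType) (mu : {measure set T -> \bar R})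
    (A : set T) (f g : T -> \bar R) :
  (forall x, A x -> 0 <= g x)%E -> (forall x, A x -> f x <= g x)%E ->
  (\int[mu]_(x in A) f x <= \int[mu]_(x in A) g x)%E.
Proof.
move=> g0 fg; rewrite integralE; apply: (@le_trans _ _ (\int[mu]_(x in A) f^\+ x)%E).
  by rewrite -[leRHS]sube0; apply: leeB => //; exact: integral_ge0.
by apply: le_integral_ge0 => x Ax; rewrite ?funepos_ge0 // funeposE ge_max fg // g0.
Qed.

Section commutator_parts.
Context {R : realType} {n : nat}.
Local Notation X := (Rn R n).
Variable mu : {measure set X -> \bar R}.
Hypothesis mu_leb : is_lebesgue mu.
Variable T : (X -> R[i]) -> X -> R[i].
Hypothesis T_CZO : CZO mu T.
Variables (b : X -> R) (m : nat).
Hypothesis mb : measurable_fun setT b.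
Variables (f : X -> R[i]) (v : X -> R).
Let g (j : bool) (y : X) : R := part j (f y) * v y.
Hypothesis Ag : forall j, admissible mu b m (g j).

Let Lg j i : (i <= m)%N -> L2r mu (fun y => b y ^+ i * g j y).
Proof.
move=> im; have := L2r_pow mb 0 im (Ag j).
by under eq_fun do rewrite subr0.
Qed.

Let fv (y : X) : R[i] := f y * real_complex R (v y).

(** [T] is complex linear almost everywhere and the powers of [b] are real, so splitting [f] and the
    values of [T] yields the four real commutators. *)
Lemma commutator_part s : {ae mu, forall x, part s (commutator T b m fv x) =
  if s then com0 (realpart T true) b m (g true) x - com0 (realpart T false) b m (g false) x
  else com0 (realpart T false) b m (g true) x + com0 (realpart T true) b m (g false) x}.
Proof.
have [lin _] := T_CZO.
pose h i := T (fun y => real_complex R (b y ^+ i) * fv y).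
have hi i : (i <= m)%N -> {ae mu, forall x, h i x =
    T (toC (fun y => b y ^+ i * g true y)) x + Complex 0 1 * T (toC (fun y => b y ^+ i * g false y)) x}.
  move=> im; have := lin _ _ (Complex 0 1) (L2_toC (Lg true im)) (L2_toC (Lg false im)).
  have -> : (fun y => toC (fun y => b y ^+ i * g true y) y + Complex 0 1 * toC (fun y => b y ^+ i * g false y) y) =
      (fun y => real_complex R (b y ^+ i) * fv y).
    apply/funext => y; rewrite /toC /fv /g /part; case: (f y) => [p q] /=.
    by apply/eqP; rewrite eq_complex /=; apply/andP; split; apply/eqP; ring.
  by [].
have hall : {ae mu, forall x, forall i, (i <= m)%N -> h i x =
    T (toC (fun y => b y ^+ i * g true y)) x + Complex 0 1 * T (toC (fun y => b y ^+ i * g false y)) x}.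
  apply: ae_foralln => i; case: (leqP i m) => im; last by apply: aeW.
  by have := hi i im; apply: filterS => x -> _.
move: hall; apply: filterS => x hx; rewrite commutatorE.
have psum (F : 'I_m.+1 -> R[i]) : part s (\sum_(i < m.+1) F i) = \sum_(i < m.+1) part s (F i).
  apply: (big_morph (part s)); last by case: s.
  by move=> [? ?] [? ?]; case: s.
rewrite psum /com0 /realpart.
case: s psum => _; [rewrite -sumrB|rewrite -big_split /=]; apply: eq_bigr => i _;
  rewrite -/(h i x) hx -1?ltnS //; case: (T _ x) => [p1 q1]; case: (T _ x) => [p2 q2] /=; ring.
Qed.

Lemma L2_pair (h1 h2 : X -> R) : L2r mu h1 -> L2r mu h2 -> L2 mu (fun y => Complex (h1 y) (h2 y)).
Proof.
move=> [m1 i1] [m2 i2]; split; first by split.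
rewrite /L2norm2; apply: (@le_lt_trans _ _ (Int mu setT (fun x => h1 x ^+ 2 + h2 x ^+ 2)%R)).
  by apply: le_integral_ge0 => x _; rewrite lee_fin ?sqr_ge0 // cmod_sqr.
rewrite Int_D //.
- by rewrite lte_add_pinfty.
- by mfun.
- by mfun.
- by move=> x; exact: sqr_ge0.
- by move=> x; exact: sqr_ge0.
Qed.

(** The recursion shifts a factor [b] to the argument, so the induction asks for all powers of [b]
    up to [k] times the argument to be in [L^2]. *)
Lemma cmeasurable_commutator : cmeasurable (commutator T b m fv).
Proof.
have [_ [[CT bdd] _]] := T_CZO.
have main k : forall h : X -> R[i], (forall i, (i <= k)%N -> L2 mu (fun y => real_complex R (b y ^+ i) * h y)) ->
    cmeasurable (commutator T b k h).
  elim: k => [|k IH] h hL /=.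
    have L0 : L2 mu h.
      have := hL 0%N (leqnn _); congr L2; apply/funext => y.
      by rewrite expr0 mul1r.
    by have [[]] := bdd h L0.
  have [mR mI] : cmeasurable (commutator T b k h) by apply: IH => i ik; apply: hL; exact: leqW.
  have [mR' mI'] : cmeasurable (commutator T b k (fun y => real_complex R (b y) * h y)).
    apply: IH => i ik; have := hL i.+1 ik; congr L2; apply/funext => y.
    by rewrite exprSr rmorphM mulrA.
  have reE (c : R) (z w : R[i]) : complex.Re (real_complex R c * z - w) = c * complex.Re z - complex.Re w.
    by case: z w => [? ?] [? ?] /=; ring.
  have imE (c : R) (z w : R[i]) : complex.Im (real_complex R c * z - w) = c * complex.Im z - complex.Im w.
    by case: z w => [? ?] [? ?] /=; ring.
  by split; [under eq_fun do rewrite reE|under eq_fun do rewrite imE]; apply: measurable_funB => //;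
    exact: measurable_funM.
apply: main => i im.
have -> : (fun y => real_complex R (b y ^+ i) * fv y) =
    (fun y => Complex (b y ^+ i * g true y) (b y ^+ i * g false y)).
  apply/funext => y; rewrite /fv /g /part; case: (f y) => [p q] /=.
  by apply/eqP; rewrite eq_complex /=; apply/andP; split; apply/eqP; ring.
exact: L2_pair (Lg true im) (Lg false im).
Qed.

End commutator_parts.

Section constant_symbol.
Context {R : realType} {n : nat}.
Local Notation X := (Rn R n).
Variable mu : {measure set X -> \bar R}.
Variables (tau : (X -> R) -> X -> R) (k : X -> R) (CT Ck : R).
Hypothesis H : real_czo mu tau k CT Ck.
Variables (b : X -> R) (m : nat) (c : R) (Q : set X).
Hypothesis mb : measurable_fun setT b.
Hypothesis m_gt0 : (0 < m)%N.
Hypothesis bc : {ae mu, forall x, Q x -> b x = c}.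

(** In the expansion around [c], the terms with [j < m] contain a positive power of [b x - c], and
    the last one applies [tau] to a function that is zero almost everywhere, as [m > 0]. *)
Lemma com0_cst (g : X -> R) : admissible mu b m g -> (forall x, ~ Q x -> g x = 0) ->
  {ae mu, forall x, Q x -> com0 tau b m g x = 0}.
Proof.
move=> Ag supp; have mg : measurable_fun setT g by case: Ag.
have h0 : {ae mu, forall x, tau (fun y => (b y - c) ^+ m * g y) x = 0}.
  apply: (tau0 H); first by mfun.
  move: bc; apply: filterS => x hx; case: (pselect (Q x)) => xQ; last by rewrite supp // mulr0.
  by rewrite hx // subrr expr0n gtn_eqF // mul0r.
have := com0E H mb c Ag; move: h0 bc; apply: filterS3 => x h0 hb e xQ.
rewrite e /comc big1 // => j _; have := ltn_ord j; rewrite ltnS leq_eqVlt => /orP[/eqP ->|jm].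
  by rewrite h0 mulr0 mul0rn.
by rewrite hb // subrr expr0n gtn_eqF ?subn_gt0 // mulr0 mul0r mul0rn.
Qed.

End constant_symbol.

Section exhaustion.
Context {R : realType} {n : nat}.
Local Notation X := (Rn R n).

Definition big_cube (N : nat) : set X := hc (pt (fun=> - N.+1%:R) : X) (2 * N.+1%:R).

Lemma big_cubeE N x : big_cube N x <-> forall i, - N.+1%:R <= co x i < N.+1%:R.
Proof.
split => h i; have := h i; rewrite co_pt.
  by rewrite (_ : - N.+1%:R + 2 * N.+1%:R = N.+1%:R) //; ring.
by rewrite (_ : - N.+1%:R + 2 * N.+1%:R = N.+1%:R) //; ring.
Qed.

Lemma big_cubeS N : big_cube N `<=` big_cube N.+1.
Proof.
move=> x /big_cubeE h; apply/big_cubeE => i; have /andP[h1 h2] := h i.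
rewrite -(natr1 N.+1) opprD; apply/andP; split; lra.
Qed.

Lemma sub_big_cube (a : X) l : exists N0, forall N, (N0 <= N)%N -> cube a l `<=` big_cube N.
Proof.
pose S : R := \sum_(i < n) `|co a i| + `|l|.
have Si i : `|co a i| + `|l| <= S.
  by rewrite lerD2r (bigD1 i) //= lerDl sumr_ge0.
have S0 : 0 <= S by rewrite addr_ge0 // sumr_ge0.
exists (Num.bound S) => N hN x /cubeE xa; apply/big_cubeE => i.
have /andP[h1 h2] := xa i; have := Si i.
have : S < N.+1%:R.
  by apply: lt_le_trans (archi_boundP S0) _; rewrite ler_nat leqW.
have := ler_norm (co a i); have := ler_norm l; have := ler_norm (- co a i); rewrite normrN.
by move=> *; apply/andP; split; lra.
Qed.

Lemma mem_big_cube (x : X) : exists N, big_cube N x.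
Proof.
have [N0 h] := sub_big_cube x 0; exists N0; apply: (h N0 (leqnn _)).
by apply/cubeE => i; rewrite addr0 lexx.
Qed.

End exhaustion.

Lemma bmo_norm_ge0 (R : realType) (n : nat) (mu : {measure set (Rn R n) -> \bar R}) (b : Rn R n -> R) :
  (0 <= bmo_norm mu b)%E.
Proof.
apply: (@le_trans _ _ (avg mu (0 : 'rV[R]_n) 1 (fun x => `|b x - fine (avg mu (0 : 'rV[R]_n) 1 b)|))).
  rewrite mule_ge0 ?lee_fin ?invr_ge0 ?exprn_ge0 //.
  by apply: integral_ge0 => x _; rewrite lee_fin.
by apply: ereal_sup_ubound; exists 0, 1.
Qed.

Lemma sparse_term_ge0 (R : realType) (n : nat) (mu : {measure set (Rn R n) -> \bar R})
    (mu_leb : is_lebesgue mu) (v : Rn R n -> R) (v_w : weight mu v) (m : nat) (b f : Rn R n -> R)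
    (o : Rn R n) (L : R) (q : @cell n) (x : Rn R n) : 0 < L -> (forall y, 0 <= f y) ->
  0 <= sparse_term mu v m b o L f q x.
Proof.
move=> L0 f0; have l0 : 0 < 3 * glen L q by rewrite mulr_gt0 // glen_gt0.
rewrite mulr_ge0 // mulr_ge0 // ?exprn_ge0 ?addr_ge0 // mulr_ge0 ?havg_ge0 // ltW //.
exact: wavg_gt0.
Qed.

Theorem theorem1p1 (R : realType) (n : nat) (n_gt0 : (0 < n)%N)
    (mu : {measure set (Rn R n) -> \bar R}) (mu_leb : is_lebesgue mu)
    (u : Rn R n -> R) (u_ge0 : forall x, 0 <= u x) (u_loc : loc_int mu u)
    (q : R) (q_gt2 : 2 < q)
    (v : Rn R n -> R) (v_w : weight mu v) (v_RH : RH_infty mu v) (v_Aq : A_q mu q v)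
    (m : nat) (b : Rn R n -> R) (b_BMO : BMO mu b) (eps : R) (eps_gt0 : 0 < eps)
    (T : (Rn R n -> R[i]) -> (Rn R n -> R[i])) (T_CZO : CZO mu T)
    (p : R) (p_gt : Num.max q (1 + (m.+1)%:R / eps) < p) :
  exists C : R, 0 < C /\
    forall (t : R) (f : Rn R n -> R[i]), 0 < t ->
      cmeasurable f ->
      (exists M : R, forall x, cmod (f x) <= M) ->
      (exists (a : 'rV[R]_n) (l : R), 0 < l /\ forall x, ~ cube a l x -> f x = 0) ->
      (\int[mu]_(x in [set x | (t < cmod (commutator T b m
                                    (fun y => f y * real_complex R (v y)) x) / v x)%R])
          (u x * v x)%:E
       <= C%:E * \int[mu]_x
            ((Phi_m m (fine (bmo_norm mu b) ^+ m * cmod (f x) / t)%R)%:E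
             * orlicz_max mu (Phi m eps) (fun y => (v y `^ (1 - conj_exp q))%R) u x
             * HLmax mu (fun y => Psi p q (v y)) x))%E.
Proof.
have pq : q < p by move: p_gt; rewrite gt_max => /andP[].
have mb : measurable_fun setT b by case: b_BMO => -[].
have mv : measurable_fun setT v by case: v_w => -[].
have mu_u : measurable_fun setT u by case: u_loc.
pose v' := pos_part v.
have mv' : measurable_fun setT v' by exact: measurable_pos_part v_w.
have v'0 x : 0 < v' x by exact: pos_part_gt0.
have [k1 [CT1 [Ck1 H1]]] := realpart_czo T_CZO true.
have [k2 [CT2 [Ck2 H2]]] := realpart_czo T_CZO false.
have [A1 A10 HA1] := real_sparse mu_leb n_gt0 v_w v_RH m b_BMO H1.
have [A2 A20 HA2] := real_sparse mu_leb n_gt0 v_w v_RH m b_BMO H2.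
have [Cw Cw0 HCw] := sparse_weak mu_leb n_gt0 q_gt2 v_w v_RH v_Aq m b_BMO eps_gt0 pq.
pose B := fine (bmo_norm mu b) ^+ m.
pose A := A1 + A2; have A0 : 0 < A by rewrite addr_gt0.
have B0 : 0 <= B by rewrite exprn_ge0 // fine_ge0 //; exact: bmo_norm_ge0.
pose Ns : R := #|{ffun 'I_n -> 'I_3}|%:R.
have Ns0 : 0 < Ns by rewrite ltr0n; apply/card_gt0P; exists [ffun=> ord0].
(* [PhiM] extracts this factor when the argument is compared with [B * f0 x / t]. For [B = 0] the
   quotient has the default value 0, and that case is treated apart. *)
pose Kc := Phi_m m (Ns * (4 * A) / B).
have Kc0 : 0 <= Kc by rewrite Phi_ge0 // divr_ge0 // !mulr_ge0 // ltW.
exists (4 * Cw * (Kc + 1)); split; first by rewrite !mulr_gt0 // ltr_wpDl.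
move=> t f t0 [mfR mfI] [M0 hM0] [a [l [l0 supp]]].
pose f0 (x : Rn R n) := cmod (f x).
have f00 x : 0 <= f0 x by exact: cmod_ge0.
have mf0 : measurable_fun setT f0.
  rewrite (_ : f0 = fun x => (complex.Re (f x) ^+ 2 + complex.Im (f x) ^+ 2) `^ 2^-1).
    by apply: (measurableT_comp (@measurable_powR _ _)); mfun.
  by apply/funext => x; rewrite powR12_sqrt ?addr_ge0 ?sqr_ge0 // -cmod_sqr sqrtr_sqr ger0_norm.
pose fp j (x : Rn R n) := part j (f x).
have mfp j : measurable_fun setT (fp j) by case: j.
have fp_le j x : `|fp j x| <= f0 x by exact: part_le_cmod.
have [N0 hN0] := sub_big_cube a l.
have fp_supp j N x : (N0 <= N)%N -> ~ big_cube N x -> fp j x = 0.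
  by move=> hN nx; rewrite /fp supp; [case: j|move=> /(hN0 N hN)].
have Ag j : admissible mu b m (fun y => fp j y * v y).
  have L0 : (0 : R) < 2 * N0.+1%:R by rewrite mulr_gt0.
  apply: (admissible_mul mu_leb v_w v_RH m b_BMO (mfp j) (M := M0) _ L0).
    by move=> x; exact: le_trans (fp_le j x) (hM0 x).
  by move=> x; exact: fp_supp.
pose com := commutator T b m (fun y => f y * real_complex R (v y)).
have [mcR mcI] : cmeasurable com by exact: (cmeasurable_commutator T_CZO mb Ag).
(* Squares avoid the modulus and the quotient, and [v'] replaces [v]. This measurable set contains
   the points of the original one where [v] is positive; at the others the integrand is not
   positive. *)
pose E : set (Rn R n) := [set x | (t * v' x) ^+ 2 < complex.Re (com x) ^+ 2 + complex.Im (com x) ^+ 2].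
have mE : measurable E.
  rewrite (_ : E = [set x | 0 < complex.Re (com x) ^+ 2 + complex.Im (com x) ^+ 2 - (t * v' x) ^+ 2]).
    apply: measurable_gt_set; apply: measurable_funB.
      by apply: measurable_funD; exact: measurable_funX.
    by apply: measurable_funX; apply: measurable_funM.
  by apply/seteqP; split => x; rewrite /E /= subr_gt0.
pose w x := weight_max mu q v m eps p u x.
have w0 x : (0 <= w x)%E by rewrite mule_ge0 ?orlicz_max_ge0 ?HLmax_ge0.
set I := (\int[mu]_x _)%E.
have I_E : I = (\int[mu]_x ((Phi_m m (B * f0 x / t))%:E * w x))%E.
  by apply: eq_integral => x _; rewrite muleA.
have I0 : (0 <= I)%E.
  rewrite I_E; apply: integral_ge0 => x _; rewrite mule_ge0 // lee_fin Phi_ge0 // divr_ge0 ?(ltW t0) //.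
  by rewrite mulr_ge0.
have muv : measurable_fun setT (fun x => u x * v' x) by mfun.
have uv0 x : 0 <= u x * v' x by rewrite mulr_ge0 // ltW.
apply: (@le_trans _ _ (Int mu E (fun x => u x * v' x)%R)).
  apply: (@le_trans _ _ (\int[mu]_(x in [set x | (t < cmod (com x) / v x)%R]) (u x * v' x * \1_E x)%:E)%E).
    apply: integral_le_ge0 => x /= hx; first by rewrite lee_fin mulr_ge0.
    rewrite lee_fin; case: (ltP 0 (v x)) => vx; last first.
      by apply: (@le_trans _ _ 0); [rewrite mulr_ge0_le0|rewrite mulr_ge0].
    have vE : v' x = v x by rewrite /v' /pos_part vx.
    rewrite indicE mem_set ?mulr1 ?vE // /E /= vE -cmod_sqr.
    by rewrite ltrXn2r ?nnegrE ?cmod_ge0 ?mulr_ge0 ?(ltW t0) ?(ltW vx) // -ltr_pdivlMr.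
  rewrite [leRHS]Int_indic; apply: Int_subset => // x.
  by rewrite mulr_ge0.
(* The root cube must contain the support of [f], and the Luxemburg norms are finite for bounded
   [u]; hence an exhaustion in both respects. *)
pose F N := (E `&` big_cube N) `&` [set x | u x <= N%:R].
have mbig N : measurable (big_cube N : set (Rn R n)) by exact: measurable_hc.
have mF N : measurable (F N).
  by apply: measurableI; [exact: measurableI|exact: measurable_le_set].
have FS N : F N `<=` F N.+1.
  move=> x [[xE xN] xu]; split; first by split => //; exact: big_cubeS.
  by apply: (le_trans xu); rewrite ler_nat.
have EF : E = \bigcup_N F N.
  apply/seteqP; split => x; last by move=> [N _ [[]]].
  move=> xE; have [N1 xN1] := mem_big_cube x.
  have N2 := archi_boundP (u_ge0 x).
  have sub k : big_cube (N1 + k) x.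
    by elim: k => [|k IH]; rewrite ?addn0 // addnS; exact: big_cubeS.
  exists (N1 + Num.bound (u x))%N => //; split => //=.
  by apply: le_trans (ltW N2) _; rewrite ler_nat leq_addl.
rewrite EF; apply: Int_bigcup_bound => // N1.
pose N := maxn N0 N1.
have F_le : forall k, F N1 `<=` F (N1 + k)%N.
  by elim=> [|k IH]; rewrite ?addn0 // addnS; exact: subset_trans IH (FS _).
apply: (@le_trans _ _ (Int mu (F N) (fun x => u x * v' x)%R)).
  by apply: Int_subset => //; rewrite /N -(subnKC (leq_maxr N0 N1)).
have hN : (N0 <= N)%N by exact: leq_maxl.
have L0 : (0 : R) < 2 * N.+1%:R by rewrite mulr_gt0.
pose o : Rn R n := pt (fun=> - N.+1%:R).
pose g j (y : Rn R n) := fp j y * v y.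
pose c4 (j : bool * bool) := com0 (realpart T j.1) b m (g j.2).
have com_le : {ae mu, forall x, cmod (com x) <= \sum_(j <- [:: (true, true); (false, false); (false, true); (true, false)]) `|c4 j x|}.
  have := commutator_part T_CZO mb Ag true; have := commutator_part T_CZO mb Ag false.
  apply: filterS2 => x eI eR; apply: le_trans (cmod_le _) _.
  rewrite !big_cons big_nil addr0 addrA; apply: lerD.
    by move: eR; rewrite /part => ->; exact: ler_normB.
  by move: eI; rewrite /part => ->; exact: ler_normD.
have Ipos : (0 <= (4 * Cw * (Kc + 1))%:E * I)%E.
  by rewrite mule_ge0 // lee_fin !mulr_ge0 ?addr_ge0 // ltW.
(* Here the right side vanishes. [B = 0] forces [m > 0] and norm 0, so [b] is almost everywhere
   constant on the cube and the commutator is zero there. *)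
have [B_0|Bn0] := eqVneq B 0.
  have m0 : (0 < m)%N.
    by rewrite lt0n; apply/eqP => m0; move/eqP: B_0; rewrite /B m0 expr0 oner_eq0.
  have bz : fine (bmo_norm mu b) = 0 by move/eqP: B_0; rewrite expf_eq0 => /andP[_ /eqP].
  have bc := bmo0_cst mu_leb b_BMO bz o L0.
  have cz j : {ae mu, forall x, big_cube N x -> c4 j x = 0}.
    have gs r x : ~ big_cube N x -> g r x = 0 by move=> nx; rewrite /g (fp_supp r N) ?mul0r.
    case: j => -[] r; [exact: (com0_cst H1 mb m0 bc (Ag r) (gs r))|].
    exact: (com0_cst H2 mb m0 bc (Ag r) (gs r)).
  suff -> : Int mu (F N) (fun x => u x * v' x)%R = 0%E by [].
  apply: ae0_Int => //.
  have call : {ae mu, forall x, big_cube N x -> cmod (com x) <= 0}.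
    have com_le2 : {ae mu, forall x, big_cube N x -> cmod (com x) <= `|c4 (false, true) x| + `|c4 (true, false) x|}.
      move: com_le (cz (true, true)) (cz (false, false)); apply: filterS3 => x hx a1 a2 xN.
      apply: le_trans hx _.
      by rewrite !big_cons big_nil a1 // a2 // normr0 !add0r addr0.
    move: com_le2 (cz (false, true)) (cz (true, false)); apply: filterS3 => x hx a3 a4 xN.
    by apply: le_trans (hx xN) _; rewrite a3 // a4 // normr0 addr0.
  move: call; apply: filterS => x hx [[xE xN] _]; exfalso; move: xE; rewrite /E /= -cmod_sqr.
  have -> : cmod (com x) = 0 by apply/eqP; rewrite eq_le hx // cmod_ge0.
  by rewrite expr0n /= ltNge sqr_ge0.
have Bp : 0 < B by rewrite lt_def Bn0.
pose js : seq (bool * bool) := [:: (true, true); (false, false); (false, true); (true, false)].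
pose sp (D : set (@cell n)) K fn x : R := \sum_(q <- cells_upto D K) sparse_term mu v m b o (2 * N.+1%:R) fn q x.
have sp0 D K fn x : (forall y, 0 <= fn y) -> 0 <= sp D K fn x.
  by move=> fn0; apply: sumr_ge0 => r _; exact: sparse_term_ge0.
have sparse j : exists (D : set (@cell n)), exists (G : @cell n -> set (Rn R n)),
  [/\ forall q, measurable (G q), forall q, G q `<=` gcell o (2 * N.+1%:R) q, trivIset D G,
      forall q, (mu (gcell o (2 * N.+1%:R) q) <= 2%:E * mu (G q))%E &
      {ae mu, forall x, big_cube N x -> exists K0, forall K, (K0 <= K)%N ->
        `|c4 j x| <= A * sp D K f0 x}].
  have fs r x : ~ hc o (2 * N.+1%:R) x -> fp r x = 0 by move=> nx; exact: (fp_supp r N).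
  case: j => -[] r.
    have [D [G [h1 h2 h3 h4 h5]]] := HA1 f0 (fp r) M0 o _ mf0 (mfp r) (fp_le r) hM0 L0 (fs r).
    exists D, G; split => //; move: h5; apply: filterS => x hx /hx[K0 hK]; exists K0 => K /hK h.
    by apply: le_trans h _; rewrite ler_wpM2r ?sp0 // lerDl ltW.
  have [D [G [h1 h2 h3 h4 h5]]] := HA2 f0 (fp r) M0 o _ mf0 (mfp r) (fp_le r) hM0 L0 (fs r).
  exists D, G; split => //; move: h5; apply: filterS => x hx /hx[K0 hK]; exists K0 => K /hK h.
  by apply: le_trans h _; rewrite ler_wpM2r ?sp0 // lerDr ltW.
have {sparse}[D HD] := choice sparse.
(* If the commutator exceeds [t v'], one of its four real parts exceeds [t v' / 4], hence one of the
   sparse sums of [c * f0] exceeds [v']. *)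
pose c : R := 4 * A / t; have c0 : 0 < c by rewrite divr_gt0 // mulr_gt0.
pose f1 x := c * f0 x.
have mf1 : measurable_fun setT f1 by rewrite /f1; mfun.
have f10 x : 0 <= f1 x by rewrite mulr_ge0 // ltW.
have sp1 j K x : sp (D j) K f1 x = c * sp (D j) K f0 x.
  by rewrite /sp mulr_sumr; apply: eq_bigr => r _; exact: sparse_termZ.
pose Bj K j : set (Rn R n) := [set x | v' x < sp (D j) K f1 x].
pose Bs K := \bigcup_(j in [set` js]) Bj K j.
(* Bounded by [N] and equal to [u] on [F N], while the maximal function on the right remains that of
   [u]. *)
pose uN x := u x * \1_[set x | u x <= N%:R] x.
have muN : measurable_fun setT uN.
  by rewrite /uN; mfun; apply: measurable_indic; exact: measurable_le_set.
have uN_u x : uN x <= u x.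
  rewrite /uN indicE; case: (pselect (u x <= N%:R)) => h; first by rewrite mem_set // mulr1.
  by rewrite memNset // mulr0.
have uN0 x : 0 <= uN x by rewrite mulr_ge0.
have uNN x : uN x <= N%:R.
  rewrite /uN indicE; case: (pselect (u x <= N%:R)) => h; first by rewrite mem_set // mulr1.
  by rewrite memNset // mulr0.
have mBj K j : measurable (Bj K j).
  have msp : measurable_fun setT (sp (D j) K f1).
    by apply: measurable_sum => r; exact: measurable_sparse_term.
  rewrite (_ : Bj K j = [set x | 0 < sp (D j) K f1 x - v' x]).
    by apply: measurable_gt_set; exact: measurable_funB.
  by apply/seteqP; split => x; rewrite /Bj /= subr_gt0.
have mBs K : measurable (Bs K) by apply: fin_bigcup_measurable => //; exact: finite_seq.
have BsS K : Bs K `<=` Bs K.+1.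
  move=> x [j jj xj]; exists j => //; rewrite /Bj /=; apply: lt_le_trans xj _.
  apply: sum_seq_le => [|r|r]; first exact: cells_upto_uniq.
    by move=> /mem_cells_upto[h1 h2]; apply/mem_cells_upto; split => //; exact: ltnW.
  exact: sparse_term_ge0.
have cover : {ae mu, forall x, F N x -> (\bigcup_K Bs K) x}.
  have HDj j : {ae mu, forall x, big_cube N x -> exists K0, forall K, (K0 <= K)%N ->
      `|c4 j x| <= A * sp (D j) K f0 x} by have [G []] := HD j.
  have HDj2 j j' : {ae mu, forall x, big_cube N x -> exists K0, forall K, (K0 <= K)%N ->
      `|c4 j x| <= A * sp (D j) K f0 x /\ `|c4 j' x| <= A * sp (D j') K f0 x}.
    move: (HDj j) (HDj j'); apply: filterS2 => x h h' xN.
    have [K1 h1] := h xN; have [K2 h2] := h' xN; exists (K1 + K2)%N => K hK.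
    by split; [apply: h1|apply: h2]; apply: leq_trans hK; rewrite ?leq_addr ?leq_addl.
  move: com_le (HDj2 (true, true) (false, false)) (HDj2 (false, true) (true, false)).
  apply: filterS3 => x hx a1 a3 [[xE xN] _].
  have [K1 h1] := a1 xN; have [K3 h3] := a3 xN.
  pose K := (K1 + K3)%N.
  have [{}h1 h2] := h1 K (leq_addr _ _); have [{}h3 h4] := h3 K (leq_addl _ _).
  exists K => //; apply: contrapT => nB.
  have small j : j \in js -> A * sp (D j) K f0 x <= t * v' x / 4.
    move=> jj; rewrite leNgt; apply/negP => h; apply: nB; exists j => //; rewrite /Bj /= sp1.
    rewrite -(ltr_pM2l t0) [ltRHS](_ : _ = 4 * (A * sp (D j) K f0 x)); last by rewrite /c; field; rewrite gt_eqF.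
    by move: h; rewrite ltr_pdivrMr // [ltRHS]mulrC.
  have s1 := small (true, true) isT; have s2 := small (false, false) isT.
  have s3 := small (false, true) isT; have s4 := small (true, false) isT.
  move: hx; rewrite !big_cons big_nil addr0 => hx.
  have : cmod (com x) <= t * v' x by clear -hx h1 h2 h3 h4 s1 s2 s3 s4; lra.
  rewrite leNgt => /negP; apply; move: xE; rewrite /E /= -cmod_sqr.
  by rewrite ltr_pXn2r ?nnegrE ?cmod_ge0 // mulr_ge0 // ltW.
have muNv : measurable_fun setT (fun x => uN x * v' x) by mfun.
have uNv0 x : 0 <= uN x * v' x by rewrite mulr_ge0 // ltW.
have -> : Int mu (F N) (fun x => u x * v' x)%R = Int mu (F N) (fun x => uN x * v' x)%R.
  by apply: Int_eq => x [_ /= xu]; rewrite /uN indicE mem_set // mulr1.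
have [Z [mZ Z0 hZ]] := ae_null cover.
have mBB : measurable (\bigcup_K Bs K) by exact: bigcupT_measurable.
apply: (@le_trans _ _ (Int mu (Z `|` \bigcup_K Bs K) (fun x => uN x * v' x)%R)).
  apply: Int_subset => // x xF; case: (pselect (Z x)) => xZ; [by left|right].
  exact: (hZ x xZ xF).
apply: le_trans (Int_setU_le mu mZ mBB muNv uNv0) _.
rewrite (Int_null mZ muNv Z0) add0e; apply: Int_bigcup_bound => // K.
apply: le_trans (Int_bigcup_seq_le mu _ (mBj K) muNv uNv0) _.
have one j : (Int mu (Bj K j) (fun x => uN x * v' x)%R <= (Cw * (Kc + 1))%:E * I)%E.
  have [G [g1 g2 g3 g4 _]] := HD j.
  apply: le_trans (HCw o _ L0 (D j) G g1 g2 g3 g4 uN u f1 N%:R K muN mf1 uN0 uNN uN_u f10) _.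
  rewrite EFinM -muleA; apply: lee_wpmul2l; first by rewrite lee_fin ltW.
  have Kc1 : 0 < Kc + 1 by rewrite ltr_wpDl.
  rewrite I_E; apply: le_trans _ (integral_scale_le mu Kc1 _); last first.
    by move=> x; rewrite mule_ge0 // lee_fin Phi_ge0 // divr_ge0 ?(ltW t0) // mulr_ge0.
  apply: le_integral_ge0 => x _.
    by rewrite mule_ge0 ?w0 // lee_fin Phi_ge0 // mulr_ge0 // ltW.
  rewrite [leRHS]muleA; apply: lee_wpmul2r; first exact: w0.
  rewrite -EFinM lee_fin.
  have Bf : 0 <= B * f0 x / t by rewrite divr_ge0 ?(ltW t0) // mulr_ge0.
  apply: (@le_trans _ _ (Kc * Phi_m m (B * f0 x / t))); last first.
    by rewrite ler_wpM2r ?Phi_ge0 // lerDl.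
  rewrite (_ : _ * f1 x = (Ns * (4 * A) / B) * (B * f0 x / t)); last first.
    by rewrite /f1 /c -/Ns; field; rewrite !gt_eqF.
  by apply: PhiM => //; rewrite divr_ge0 // !mulr_ge0 // ltW.
apply: (@le_trans _ _ (\sum_(j <- js) (Cw * (Kc + 1))%:E * I)%E).
  by apply: lee_sum => j _; exact: one.
have CK : (0 <= (Cw * (Kc + 1))%:E)%E by rewrite lee_fin mulr_ge0 ?addr_ge0 // ltW.
rewrite -ge0_sume_distrl // !big_cons big_nil adde0 -!EFinD; apply: lee_wpmul2r => //.
by rewrite lee_fin; apply: eq_ler; ring.
Qed.
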